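(* Let $X$ be a complex Banach space, let $-1<\gamma<0$, $0<\omega<\pi/2$, $A\in\Theta_\omega^\gamma(X)$ and $1+\gamma<\alpha<\frac{\pi}{2\omega}$. Let $\phi:[0,+\infty)\to[0,+\infty)$ be continuous with $\phi(t)>0$ for $t>0$. Then the solution operator of the abstract Cauchy problem $$u_t(t)=\phi(t)A^{\alpha}u(t),\quad 0<t<T,\qquad u(0)=u_0\in D(A^\alpha),$$ is given by $$\mathscr{T}_{\alpha,\phi}(t)=\mathscr{T}_\alpha\left(\int_0^t\phi(s)\,ds\right),\quad 0<t<T.$$
   Context: Sectors: for $0<\mu<\pi$, $S_\mu=\{z\in\mathbb{C}\setminus\{0\}:|\arg z|\le\mu\}\cup\{0\}$, with $\arg$ valued in $(-\pi,\pi]$. Almost sectorial operators: for $-1<\gamma<0$ and $0\le\omega<\pi$, $\Theta_\omega^\gamma(X)$ is the set of closed linear operators $A:D(A)\subset X\to X$ (domain and range not assumed dense) such that (a) the spectrum satisfies $\sigma(A)\subset S_\omega$; (b) for every $\omega<\mu<\pi$ there is $C_\mu>0$ with $\|(z-A)^{-1}\|\le C_\mu|z|^\gamma$ for all $z\notin S_\mu$. Path: for $0<\theta<\pi$, $\Gamma_\theta=\{\rho e^{-i\theta}:\rho>0\}\cup\{\rho e^{i\theta}:\rho>0\}$, oriented so that the sector $\{z\neq 0: |\arg z|<\theta\}$ lies to its left. Fractional powers: put $\psi_m(z)=z/(1+z)^m$. For $\alpha>0$ choose integers $k\ge1$, $m\ge2$ with $(m-1)k>\alpha+1+\gamma$,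 and $\omega<\theta<\pi$; the operator $B=\frac{1}{2\pi i}\int_{\Gamma_\theta}z^\alpha\psi_m(z)^k(z-A)^{-1}dz$ is bounded on $X$ (absolutely convergent integral), and $\psi_m^k(A)=A^k(1+A)^{-mk}$ is bounded and injective with range $D(A^{(m-1)k})$. Then $A^\alpha=(\psi_m^k(A))^{-1}B$ with domain $D(A^\alpha)=\{x\in X: Bx\in D(A^{(m-1)k})\}$. Semigroup: for $t>0$ and $0<\alpha<\frac{\pi}{2\omega}$, $\mathscr{T}_\alpha(t)=\frac{1}{2\pi i}\int_{\Gamma_\theta}e^{-tz^\alpha}(z-A)^{-1}dz$ with $\omega<\theta<\min\{\pi,\frac{\pi}{2\alpha}\}$, a bounded operator on $X$. The solution operator of the problem is the family of operators sending the initial datum $u_0$ to the classical solution $u(t)$, where a classical solution is a function $u\in C([0,T);X)\cap C^1((0,T);X)$ with $u(t)\in D(A^\alpha)$ for $0<t<T$ which satisfies the equation and the initial condition.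
   Formalization: The equation is corrected to u_t = -φ(t)A^α u: with the printed sign the claim fails (X = C, A = 1, φ = 1 gives T_α(t) = e^{-t}, while u' = u has the solution e^t u_0). *)

(* Defs.v *)
From Stdlib Require Import Reals Lra.
From Coquelicot Require Import Coquelicot.
Open Scope R_scope.

(** * Restriction of scalars from [C] to [R]

    Coquelicot integrates and differentiates functions of a real variable only
    with values in a normed module over [R], hence this passage.  The carrier,
    the uniform structure and the norm are those of [V]. *)

Section RestrictScalars.

Variable V : CompleteNormedModule C_AbsRing.

Definition Rscal (r : R) (x : V) : V := scal (RtoC r : C_AbsRing) x.

Lemma Rscal_assoc (a b : R) (x : V) :
  Rscal a (Rscal b x) = Rscal (mult a b) x.
Proof.
unfold Rscal; rewrite scal_assoc; apply (f_equal (fun c => scal c x)).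
exact (eq_sym (RtoC_mult a b)).
Qed.

Lemma Rscal_one (x : V) : Rscal one x = x.
Proof. exact (scal_one x). Qed.

Lemma Rscal_distr_l (a : R) (x y : V) :
  Rscal a (plus x y) = plus (Rscal a x) (Rscal a y).
Proof. exact (scal_distr_l (RtoC a : C_AbsRing) x y). Qed.

Lemma Rscal_distr_r (a b : R) (x : V) :
  Rscal (plus a b) x = plus (Rscal a x) (Rscal b x).
Proof.
refine (eq_trans _ (scal_distr_r (RtoC a : C_AbsRing) (RtoC b) x)).
exact (f_equal (fun c : C_AbsRing => scal c x) (RtoC_plus a b)).
Qed.

Definition restrict_ModuleSpace_class : ModuleSpace.class_of R_Ring V :=
  ModuleSpace.Class R_Ring V (AbelianGroup.class V)
    (ModuleSpace.Mixin R_Ring V Rscal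
       Rscal_assoc Rscal_one Rscal_distr_l Rscal_distr_r).

Definition restrict_NormedModuleAux_class :
  NormedModuleAux.class_of R_AbsRing V :=
  NormedModuleAux.Class R_AbsRing V restrict_ModuleSpace_class
    (UniformSpace.class V).

Definition restrict_NormedModuleAux : NormedModuleAux R_AbsRing :=
  NormedModuleAux.Pack R_AbsRing V restrict_NormedModuleAux_class V.

Lemma Rscal_norm (l : R) (x : V) : norm (Rscal l x) <= Rabs l * norm x.
Proof.
unfold Rscal; rewrite <- Cmod_R; exact (norm_scal (RtoC l : C_AbsRing) x).
Qed.

Definition restrict_NormedModule_mixin :
  NormedModule.mixin_of R_AbsRing restrict_NormedModuleAux :=
  NormedModule.Mixin R_AbsRing restrict_NormedModuleAux
    (norm : V -> R) (@norm_factor _ V)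
    (@norm_triangle _ V) Rscal_norm (@norm_compat1 _ V) (@norm_compat2 _ V)
    (@norm_eq_zero _ V).

Definition restrict_scalars : CompleteNormedModule R_AbsRing :=
  CompleteNormedModule.Pack R_AbsRing V
    (CompleteNormedModule.Class R_AbsRing V
       (NormedModule.Class R_AbsRing V restrict_NormedModuleAux_class
          restrict_NormedModule_mixin)
       (CompleteSpace.class (CompleteNormedModule.CompleteSpace _ V))) V.

End RestrictScalars.

(** * Complex exponential, argument, real powers, sectors *)

Definition cis (t : R) : C := (cos t, sin t).

Definition Cexp (z : C) : C := RtoC (exp (Re z)) * cis (Im z).

(** The argument in [(-PI, PI]]; meaningful for [z <> 0]. *)
Definition Carg (z : C) : R :=
  if Rle_dec 0 (Im z) then acos (Re z / Cmod z) else - acos (Re z / Cmod z).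

(** Principal branch of [z ^ a]; meaningful for [z <> 0]. *)
Definition Cpower (z : C) (a : R) : C :=
  RtoC (Rpower (Cmod z) a) * cis (a * Carg z).

Definition sector (mu : R) (z : C) : Prop :=
  (z <> 0 /\ Rabs (Carg z) <= mu) \/ z = 0.

(** [(1 / (2 i pi)) * \int_{Gamma_theta} F(z) dz].  With the sector to the left
    of the path, the ray [arg z = theta] is run through inwards and the ray
    [arg z = - theta] outwards. *)
Definition path_integral {X : CompleteNormedModule C_AbsRing}
    (theta : R) (F : C -> X) : X :=
  let ray (a : R) : X :=
    @RInt_gen (restrict_scalars X)
      (fun rho : R => scal (cis a : C_AbsRing) (F (RtoC rho * cis a)%C))
      (at_right 0) (Rbar_locally p_infty) in
  scal (/ (2 * PI * Ci) : C)%C (minus (ray (- theta)) (ray theta)).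

(** * Unbounded operators *)

(** The value of [op] outside [dom] is irrelevant. *)
Record partial_op (X : Type) := PartialOp {
  dom : X -> Prop;
  op : X -> X }.
Arguments PartialOp {X} dom op.
Arguments dom {X} p x.
Arguments op {X} p x.

Section Operators.

Context {X : CompleteNormedModule C_AbsRing}.
Implicit Type A : partial_op X.

Definition linear_op A : Prop :=
  dom A zero /\
  (forall x y, dom A x -> dom A y ->
     dom A (plus x y) /\ op A (plus x y) = plus (op A x) (op A y)) /\
  (forall (c : C_AbsRing) x, dom A x ->
     dom A (scal c x) /\ op A (scal c x) = scal c (op A x)).

Definition closed_op A : Prop :=
  closed (fun p : X * X => dom A (fst p) /\ op A (fst p) = snd p).

(** [z x - A x] *)
Definition shifted A (z : C) (x : X) : X :=
  minus (scal (z : C_AbsRing) x) (op A x).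

Definition resolvent_set A (z : C) : Prop :=
  (forall y, exists! x, dom A x /\ shifted A z x = y) /\
  (exists M : R, forall x, dom A x -> norm x <= M * norm (shifted A z x)).

Definition spectrum A (z : C) : Prop := ~ resolvent_set A z.

(** [(z - A)^{-1}] for [z] in the resolvent set. *)
Definition resolvent A (z : C) (y : X) : X :=
  iota (fun x => dom A x /\ shifted A z x = y).

Definition almost_sectorial (gamma omega : R) A : Prop :=
  linear_op A /\ closed_op A /\
  (forall z, spectrum A z -> sector omega z) /\
  (forall mu, omega < mu < PI ->
     exists K : R, 0 < K /\
       forall z, ~ sector mu z ->
         forall x, norm (resolvent A z x) <= K * Rpower (Cmod z) gamma * norm x).

Fixpoint dom_pow A (n : nat) (x : X) : Prop :=
  match n with
  | O => True
  | S n' => dom A x /\ dom_pow A n' (op A x)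
  end.

(** [(1 + A)^{-1} = - (-1 - A)^{-1}] *)
Definition inv_one_plus A (x : X) : X := opp (resolvent A (RtoC (-1)) x).

(** [psi_m^k (A) = A^k (1 + A)^{-mk}] *)
Definition psi_op A (k m : nat) (x : X) : X :=
  Nat.iter k (op A) (Nat.iter (m * k) (inv_one_plus A) x).

Definition psi (m : nat) (z : C) : C := (z / (1 + z) ^ m)%C.

Definition frac_B A (alpha : R) (k m : nat) (theta : R) (x : X) : X :=
  path_integral theta
    (fun z => scal (Cpower z alpha * psi m z ^ k : C)%C (resolvent A z x)).

(** [A^alpha = (psi_m^k (A))^{-1} B] *)
Definition frac_power A (alpha : R) (k m : nat) (theta : R) : partial_op X :=
  PartialOp
    (fun x => dom_pow A ((m - 1) * k) (frac_B A alpha k m theta x))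
    (fun x => iota (fun y => psi_op A k m y = frac_B A alpha k m theta x)).

Definition semigroup A (alpha theta t : R) (x : X) : X :=
  path_integral theta
    (fun z => scal (Cexp (- (RtoC t * Cpower z alpha)) : C)%C (resolvent A z x)).

(** * The Cauchy problem [u' = c(t) L u] on [(0, T)], [u(0) = u0] *)

Definition classical_solution (c : R -> R) (L : partial_op X) (T : R)
    (u0 : X) (u : R -> X) : Prop :=
  (forall t, 0 <= t < T ->
     filterlim u (within (fun s => 0 <= s < T) (locally t)) (locally (u t))) /\
  (exists du : R -> X, forall t, 0 < t < T ->
     @is_derive R_AbsRing (restrict_scalars X) u t (du t) /\
     continuous du t /\
     dom L (u t) /\
     du t = scal (RtoC (c t) : C_AbsRing) (op L (u t))) /\
  u 0 = u0.

(** For every [u0] in the domain of [L] there is a classical solution, and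
    [S t u0] is the value at [t] of any such solution (so that it is unique). *)
Definition solution_operator (c : R -> R) (L : partial_op X) (T : R)
    (S : R -> X -> X) : Prop :=
  forall u0, dom L u0 ->
    (exists u, classical_solution c L T u0 u) /\
    (forall u, classical_solution c L T u0 u ->
       forall t, 0 < t < T -> u t = S t u0).

End Operators.

(* Main.v *)
Require Import Defs.
From Stdlib Require Import Reals Lra Lia List ClassicalEpsilon FunctionalExtensionality.
From Coquelicot Require Import Coquelicot.
Open Scope R_scope.

(** Let [Phi f x] be the integral [(1 / 2 i pi) \int f(z) R(z) x dz] over the
    boundary of a sector inside the right half plane, for [f] holomorphic
    there and [O(|z|^-p)], [p > 1 + gamma].  Fubini, the resolvent identity and
    Cauchy's formula give [Phi (f g) = Phi f o Phi g], hence, with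
    [T(t) = Phi (exp (- t z^alpha))] and [L = A^alpha], that [T' = - L T] and
    that [T] commutes with [L].  Although [T(t)] may be unbounded as [t -> 0],
    writing [x = W (x + L x)] with [W = Phi (1 / (1 + z^alpha))], which
    converges because [alpha > 1 + gamma], gives
    [|T(t) x - x| <= M t^d (|x| + |L x|)] for some [d > 0].  So
    [T(\int_0^t phi) u0] is a solution; for any solution [u],
    [s |-> T(\int_s^t phi) u(s)] is constant on [(0, t)], and its limits at the
    two ends are [T(\int_0^t phi) u0] and [u(t)]. *)

(** * Linear identities in modules, by reflection *)

(** Contours consist of two rays, the only deformation is a rotation, and the only form of Cauchy's
    theorem is the one on a polar rectangle; hence holomorphy is expressed by derivatives in the
    radius and in the angle. Improper integrals are dominated by a weight with explicit integral, so
    truncation to [[1/n, n]] costs [O(n^-e)]; Fubini and Cauchy are proved on compact rectangles and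
    passed to the limit with these errors.

    The right half plane enters through Cauchy's formula: the subtracted kernel with pole [z] has a
    second pole [-z], which must stay outside the sector.

    Since [z^alpha] grows, [A^alpha] is not itself a value of [Phi]. The injective regulariser
    [psi_op] is one, and identities for [A^alpha] are checked after applying it. Its injectivity and
    its range rest on [A] being bijective, a consequence of [gamma > -1].

    In the uniqueness argument the delicate end is [s -> t], where [T] may blow up: there the graph
    norm of [u(s)] must be bounded, and it is, because [L u = - u' / phi] with [u'] continuous and
    [phi(t) > 0]. *)

Section LinearCombinations.
Context {K : Ring} {V : ModuleSpace K}.

(** Linear expressions over a list of atoms. Equality is reduced to equality of the coefficients of
    each atom, that is, to identities between scalars that [ring] can close. *)
Inductive lexp :=
| LAtom (n : nat) | LZero | LPlus (a b : lexp) | LOpp (a : lexp)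
| LScal (c : K) (a : lexp).

Fixpoint leval (env : list V) (e : lexp) : V :=
  match e with
  | LAtom n => nth n env zero
  | LZero => zero
  | LPlus a b => plus (leval env a) (leval env b)
  | LOpp a => opp (leval env a)
  | LScal c a => scal c (leval env a)
  end.

Fixpoint lcoef (e : lexp) (n : nat) : K :=
  match e with
  | LAtom m => if Nat.eqb m n then one else zero
  | LZero => zero
  | LPlus a b => plus (lcoef a n) (lcoef b n)
  | LOpp a => opp (lcoef a n)
  | LScal c a => mult c (lcoef a n)
  end.

Fixpoint lsum (env : list V) (f : nat -> K) (k : nat) : V :=
  match env with
  | nil => zero
  | x :: env' => plus (scal (f k) x) (lsum env' f (S k))
  end.

Lemma lsum_plus env f g k :
  lsum env (fun n => plus (f n) (g n)) k = plus (lsum env f k) (lsum env g k).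
Proof.
revert k; induction env as [|x env IH]; intros k; simpl.
{ now rewrite plus_zero_l. }
rewrite IH, scal_distr_r.
rewrite <- !plus_assoc; f_equal.
rewrite !plus_assoc; f_equal; apply plus_comm.
Qed.

Lemma lsum_scal env c f k :
  lsum env (fun n => mult c (f n)) k = scal c (lsum env f k).
Proof.
revert k; induction env as [|x env IH]; intros k; simpl.
{ now rewrite scal_zero_r. }
now rewrite IH, scal_distr_l, scal_assoc.
Qed.

Lemma lsum_zero env f k : (forall n, f n = zero) -> lsum env f k = zero.
Proof.
intros H; revert k; induction env as [|x env IH]; intros k; simpl; trivial.
now rewrite IH, H, scal_zero_l, plus_zero_l.
Qed.

Lemma lsum_opp env f k : lsum env (fun n => opp (f n)) k = opp (lsum env f k).
Proof.
revert k; induction env as [|x env IH]; intros k; simpl.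
{ symmetry; apply (@opp_zero V). }
rewrite IH, scal_opp_l; symmetry; apply (@opp_plus V).
Qed.

Lemma lsum_atom env m k :
  lsum env (fun n => if Nat.eqb (k + m) n then one else zero) k
  = nth m env zero.
Proof.
revert m k; induction env as [|x env IH]; intros m k; simpl.
{ now destruct m. }
destruct m as [|m].
- rewrite Nat.add_0_r, Nat.eqb_refl, scal_one.
  assert (H : forall l j, (k < j)%nat ->
    lsum l (fun n => if Nat.eqb k n then one else zero) j = zero).
  { induction l as [|y l IHl]; intros j Hj; simpl; trivial.
    destruct (Nat.eqb_spec k j); [lia|].
    rewrite IHl by lia. now rewrite scal_zero_l, plus_zero_l. }
  rewrite H by lia. apply plus_zero_r.
- destruct (Nat.eqb_spec (k + S m) k); [lia|].
  rewrite scal_zero_l, plus_zero_l.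
  rewrite <- (IH m (S k)). now replace (k + S m)%nat with (S k + m)%nat by lia.
Qed.

Lemma leval_lsum env e : leval env e = lsum env (lcoef e) 0.
Proof.
induction e as [n| |a IHa b IHb|a IHa|c a IHa]; simpl.
- symmetry; apply (lsum_atom env n 0).
- symmetry; now apply lsum_zero.
- rewrite IHa, IHb; symmetry; apply lsum_plus.
- rewrite IHa; symmetry; apply lsum_opp.
- rewrite IHa; symmetry; apply lsum_scal.
Qed.

(** The last equation is not followed by [True], so that repeated splitting leaves exactly one
    equation per atom. *)
Fixpoint lsame (k : nat) (N : nat) (a b : lexp) : Prop :=
  match N with
  | O => True
  | S O => lcoef a k = lcoef b k
  | S N' => lcoef a k = lcoef b k /\ lsame (S k) N' a b
  end.

Lemma leval_eq env a b : lsame 0 (length env) a b -> leval env a = leval env b.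
Proof.
intros H; rewrite !leval_lsum.
revert H; generalize 0%nat; induction env as [|x env IH]; intros k H; trivial.
simpl in *.
destruct env as [|y env].
{ simpl; now rewrite H. }
destruct H as [H1 H2]. rewrite H1, (IH (S k) H2); trivial.
Qed.

End LinearCombinations.

(** Atoms are compared by unification rather than syntactically, because one vector may occur in
    several convertible forms. *)
Ltac ladd x env :=
  let rec go l :=
    match l with
    | nil => constr:(x :: env)
    | cons ?y ?l' => match x with _ => let _ := constr:(ltac:(unify x y; exact I)) in env end
    | cons _ ?l' => go l'
    end in go env.

Ltac latoms V e env :=
  lazymatch e with
  | plus ?a ?b => let env := latoms V a env in latoms V b env
  | minus ?a ?b => let env := latoms V a env in latoms V b env
  | opp ?a => latoms V a env
  | scal _ ?a => latoms V a env
  | zero => env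
  | ?x => ladd x env
  end.

Ltac lindex x env :=
  lazymatch env with
  | cons ?y ?l =>
    match x with
    | _ => let _ := constr:(ltac:(unify x y; exact I)) in constr:(O)
    | _ => let n := lindex x l in constr:(S n)
    end
  end.

Ltac lreify K V e env :=
  lazymatch e with
  | plus ?a ?b => let a' := lreify K V a env in let b' := lreify K V b env in
                  constr:(@LPlus K a' b')
  | minus ?a ?b => let a' := lreify K V a env in let b' := lreify K V b env in
                  constr:(@LPlus K a' (LOpp b'))
  | opp ?a => let a' := lreify K V a env in constr:(@LOpp K a')
  | scal ?c ?a => let a' := lreify K V a env in constr:(@LScal K c a')
  | zero => constr:(@LZero K)
  | ?x => let n := lindex x env in constr:(@LAtom K n)
  end.

Ltac lin_gen K V :=
  match goal with
  | |- @eq _ ?a ?b =>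
    let env := latoms V a (@nil (ModuleSpace.sort K V)) in
    let env := latoms V b env in
    let a' := lreify K V a env in
    let b' := lreify K V b env in
    change (@leval K V env a' = @leval K V env b');
    apply leval_eq; simpl
  end.

Ltac linC X := lin_gen C_Ring X;
  unfold plus, mult, opp, zero, one; simpl; repeat split; try ring.
Ltac linR V := lin_gen R_Ring V;
  unfold plus, mult, opp, zero, one; simpl; repeat split; try ring.

(** * Continuity and integration with values in a normed module *)

Section NormedModule.
Context {V : NormedModule R_AbsRing}.

Lemma norm_minus_sym (x y : V) : norm (minus x y) = norm (minus y x).
Proof. rewrite <- norm_opp. f_equal. linR V. Qed.

Lemma norm_triangle3 (x y z : V) :
  norm (minus x z) <= norm (minus x y) + norm (minus y z).
Proof.
replace (minus x z) with (plus (minus x y) (minus y z)) by linR V.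
apply norm_triangle.
Qed.

Lemma norm_minus_le (x y : V) : norm (minus x y) <= norm x + norm y.
Proof. unfold minus. rewrite <- (norm_opp y). apply norm_triangle. Qed.

Lemma norm_le_minus (x y : V) : norm x <= norm y + norm (minus x y).
Proof.
replace x with (plus y (minus x y)) at 1 by linR V. apply norm_triangle.
Qed.

Lemma norm_eq_le (x y : V) c : x = y -> norm y <= c -> norm x <= c.
Proof. now intros ->. Qed.

Lemma norm_eq_lt (x y : V) c : x = y -> norm y < c -> norm x < c.
Proof. now intros ->. Qed.

Lemma filterlim_norm_iff {T : Type} (F : (T -> Prop) -> Prop) {FF : Filter F}
  (f : T -> V) (l : V) :
  filterlim f F (locally l) <->
  forall eps, 0 < eps -> F (fun t => norm (minus (f t) l) < eps).
Proof.
split.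
- intros H eps Heps.
  apply (H (fun y => norm (minus y l) < eps)).
  apply locally_le_locally_norm. now exists (mkposreal eps Heps).
- intros H P HP. apply locally_norm_le_locally in HP.
  destruct HP as [eps HP]. unfold filtermap.
  apply filter_imp with (2 := H eps (cond_pos eps)). intros t Ht. now apply HP.
Qed.

Lemma locally_R_iff (x : R) (P : R -> Prop) :
  locally x P <-> exists d, 0 < d /\ forall y, Rabs (y - x) < d -> P y.
Proof.
split.
- intros [d H]. exists d; split; [apply cond_pos|]. intros y Hy. now apply H.
- intros [d [Hd H]]. exists (mkposreal d Hd). intros y Hy. now apply H.
Qed.

Lemma locally_R2_iff (x y : R) (P : R * R -> Prop) :
  locally (x, y) P <-> exists d, 0 < d /\
    forall x' y', Rabs (x' - x) < d -> Rabs (y' - y) < d -> P (x', y').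
Proof.
split.
- intros [d H]. exists d; split; [apply cond_pos|]. intros x' y' Hx Hy.
  apply H. now split.
- intros [d [Hd H]]. exists (mkposreal d Hd). intros [x' y'] [Hx Hy].
  now apply H.
Qed.

Lemma continuous_eps (f : R -> V) (x : R) :
  continuous f x <-> forall eps, 0 < eps -> exists d, 0 < d /\
    forall y, Rabs (y - x) < d -> norm (minus (f y) (f x)) < eps.
Proof.
unfold continuous. rewrite filterlim_norm_iff by apply locally_filter.
split; intros H eps Heps; specialize (H eps Heps).
- now apply locally_R_iff.
- now apply locally_R_iff.
Qed.

Lemma is_derive_eps (f : R -> V) (x : R) (l : V) :
  is_derive f x l <-> forall eps, 0 < eps -> exists d, 0 < d /\
    forall y, Rabs (y - x) < d ->
      norm (minus (minus (f y) (f x)) (scal (y - x) l)) <= eps * Rabs (y - x).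
Proof.
split.
- intros [_ H] eps Heps.
  specialize (H x (fun P HP => HP) (mkposreal eps Heps)).
  apply locally_R_iff in H. exact H.
- intros H. split; [apply is_linear_scal_l|].
  intros x' Hx'.
  assert (x = x') by exact (is_filter_lim_locally_unique (V := AbsRing_NormedModule R_AbsRing) x x' Hx'). subst x'.
  intros eps. specialize (H eps (cond_pos eps)).
  apply locally_R_iff. exact H.
Qed.

End NormedModule.

Section CompleteModule.
Context {V : CompleteNormedModule R_AbsRing}.

Lemma constant_of_derive_zero (f : R -> V) (a b : R) :
  (forall x, Rmin a b <= x <= Rmax a b -> is_derive f x zero) -> f a = f b.
Proof.
intros H.
assert (I : is_RInt (fun _ => zero) a b (minus (f b) (f a))).
{ apply is_RInt_derive; [exact H|]. intros; apply continuous_const. }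
assert (I' : is_RInt (fun _ => zero) a b (scal (b - a) (zero : V)))
  by exact (is_RInt_const a b (zero : V)).
apply is_RInt_unique in I. apply is_RInt_unique in I'.
rewrite I in I'. change (minus (f b) (f a) = scal (b - a) (zero : V)) in I'. rewrite (scal_zero_r (V := V)) in I'.
replace (f b) with (plus (minus (f b) (f a)) (f a)) by linR V.
rewrite I'. symmetry. apply plus_zero_l.
Qed.

Lemma norm_RInt_const (f : R -> V) (a b M : R) :
  ex_RInt f a b ->
  (forall x, Rmin a b <= x <= Rmax a b -> norm (f x) <= M) ->
  norm (RInt f a b) <= Rabs (b - a) * M.
Proof.
intros Hex H.
apply (norm_RInt_le_const_abs f a b); trivial.
now apply RInt_correct.
Qed.

Lemma mean_value (f df : R -> V) (a b M : R) :
  (forall x, Rmin a b <= x <= Rmax a b -> is_derive f x (df x)) ->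
  (forall x, Rmin a b <= x <= Rmax a b -> continuous df x) ->
  (forall x, Rmin a b <= x <= Rmax a b -> norm (df x) <= M) ->
  norm (minus (f b) (f a)) <= Rabs (b - a) * M.
Proof.
intros H1 H2 H3. apply (norm_RInt_le_const_abs df a b); trivial.
now apply is_RInt_derive.
Qed.

(** * Joint continuity and Fubini's theorem on rectangles *)

Definition cont2 (f : R -> R -> V) (a b : R) : Prop :=
  continuous (fun p : R * R => f (fst p) (snd p)) (a, b).

Lemma cont2_eps (f : R -> R -> V) (a b : R) :
  cont2 f a b <-> forall eps, 0 < eps -> exists d, 0 < d /\
    forall x y, Rabs (x - a) < d -> Rabs (y - b) < d ->
      norm (minus (f x y) (f a b)) < eps.
Proof.
unfold cont2, continuous. rewrite (filterlim_norm_iff (V := V)) by apply locally_filter.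
split; intros H eps Heps; specialize (H eps Heps).
- apply locally_R2_iff in H. exact H.
- apply locally_R2_iff. exact H.
Qed.

Lemma cont2_l (f : R -> R -> V) (a b : R) :
  cont2 f a b -> continuous (fun x => f x b) a.
Proof.
rewrite cont2_eps, (continuous_eps (V := V)). intros H eps Heps.
destruct (H eps Heps) as [d [Hd H']]. exists d; split; trivial.
intros y Hy. apply H'; trivial. rewrite Rminus_eq_0, Rabs_R0; trivial.
Qed.

Lemma cont2_r (f : R -> R -> V) (a b : R) :
  cont2 f a b -> continuous (fun y => f a y) b.
Proof.
rewrite cont2_eps, (continuous_eps (V := V)). intros H eps Heps.
destruct (H eps Heps) as [d [Hd H']]. exists d; split; trivial.
intros y Hy. apply H'; trivial. rewrite Rminus_eq_0, Rabs_R0; trivial.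
Qed.

Lemma cont2_swap (f : R -> R -> V) (a b : R) :
  cont2 f a b -> cont2 (fun y x => f x y) b a.
Proof.
rewrite !cont2_eps. intros H eps Heps.
destruct (H eps Heps) as [d [Hd H']]. exists d; split; trivial.
intros; now apply H'.
Qed.

(** Compactness of [[c, d]]: continuity at the points [(a, z)] gives a radius for each [z], and a
    covering argument replaces these radii by a single one. *)
Lemma tube (f : R -> R -> V) (a c d eps : R) :
  (forall z, c <= z <= d -> cont2 f a z) -> 0 < eps ->
  exists del, 0 < del /\ forall x z, Rabs (x - a) < del -> c <= z <= d ->
    norm (minus (f x z) (f a z)) < eps.
Proof.
intros H Heps.
assert (E : forall z, exists r : posreal, c <= z <= d ->
  forall x y, Rabs (x - a) < r -> Rabs (y - z) < r ->
  norm (minus (f x y) (f a z)) < eps / 2).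
{ intros z. destruct (Rle_dec c z) as [h1|h1].
  2: { exists (mkposreal 1 Rlt_0_1). lra. }
  destruct (Rle_dec z d) as [h2|h2].
  2: { exists (mkposreal 1 Rlt_0_1). lra. }
  specialize (H z (conj h1 h2)). rewrite cont2_eps in H.
  destruct (H (eps / 2)) as [r [Hr H']]; [lra|].
  exists (mkposreal r Hr). intros _. exact H'. }
set (del := fun z => proj1_sig (constructive_indefinite_description _ (E z))).
assert (Hdel := fun z => proj2_sig (constructive_indefinite_description _ (E z))).
change (forall z, c <= z <= d -> forall x y, Rabs (x - a) < del z ->
  Rabs (y - z) < del z -> norm (minus (f x y) (f a z)) < eps / 2) in Hdel.
destruct (compactness_value_1d c d del) as [r Hr].
exists r. split; [apply cond_pos|].
intros x z Hx Hz.
destruct (Rlt_dec (norm (minus (f x z) (f a z))) eps) as [|n]; trivial.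
(* The covering point is only known not to be absent (a double negation), so the decidable
   inequality is proved by contradiction. *)
exfalso. apply (Hr z Hz). intros [t [Ht [Hzt Hrt]]]. apply n.
specialize (Hdel t Ht).
assert (H1 := Hdel x z ltac:(lra) Hzt).
assert (H2 := Hdel a z ltac:(rewrite Rminus_eq_0, Rabs_R0; apply cond_pos) Hzt).
apply Rle_lt_trans with (1 := norm_triangle3 _ (f a t) _).
rewrite (norm_minus_sym (f a t)).
replace eps with (eps / 2 + eps / 2) by field.
now apply Rplus_lt_compat.
Qed.

Lemma ex_RInt_cont (f : R -> V) a b :
  (forall x, Rmin a b <= x <= Rmax a b -> continuous f x) -> ex_RInt f a b.
Proof. intros; now apply ex_RInt_continuous. Qed.

Lemma RInt_minus_cont (f g : R -> V) a b :
  ex_RInt f a b -> ex_RInt g a b ->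
  RInt (fun x => minus (f x) (g x)) a b = minus (RInt f a b) (RInt g a b).
Proof. intros; now apply RInt_minus. Qed.

Lemma continuous_RInt_param (f : R -> R -> V) (a0 a1 a c d : R) :
  c <= d -> a0 < a < a1 ->
  (forall x z, a0 < x < a1 -> c <= z <= d -> cont2 f x z) ->
  continuous (fun x => RInt (f x) c d) a.
Proof.
intros Hcd Ha H. apply (continuous_eps (V := V)). intros eps Heps.
set (e := eps / (2 * (d - c + 1))).
assert (He : 0 < e) by (apply Rdiv_lt_0_compat; lra).
destruct (tube f a c d e) as [del [Hdel Ht]]; [now intros; apply H|trivial|].
exists (Rmin del (Rmin (a - a0) (a1 - a))). split.
{ repeat apply Rmin_pos; lra. }
intros x Hx.
assert (Hx1 : Rabs (x - a) < del) by (eapply Rlt_le_trans; [exact Hx|apply Rmin_l]).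
assert (Hx2 : a0 < x < a1).
{ assert (Rmin del (Rmin (a - a0) (a1 - a)) <= Rmin (a - a0) (a1 - a)) by apply Rmin_r.
  assert (Rmin (a - a0) (a1 - a) <= a - a0) by apply Rmin_l.
  assert (Rmin (a - a0) (a1 - a) <= a1 - a) by apply Rmin_r.
  apply Rabs_lt_between in Hx. lra. }
assert (Hex : forall y, a0 < y < a1 -> ex_RInt (f y) c d).
{ intros y Hy. apply ex_RInt_cont. intros z Hz.
  rewrite Rmin_left, Rmax_right in Hz by trivial.
  apply cont2_r. now apply H. }
rewrite <- RInt_minus_cont by now apply Hex.
apply Rle_lt_trans with (Rabs (d - c) * e).
- apply norm_RInt_const.
  + apply (ex_RInt_minus (V := V)); now apply Hex.
  + intros z Hz. rewrite Rmin_left, Rmax_right in Hz by trivial.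
    left; now apply Ht.
- rewrite Rabs_pos_eq by lra.
  assert (e * (2 * (d - c + 1)) = eps) by (unfold e; field; lra).
  nra.
Qed.

(** As functions of the upper bound [t] in place of [b], both iterated integrals vanish at [a] and
    have the derivative [RInt (f t) c d]. Continuity on a larger open rectangle makes these
    derivatives two-sided at the end points. *)
Lemma fubini (f : R -> R -> V) (a0 a1 c0 c1 a b c d : R) :
  a0 < a -> a <= b -> b < a1 -> c0 < c -> c <= d -> d < c1 ->
  (forall x z, a0 < x < a1 -> c0 < z < c1 -> cont2 f x z) ->
  RInt (fun x => RInt (fun z => f x z) c d) a b =
  RInt (fun z => RInt (fun x => f x z) a b) c d.
Proof.
intros Ha Hab Hb Hc Hcd Hd H.
assert (Cin : forall x, a0 < x < a1 -> continuous (fun x => RInt (f x) c d) x).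
{ intros x Hx. apply continuous_RInt_param with a0 a1; trivial.
  intros y z Hy Hz. apply H; lra. }
assert (Exx : forall z u v, c0 < z < c1 -> a0 < u < a1 -> a0 < v < a1 ->
   ex_RInt (fun x => f x z) u v).
{ intros z u v Hz Hu Hv. apply ex_RInt_cont. intros x Hx.
  apply cont2_l. apply H; trivial.
  split; [apply Rlt_le_trans with (2 := proj1 Hx)|apply Rle_lt_trans with (1 := proj2 Hx)].
  - now apply Rmin_glb_lt. - now apply Rmax_lub_lt. }
assert (Czz : forall u v, a0 < u -> u <= v -> v < a1 -> forall z, c0 < z < c1 ->
   continuous (fun z => RInt (fun x => f x z) u v) z).
{ intros u v Hu Huv Hv z Hz.
  apply (continuous_RInt_param (fun z x => f x z)) with c0 c1; trivial.
  intros y x Hy Hx. apply cont2_swap. apply H; lra. }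
assert (Ezz : forall u v, a0 < u < a1 -> a0 < v < a1 ->
   ex_RInt (fun z => RInt (fun x => f x z) u v) c d).
{ intros u v Hu Hv. apply ex_RInt_cont.
  rewrite Rmin_left, Rmax_right by trivial. intros z Hz.
  destruct (Rle_dec u v) as [L|L].
  - apply Czz; try lra.
  - apply continuous_ext_loc with (fun z => opp (RInt (fun x => f x z) v u)).
    + apply locally_R_iff. exists (Rmin (z - c0) (c1 - z)).
      split; [apply Rmin_pos; lra|].
      intros y Hy. apply opp_RInt_swap. apply Exx; trivial.
      assert (Rmin (z - c0) (c1 - z) <= z - c0) by apply Rmin_l.
      assert (Rmin (z - c0) (c1 - z) <= c1 - z) by apply Rmin_r.
      apply Rabs_lt_between in Hy. lra.
    + apply (continuous_opp (V := V)). apply Czz; lra. }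
set (P := fun t => RInt (fun x => RInt (f x) c d) a t).
set (Q := fun t => RInt (fun z => RInt (fun x => f x z) a t) c d).
enough (E : minus (P a) (Q a) = minus (P b) (Q b)).
{ replace (P a) with (zero : V) in E by (unfold P; now rewrite RInt_point).
  replace (Q a) with (zero : V) in E.
  - change (P b = Q b).
    replace (P b) with (plus (minus (P b) (Q b)) (Q b)) by linR V.
    rewrite <- E. linR V.
  - unfold Q. rewrite (RInt_ext _ (fun _ => zero)).
    + rewrite RInt_const. symmetry; apply (scal_zero_r (V := V)).
    + intros z _. apply RInt_point. }
apply (constant_of_derive_zero (fun t => minus (P t) (Q t))).
rewrite Rmin_left, Rmax_right by trivial. intros t Ht.
assert (Ez : minus (RInt (f t) c d) (RInt (f t) c d) = (zero : V)) by linR V.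
change (is_derive (fun t => minus (P t) (Q t)) t (zero : V)). rewrite <- Ez.
apply (is_derive_minus (V := V)).
- apply (is_derive_RInt (V := V) (fun x => RInt (f x) c d) P a t).
  + apply locally_R_iff. exists (Rmin (t - a0) (a1 - t)).
    split; [apply Rmin_pos; lra|]. intros y Hy.
    assert (Rmin (t - a0) (a1 - t) <= t - a0) by apply Rmin_l.
    assert (Rmin (t - a0) (a1 - t) <= a1 - t) by apply Rmin_r.
    apply Rabs_lt_between in Hy.
    apply (RInt_correct (V := V)). apply ex_RInt_cont. intros x Hx. apply Cin.
    split; [apply Rlt_le_trans with (2 := proj1 Hx)|apply Rle_lt_trans with (1 := proj2 Hx)].
    apply Rmin_glb_lt; lra. apply Rmax_lub_lt; lra.
  + apply Cin; lra.
- apply (is_derive_eps (V := V)). intros eps Heps.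
  set (e := eps / (d - c + 1)).
  assert (He : 0 < e) by (apply Rdiv_lt_0_compat; lra).
  destruct (tube f t c d e) as [del [Hdel Htu]]; [intros; apply H; lra|trivial|].
  exists (Rmin del (Rmin (t - a0) (a1 - t))).
  split; [repeat apply Rmin_pos; lra|]. intros y Hy.
  assert (Hy1 : Rabs (y - t) < del) by (eapply Rlt_le_trans; [exact Hy|apply Rmin_l]).
  assert (Hy2 : a0 < y < a1).
  { assert (Rmin del (Rmin (t - a0) (a1 - t)) <= Rmin (t - a0) (a1 - t)) by apply Rmin_r.
    assert (Rmin (t - a0) (a1 - t) <= t - a0) by apply Rmin_l.
    assert (Rmin (t - a0) (a1 - t) <= a1 - t) by apply Rmin_r.
    apply Rabs_lt_between in Hy. lra. }
  assert (Et : ex_RInt (f t) c d).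
  { apply ex_RInt_cont. rewrite Rmin_left, Rmax_right by trivial.
    intros z Hz. apply cont2_r. apply H; lra. }
  (* Differentiation under the integral sign: the remainder is the integral of [f x z - f t z] over
     the strip between [t] and [y], and [tube] makes this difference uniformly small. *)
  assert (EQ : minus (minus (Q y) (Q t)) (scal (y - t) (RInt (f t) c d))
    = RInt (fun z => RInt (fun x => minus (f x z) (f t z)) t y) c d).
  2 : change (norm (minus (minus (Q y) (Q t)) (scal (y - t) (RInt (f t) c d)))
        <= eps * Rabs (y - t)); rewrite EQ; clear EQ.
  + symmetry.
    rewrite (RInt_ext _ (fun z => minus (minus (RInt (fun x => f x z) a y)
       (RInt (fun x => f x z) a t)) (scal (y - t) (f t z)))).
    * rewrite RInt_minus_cont, RInt_minus_cont.
      2, 3 : apply Ezz; lra.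
      2 : apply (ex_RInt_minus (V := V)); apply Ezz; lra.
      2 : now apply (ex_RInt_scal (V := V)).
      rewrite (RInt_scal (V := V)); trivial.
    * rewrite Rmin_left, Rmax_right by trivial. intros z Hz.
      rewrite RInt_minus_cont, RInt_const.
      2 : apply Exx; lra. 2 : apply ex_RInt_const.
      rewrite <- (RInt_Chasles (fun x => f x z) a t y).
      2, 3 : apply Exx; lra.
      match goal with |- ?L = minus (minus (plus ?A ?B) ?A) ?D =>
        change (minus B D = minus (minus (plus A B) A) D);
        generalize A B D; intros; linR V end.
  + apply Rle_trans with (Rabs (d - c) * (Rabs (y - t) * e)).
    * apply norm_RInt_const.
      { apply ex_RInt_ext with
          (fun z => minus (RInt (fun x => f x z) t y) (scal (y - t) (f t z))).
        - rewrite Rmin_left, Rmax_right by trivial. intros z Hz.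
          rewrite RInt_minus_cont, RInt_const; trivial.
          apply Exx; lra. apply ex_RInt_const.
        - apply (ex_RInt_minus (V := V)). apply Ezz; lra.
          now apply (ex_RInt_scal (V := V)). }
      rewrite Rmin_left, Rmax_right by trivial. intros z Hz.
      apply norm_RInt_const.
      { apply (ex_RInt_minus (V := V)). apply Exx; lra. apply ex_RInt_const. }
      intros x Hx. left. apply Htu; trivial.
      apply Rle_lt_trans with (2 := Hy1).
      destruct (Rle_dec t y).
      - rewrite Rmin_left, Rmax_right in Hx by trivial.
        rewrite !Rabs_pos_eq; lra.
      - rewrite Rmin_right, Rmax_left in Hx by lra.
        rewrite !Rabs_left1; lra.
    * rewrite (Rabs_pos_eq (d - c)) by lra.
      assert (e * (d - c + 1) = eps) by (unfold e; field; lra).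
      assert (0 <= Rabs (y - t)) by apply Rabs_pos. nra.
Qed.

End CompleteModule.

(** * Improper integrals on the half line *)

Lemma Rpower_pos x y : 0 < Rpower x y.
Proof. apply exp_pos. Qed.

Lemma Rpower_le_exp x a b : 1 <= x -> a <= b -> Rpower x a <= Rpower x b.
Proof.
intros Hx Hab. destruct (Req_dec x 1) as [->|n].
- rewrite !(Rpower_ln_1) || (unfold Rpower; rewrite ln_1, !Rmult_0_r; lra).
- destruct Hab as [Hab| ->]; [|lra]. left. apply Rpower_lt; lra.
Qed.

Lemma Rpower_ge_exp x a b : 0 < x <= 1 -> a <= b -> Rpower x b <= Rpower x a.
Proof.
intros Hx Hab. unfold Rpower.
assert (Hl : ln x <= 0).
{ rewrite <- ln_1. destruct (Req_dec x 1) as [->|n]; [lra|].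
  left; apply ln_increasing; lra. }
destruct (Req_dec (a * ln x) (b * ln x)) as [->|n]; [lra|].
left; apply exp_increasing. nra.
Qed.

Lemma Rpower_lt_base x y e : 0 < e -> 0 < x < y -> Rpower x e < Rpower y e.
Proof.
intros He Hx. unfold Rpower. apply exp_increasing.
apply Rmult_lt_compat_l; trivial. apply ln_increasing; lra.
Qed.

Lemma Rpower_1_l e : Rpower 1 e = 1.
Proof. unfold Rpower. rewrite ln_1, Rmult_0_r. apply exp_0. Qed.

(** The derivative in [r] of [atan (r ^ e)]: a weight comparable to [r^(e-1)]
    near [0] and to [r^(-e-1)] near infinity, with integral [PI / 2]. *)
Definition kap (e r : R) : R := Rpower r e * e / r / (1 + (Rpower r e) ^ 2).

Lemma kap_pos e r : 0 < e -> 0 < r -> 0 < kap e r.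
Proof.
intros He Hr. unfold kap. assert (H := Rpower_pos r e).
assert (0 < 1 + Rpower r e ^ 2) by nra.
apply Rdiv_lt_0_compat; trivial. apply Rdiv_lt_0_compat; trivial. nra.
Qed.

Lemma is_derive_Rpower e r : 0 < r ->
  is_derive (fun x => Rpower x e) r (e * Rpower r e / r).
Proof.
intros Hr. unfold Rpower. auto_derive; trivial. field; lra.
Qed.

Lemma is_derive_atan_Rpower e r : 0 < r ->
  is_derive (fun x => atan (Rpower x e)) r (kap e r).
Proof.
intros Hr. unfold kap, Rpower.
auto_derive; trivial.
assert (H := exp_pos (e * ln r)).
unfold Rsqr. field. repeat split; nra.
Qed.

Lemma continuous_Rpower e r : 0 < r -> continuous (fun x => Rpower x e) r.
Proof.
intros Hr. apply (ex_derive_continuous (fun x => Rpower x e)).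
eexists; now apply is_derive_Rpower.
Qed.

Lemma continuous_kap e r : 0 < r -> continuous (kap e) r.
Proof.
intros Hr. apply (ex_derive_continuous (kap e)). unfold kap, Rpower.
auto_derive. repeat split; trivial; try lra.
assert (H := exp_pos (e * ln r)). nra.
Qed.

Lemma atan_le_id x : 0 <= x -> atan x <= x.
Proof.
intros Hx. destruct (Req_dec x 0) as [->|n]. { rewrite atan_0; lra. }
destruct (MVT_gen (fun x => x - atan x) 0 x (fun x => 1 - / (1 + x ^ 2))) as [c [Hc E]].
- intros y Hy. auto_derive; trivial. field. nra.
- intros y Hy. apply continuity_pt_filterlim.
  apply (ex_derive_continuous (fun x => x - atan x)). auto_derive; trivial.
- rewrite atan_0 in E.
  assert (0 <= 1 - / (1 + c ^ 2)).
  { assert (/ (1 + c ^ 2) <= / 1); [|lra]. apply Rinv_le_contravar; nra. }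
  nra.
Qed.

(** The left side is the mass of [kap e] on [[r, +oo)]. It is the [atan] of the inverse power, and
    [atan x <= x]. *)
Lemma atan_Rpower_ge e r : 0 < r -> PI / 2 - atan (Rpower r e) <= Rpower r (- e).
Proof.
intros Hr. rewrite <- atan_inv by apply Rpower_pos.
rewrite Rpower_Ropp. apply atan_le_id. left. apply Rinv_0_lt_compat, Rpower_pos.
Qed.

Lemma atan_Rpower_bound e r : 0 < atan (Rpower r e) < PI / 2.
Proof.
split; [|apply atan_bound]. rewrite <- atan_0. apply atan_increasing, Rpower_pos.
Qed.

Lemma is_RInt_kap e a b : 0 < a -> 0 < b ->
  is_RInt (kap e) a b (atan (Rpower b e) - atan (Rpower a e)).
Proof.
intros Ha Hb.
apply (is_RInt_derive (V := R_CompleteNormedModule) (fun x => atan (Rpower x e))).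
- intros x Hx. apply is_derive_atan_Rpower.
  apply Rlt_le_trans with (2 := proj1 Hx). now apply Rmin_glb_lt.
- intros x Hx. apply continuous_kap.
  apply Rlt_le_trans with (2 := proj1 Hx). now apply Rmin_glb_lt.
Qed.

Lemma Rpower_small e eta : 0 < e -> 0 < eta ->
  exists r0, 0 < r0 /\ forall r, 0 < r <= r0 -> Rpower r e <= eta.
Proof.
intros He Heta. exists (Rpower eta (/ e)). split; [apply Rpower_pos|].
intros r Hr. replace eta with (Rpower (Rpower eta (/ e)) e).
- destruct (Req_dec r (Rpower eta (/ e))) as [->|n]; [lra|].
  left. apply Rpower_lt_base; lra.
- rewrite Rpower_mult, Rinv_l by lra. now apply Rpower_1.
Qed.

Lemma Rpower_small_inf e eta : 0 < e -> 0 < eta ->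
  exists r1, 0 < r1 /\ forall r, r1 <= r -> Rpower r (- e) <= eta.
Proof.
intros He Heta. destruct (Rpower_small e eta He Heta) as [r0 [H0 H]].
exists (/ r0). split; [now apply Rinv_0_lt_compat|].
intros r Hr. assert (0 < / r0) by now apply Rinv_0_lt_compat.
assert (0 < r) by lra.
replace (Rpower r (- e)) with (Rpower (/ r) e).
- apply H. split; [now apply Rinv_0_lt_compat|].
  rewrite <- (Rinv_inv r0). now apply Rinv_le_contravar.
- unfold Rpower. f_equal. rewrite ln_Rinv by trivial. ring.
Qed.

(** * Improper integrals dominated by the weight *)

Section Improper.
Context {V : CompleteNormedModule R_AbsRing}.

Definition pint (f : R -> V) : V := RInt_gen f (at_right 0) (Rbar_locally p_infty).

(** Domination by a weight with known tails stands in for absolute integrability: every improper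
    integral then comes with an explicit truncation error, and the constant [C] can be tracked
    through parameters. *)
Definition dominated (f : R -> V) (C e : R) : Prop :=
  0 < e /\ forall r, 0 < r -> continuous f r /\ norm (f r) <= C * kap e r.

Lemma dominated_C_ge0 f C e : dominated f C e -> 0 <= C.
Proof.
intros [He H]. destruct (H 1 Rlt_0_1) as [_ H1].
assert (Hk := kap_pos e 1 He Rlt_0_1).
assert (0 <= norm (f 1)) by apply (norm_ge_0 (V := V)). nra.
Qed.

Lemma ex_RInt_pos (f : R -> V) a b :
  (forall r, 0 < r -> continuous f r) -> 0 < a -> 0 < b -> ex_RInt f a b.
Proof.
intros H Ha Hb. apply ex_RInt_cont. intros x Hx. apply H.
apply Rlt_le_trans with (2 := proj1 Hx). now apply Rmin_glb_lt.
Qed.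

Lemma norm_RInt_dominated_ord f C e a b : dominated f C e -> 0 < a -> a <= b ->
  norm (RInt f a b) <= C * (atan (Rpower b e) - atan (Rpower a e)).
Proof.
intros [He H] Ha Hab.
apply (norm_RInt_le f (fun r => C * kap e r) a b); trivial.
- intros x Hx. apply H. lra.
- apply (RInt_correct (V := V)). apply ex_RInt_pos; try lra. intros r Hr; now apply H.
- apply (is_RInt_scal (V := R_NormedModule)). apply is_RInt_kap; lra.
Qed.

Lemma norm_RInt_dominated f C e a b : dominated f C e -> 0 < a -> 0 < b ->
  norm (RInt f a b) <= C * Rabs (atan (Rpower b e) - atan (Rpower a e)).
Proof.
intros H Ha Hb. assert (HC := dominated_C_ge0 f C e H).
destruct (Rle_dec a b) as [L|L].
- apply Rle_trans with (1 := norm_RInt_dominated_ord f C e a b H Ha L).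
  apply Rmult_le_compat_l; trivial. apply Rle_abs.
- assert (E : RInt f a b = opp (RInt f b a)).
  { symmetry. apply (opp_RInt_swap (V := V)). apply ex_RInt_pos; trivial.
    intros r Hr; now apply (proj2 H). }
  rewrite E. apply Rle_trans with (norm (RInt f b a)).
  { right. apply (norm_opp (V := V)). }
  apply Rle_trans with (1 := norm_RInt_dominated_ord f C e b a H Hb ltac:(lra)).
  apply Rmult_le_compat_l; trivial. rewrite Rabs_minus_sym. apply Rle_abs.
Qed.

(** Cauchy's criterion: two truncations differ by integrals over pieces of [(0, r0]] and of
    [[r1, +oo)], on which the weight has small mass. *)
Lemma pint_correct f C e : dominated f C e ->
  is_RInt_gen f (at_right 0) (Rbar_locally p_infty) (pint f).
Proof.
intros H. apply (RInt_gen_correct (V := V)).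
assert (HC := dominated_C_ge0 f C e H).
assert (Hc : forall r, 0 < r -> continuous f r) by (intros; now apply (proj2 H)).
assert (He : 0 < e) by apply H.
assert (L : exists l, filterlim (fun ab : R * R => RInt f (fst ab) (snd ab))
  (filter_prod (at_right 0) (Rbar_locally p_infty)) (locally l)).
{ apply (proj1 (filterlim_locally_cauchy (U := V) _)). intros eps.
  (* Each of the two tails contributes at most [C * eta]; the summand 1 covers [C = 0]. *)
  set (eta := eps / (4 * (C + 1))).
  assert (Heta : 0 < eta).
  { apply Rdiv_lt_0_compat; [apply cond_pos|lra]. }
  destruct (Rpower_small e eta He Heta) as [r0 [Hr0 H0]].
  destruct (Rpower_small_inf e eta He Heta) as [r1 [Hr1 H1]].
  exists (fun ab => 0 < fst ab <= r0 /\ r1 <= snd ab). split.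
  - apply Filter_prod with (fun a => 0 < a <= r0) (fun b => r1 <= b).
    + exists (mkposreal r0 Hr0). intros y Hy Hy'. apply Rabs_lt_between in Hy.
      change (- r0 < y - 0 < r0) in Hy. lra.
    + exists r1. intros; lra.
    + intros a b Ha Hb. now split.
  - intros [a b] [a' b']; simpl. intros [Ha Hb] [Ha' Hb'].
    apply (norm_compat1 (V := V)).
    assert (E : minus (RInt f a' b') (RInt f a b) = plus (RInt f a' a) (RInt f b b')).
    { rewrite <- (RInt_Chasles f a' a b'), <- (RInt_Chasles f a b b');
      try (apply ex_RInt_pos; lra || trivial).
      generalize (RInt f a' a) (RInt f a b) (RInt f b b'). intros. linR V. }
    change (norm (minus (RInt f a' b') (RInt f a b)) < eps).
    rewrite E. apply Rle_lt_trans with (1 := norm_triangle (V := V) _ _).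
    assert (B1 := norm_RInt_dominated f C e a' a H ltac:(lra) ltac:(lra)).
    assert (B2 := norm_RInt_dominated f C e b b' H ltac:(lra) ltac:(lra)).
    assert (forall x, 0 < x <= r0 -> 0 < atan (Rpower x e) <= eta).
    { intros x Hx. split; [apply atan_Rpower_bound|].
      apply Rle_trans with (2 := H0 x Hx). apply atan_le_id. left; apply Rpower_pos. }
    assert (forall x, r1 <= x -> PI / 2 - eta <= atan (Rpower x e) < PI / 2).
    { intros x Hx. split; [|apply atan_Rpower_bound].
      assert (A := atan_Rpower_ge e x ltac:(lra)). specialize (H1 x Hx). lra. }
    assert (Rabs (atan (Rpower a e) - atan (Rpower a' e)) <= eta).
    { assert (Q1 := H2 a Ha). assert (Q2 := H2 a' Ha'). apply Rabs_le. lra. }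
    assert (Rabs (atan (Rpower b' e) - atan (Rpower b e)) <= eta).
    { assert (Q1 := H3 b Hb). assert (Q2 := H3 b' Hb'). apply Rabs_le. lra. }
    apply Rle_lt_trans with (C * eta + C * eta).
    + apply Rplus_le_compat.
      * apply Rle_trans with (1 := B1). now apply Rmult_le_compat_l.
      * apply Rle_trans with (1 := B2). now apply Rmult_le_compat_l.
    + assert (eta * (4 * (C + 1)) = eps) by (unfold eta; field; lra).
      assert (0 < eps) by apply cond_pos. nra. }
destruct L as [l Hl]. exists l.
intros P HP. specialize (Hl P HP). unfold filtermap in Hl.
unfold filtermapi.
assert (Hpos : filter_prod (at_right 0) (Rbar_locally p_infty)
  (fun ab : R * R => 0 < fst ab /\ 0 < snd ab)).
{ apply Filter_prod with (fun a => 0 < a) (fun b => 0 < b).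
  + exists (mkposreal 1 Rlt_0_1). intros y _ Hy. exact Hy.
  + now exists 0.
  + intros a b Ha Hb. now split. }
generalize (filter_and _ _ Hl Hpos). apply filter_imp.
intros [a b] [Hab [Ha Hb]]. exists (RInt f a b). split; trivial.
apply (RInt_correct (V := V)). now apply ex_RInt_pos.
Qed.

(** If the bound failed by some [eps], a truncation [[a', b']] containing [[a, b]] and within [eps]
    of the integral would contradict the bound on the two pieces of [[a', b']] outside [[a, b]]. *)
Lemma pint_approx f C e a b : dominated f C e -> 0 < a -> a <= b ->
  norm (minus (pint f) (RInt f a b)) <= C * (Rpower a e + Rpower b (- e)).
Proof.
intros H Ha Hab. assert (Hp := pint_correct f C e H).
assert (HC := dominated_C_ge0 f C e H).
assert (Hc : forall r, 0 < r -> continuous f r) by (intros; now apply (proj2 H)).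
apply Rnot_lt_le. intros L.
set (eps := norm (minus (pint f) (RInt f a b)) - C * (Rpower a e + Rpower b (- e))).
assert (Heps : 0 < eps) by (unfold eps; lra).
assert (HP : locally (pint f) (fun y => norm (minus y (pint f)) < eps)).
{ apply (locally_le_locally_norm (V := V)). now exists (mkposreal eps Heps). }
specialize (Hp _ HP). unfold filtermapi in Hp.
destruct Hp as [Q1 Q2 [d HQ1] [M HQ2] HQ].
set (a' := Rmin (d / 2) a). set (b' := Rmax (M + 1) b).
assert (Ha' : 0 < a' <= a).
{ split; [apply Rmin_pos; trivial|apply Rmin_r]. assert (0 < d) by apply cond_pos. lra. }
assert (Hb' : b <= b') by apply Rmax_r.
destruct (HQ a' b') as [y [Hy1 Hy2]].
{ apply HQ1. 2 : apply Ha'.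
  change (Rabs (a' - 0) < d). rewrite Rminus_0_r, Rabs_pos_eq by lra.
  apply Rle_lt_trans with (d / 2); [apply Rmin_l|]. assert (0 < d) by apply cond_pos. lra. }
{ apply HQ2. apply Rlt_le_trans with (M + 1); [lra|apply Rmax_l]. }
simpl in Hy1. apply (is_RInt_unique (V := V)) in Hy1. subst y.
assert (E : minus (RInt f a' b') (RInt f a b) = plus (RInt f a' a) (RInt f b b')).
{ rewrite <- (RInt_Chasles f a' a b'), <- (RInt_Chasles f a b b');
  try (apply ex_RInt_pos; lra || trivial).
  generalize (RInt f a' a) (RInt f a b) (RInt f b b'). intros. linR V. }
assert (B1 := norm_RInt_dominated_ord f C e a' a H ltac:(lra) ltac:(lra)).
assert (B2 := norm_RInt_dominated_ord f C e b b' H ltac:(lra) ltac:(lra)).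
assert (A1 := atan_Rpower_bound e a'). assert (A2 := atan_Rpower_bound e b').
assert (A3 := atan_le_id (Rpower a e) (Rlt_le _ _ (Rpower_pos _ _))).
assert (A4 := atan_Rpower_ge e b ltac:(lra)).
assert (T : norm (minus (pint f) (RInt f a b)) <=
  norm (minus (RInt f a' b') (pint f)) + norm (minus (RInt f a' b') (RInt f a b))).
{ eapply Rle_trans; [apply (norm_triangle3 (V := V) _ (RInt f a' b'))|].
  apply Rplus_le_compat_r. right. apply (norm_minus_sym (V := V)). }
rewrite E in T.
assert (T2 := norm_triangle (V := V) (RInt f a' a) (RInt f b b')).
unfold eps in Hy2. clear E HP HQ1 HQ2 HQ.
match type of T2 with ?u <= _ => match type of T with _ <= _ + ?w => change w with u in T end end.
assert (C * (atan (Rpower a e) - atan (Rpower a' e)) <= C * Rpower a e)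
  by (apply Rmult_le_compat_l; lra).
assert (C * (atan (Rpower b' e) - atan (Rpower b e)) <= C * Rpower b (- e))
  by (apply Rmult_le_compat_l; lra).
apply (Rlt_irrefl (norm (minus (pint f) (RInt f a b)))).
apply Rle_lt_trans with (1 := T).
eapply Rlt_le_trans. { apply Rplus_lt_le_compat. exact Hy2. exact T2. }
apply Rle_trans with (norm (minus (pint f) (RInt f a b)) -
  C * (Rpower a e + Rpower b (- e)) + (C * Rpower a e + C * Rpower b (- e))).
- apply Rplus_le_compat_l. apply Rplus_le_compat; eapply Rle_trans; eassumption.
- right; ring.
Qed.

(** Truncation to the degenerate interval [[1, 1]]: the tails are the whole integral and each of
    them costs at most [C]. *)
Lemma norm_pint_le f C e : dominated f C e -> norm (pint f) <= 2 * C.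
Proof.
intros H. assert (A := pint_approx f C e 1 1 H Rlt_0_1 (Rle_refl 1)).
rewrite !Rpower_1_l in A.
assert (E : minus (pint f) (RInt f 1 1) = pint f).
{ rewrite RInt_point. generalize (pint f). intros. linR V. }
rewrite E in A. lra.
Qed.

(** The way in which identities between improper integrals are proved: both sides are compared with
    the same truncated expression, with errors [O(n^-e)]. *)
Lemma dominated_cauchy_eq (x y : V) (C : R) (e : R) :
  0 < e -> (forall n, 1 <= n -> norm (minus x y) <= C * Rpower n (- e)) -> x = y.
Proof.
intros He H.
assert (Z : norm (minus x y) = 0).
{ apply Rle_antisym; [|apply (norm_ge_0 (V := V))].
  apply Rnot_lt_le. intros L.
  assert (HC : 0 < C).
  { specialize (H 1 (Rle_refl 1)). rewrite Rpower_1_l in H. lra. }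
  destruct (Rpower_small_inf e (norm (minus x y) / (2 * C)) He) as [r1 [Hr1 H1]].
  { apply Rdiv_lt_0_compat; lra. }
  specialize (H (Rmax 1 r1) (Rmax_l _ _)). specialize (H1 (Rmax 1 r1) (Rmax_r _ _)).
  apply Rmult_le_compat_l with (r := C) in H1; [|lra].
  replace (C * (norm (minus x y) / (2 * C))) with (norm (minus x y) / 2) in H1
    by (field; lra). lra. }
apply (norm_eq_zero (V := V)) in Z.
assert (E : x = plus (minus x y) y) by linR V.
rewrite E, Z. apply plus_zero_l.
Qed.

End Improper.

(** * Bounded linear maps under the integral sign *)

Section BoundedMaps.
Context {V W : CompleteNormedModule R_AbsRing}.
Variable (L : V -> W) (M : R).
Hypothesis L_plus : forall x y, L (plus x y) = plus (L x) (L y).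
Hypothesis L_scal : forall (c : R) x, L (scal c x) = scal c (L x).
Hypothesis L_bound : forall x, norm (L x) <= M * norm x.

Lemma bmap_minus x y : L (minus x y) = minus (L x) (L y).
Proof.
assert (E : minus x y = plus x (scal (-1) y)) by linR V.
rewrite E, L_plus, L_scal. generalize (L x) (L y). intros. linR W.
Qed.

Lemma bmap_M : exists M', 0 < M' /\ forall x, norm (L x) <= M' * norm x.
Proof.
exists (Rmax M 1). split; [apply Rlt_le_trans with (2 := Rmax_r _ _); lra|].
intros x. apply Rle_trans with (1 := L_bound x).
apply Rmult_le_compat_r; [apply (norm_ge_0 (V := V))|apply Rmax_l].
Qed.

Lemma bmap_continuous (f : R -> V) x : continuous f x -> continuous (fun r => L (f r)) x.
Proof.
intros H. apply (continuous_eps (V := W)). intros eps Heps.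
destruct bmap_M as [M' [HM' HL]].
destruct (proj1 (continuous_eps (V := V) f x) H (eps / M')) as [d [Hd Hf]].
{ now apply Rdiv_lt_0_compat. }
exists d; split; trivial. intros y Hy.
apply (norm_eq_lt (V := W) _ _ _ (eq_sym (bmap_minus _ _))).
apply Rle_lt_trans with (1 := HL _).
apply Rmult_lt_reg_r with (/ M'); [now apply Rinv_0_lt_compat|].
replace (M' * norm (minus (f y) (f x)) * / M') with (norm (minus (f y) (f x)))
  by (field; lra).
now apply Hf.
Qed.

Lemma bmap_is_derive (f : R -> V) x l :
  is_derive f x l -> is_derive (fun r => L (f r)) x (L l).
Proof.
intros H. apply (is_derive_eps (V := W)). intros eps Heps.
destruct bmap_M as [M' [HM' HL]].
destruct (proj1 (is_derive_eps (V := V) f x l) H (eps / M')) as [d [Hd Hf]].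
{ now apply Rdiv_lt_0_compat. }
exists d; split; trivial. intros y Hy.
assert (E : minus (minus (L (f y)) (L (f x))) (scal (y - x) (L l)) =
   L (minus (minus (f y) (f x)) (scal (y - x) l))).
{ now rewrite !bmap_minus, L_scal. }
apply (norm_eq_le (V := W) _ _ _ E). apply Rle_trans with (1 := HL _).
specialize (Hf y Hy). apply Rmult_le_compat_l with (r := M') in Hf; [|lra].
replace (eps * Rabs (y - x)) with (M' * (eps / M' * Rabs (y - x))) by (field; lra).
exact Hf.
Qed.

(** Fundamental theorem of calculus: [L] of a primitive of [f] is a primitive of [L f]. *)
Lemma bmap_RInt (f : R -> V) a b :
  a <= b -> (forall x, a <= x <= b -> continuous f x) ->
  RInt (fun x => L (f x)) a b = L (RInt f a b).
Proof.
intros Hab Hf.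
(* Extend [f] continuously so that the primitive is differentiable at the ends. *)
set (g := fun x => f (Rmax a (Rmin b x))).
assert (Hg : forall x, continuous g x).
{ intros x. apply (continuous_eps (V := V)). intros eps Heps.
  destruct (proj1 (continuous_eps (V := V) f (Rmax a (Rmin b x)))
    (Hf _ ltac:(split; [apply Rmax_l|apply Rmax_lub; [lra|apply Rmin_l]])) eps Heps) as [d [Hd H]].
  exists d; split; trivial. intros y Hy. apply H.
  apply Rle_lt_trans with (2 := Hy).
  unfold Rmax, Rmin; repeat destruct Rle_dec; unfold Rabs; repeat destruct Rcase_abs; lra. }
assert (Efg : forall x, a <= x <= b -> f x = g x).
{ intros x Hx. unfold g. rewrite Rmin_right, Rmax_right; lra || trivial. }
assert (Eg : RInt f a b = RInt g a b).
{ apply RInt_ext. rewrite Rmin_left, Rmax_right by trivial.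
  intros x Hx. apply Efg; lra. }
assert (Eg' : RInt (fun x => L (f x)) a b = RInt (fun x => L (g x)) a b).
{ apply (RInt_ext (V := W)). rewrite Rmin_left, Rmax_right by trivial.
  intros x Hx. rewrite Efg; lra || trivial. }
rewrite Eg, Eg'.
assert (I : is_RInt (fun x => L (g x)) a b
  (minus (L (RInt g a b)) (L (RInt g a a)))).
{ apply (is_RInt_derive (V := W) (fun x => L (RInt g a x))).
  - intros x _. apply bmap_is_derive.
    apply (is_derive_RInt (V := V) g (fun x => RInt g a x) a x); [|apply Hg].
    apply filter_forall. intros y. apply (RInt_correct (V := V)).
    apply ex_RInt_cont. intros; apply Hg.
  - intros x _. apply bmap_continuous, Hg. }
apply (is_RInt_unique (V := W)) in I. rewrite I.
rewrite <- bmap_minus. f_equal. rewrite RInt_point.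
generalize (RInt g a b). intros. linR V.
Qed.

Lemma bmap_dominated (f : R -> V) C e : dominated f C e -> 0 <= M ->
  dominated (fun r => L (f r)) (M * C) e.
Proof.
intros [He H] HM. split; trivial. intros r Hr. destruct (H r Hr) as [H1 H2]. split.
- now apply bmap_continuous.
- apply Rle_trans with (1 := L_bound _). rewrite Rmult_assoc.
  now apply Rmult_le_compat_l.
Qed.

(** Both sides are close to [L] of the integral over [[1/n, n]]: the left one by its own truncation
    error, the right one by that of [f] multiplied by the bound of [L]. *)
Lemma bmap_pint (f : R -> V) C e : dominated f C e ->
  pint (fun r => L (f r)) = L (pint f).
Proof.
intros H. destruct bmap_M as [M' [HM' HL]].
assert (HC := dominated_C_ge0 f C e H).
assert (HLf : dominated (fun r => L (f r)) (M' * C) e).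
{ split; [apply H|]. intros r Hr. destruct (proj2 H r Hr) as [H1 H2]. split.
  - now apply bmap_continuous.
  - apply Rle_trans with (1 := HL _). rewrite Rmult_assoc.
    apply Rmult_le_compat_l; lra || trivial. }
apply (dominated_cauchy_eq (V := W)) with (C := 4 * (M' * C)) (e := e); [apply H|].
intros n Hn.
assert (Hn' : 0 < / n <= n).
{ split; [apply Rinv_0_lt_compat; lra|]. apply Rle_trans with 1; trivial.
  rewrite <- Rinv_1. apply Rinv_le_contravar; lra. }
assert (EP : Rpower (/ n) e = Rpower n (- e)).
{ unfold Rpower. rewrite ln_Rinv by lra. f_equal. ring. }
eapply Rle_trans; [apply (norm_triangle3 (V := W) _ (RInt (fun r => L (f r)) (/ n) n))|].
rewrite bmap_RInt; [|lra|intros; apply (proj2 H); lra].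
assert (B1 := pint_approx (fun r => L (f r)) (M' * C) e (/ n) n HLf ltac:(lra) ltac:(lra)).
assert (B2 := pint_approx f C e (/ n) n H ltac:(lra) ltac:(lra)).
rewrite bmap_RInt in B1; [|lra|intros; apply (proj2 H); lra].
rewrite EP in B1, B2. rewrite <- bmap_minus.
eapply Rle_trans; [apply Rplus_le_compat; [exact B1|apply HL]|].
rewrite (norm_minus_sym (V := V)).
apply Rmult_le_compat_l with (r := M') in B2; [|lra].
eapply Rle_trans; [apply Rplus_le_compat_l, B2|]. right; ring.
Qed.

End BoundedMaps.

Section PintLinear.
Context {V : CompleteNormedModule R_AbsRing}.

Lemma pint_ext (f g : R -> V) C e : dominated f C e ->
  (forall r, 0 < r -> f r = g r) -> pint f = pint g.
Proof.
intros H E. symmetry.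
apply (is_RInt_gen_unique (V := V)).
apply is_RInt_gen_ext with (f := f); [|now apply pint_correct with C e].
apply Filter_prod with (fun a => 0 < a) (fun b => 0 < b).
+ exists (mkposreal 1 Rlt_0_1). intros y _ Hy. exact Hy.
+ now exists 0.
+ intros a b Ha Hb x Hx. apply E. simpl in Hx.
  apply Rlt_trans with (2 := proj1 Hx). now apply Rmin_glb_lt.
Qed.

Lemma dominated_ext (f g : R -> V) C e : dominated f C e ->
  (forall r, 0 < r -> f r = g r) -> dominated g C e.
Proof.
intros [He H] E. split; trivial. intros r Hr. destruct (H r Hr) as [H1 H2].
rewrite <- E by trivial. split; trivial.
apply continuous_ext_loc with f; trivial.
apply locally_R_iff. exists r. split; trivial. intros y Hy. apply E.
apply Rabs_lt_between in Hy. lra.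
Qed.

Lemma kap_ge_lo e r : 0 < e -> 0 < r <= 1 -> e / 2 * Rpower r (e - 1) <= kap e r.
Proof.
intros He Hr. unfold kap, Rminus. rewrite Rpower_plus, Rpower_Ropp, Rpower_1 by lra.
assert (H : Rpower r e <= 1).
{ rewrite <- (Rpower_O r) by lra. apply Rpower_ge_exp; lra. }
assert (H0 := Rpower_pos r e).
apply Rmult_le_reg_r with (r * (1 + Rpower r e ^ 2)).
{ apply Rmult_lt_0_compat; nra. }
replace (Rpower r e * e / r / (1 + Rpower r e ^ 2) * (r * (1 + Rpower r e ^ 2)))
  with (Rpower r e * e) by (field; split; nra).
replace (e / 2 * (Rpower r e * / r) * (r * (1 + Rpower r e ^ 2)))
  with (e * Rpower r e * ((1 + Rpower r e ^ 2) / 2)) by (field; lra).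
assert (0 < e * Rpower r e) by now apply Rmult_lt_0_compat.
assert ((1 + Rpower r e ^ 2) / 2 <= 1) by nra. nra.
Qed.

Lemma kap_ge_hi e r : 0 < e -> 1 <= r -> e / 2 * Rpower r (- e - 1) <= kap e r.
Proof.
intros He Hr. unfold kap, Rminus. rewrite Rpower_plus, !Rpower_Ropp, Rpower_1 by lra.
assert (H : 1 <= Rpower r e).
{ rewrite <- (Rpower_O r) by lra. apply Rpower_le_exp; lra. }
apply Rmult_le_reg_r with (r * (1 + Rpower r e ^ 2)).
{ apply Rmult_lt_0_compat; nra. }
replace (Rpower r e * e / r / (1 + Rpower r e ^ 2) * (r * (1 + Rpower r e ^ 2)))
  with (Rpower r e * e) by (field; split; nra).
replace (e / 2 * (/ Rpower r e * / r) * (r * (1 + Rpower r e ^ 2)))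
  with (e * (/ Rpower r e * ((1 + Rpower r e ^ 2) / 2))) by (field; lra).
rewrite (Rmult_comm (Rpower r e)). apply Rmult_le_compat_l; [lra|].
apply Rmult_le_reg_l with (Rpower r e); [lra|].
rewrite <- Rmult_assoc, Rinv_r by lra. nra.
Qed.

(** A bound by powers [r ^ x], [x > -1] near [0], and [r ^ y], [y < -1] near
    infinity, is a bound by a multiple of some [kap e]. *)
Lemma kap_of_powers x y : -1 < x -> y < -1 -> exists e C, 0 < e /\ 0 < C /\
  forall r B, 0 < r -> (r <= 1 -> B <= Rpower r x) -> (1 <= r -> B <= Rpower r y) ->
  B <= C * kap e r.
Proof.
intros Hx Hy. set (e := Rmin (x + 1) (- 1 - y)).
assert (He : 0 < e) by (apply Rmin_pos; lra).
assert (e <= x + 1) by apply Rmin_l. assert (e <= - 1 - y) by apply Rmin_r.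
exists e, (2 / e). split; trivial. split; [apply Rdiv_lt_0_compat; lra|].
intros r B Hr H1 H2.
assert (A : forall p, B <= p -> e / 2 * p <= kap e r -> B <= 2 / e * kap e r).
{ intros p Hp Hk. apply Rle_trans with (1 := Hp).
  replace p with (2 / e * (e / 2 * p)) by (field; lra).
  apply Rmult_le_compat_l; trivial. left; apply Rdiv_lt_0_compat; lra. }
destruct (Rle_dec r 1) as [L|L].
- apply A with (Rpower r (e - 1)).
  + apply Rle_trans with (1 := H1 L). apply Rpower_ge_exp; lra.
  + apply kap_ge_lo; lra.
- apply A with (Rpower r (- e - 1)).
  + apply Rle_trans with (1 := H2 ltac:(lra)). apply Rpower_le_exp; lra.
  + apply kap_ge_hi; lra.
Qed.

Lemma pint_plus (f g : R -> V) C e C' e' : dominated f C e -> dominated g C' e' ->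
  pint (fun r => plus (f r) (g r)) = plus (pint f) (pint g).
Proof.
intros Hf Hg. apply (is_RInt_gen_unique (V := V)).
apply (is_RInt_gen_plus (V := V)).
- now apply pint_correct with C e.
- now apply pint_correct with C' e'.
Qed.

Lemma pint_minus (f g : R -> V) C e C' e' : dominated f C e -> dominated g C' e' ->
  pint (fun r => minus (f r) (g r)) = minus (pint f) (pint g).
Proof.
intros Hf Hg. apply (is_RInt_gen_unique (V := V)).
apply (is_RInt_gen_minus (V := V)).
- now apply pint_correct with C e.
- now apply pint_correct with C' e'.
Qed.

(** * Integrals depending on a parameter *)

Variable F : R -> R -> V.
Variables C e1 e2 : R.
Hypothesis HF : forall x z, 0 < x -> 0 < z -> cont2 F x z.
Hypothesis HB : forall x z, 0 < x -> 0 < z -> norm (F x z) <= C * (kap e1 x * kap e2 z).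
Hypothesis He1 : 0 < e1.
Hypothesis He2 : 0 < e2.

Lemma param_slice x : 0 < x -> dominated (F x) (C * kap e1 x) e2.
Proof.
intros Hx. split; trivial. intros z Hz. split.
- apply cont2_r. now apply HF.
- rewrite Rmult_assoc. now apply HB.
Qed.

Lemma param_C : 0 <= C.
Proof.
assert (H := HB 1 1 Rlt_0_1 Rlt_0_1).
assert (0 <= norm (F 1 1)) by apply (norm_ge_0 (V := V)).
assert (0 < kap e1 1 * kap e2 1)
  by (apply Rmult_lt_0_compat; apply kap_pos; lra).
apply Rnot_lt_le. intros L. nra.
Qed.

Lemma inv_n n : 1 <= n -> 0 < / n <= n.
Proof.
intros Hn. split; [apply Rinv_0_lt_compat; lra|]. apply Rle_trans with 1; trivial.
rewrite <- Rinv_1. apply Rinv_le_contravar; lra.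
Qed.

Lemma Rpower_inv_n n e : 1 <= n -> Rpower (/ n) e = Rpower n (- e).
Proof. intros Hn. unfold Rpower. rewrite ln_Rinv by lra. f_equal. ring. Qed.

Lemma param_RInt_continuous x n : 0 < x -> 1 <= n ->
  continuous (fun x => RInt (F x) (/ n) n) x.
Proof.
intros Hx Hn. destruct (inv_n n Hn).
apply continuous_RInt_param with 0 (x + 1); lra || trivial.
intros y z Hy Hz. apply HF; lra.
Qed.

Lemma param_pint_approx x n : 0 < x -> 1 <= n ->
  norm (minus (pint (F x)) (RInt (F x) (/ n) n)) <= 2 * C * Rpower n (- e2) * kap e1 x.
Proof.
intros Hx Hn. destruct (inv_n n Hn).
eapply Rle_trans; [apply (pint_approx _ _ _ _ _ (param_slice x Hx)); lra|].
rewrite Rpower_inv_n by trivial. right; ring.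
Qed.

(** The truncated integrals are continuous and converge locally uniformly: their error at [x] is
    [2 C n^-e2 kap e1 x], and [kap e1] is bounded near [x]. *)
Lemma param_pint_continuous x : 0 < x -> continuous (fun x => pint (F x)) x.
Proof.
intros Hx. apply (continuous_eps (V := V)). intros eps Heps.
assert (HC := param_C).
assert (Hk : continuous (kap e1) x) by now apply continuous_kap.
destruct (proj1 (continuous_eps (V := R_NormedModule) (kap e1) x) Hk 1 Rlt_0_1)
  as [d1 [Hd1 H1]].
set (K := kap e1 x + 1).
assert (HK : 0 < K) by (unfold K; assert (Q := kap_pos e1 x He1 Hx); lra).
destruct (Rpower_small_inf e2 (eps / (8 * (C + 1) * K)) He2) as [r1 [Hr1 Hn]].
{ apply Rdiv_lt_0_compat; trivial. apply Rmult_lt_0_compat; lra. }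
set (n := Rmax 1 r1).
assert (Hn1 : 1 <= n) by apply Rmax_l.
specialize (Hn n (Rmax_r _ _)).
destruct (proj1 (continuous_eps (V := V) _ x) (param_RInt_continuous x n Hx Hn1) (eps / 4))
  as [d2 [Hd2 H2]]; [lra|].
exists (Rmin x (Rmin d1 d2)). split; [repeat apply Rmin_pos; trivial|].
intros y Hy.
assert (Rmin x (Rmin d1 d2) <= x) by apply Rmin_l.
assert (Rmin x (Rmin d1 d2) <= Rmin d1 d2) by apply Rmin_r.
assert (Rmin d1 d2 <= d1) by apply Rmin_l.
assert (Rmin d1 d2 <= d2) by apply Rmin_r.
assert (Hy0 : 0 < y) by (apply Rabs_lt_between in Hy; lra).
specialize (H1 y ltac:(lra)). specialize (H2 y ltac:(lra)).
assert (Ky : kap e1 y <= K).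
{ change (Rabs (kap e1 y - kap e1 x) < 1) in H1.
  apply Rabs_lt_between in H1. unfold K.
  change (- (1) < kap e1 y - kap e1 x < 1) in H1. lra. }
assert (A : forall z, 0 < z -> kap e1 z <= K ->
  norm (minus (pint (F z)) (RInt (F z) (/ n) n)) <= eps / 4).
{ intros z Hz HKz. apply Rle_trans with (1 := param_pint_approx z n Hz Hn1).
  assert (P := Rpower_pos n (- e2)).
  apply Rle_trans with (2 * (C + 1) * Rpower n (- e2) * K).
  - assert (0 < kap e1 z) by now apply kap_pos.
    apply Rmult_le_compat; try lra. apply Rmult_le_pos; lra.
  - apply Rmult_le_compat_l with (r := 2 * (C + 1) * K) in Hn.
    2 : apply Rmult_le_pos; lra.
    replace (2 * (C + 1) * K * (eps / (8 * (C + 1) * K))) with (eps / 4) in Hn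
      by (field; lra). lra. }
assert (A1 := A y Hy0 Ky).
assert (A2 := A x Hx ltac:(unfold K; lra)).
eapply Rle_lt_trans; [apply (norm_triangle3 (V := V) _ (RInt (F y) (/ n) n))|].
eapply Rle_lt_trans; [apply Rplus_le_compat_l, (norm_triangle3 (V := V) _ (RInt (F x) (/ n) n))|].
rewrite (norm_minus_sym (V := V) (RInt (F x) (/ n) n)).
eapply Rle_lt_trans; [apply Rplus_le_compat; [exact A1|
  apply Rplus_le_compat; [left; exact H2|exact A2]]|].
lra.
Qed.

Lemma param_dominated : dominated (fun x => pint (F x)) (2 * C) e1.
Proof.
split; trivial. intros x Hx. split; [now apply param_pint_continuous|].
eapply Rle_trans; [apply (norm_pint_le _ _ _ (param_slice x Hx))|]. right; ring.
Qed.

(** The improper double integral is compared with the integral over the square [[1/n, n]^2]; the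
    worse of the two tails decides the exponent. *)
Lemma double_pint_approx n : 1 <= n ->
  norm (minus (pint (fun x => pint (F x)))
    (RInt (fun x => RInt (F x) (/ n) n) (/ n) n)) <=
  8 * C * Rpower n (- Rmin e1 e2).
Proof.
intros Hn. destruct (inv_n n Hn) as [Hn0 Hn1]. assert (HC := param_C).
eapply Rle_trans; [apply (norm_triangle3 (V := V) _ (RInt (fun x => pint (F x)) (/ n) n))|].
assert (B1 := pint_approx _ _ _ (/ n) n param_dominated Hn0 Hn1).
rewrite Rpower_inv_n in B1 by trivial.
(* The truncation error of the inner integral is again dominated in [x], now with a constant that
   tends to 0 with [n]. *)
assert (D : dominated (fun x => minus (pint (F x)) (RInt (F x) (/ n) n))
  (2 * C * Rpower n (- e2)) e1).
{ split; trivial. intros x Hx. split.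
  - apply (continuous_minus (V := V)). now apply param_pint_continuous.
    now apply param_RInt_continuous.
  - now apply param_pint_approx. }
assert (B2 := norm_RInt_dominated_ord _ _ _ (/ n) n D Hn0 Hn1).
rewrite RInt_minus_cont in B2.
2, 3 : apply ex_RInt_pos; lra || (intros; try now apply param_pint_continuous); try now apply param_RInt_continuous.
eapply Rle_trans; [apply Rplus_le_compat; [exact B1|exact B2]|].
assert (P2 : Rpower n (- e2) <= Rpower n (- Rmin e1 e2)).
{ apply Rpower_le_exp; trivial. assert (Rmin e1 e2 <= e2) by apply Rmin_r. lra. }
assert (P1 : Rpower n (- e1) <= Rpower n (- Rmin e1 e2)).
{ apply Rpower_le_exp; trivial. assert (Rmin e1 e2 <= e1) by apply Rmin_l. lra. }
assert (A1 := atan_Rpower_bound e1 n). assert (A2 := atan_Rpower_bound e1 (/ n)).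
assert (HP := PI_4). assert (P0 := Rpower_pos n (- e2)).
apply Rle_trans with (4 * C * Rpower n (- e1) + 2 * C * Rpower n (- e2) * 2).
- apply Rplus_le_compat; [lra|]. apply Rmult_le_compat_l; [|lra].
  apply Rmult_le_pos; lra.
- apply Rmult_le_compat_l with (r := 4 * C) in P1; [|lra].
  apply Rmult_le_compat_l with (r := 4 * C) in P2; [|lra]. lra.
Qed.

End PintLinear.

(** The squares [[1/n, n]^2] are invariant under exchange of the variables, so both iterated
    integrals are within [O(n^-e)] of the same proper double integral. A bound by a product of
    weights is what makes both orders converge. *)
Lemma fubini_pint {V : CompleteNormedModule R_AbsRing} (F : R -> R -> V) C e1 e2 :
  (forall x z, 0 < x -> 0 < z -> cont2 F x z) ->
  (forall x z, 0 < x -> 0 < z -> norm (F x z) <= C * (kap e1 x * kap e2 z)) ->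
  0 < e1 -> 0 < e2 ->
  pint (fun x => pint (fun z => F x z)) = pint (fun z => pint (fun x => F x z)).
Proof.
intros HF HB He1 He2.
apply (dominated_cauchy_eq (V := V)) with (C := 16 * C) (e := Rmin e1 e2).
{ now apply Rmin_pos. }
intros n Hn. destruct (inv_n n Hn) as [Hn0 Hn1].
assert (B1 := double_pint_approx F C e1 e2 HF HB He1 He2 n Hn).
assert (B2 := double_pint_approx (fun z x => F x z) C e2 e1
  ltac:(intros; apply cont2_swap; now apply HF)
  ltac:(intros; rewrite (Rmult_comm (kap e2 _)); now apply HB) He2 He1 n Hn).
rewrite Rmin_comm in B2.
rewrite <- (fubini F 0 (n + 1) 0 (n + 1)) in B2; try lra.
2 : intros; apply HF; lra.
eapply Rle_trans; [apply (norm_triangle3 (V := V) _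
  (RInt (fun x => RInt (fun z => F x z) (/ n) n) (/ n) n))|].
rewrite (norm_minus_sym (V := V) (RInt (fun x => RInt (fun z => F x z) (/ n) n) (/ n) n)).
eapply Rle_trans; [apply Rplus_le_compat; [exact B1|exact B2]|]. right; ring.
Qed.

(** * Functions with values in a module over [C] *)

Notation RS := restrict_scalars.
Notation CC := C_CompleteNormedModule.

Ltac cring := match goal with |- @eq _ ?a ?b => change (@eq C a b) end; ring.

Lemma cis_plus a b : cis (a + b) = (cis a * cis b)%C.
Proof. unfold cis, Cmult; simpl. now rewrite cos_plus, sin_plus, (Rplus_comm (sin a * cos b)), (Rplus_comm (cos a * sin b)) . Qed.

Lemma Cmod_cis a : Cmod (cis a) = 1.
Proof.
unfold Cmod, cis; simpl. replace (cos a * (cos a * 1) + sin a * (sin a * 1)) with 1.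
{ apply sqrt_1. }
generalize (sin2_cos2 a). unfold Rsqr. lra.
Qed.

Lemma cis_0 : cis 0 = RtoC 1.
Proof. unfold cis. now rewrite cos_0, sin_0. Qed.

Lemma cis_neq_0 a : cis a <> RtoC 0.
Proof. apply Cmod_gt_0. rewrite Cmod_cis. lra. Qed.

Definition polar (r a : R) : C := (RtoC r * cis a)%C.

Lemma Cmod_polar r a : 0 <= r -> Cmod (polar r a) = r.
Proof. intros. unfold polar. rewrite Cmod_mult, Cmod_cis, Cmod_R, Rabs_pos_eq; lra. Qed.

Lemma polar_neq_0 r a : 0 < r -> polar r a <> RtoC 0.
Proof. intros. apply Cmod_gt_0. rewrite Cmod_polar; lra. Qed.

Lemma Cmod_le_sum (x y : R) : Cmod (x, y) <= Rabs x + Rabs y.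
Proof.
replace (x, y) with (RtoC x + RtoC y * Ci)%C.
- eapply Rle_trans; [apply Cmod_triangle|].
  rewrite Cmod_mult, Cmod_Ci, !Cmod_R. lra.
- apply injective_projections; simpl; ring.
Qed.

Section CModule.
Context {X : CompleteNormedModule C_AbsRing}.

Lemma xnorm_eq_le (x y : X) c : x = y -> norm y <= c -> norm x <= c.
Proof. now intros ->. Qed.

Lemma xnorm_eq_lt (x y : X) c : x = y -> norm y < c -> norm x < c.
Proof. now intros ->. Qed.

Lemma xnorm_triangle (x y : X) : norm (plus x y) <= norm x + norm y.
Proof. exact (norm_triangle (V := X) x y). Qed.

Lemma xnorm_triangle3 (x y z : X) :
  norm (minus x z) <= norm (minus x y) + norm (minus y z).
Proof. exact (norm_triangle3 (V := RS X) x y z). Qed.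

Lemma xnorm_minus_le (x y : X) : norm (minus x y) <= norm x + norm y.
Proof. exact (norm_minus_le (V := RS X) x y). Qed.

Lemma xnorm_minus_sym (x y : X) : norm (minus x y) = norm (minus y x).
Proof. exact (norm_minus_sym (V := RS X) x y). Qed.

Lemma xnorm_le_minus (x y : X) : norm x <= norm y + norm (minus x y).
Proof. exact (norm_le_minus (V := RS X) x y). Qed.

Lemma xnorm_ge_0 (x : X) : 0 <= norm x.
Proof. exact (norm_ge_0 x). Qed.

Lemma norm_scal_C (c : C) (x : X) : norm (scal (c : C_AbsRing) x) <= Cmod c * norm x.
Proof. exact (norm_scal (c : C_AbsRing) x). Qed.

Definition is_der (f : R -> X) (x : R) (l : X) : Prop :=
  @is_derive R_AbsRing (RS X) f x l.

Definition cont (f : R -> X) (x : R) : Prop := @continuous R_UniformSpace X f x.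

Lemma is_der_eps (f : R -> X) (x : R) (l : X) :
  is_der f x l <-> forall eps, 0 < eps -> exists d, 0 < d /\
    forall y, Rabs (y - x) < d ->
      norm (minus (minus (f y) (f x)) (scal (RtoC (y - x) : C_AbsRing) l)) <= eps * Rabs (y - x).
Proof. exact (is_derive_eps (V := RS X) f x l). Qed.

Lemma cont_eps (f : R -> X) (x : R) :
  cont f x <-> forall eps, 0 < eps -> exists d, 0 < d /\
    forall y, Rabs (y - x) < d -> norm (minus (f y) (f x)) < eps.
Proof. exact (continuous_eps (V := RS X) f x). Qed.

Lemma is_der_cont (f : R -> X) x l : is_der f x l -> cont f x.
Proof.
intros H. apply (ex_derive_continuous (K := R_AbsRing) (V := RS X)). now exists l.
Qed.

(** [C] carries two uniform structures, the product one and that of the modulus. Continuity of [c]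
    is stated for the first, continuity of the multiplication by scalars for the second. *)
Lemma continuous_scal_C {T : UniformSpace} (c : T -> C) (v : T -> X) (x : T) :
  continuous (c : T -> C_UniformSpace) x -> continuous v x ->
  continuous (fun t => scal (c t : C_AbsRing) (v t)) x.
Proof.
intros Hc Hv.
assert (Hc' : filterlim c (locally x) (@locally (AbsRing_UniformSpace C_AbsRing) (c x))).
{ intros P [d HP].
  assert (A := proj1 (filterlim_norm_iff (V := RS CC) (locally x) c (c x)) Hc d (cond_pos d)).
  unfold filtermap. revert A. apply filter_imp. intros t Ht. apply HP. exact Ht. }
apply (filterlim_comp_2 (G := @locally (AbsRing_UniformSpace C_AbsRing) (c x))
  (H := locally (v x)) c v (fun a b => scal (a : C_AbsRing) b)); trivial.
apply (filterlim_scal (K := C_AbsRing) (V := X)).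
Qed.

Lemma is_der_scal (c : R -> C) (v : R -> X) x (dc : C) (dv : X) :
  @is_derive R_AbsRing (RS CC) c x dc -> is_der v x dv ->
  is_der (fun t => scal (c t : C_AbsRing) (v t)) x
    (plus (scal (dc : C_AbsRing) (v x)) (scal (c x : C_AbsRing) dv)).
Proof.
intros Hc Hv. apply is_der_eps. intros eps Heps.
assert (Hcc : @continuous R_UniformSpace C_UniformSpace c x).
{ apply (ex_derive_continuous (K := R_AbsRing) (V := RS CC)). now exists dc. }
set (N := norm (v x) + Cmod (c x) + norm dv + 1).
assert (N0 := xnorm_ge_0 (v x)). assert (N1 := Cmod_ge_0 (c x)). assert (N2 := xnorm_ge_0 dv).
assert (HN : 0 < N) by (unfold N; lra).
set (e := eps / (4 * N)).
assert (He : 0 < e) by (apply Rdiv_lt_0_compat; lra).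
destruct (proj1 (is_derive_eps (V := RS CC) c x dc) Hc e He) as [d1 [Hd1 H1]].
destruct (proj1 (is_der_eps v x dv) Hv (Rmin 1 e)) as [d2 [Hd2 H2]].
{ apply Rmin_pos; lra. }
destruct (proj1 (continuous_eps (V := RS CC) c x) Hcc (Rmin 1 e)) as [d3 [Hd3 H3]].
{ apply Rmin_pos; lra. }
exists (Rmin d1 (Rmin d2 d3)). split; [repeat apply Rmin_pos; trivial|].
intros y Hy.
assert (Rmin d1 (Rmin d2 d3) <= d1) by apply Rmin_l.
assert (Rmin d1 (Rmin d2 d3) <= Rmin d2 d3) by apply Rmin_r.
assert (Rmin d2 d3 <= d2) by apply Rmin_l.
assert (Rmin d2 d3 <= d3) by apply Rmin_r.
specialize (H1 y ltac:(lra)). specialize (H2 y ltac:(lra)). specialize (H3 y ltac:(lra)).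
change (Cmod (c y - c x - RtoC (y - x) * dc) <= e * Rabs (y - x)) in H1.
change (Cmod (c y - c x) < Rmin 1 e) in H3.
set (h := RtoC (y - x)) in *. set (R1 := (c y - c x - h * dc)%C) in *.
set (R2 := minus (minus (v y) (v x)) (scal (h : C_AbsRing) dv)) in *.
set (R3 := (c y - c x)%C) in *.
(* Exact expansion of the increment of the product: [R1] and [R2] are the first-order remainders of
   [c] and [v], and [R3 h dv] is of second order because [R3] is an increment of [c]. *)
assert (E : minus (minus (scal (c y : C_AbsRing) (v y)) (scal (c x : C_AbsRing) (v x)))
  (scal (h : C_AbsRing) (plus (scal (dc : C_AbsRing) (v x)) (scal (c x : C_AbsRing) dv)))
  = plus (plus (scal (R1 : C_AbsRing) (v x)) (scal (c y : C_AbsRing) R2))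
     (scal (Cmult R3 h : C_AbsRing) dv)).
{ unfold R1, R2, R3. generalize (c y) (c x) h (v x) (v y). intros. linC X. }
apply (xnorm_eq_le _ _ _ E).
assert (Hh : Cmod h = Rabs (y - x)) by apply Cmod_R.
assert (Hm1 : Rmin 1 e <= 1) by apply Rmin_l.
assert (Hm2 : Rmin 1 e <= e) by apply Rmin_r.
assert (Hcy : Cmod (c y) <= N).
{ replace (c y) with (c x + R3)%C by (unfold R3; ring).
  eapply Rle_trans; [apply Cmod_triangle|]. unfold N. lra. }
assert (Ay := Rabs_pos (y - x)).
eapply Rle_trans; [apply xnorm_triangle|].
eapply Rle_trans; [apply Rplus_le_compat; [apply xnorm_triangle|apply norm_scal_C]|].
eapply Rle_trans; [apply Rplus_le_compat_r, Rplus_le_compat; apply norm_scal_C|].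
rewrite Cmod_mult, Hh.
assert (T1 : Cmod R1 * norm (v x) <= e * Rabs (y - x) * N).
{ apply Rmult_le_compat; trivial. apply Cmod_ge_0. unfold N; lra. }
assert (T2 : Cmod (c y) * norm R2 <= N * (e * Rabs (y - x))).
{ apply Rmult_le_compat; trivial. apply Cmod_ge_0. apply xnorm_ge_0.
  apply Rle_trans with (1 := H2). now apply Rmult_le_compat_r. }
assert (T3 : Cmod R3 * Rabs (y - x) * norm dv <= e * Rabs (y - x) * N).
{ apply Rmult_le_compat; trivial. apply Rmult_le_pos; trivial. apply Cmod_ge_0.
  apply Rmult_le_compat_r; lra. unfold N; lra. }
assert (EE : e * (4 * N) = eps) by (unfold e; field; lra).
assert (0 <= e * Rabs (y - x) * N).
{ apply Rmult_le_pos; [apply Rmult_le_pos|]; lra. }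
nra.
Qed.

Lemma is_der_plus (f g : R -> X) x df dg : is_der f x df -> is_der g x dg ->
  is_der (fun t => plus (f t) (g t)) x (plus df dg).
Proof. exact (is_derive_plus (V := RS X) f g x df dg). Qed.

Lemma is_der_const (v : X) x : is_der (fun _ => v) x zero.
Proof. exact (is_derive_const (V := RS X) v x). Qed.

Lemma is_der_opp (f : R -> X) x df : is_der f x df -> is_der (fun t => opp (f t)) x (opp df).
Proof. exact (is_derive_opp (V := RS X) f x df). Qed.

Lemma is_der_ext (f g : R -> X) x l : (forall t, f t = g t) -> is_der f x l -> is_der g x l.
Proof. exact (is_derive_ext (V := RS X) f g x l). Qed.

Lemma is_der_ext_loc (f g : R -> X) x l : locally x (fun t => f t = g t) ->
  is_der f x l -> is_der g x l.
Proof. exact (is_derive_ext_loc (V := RS X) f g x l). Qed.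

End CModule.

Notation is_derC := (@is_der CC).
Notation contC := (@cont CC).

Lemma is_derC_pair (u v : R -> R) x du dv : is_derive u x du -> is_derive v x dv ->
  is_derC (fun t => (u t, v t)) x (du, dv).
Proof.
intros Hu Hv. apply (is_der_eps (X := CC)). intros eps Heps.
destruct (proj1 (is_derive_eps (V := R_NormedModule) u x du) Hu (eps / 2)) as [d1 [Hd1 H1]]; [lra|].
destruct (proj1 (is_derive_eps (V := R_NormedModule) v x dv) Hv (eps / 2)) as [d2 [Hd2 H2]]; [lra|].
exists (Rmin d1 d2). split; [now apply Rmin_pos|]. intros y Hy.
assert (Rmin d1 d2 <= d1) by apply Rmin_l. assert (Rmin d1 d2 <= d2) by apply Rmin_r.
specialize (H1 y ltac:(lra)). specialize (H2 y ltac:(lra)).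
change (Rabs (u y - u x - (y - x) * du) <= eps / 2 * Rabs (y - x)) in H1.
change (Rabs (v y - v x - (y - x) * dv) <= eps / 2 * Rabs (y - x)) in H2.
change (Cmod ((u y, v y) - (u x, v x) - RtoC (y - x) * (du, dv)) <= eps * Rabs (y - x)).
replace ((u y, v y) - (u x, v x) - RtoC (y - x) * (du, dv))%C
  with (u y - u x - (y - x) * du, v y - v x - (y - x) * dv)
  by (apply injective_projections; simpl; ring).
eapply Rle_trans; [apply Cmod_le_sum|]. lra.
Qed.

Lemma is_derC_Re c x dc : is_derC c x dc -> is_derive (fun t => Re (c t)) x (Re dc).
Proof.
apply (bmap_is_derive (V := RS CC) (W := R_CompleteNormedModule) Re 1).
- reflexivity.
- intros k z. change (Re (RtoC k * z) = k * Re z). destruct z as [p q]. unfold Cmult, RtoC, Re, Im. simpl. ring.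
- intros z. rewrite Rmult_1_l. apply re_le_Cmod.
Qed.

Lemma is_derC_Im c x dc : is_derC c x dc -> is_derive (fun t => Im (c t)) x (Im dc).
Proof.
apply (bmap_is_derive (V := RS CC) (W := R_CompleteNormedModule) Im 1).
- reflexivity.
- intros k z. change (Im (RtoC k * z) = k * Im z). destruct z as [p q]. unfold Cmult, RtoC, Re, Im. simpl. ring.
- intros z. rewrite Rmult_1_l. eapply Rle_trans; [|apply Rmax_Cmod]. apply Rmax_r.
Qed.

Lemma is_derC_mult f g x df dg : is_derC f x df -> is_derC g x dg ->
  is_derC (fun t => (f t * g t)%C) x (df * g x + f x * dg)%C.
Proof. exact (is_der_scal (X := CC) f g x df dg). Qed.

Lemma is_derC_R u x du : is_derive u x du -> is_derC (fun t => RtoC (u t)) x (RtoC du).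
Proof. intros H. apply is_derC_pair; trivial. apply (is_derive_const (V := R_NormedModule)). Qed.

Lemma is_derC_eq f x l l' : is_derC f x l -> l = l' -> is_derC f x l'.
Proof. now intros H <-. Qed.

Lemma is_derC_cis (u : R -> R) x du : is_derive u x du ->
  is_derC (fun t => cis (u t)) x (RtoC du * Ci * cis (u x))%C.
Proof.
intros H. eapply is_derC_eq.
- apply is_derC_pair.
  + apply (is_derive_comp cos u x); [apply is_derive_cos|exact H].
  + apply (is_derive_comp sin u x); [apply is_derive_sin|exact H].
- unfold scal; simpl; unfold mult; simpl.
  apply injective_projections; simpl; ring.
Qed.

Lemma is_derC_exp f x df : is_derC f x df ->
  is_derC (fun t => Cexp (f t)) x (df * Cexp (f x))%C.
Proof.
intros H. assert (Hr := is_derC_Re _ _ _ H). assert (Hi := is_derC_Im _ _ _ H).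
unfold Cexp. eapply is_derC_eq.
- apply is_derC_mult.
  + apply is_derC_R. apply (is_derive_comp exp (fun t => Re (f t)) x); [apply is_derive_exp|exact Hr].
  + apply is_derC_cis. exact Hi.
- unfold scal; simpl; unfold mult; simpl.
  destruct df as [p q]. apply injective_projections; simpl; ring.
Qed.

Lemma C_norm2_neq_0 (z : C) : z <> RtoC 0 -> Re z ^ 2 + Im z ^ 2 <> 0.
Proof.
intros H E. apply H. apply Cmod_eq_0. assert (A := Cmod2_alt z).
rewrite E in A. apply Rsqr_0_uniq. unfold Rsqr. lra.
Qed.

Lemma is_derC_inv f x df : is_derC f x df -> f x <> RtoC 0 ->
  is_derC (fun t => (/ f t)%C) x (- df * (/ f x * / f x))%C.
Proof.
intros H Hf. assert (Hr := is_derC_Re _ _ _ H). assert (Hi := is_derC_Im _ _ _ H).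
assert (N := C_norm2_neq_0 _ Hf).
apply (is_der_ext (X := CC)) with (fun t => (Re (f t) / (Re (f t) ^ 2 + Im (f t) ^ 2),
   - Im (f t) / (Re (f t) ^ 2 + Im (f t) ^ 2))).
{ reflexivity. }
set (u := fun t => Re (f t)) in *. set (v := fun t => Im (f t)) in *.
eapply is_derC_eq.
- apply (is_derC_pair (fun t => u t / (u t ^ 2 + v t ^ 2)) (fun t => - v t / (u t ^ 2 + v t ^ 2))).
  + auto_derive.
    * repeat split; try (exists (Re df); exact Hr); try (exists (Im df); exact Hi).
      intros E; apply N. unfold u, v in E. rewrite <- E. ring.
    * change (fun x0 : R => u x0) with u. change (fun x0 : R => v x0) with v.
      rewrite (is_derive_unique u x _ Hr), (is_derive_unique v x _ Hi). reflexivity.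
  + auto_derive.
    * repeat split; try (exists (Re df); exact Hr); try (exists (Im df); exact Hi).
      intros E; apply N. unfold u, v in E. rewrite <- E. ring.
    * change (fun x0 : R => u x0) with u. change (fun x0 : R => v x0) with v.
      rewrite (is_derive_unique u x _ Hr), (is_derive_unique v x _ Hi). reflexivity.
- unfold u, v. destruct (f x) as [p q]. destruct df as [s t].
  apply injective_projections; simpl in *; field; intros E; apply N; rewrite <- E; ring.
Qed.

Lemma continuous_C_pair {T : UniformSpace} (u v : T -> R) (x : T) :
  continuous u x -> continuous v x -> continuous (fun t => (u t, v t) : C_UniformSpace) x.
Proof.
intros Hu Hv P [d HP].
assert (H1 := Hu (ball (u x) d) (locally_ball _ _)).
assert (H2 := Hv (ball (v x) d) (locally_ball _ _)).
unfold filtermap in *.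
assert (H3 := filter_and _ _ H1 H2). revert H3. apply filter_imp. intros t [A B].
apply HP. split; trivial.
Qed.

Lemma continuous_C_Re {T : UniformSpace} (f : T -> C_UniformSpace) (x : T) :
  continuous f x -> continuous (fun t => Re (f t)) x.
Proof.
intros H. apply (continuous_comp f Re); trivial.
intros P [d HP]. exists d. intros y [Hy _]. now apply HP.
Qed.

Lemma continuous_C_Im {T : UniformSpace} (f : T -> C_UniformSpace) (x : T) :
  continuous f x -> continuous (fun t => Im (f t)) x.
Proof.
intros H. apply (continuous_comp f Im); trivial.
intros P [d HP]. exists d. intros y [_ Hy]. now apply HP.
Qed.

Lemma continuous_C_mult {T : UniformSpace} (f g : T -> C_UniformSpace) (x : T) :
  continuous f x -> continuous g x -> continuous (fun t => (f t * g t)%C : C_UniformSpace) x.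
Proof. exact (continuous_scal_C (X := CC) f g x). Qed.

Lemma continuous_cis {T : UniformSpace} (u : T -> R) (x : T) :
  continuous u x -> continuous (fun t => cis (u t) : C_UniformSpace) x.
Proof.
intros H. apply continuous_C_pair.
- apply (continuous_comp u cos); trivial. apply continuous_cos.
- apply (continuous_comp u sin); trivial. apply continuous_sin.
Qed.

Lemma continuous_RtoC {T : UniformSpace} (u : T -> R) (x : T) :
  continuous u x -> continuous (fun t => RtoC (u t) : C_UniformSpace) x.
Proof. intros H. apply continuous_C_pair; trivial. apply continuous_const. Qed.

Lemma continuous_Cexp {T : UniformSpace} (f : T -> C_UniformSpace) (x : T) :
  continuous f x -> continuous (fun t => Cexp (f t) : C_UniformSpace) x.
Proof.
intros H. unfold Cexp. apply continuous_C_mult.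
- apply continuous_RtoC. apply (continuous_comp (fun t => Re (f t)) exp).
  now apply continuous_C_Re. apply continuous_exp.
- apply continuous_cis. now apply continuous_C_Im.
Qed.

Lemma continuous_C_inv {T : UniformSpace} (f : T -> C_UniformSpace) (x : T) :
  continuous f x -> f x <> RtoC 0 -> continuous (fun t => (/ f t)%C : C_UniformSpace) x.
Proof.
intros H Hf. assert (Hr := continuous_C_Re _ _ H). assert (Hi := continuous_C_Im _ _ H).
assert (N := C_norm2_neq_0 _ Hf).
assert (Hn : continuous (fun t => / (Re (f t) ^ 2 + Im (f t) ^ 2)) x).
{ apply (continuous_comp (fun t => Re (f t) ^ 2 + Im (f t) ^ 2) Rinv).
  - apply (continuous_plus (V := R_NormedModule)); simpl.
    + apply (continuous_mult (K := R_AbsRing)); trivial.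
      apply (continuous_mult (K := R_AbsRing)); trivial. apply continuous_const.
    + apply (continuous_mult (K := R_AbsRing)); trivial.
      apply (continuous_mult (K := R_AbsRing)); trivial. apply continuous_const.
  - now apply continuous_Rinv. }
unfold Cinv. apply continuous_C_pair.
- now apply (continuous_mult (K := R_AbsRing)).
- apply (continuous_mult (K := R_AbsRing)); trivial.
  now apply (continuous_opp (V := R_NormedModule)).
Qed.

Notation "c *: x" := (scal (K := AbsRing.Ring C_AbsRing) c%C x)
  (at level 40, left associativity).

(** * Holomorphic functions in polar coordinates *)

Section PolarHolomorphic.
Context {X : CompleteNormedModule C_AbsRing}.

Definition xcont2 (f : R -> R -> X) (r a : R) : Prop := @cont2 (RS X) f r a.

(** [f r a] stands for [F (r e^{ia})] with [F] holomorphic, and [f1] for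
    [F']: the polar form of the Cauchy-Riemann equations. *)
Definition polat (f f1 : R -> R -> X) (r a : R) : Prop :=
  is_der (fun r => f r a) r (cis a *: f1 r a) /\
  is_der (fun a => f r a) a ((Ci * RtoC r * cis a) *: f1 r a) /\
  xcont2 f r a /\ xcont2 f1 r a.

Definition polhol (lo hi : R) (f : R -> R -> X) : Prop :=
  exists f1 : R -> R -> X, forall r a, 0 < r -> lo < a < hi -> polat f f1 r a.

Lemma polhol_cont2 lo hi f r a : polhol lo hi f -> 0 < r -> lo < a < hi -> xcont2 f r a.
Proof. intros [f1 H] Hr Ha. now apply (H r a). Qed.

Lemma polhol_cont lo hi f r a : polhol lo hi f -> 0 < r -> lo < a < hi ->
  cont (fun r => f r a) r.
Proof. intros H Hr Ha. apply (cont2_l (V := RS X)). now apply (polhol_cont2 lo hi). Qed.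

Lemma polhol_sub lo hi lo' hi' f : polhol lo hi f -> lo <= lo' -> hi' <= hi ->
  polhol lo' hi' f.
Proof. intros [f1 H] H1 H2. exists f1. intros r a Hr Ha. apply H; lra. Qed.

Lemma xcont2_ext lo hi (f g : R -> R -> X) r a :
  (forall r a, 0 < r -> lo < a < hi -> f r a = g r a) ->
  0 < r -> lo < a < hi -> xcont2 f r a -> xcont2 g r a.
Proof.
intros E Hr Ha H. unfold xcont2, cont2 in *.
apply continuous_ext_loc with (2 := H).
apply locally_R2_iff. exists (Rmin r (Rmin (a - lo) (hi - a))).
split; [repeat apply Rmin_pos; lra|]. intros x y Hx Hy. apply E.
- assert (Rmin r (Rmin (a - lo) (hi - a)) <= r) by apply Rmin_l.
  apply Rabs_lt_between in Hx. simpl. lra.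
- assert (Rmin r (Rmin (a - lo) (hi - a)) <= Rmin (a - lo) (hi - a)) by apply Rmin_r.
  assert (Rmin (a - lo) (hi - a) <= a - lo) by apply Rmin_l.
  assert (Rmin (a - lo) (hi - a) <= hi - a) by apply Rmin_r.
  apply Rabs_lt_between in Hy. simpl. lra.
Qed.

Lemma polhol_ext lo hi f g : (forall r a, 0 < r -> lo < a < hi -> f r a = g r a) ->
  polhol lo hi f -> polhol lo hi g.
Proof.
intros E [f1 H]. exists f1. intros r a Hr Ha. destruct (H r a Hr Ha) as [H1 [H2 [H3 H4]]].
split; [|split; [|split]]; trivial.
- apply (is_der_ext_loc (fun r => f r a)); [|exact H1]. apply locally_R_iff. exists r; split; trivial.
  intros y Hy. apply E; trivial. apply Rabs_lt_between in Hy. lra.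
- apply (is_der_ext_loc (fun a => f r a)); [|exact H2]. apply locally_R_iff.
  exists (Rmin (a - lo) (hi - a)); split; [repeat apply Rmin_pos; lra|].
  intros y Hy. apply E; trivial.
  assert (Rmin (a - lo) (hi - a) <= a - lo) by apply Rmin_l.
  assert (Rmin (a - lo) (hi - a) <= hi - a) by apply Rmin_r.
  apply Rabs_lt_between in Hy. lra.
- now apply (xcont2_ext lo hi f).
Qed.

Lemma is_der_eq (f : R -> X) x l l' : is_der f x l -> l = l' -> is_der f x l'.
Proof. now intros H <-. Qed.

Lemma polhol_plus lo hi f g : polhol lo hi f -> polhol lo hi g ->
  polhol lo hi (fun r a => plus (f r a) (g r a)).
Proof.
intros [f1 Hf] [g1 Hg]. exists (fun r a => plus (f1 r a) (g1 r a)).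
intros r a Hr Ha. destruct (Hf r a Hr Ha) as [F1 [F2 [F3 F4]]].
destruct (Hg r a Hr Ha) as [G1 [G2 [G3 G4]]]. split; [|split; [|split]].
- eapply is_der_eq; [apply is_der_plus; [exact F1|exact G1]|]. linC X.
- eapply is_der_eq; [apply is_der_plus; [exact F2|exact G2]|]. linC X.
- now apply (continuous_plus (V := RS X)).
- now apply (continuous_plus (V := RS X)).
Qed.

Lemma polhol_const lo hi (v : X) : polhol lo hi (fun _ _ => v).
Proof.
exists (fun _ _ => zero). intros r a Hr Ha. split; [|split; [|split]].
- eapply is_der_eq; [apply is_der_const|]. linC X.
- eapply is_der_eq; [apply is_der_const|]. linC X.
- apply continuous_const.
- apply continuous_const.
Qed.

Lemma polat_scal (g g1 : R -> R -> C) f f1 r a :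
  (is_derC (fun r => g r a) r (cis a * g1 r a)%C /\
    is_derC (fun a => g r a) a (Ci * RtoC r * cis a * g1 r a)%C /\
    @cont2 (RS CC) g r a /\ @cont2 (RS CC) g1 r a) ->
  polat f f1 r a ->
  polat (fun r a => g r a *: f r a)
    (fun r a => plus (g1 r a *: f r a) (g r a *: f1 r a)) r a.
Proof.
intros [G1 [G2 [G3 G4]]] [F1 [F2 [F3 F4]]].
split; [|split; [|split]].
- eapply is_der_eq; [apply is_der_scal; [exact G1|exact F1]|]. linC X.
- eapply is_der_eq; [apply is_der_scal; [exact G2|exact F2]|]. linC X.
- now apply continuous_scal_C.
- apply (continuous_plus (V := RS X)); now apply continuous_scal_C.
Qed.

(** Cauchy's theorem on a polar rectangle. *)
Lemma box (lo hi rlo rhi : R) (f f1 : R -> R -> X) a0 a1 r0 r1 :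
  (forall r a, rlo < r < rhi -> lo < a < hi -> polat f f1 r a) ->
  lo < a0 -> a0 <= a1 -> a1 < hi -> 0 <= rlo < r0 -> r0 <= r1 < rhi ->
  minus (RInt (V := RS X) (fun r => cis a1 *: f r a1) r0 r1)
        (RInt (V := RS X) (fun r => cis a0 *: f r a0) r0 r1) =
  RInt (V := RS X) (fun a => minus ((Ci * RtoC r1 * cis a) *: f r1 a)
                      ((Ci * RtoC r0 * cis a) *: f r0 a)) a0 a1.
Proof.
intros H Ha0 Ha Ha1 Hr0 [Hr Hrhi].
(* [D] is both the derivative of [e^{ia} f] in [a] and that of [i r e^{ia} f] in [r]: this is the
   closedness of [f dz]. Each side of the statement is one of the iterated integrals of [D]. *)
set (D := fun r a => (Ci * cis a) *: plus (f r a) ((RtoC r * cis a) *: f1 r a)).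
assert (HD : forall r a, rlo < r < rhi -> lo < a < hi -> xcont2 D r a).
{ intros r a Hr' Ha'. destruct (H r a Hr' Ha') as [F1 [F2 [F3 F4]]].
  assert (Cc : continuous (fun p : R * R => cis (snd p) : C_UniformSpace) (r, a)).
  { apply continuous_cis. apply continuous_snd. }
  apply continuous_scal_C.
  - apply (continuous_C_mult (fun _ => Ci)); trivial. apply continuous_const.
  - apply (continuous_plus (V := RS X)); trivial.
    apply continuous_scal_C; trivial.
    apply (continuous_C_mult (fun p : R * R => RtoC (fst p))); trivial.
    apply continuous_RtoC. apply continuous_fst. }
assert (HcR : forall r a, rlo < r < rhi -> lo < a < hi -> cont (fun r => cis a *: f r a) r).
{ intros r a Hr' Ha'. destruct (H r a Hr' Ha') as [F1 [F2 [F3 F4]]].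
  apply continuous_scal_C; [apply continuous_const|].
  now apply (cont2_l (V := RS X)). }
assert (L : minus (RInt (V := RS X) (fun r => cis a1 *: f r a1) r0 r1)
        (RInt (V := RS X) (fun r => cis a0 *: f r a0) r0 r1) =
  RInt (V := RS X) (fun r => RInt (V := RS X) (fun a => D r a) a0 a1) r0 r1).
{ transitivity (RInt (V := RS X) (fun r => minus (cis a1 *: f r a1) (cis a0 *: f r a0)) r0 r1).
  - symmetry. apply (RInt_minus_cont (V := RS X));
    apply (ex_RInt_cont (V := RS X)); rewrite Rmin_left, Rmax_right by trivial;
    intros; apply HcR; lra.
  - apply (RInt_ext (V := RS X)). rewrite Rmin_left, Rmax_right by trivial.
    intros r Hr'. symmetry. apply (is_RInt_unique (V := RS X)).
    apply (is_RInt_derive (V := RS X) (fun a => cis a *: f r a)).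
    + rewrite Rmin_left, Rmax_right by trivial. intros a Ha'.
      destruct (H r a ltac:(lra) ltac:(lra)) as [F1 [F2 [F3 F4]]].
      eapply is_der_eq.
      * apply is_der_scal; [|exact F2].
        apply (is_derC_cis (fun a => a)). apply is_derive_id.
      * unfold D. linC X.
    + rewrite Rmin_left, Rmax_right by trivial. intros a Ha'.
      apply (cont2_r (V := RS X)). apply HD; lra. }
rewrite L.
rewrite (fubini (V := RS X) D rlo rhi lo hi); try lra.
2 : { intros; apply HD; lra. }
apply (RInt_ext (V := RS X)). rewrite Rmin_left, Rmax_right by trivial.
intros a Ha'. apply (is_RInt_unique (V := RS X)).
apply (is_RInt_derive (V := RS X) (fun r => (Ci * RtoC r * cis a) *: f r a)).
- rewrite Rmin_left, Rmax_right by trivial. intros r Hr'.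
  destruct (H r a ltac:(lra) ltac:(lra)) as [F1 [F2 [F3 F4]]].
  eapply is_der_eq.
  + apply is_der_scal; [|exact F1].
    apply is_derC_mult; [|apply (is_der_const (X := CC))].
    apply is_derC_mult; [apply (is_der_const (X := CC))|].
    apply (is_derC_R (fun r => r)). apply is_derive_id.
  + unfold D. linC X.
- rewrite Rmin_left, Rmax_right by trivial. intros r Hr'.
  apply (cont2_l (V := RS X)). apply HD; lra.
Qed.

(** * Integrals over rays and their rotation *)

Definition ray (f : R -> R -> X) (a : R) : X :=
  @pint (RS X) (fun r => cis a *: f r a).

Lemma norm_cis_scal a (v : X) : norm (cis a *: v) <= norm v.
Proof.
eapply Rle_trans; [apply norm_scal_C|]. rewrite Cmod_cis. lra.
Qed.

Lemma ray_dominated lo hi f a C e : polhol lo hi f -> lo < a < hi -> 0 < e ->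
  (forall r, 0 < r -> norm (f r a) <= C * kap e r) ->
  @dominated (RS X) (fun r => cis a *: f r a) C e.
Proof.
intros Hf Ha He HB. split; trivial. intros r Hr. split.
- apply continuous_scal_C; [apply continuous_const|]. now apply (polhol_cont lo hi).
- eapply Rle_trans; [apply norm_cis_scal|]. now apply HB.
Qed.

(** With the length factor [r], an arc of radius [r] contributes [r * kap e r] per unit of angle;
    this and the companion bound make arcs vanish at both ends of a ray. *)
Lemma r_kap_hi e r : 0 < e -> 0 < r -> r * kap e r <= e * Rpower r (- e).
Proof.
intros He Hr. unfold kap. assert (P := Rpower_pos r e). rewrite Rpower_Ropp.
assert (Q : 0 < 1 + Rpower r e ^ 2) by nra.
apply Rmult_le_reg_r with (Rpower r e * (1 + Rpower r e ^ 2)).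
{ now apply Rmult_lt_0_compat. }
replace (r * (Rpower r e * e / r / (1 + Rpower r e ^ 2)) * (Rpower r e * (1 + Rpower r e ^ 2)))
  with (e * (Rpower r e ^ 2)) by (field; lra).
replace (e * / Rpower r e * (Rpower r e * (1 + Rpower r e ^ 2)))
  with (e * (1 + Rpower r e ^ 2)) by (field; lra).
nra.
Qed.

Lemma r_kap_lo e r : 0 < e -> 0 < r -> r * kap e r <= e * Rpower r e.
Proof.
intros He Hr. unfold kap. assert (P := Rpower_pos r e).
assert (Q : 0 < 1 + Rpower r e ^ 2) by nra.
apply Rmult_le_reg_r with (1 + Rpower r e ^ 2); trivial.
replace (r * (Rpower r e * e / r / (1 + Rpower r e ^ 2)) * (1 + Rpower r e ^ 2))
  with (e * Rpower r e) by (field; lra).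
assert (0 < e * Rpower r e) by now apply Rmult_lt_0_compat. nra.
Qed.

(** Cauchy's theorem on the rectangle with radii in [[1/n, n]] and angles in [[a0, a1]]: the two
    arcs contribute [O(n^-e)]. *)
Lemma ray_rotate lo hi f a0 a1 C e : polhol lo hi f -> lo < a0 -> a0 <= a1 -> a1 < hi ->
  0 < e -> (forall r a, 0 < r -> a0 <= a <= a1 -> norm (f r a) <= C * kap e r) ->
  ray f a0 = ray f a1.
Proof.
intros Hf Ha0 Ha Ha1 He HB.
assert (D0 := ray_dominated lo hi f a0 C e Hf ltac:(lra) He ltac:(intros; apply HB; lra)).
assert (D1 := ray_dominated lo hi f a1 C e Hf ltac:(lra) He ltac:(intros; apply HB; lra)).
assert (HC := dominated_C_ge0 (V := RS X) _ _ _ D0).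
apply (dominated_cauchy_eq (V := RS X)) with
  (C := 4 * C + (a1 - a0) * (2 * (C * e))) (e := e); trivial.
intros n Hn. destruct (inv_n n Hn) as [Hn0 Hn1].
assert (B0 := pint_approx (V := RS X) _ _ _ (/ n) n D0 Hn0 Hn1).
assert (B1 := pint_approx (V := RS X) _ _ _ (/ n) n D1 Hn0 Hn1).
rewrite Rpower_inv_n in B0, B1 by trivial.
assert (P := Rpower_pos n (- e)).
assert (B2 : norm (minus (RInt (V := RS X) (fun r => cis a1 *: f r a1) (/ n) n)
        (RInt (V := RS X) (fun r => cis a0 *: f r a0) (/ n) n)) <=
        (a1 - a0) * (2 * (C * e) * Rpower n (- e))).
{ destruct Hf as [f1 Hf1].
  apply (xnorm_eq_le _ _ _ (box lo hi 0 (n + 1) f f1 a0 a1 (/ n) n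
    ltac:(intros; apply Hf1; lra) Ha0 Ha Ha1 ltac:(lra) ltac:(lra))).
  assert (Hf : polhol lo hi f) by now exists f1.
  rewrite <- (Rabs_pos_eq (a1 - a0)) by lra.
  apply (norm_RInt_const (V := RS X)).
  - apply ex_RInt_cont. rewrite Rmin_left, Rmax_right by trivial. intros a Ha'.
    apply (continuous_minus (V := RS X)).
    + apply continuous_scal_C.
      * apply (continuous_C_mult (fun _ => (Ci * RtoC n)%C)); [apply continuous_const|].
        apply continuous_cis, continuous_id.
      * apply (cont2_r (V := RS X)). apply (polhol_cont2 lo hi); trivial; lra.
    + apply continuous_scal_C.
      * apply (continuous_C_mult (fun _ => (Ci * RtoC (/ n))%C)); [apply continuous_const|].
        apply continuous_cis, continuous_id.
      * apply (cont2_r (V := RS X)). apply (polhol_cont2 lo hi); trivial; lra.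
  - rewrite Rmin_left, Rmax_right by trivial. intros a Ha'.
    eapply Rle_trans; [apply xnorm_minus_le|].
    assert (E : forall r, 0 < r -> norm ((Ci * RtoC r * cis a) *: f r a) <= C * (r * kap e r)).
    { intros r Hr. eapply Rle_trans; [apply norm_scal_C|].
      rewrite !Cmod_mult, Cmod_Ci, Cmod_R, Cmod_cis, Rabs_pos_eq by lra.
      assert (norm (f r a) <= C * kap e r) by now apply HB.
      replace (C * (r * kap e r)) with (1 * r * 1 * (C * kap e r)) by ring.
      apply Rmult_le_compat_l; lra. }
    eapply Rle_trans; [apply Rplus_le_compat; apply E; lra|].
    assert (K1 := r_kap_hi e n He ltac:(lra)). assert (K2 := r_kap_lo e (/ n) He Hn0).
    rewrite Rpower_inv_n in K2 by trivial.
    apply Rmult_le_compat_l with (r := C) in K1; trivial.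
    apply Rmult_le_compat_l with (r := C) in K2; trivial. lra. }
eapply Rle_trans; [apply (norm_triangle3 (V := RS X) _
  (RInt (V := RS X) (fun r => cis a0 *: f r a0) (/ n) n))|].
eapply Rle_trans; [apply Rplus_le_compat_l; apply (norm_triangle3 (V := RS X) _
  (RInt (V := RS X) (fun r => cis a1 *: f r a1) (/ n) n))|].
rewrite (norm_minus_sym (V := RS X) (RInt (V := RS X) (fun r => cis a0 *: f r a0) (/ n) n)).
rewrite (norm_minus_sym (V := RS X) _ (ray f a1)).
eapply Rle_trans; [apply Rplus_le_compat; [exact B0|
  apply Rplus_le_compat; [exact B2|exact B1]]|].
right; ring.
Qed.

End PolarHolomorphic.

(** * Scalar holomorphic functions in polar coordinates *)

Notation polholC := (@polhol CC).

Lemma polhol_mul {X : CompleteNormedModule C_AbsRing} lo hi (g : R -> R -> C) (f : R -> R -> X) :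
  polholC lo hi g -> polhol lo hi f -> polhol lo hi (fun r a => g r a *: f r a).
Proof.
intros [g1 Hg] [f1 Hf]. eexists. intros r a Hr Ha.
apply polat_scal; [exact (Hg r a Hr Ha)|exact (Hf r a Hr Ha)].
Qed.

Lemma polholC_mult lo hi f g : polholC lo hi f -> polholC lo hi g ->
  polholC lo hi (fun r a => (f r a * g r a)%C).
Proof. exact (polhol_mul (X := CC) lo hi f g). Qed.

Lemma polholC_plus lo hi f g : polholC lo hi f -> polholC lo hi g ->
  polholC lo hi (fun r a => (f r a + g r a)%C).
Proof. exact (polhol_plus (X := CC) lo hi f g). Qed.

Lemma polholC_const lo hi c : polholC lo hi (fun _ _ => c).
Proof. exact (polhol_const (X := CC) lo hi c). Qed.

Lemma polholC_opp lo hi f : polholC lo hi f -> polholC lo hi (fun r a => (- f r a)%C).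
Proof.
intros H. apply (polhol_ext (X := CC)) with (fun r a => (-(1) * f r a)%C).
- intros; cring.
- apply polholC_mult; trivial. apply polholC_const.
Qed.

Lemma polholC_minus lo hi f g : polholC lo hi f -> polholC lo hi g ->
  polholC lo hi (fun r a => (f r a - g r a)%C).
Proof. intros Hf Hg. apply polholC_plus; trivial. now apply polholC_opp. Qed.

Lemma continuous_polar (p : R * R) :
  continuous (fun p : R * R => polar (fst p) (snd p) : C_UniformSpace) p.
Proof.
apply continuous_C_mult.
- apply continuous_RtoC, continuous_fst.
- apply continuous_cis, continuous_snd.
Qed.

Lemma polholC_id lo hi : polholC lo hi polar.
Proof.
exists (fun _ _ => RtoC 1). intros r a Hr Ha. split; [|split; [|split]].
- eapply is_derC_eq.
  + apply is_derC_mult; [|apply (is_der_const (X := CC))].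
    apply (is_derC_R (fun r => r)). apply is_derive_id.
  + unfold zero, one; simpl. unfold scal; simpl. unfold mult; simpl.
    apply injective_projections; simpl; ring.
- eapply is_derC_eq.
  + apply is_derC_mult; [apply (is_der_const (X := CC))|].
    apply (is_derC_cis (fun a => a)). apply is_derive_id.
  + unfold zero, one; simpl. unfold scal; simpl. unfold mult; simpl.
    apply injective_projections; simpl; ring.
- apply continuous_polar.
- apply continuous_const.
Qed.

Lemma polatC_inv (f f1 : R -> R -> C) r a : @polat CC f f1 r a -> f r a <> RtoC 0 ->
  @polat CC (fun r a => (/ f r a)%C) (fun r a => (- f1 r a * (/ f r a * / f r a))%C) r a.
Proof.
intros [F1 [F2 [F3 F4]]] H0.
assert (I : continuous (fun p : R * R => (/ f (fst p) (snd p))%C : C_UniformSpace) (r, a)).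
{ now apply continuous_C_inv. }
split; [|split; [|split]].
- eapply is_derC_eq; [apply is_derC_inv; [exact F1|trivial]|].
  change (- (cis a * f1 r a) * (/ f r a * / f r a) =
    cis a * (- f1 r a * (/ f r a * / f r a)))%C. ring.
- eapply is_derC_eq; [apply is_derC_inv; [exact F2|trivial]|].
  change (- (Ci * RtoC r * cis a * f1 r a) * (/ f r a * / f r a) =
    Ci * RtoC r * cis a * (- f1 r a * (/ f r a * / f r a)))%C. ring.
- exact I.
- apply continuous_C_mult.
  + apply (continuous_opp (V := CC)). exact F4.
  + now apply continuous_C_mult.
Qed.

Lemma polholC_inv lo hi f : polholC lo hi f ->
  (forall r a, 0 < r -> lo < a < hi -> f r a <> RtoC 0) ->
  polholC lo hi (fun r a => (/ f r a)%C).
Proof.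
intros [f1 Hf] H0. eexists. intros r a Hr Ha. apply polatC_inv.
- now apply Hf.
- now apply H0.
Qed.

Lemma polholC_exp lo hi f : polholC lo hi f -> polholC lo hi (fun r a => Cexp (f r a)).
Proof.
intros [f1 Hf]. exists (fun r a => (f1 r a * Cexp (f r a))%C).
intros r a Hr Ha. destruct (Hf r a Hr Ha) as [F1 [F2 [F3 F4]]]. split; [|split; [|split]].
- eapply is_derC_eq; [apply is_derC_exp; exact F1|].
  change (cis a * f1 r a * Cexp (f r a) = cis a * (f1 r a * Cexp (f r a)))%C. ring.
- eapply is_derC_eq; [apply is_derC_exp; exact F2|].
  change (Ci * RtoC r * cis a * f1 r a * Cexp (f r a) =
    Ci * RtoC r * cis a * (f1 r a * Cexp (f r a)))%C. ring.
- now apply continuous_Cexp.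
- apply continuous_C_mult; trivial. now apply continuous_Cexp.
Qed.

Lemma polholC_pow lo hi f n : polholC lo hi f -> polholC lo hi (fun r a => (f r a ^ n)%C).
Proof.
intros H. induction n as [|n IH]; simpl.
- apply polholC_const.
- now apply polholC_mult.
Qed.

(** Polar form of [z ^ al]. *)
Definition zpow (al r a : R) : C := (RtoC (Rpower r al) * cis (al * a))%C.

Lemma continuous_zpow al r a : 0 < r ->
  continuous (fun p : R * R => zpow al (fst p) (snd p) : C_UniformSpace) (r, a).
Proof.
intros Hr. apply continuous_C_mult.
- apply continuous_RtoC.
  apply (continuous_comp (fun p : R * R => fst p) (fun x => Rpower x al)).
  + apply continuous_fst.
  + now apply continuous_Rpower.
- apply continuous_cis.
  apply (continuous_mult (K := R_AbsRing) (fun _ => al)).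
  apply continuous_const. apply continuous_snd.
Qed.

Lemma polholC_zpow lo hi al : polholC lo hi (zpow al).
Proof.
exists (fun r a => (RtoC al * zpow (al - 1) r a)%C). intros r a Hr Ha.
assert (Er : Rpower r al = Rpower r (al - 1) * r).
{ rewrite <- (Rpower_1 r) at 3 by trivial. rewrite <- Rpower_plus. f_equal; ring. }
assert (Ec : cis (al * a) = (cis ((al - 1) * a) * cis a)%C).
{ rewrite <- cis_plus. f_equal; ring. }
split; [|split; [|split]].
- eapply is_derC_eq.
  + apply is_derC_mult; [|apply (is_der_const (X := CC))].
    apply is_derC_R. now apply is_derive_Rpower.
  + unfold zpow. change (RtoC (al * Rpower r al / r) * cis (al * a) + RtoC (Rpower r al) * 0 =
      cis a * (RtoC al * (RtoC (Rpower r (al - 1)) * cis ((al - 1) * a))))%C.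
    rewrite Er, Ec. replace (al * (Rpower r (al - 1) * r) / r) with (al * Rpower r (al - 1))
      by (field; lra). rewrite RtoC_mult. ring.
- eapply is_derC_eq.
  + apply is_derC_mult; [apply (is_der_const (X := CC))|].
    apply (is_derC_cis (fun a => al * a)). apply (is_derive_scal (fun x => x)).
    apply is_derive_id.
  + unfold zpow. change (0 * cis (al * a) + RtoC (Rpower r al) * (RtoC (al * 1) * Ci * cis (al * a))
      = Ci * RtoC r * cis a * (RtoC al * (RtoC (Rpower r (al - 1)) * cis ((al - 1) * a))))%C.
    rewrite Er, Ec, Rmult_1_r, RtoC_mult. ring.
- now apply continuous_zpow.
- apply (continuous_C_mult (fun _ => RtoC al)); [apply continuous_const|].
  now apply continuous_zpow.
Qed.

(** [e] and [C] depend on the exponents alone, which keeps later bounds uniform in, and linear in,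
    the size [C0] of the function, including [C0 = 0]. *)
Lemma kap_of_powers_scaled x y : -1 < x -> y < -1 -> exists e C, 0 < e /\ 0 < C /\
  forall C0 r B, 0 <= C0 -> 0 < r -> (r <= 1 -> B <= C0 * Rpower r x) ->
  (1 <= r -> B <= C0 * Rpower r y) -> B <= C * C0 * kap e r.
Proof.
intros Hx Hy. destruct (kap_of_powers x y Hx Hy) as [e [C [He [HC H]]]].
exists e, C. split; [trivial|split; trivial]. intros C0 r B HC0 Hr H1 H2.
destruct HC0 as [HC0|<-].
- specialize (H r (B / C0) Hr). apply Rmult_le_reg_r with (/ C0); [now apply Rinv_0_lt_compat|].
  replace (C * C0 * kap e r * / C0) with (C * kap e r) by (field; lra).
  apply H; intros L; [specialize (H1 L)|specialize (H2 L)];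
  apply Rmult_le_reg_r with C0; trivial; unfold Rdiv;
  rewrite Rmult_assoc, Rinv_l, Rmult_1_r by lra; lra.
- rewrite Rmult_0_r, Rmult_0_l. destruct (Rle_dec r 1) as [L|L].
  + specialize (H1 L). lra.
  + specialize (H2 ltac:(lra)). lra.
Qed.

(** * Distances in polar coordinates *)

Lemma Cmod_sqr (z : C) : Cmod z ^ 2 = Re z ^ 2 + Im z ^ 2.
Proof. apply Cmod2_alt. Qed.

Lemma polar_dist2 r a s b :
  Cmod (polar r a - polar s b) ^ 2 = r ^ 2 + s ^ 2 - 2 * r * s * cos (a - b).
Proof.
rewrite Cmod_sqr, cos_minus. unfold polar, cis; simpl.
assert (A := sin2_cos2 a). assert (B := sin2_cos2 b). unfold Rsqr in *.
transitivity (r ^ 2 * (sin a * sin a + cos a * cos a) + s ^ 2 * (sin b * sin b + cos b * cos b)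
  - 2 * r * s * (cos a * cos b + sin a * sin b)); [ring|rewrite A, B; ring].
Qed.

Lemma le_of_sqr x y : 0 <= y -> x ^ 2 <= y ^ 2 -> x <= y.
Proof. intros Hy H. apply Rnot_lt_le. intros L. nra. Qed.

(** With [t] the sine of the half angle, the squared distance equals
    [t^2 (r + s)^2 + (1 - t^2) (r - s)^2]. *)
Lemma polar_dist_ge r a s b : 0 < r -> 0 < s ->
  Rabs (sin ((a - b) / 2)) * (r + s) <= Cmod (polar r a - polar s b).
Proof.
intros Hr Hs. apply le_of_sqr; [apply Cmod_ge_0|].
rewrite polar_dist2, Rpow_mult_distr, pow2_abs.
replace (a - b) with (2 * ((a - b) / 2)) at 2 by field.
rewrite cos_2a_sin. set (t := sin ((a - b) / 2)).
assert (Ht : t * t <= 1).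
{ assert (A := sin2_cos2 ((a - b) / 2)). unfold Rsqr in A. fold t in A. nra. }
assert (0 <= (1 - t * t) * (r - s) ^ 2) by (apply Rmult_le_pos; [lra|apply pow2_ge_0]).
lra.
Qed.

Lemma polar_dist_ge_r r a s b : 0 < r -> 0 < s -> Rabs (r - s) <= Cmod (polar r a - polar s b).
Proof.
intros Hr Hs. apply le_of_sqr; [apply Cmod_ge_0|].
rewrite polar_dist2, pow2_abs.
assert (cos (a - b) <= 1) by apply COS_bound.
assert (0 <= r * s * (1 - cos (a - b))) by (repeat apply Rmult_le_pos; lra). lra.
Qed.

Lemma sin_ge_half x : 0 <= x <= 1 -> x / 2 <= sin x.
Proof.
intros Hx. destruct (MVT_gen sin 0 x cos) as [c [Hc E]].
- intros y _. apply is_derive_sin.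
- intros y _. apply continuity_sin.
- rewrite sin_0 in E. rewrite Rmin_left, Rmax_right in Hc by lra.
  assert (1 / 2 <= cos c).
  { rewrite <- cos_PI3. assert (P := PI2_3_2). assert (P4 := PI_4).
    apply cos_decr_1; lra. }
  nra.
Qed.

(** Together with [polar_dist_ge_r] it bounds both polar increments by the distance, as needed to
    bound a difference quotient at a removable singularity. *)
Lemma polar_dist_ge_a r a s b : 0 < r -> 0 < s -> Rabs (a - b) <= 1 ->
  s * Rabs (a - b) <= 4 * Cmod (polar r a - polar s b).
Proof.
intros Hr Hs Ha. assert (H := polar_dist_ge r a s b Hr Hs).
assert (A : Rabs (a - b) / 4 <= Rabs (sin ((a - b) / 2))).
{ assert (Hp := Rabs_pos (a - b)). assert (G : Rabs (sin ((a - b) / 2)) = sin (Rabs (a - b) / 2)).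
  { unfold Rabs at 2. destruct (Rcase_abs (a - b)).
    - replace (- (a - b) / 2) with (- ((a - b) / 2)) by field. rewrite sin_neg.
      rewrite Rabs_left1; trivial.
      replace ((a - b) / 2) with (- (- (a - b) / 2)) by field. rewrite sin_neg.
      assert (B := sin_ge_half (- (a - b) / 2)). rewrite Rabs_left1 in Ha by lra. lra.
    - apply Rabs_pos_eq. assert (B := sin_ge_half ((a - b) / 2)).
      rewrite Rabs_pos_eq in Ha by lra. lra. }
  rewrite G. assert (B := sin_ge_half (Rabs (a - b) / 2) ltac:(lra)). lra. }
assert (Q : Rabs (a - b) / 4 * (r + s) <= Rabs (sin ((a - b) / 2)) * (r + s)).
{ apply Rmult_le_compat_r; lra. }
assert (0 <= Rabs (a - b)) by apply Rabs_pos. nra.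
Qed.

Lemma polar_neq r a s b : 0 < r -> 0 < s -> (r <> s \/ sin ((a - b) / 2) <> 0) ->
  (polar r a - polar s b)%C <> RtoC 0.
Proof.
intros Hr Hs H. apply Cmod_gt_0. destruct H as [H|H].
- apply Rlt_le_trans with (2 := polar_dist_ge_r r a s b Hr Hs).
  apply Rabs_pos_lt. lra.
- apply Rlt_le_trans with (2 := polar_dist_ge r a s b Hr Hs).
  apply Rmult_lt_0_compat; [now apply Rabs_pos_lt|lra].
Qed.

Lemma polar_opp s b : polar s (b + PI) = (- polar s b)%C.
Proof. unfold polar. rewrite cis_plus. unfold cis at 2. rewrite cos_PI, sin_PI.
apply injective_projections; simpl; ring. Qed.

Lemma polar_sum_ge r a s b : 0 < r -> 0 < s ->
  Rabs (cos ((a - b) / 2)) * (r + s) <= Cmod (polar r a + polar s b).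
Proof.
intros Hr Hs. assert (H := polar_dist_ge r a s (b + PI) Hr Hs).
rewrite polar_opp in H.
replace ((a - (b + PI)) / 2) with (- (PI / 2 - (a - b) / 2)) in H by field.
rewrite sin_neg, sin_shift, Rabs_Ropp in H.
now replace (polar r a - - polar s b)%C with (polar r a + polar s b)%C in H by ring.
Qed.

(** * An explicitly integrable kernel *)

Lemma pint_primitive {V : CompleteNormedModule R_AbsRing} (P f : R -> V) l0 l1 :
  (forall r, 0 < r -> is_derive P r (f r)) -> (forall r, 0 < r -> continuous f r) ->
  filterlim P (at_right 0) (locally l0) ->
  filterlim P (Rbar_locally p_infty) (locally l1) -> pint f = minus l1 l0.
Proof.
intros HP Hf H0 H1. apply (is_RInt_gen_unique (V := V)).
assert (L : filterlim (fun ab : R * R => minus (P (snd ab)) (P (fst ab)))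
  (filter_prod (at_right 0) (Rbar_locally p_infty)) (locally (minus l1 l0))).
{ apply (filterlim_comp_2 (G := locally l1) (H := locally (opp l0))
   (fun ab : R * R => P (snd ab)) (fun ab : R * R => opp (P (fst ab))) plus).
  - apply filterlim_comp with (2 := H1). apply filterlim_snd.
  - apply filterlim_comp with (locally l0).
    + apply filterlim_comp with (2 := H0). apply filterlim_fst.
    + apply (filterlim_opp (V := V)).
  - apply (filterlim_plus (V := V)). }
intros Q HQ. specialize (L Q HQ). unfold filtermap in L. unfold filtermapi.
assert (Hpos : filter_prod (at_right 0) (Rbar_locally p_infty)
  (fun ab : R * R => 0 < fst ab /\ 0 < snd ab)).
{ apply Filter_prod with (fun a => 0 < a) (fun b => 0 < b).
  + exists (mkposreal 1 Rlt_0_1). intros y _ Hy. exact Hy.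
  + now exists 0.
  + intros a b Ha Hb. now split. }
generalize (filter_and _ _ L Hpos). apply filter_imp.
intros [a b] [Hab [Ha Hb]]. exists (minus (P b) (P a)). split; trivial.
apply (is_RInt_derive (V := V)).
- intros x [Hx _]. apply HP. apply Rlt_le_trans with (2 := Hx). now apply Rmin_glb_lt.
- intros x [Hx _]. apply Hf. apply Rlt_le_trans with (2 := Hx). now apply Rmin_glb_lt.
Qed.

(** The integral of [2 z / (w^2 - z^2)] over a ray is explicit: [prim_re] and
    [prim_im] are the parts of [ln ((w - z) / (w + z))] up to a constant, with
    [z = s e^{ib}], [w = r e^{ia}], [c = cos (a - b)], [sg * m = sin (a - b)]. *)
Section KernelPrimitive.
Variables (s c m sg : R).
Hypothesis Hs : 0 < s.
Hypothesis Hm : 0 < m.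
Hypothesis Hcm : c ^ 2 + m ^ 2 = 1.
Hypothesis Hsg : sg = 1 \/ sg = -1.

Definition prim_re r := / 2 * (ln ((r - c * s) ^ 2 + (s * m) ^ 2) - ln ((r + c * s) ^ 2 + (s * m) ^ 2)).
Definition prim_im r := - sg * (atan ((r + c * s) / (s * m)) + atan ((r - c * s) / (s * m))).

Lemma prim_pos t : 0 < t ^ 2 + (s * m) ^ 2.
Proof. assert (0 < s * m) by now apply Rmult_lt_0_compat. nra. Qed.

Definition prim_den r := ((r - c * s) ^ 2 + (s * m) ^ 2) * ((r + c * s) ^ 2 + (s * m) ^ 2).

Lemma prim_den_pos r : 0 < prim_den r.
Proof. apply Rmult_lt_0_compat; apply prim_pos. Qed.

Lemma prim_re_derive r : is_derive prim_re r (2 * c * s * (r ^ 2 - s ^ 2) / prim_den r).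
Proof.
assert (A := prim_pos (r - c * s)). assert (B := prim_pos (r + c * s)).
unfold prim_re. auto_derive.
- repeat split; trivial; simpl in *; lra.
- unfold prim_den.
  transitivity (((r - c * s) * ((r + c * s) ^ 2 + (s * m) ^ 2) -
   (r + c * s) * ((r - c * s) ^ 2 + (s * m) ^ 2)) /
   (((r - c * s) ^ 2 + (s * m) ^ 2) * ((r + c * s) ^ 2 + (s * m) ^ 2))).
  + simpl in *. field. lra.
  + f_equal. replace (m ^ 2) with (1 - c ^ 2) by lra.
    replace ((s * m) ^ 2) with (s ^ 2 * (1 - c ^ 2)) by (rewrite <- Hcm; ring). ring.
Qed.

Lemma prim_im_derive r : is_derive prim_im r (- 2 * s * (sg * m) * (r ^ 2 + s ^ 2) / prim_den r).
Proof.
assert (A := prim_pos (r - c * s)). assert (B := prim_pos (r + c * s)).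
assert (0 < s * m) by now apply Rmult_lt_0_compat.
unfold prim_im. auto_derive; trivial.
unfold prim_den.
transitivity (- sg * (s * m) * (((r - c * s) ^ 2 + (s * m) ^ 2) + ((r + c * s) ^ 2 + (s * m) ^ 2))
  / (((r - c * s) ^ 2 + (s * m) ^ 2) * ((r + c * s) ^ 2 + (s * m) ^ 2))).
- simpl in *. unfold Rsqr. field. repeat split; nra.
- f_equal.
  replace ((s * m) ^ 2) with (s ^ 2 * (1 - c ^ 2)) by (rewrite <- Hcm; ring). ring.
Qed.

Lemma prim_zero : filterlim (fun r => (prim_re r, prim_im r) : CC) (at_right 0)
  (@locally CC (RtoC 0)).
Proof.
assert (E : RtoC 0 = (prim_re 0, prim_im 0)).
{ unfold prim_re, prim_im. apply injective_projections; simpl.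
  - replace (0 - c * s) with (- (0 + c * s)) by ring.
    replace (- (0 + c * s) * (- (0 + c * s) * 1)) with ((0 + c * s) * ((0 + c * s) * 1)) by ring.
    ring.
  - replace ((0 - c * s) / (s * m)) with (- ((0 + c * s) / (s * m))) by (field; lra).
    rewrite atan_opp. ring. }
rewrite E.
assert (K : @continuous R_UniformSpace C_UniformSpace (fun r => (prim_re r, prim_im r)) 0).
2 : { intros P HP. specialize (K P HP). unfold filtermap, at_right, within in *.
  revert K. apply filter_imp. now intros. }
apply (continuous_C_pair prim_re prim_im (0 : R_UniformSpace)).
- apply (ex_derive_continuous prim_re). eexists; apply prim_re_derive.
- apply (ex_derive_continuous prim_im). eexists; apply prim_im_derive.
Qed.

(** The substitution [t = 1/r] turns the limit at infinity into continuity of [G] at 0: the terms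
    [ln (r * r)] cancel, and [atan y = PI / 2 - atan (1 / y)] removes the unbounded arguments. *)
Lemma prim_inf : filterlim (fun r => (prim_re r, prim_im r) : CC) (Rbar_locally p_infty)
  (@locally CC ((0, - sg * PI) : C)).
Proof.
set (G := fun t => (/ 2 * (ln (1 - 2 * c * s * t + s ^ 2 * t ^ 2) - ln (1 + 2 * c * s * t + s ^ 2 * t ^ 2)),
  - sg * (PI - atan (s * m * t / (1 + c * s * t)) - atan (s * m * t / (1 - c * s * t)))) : CC).
assert (E : (0, - sg * PI) = G 0).
{ unfold G. apply injective_projections; simpl.
  - rewrite !Rmult_0_r, !Rmult_0_l, !Rmult_0_r, Rminus_0_r, !Rplus_0_r. ring.
  - rewrite !Rmult_0_r. unfold Rdiv. rewrite !Rmult_0_l, atan_0. ring. }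
rewrite E.
assert (Hc : -1 < c < 1) by nra.
assert (0 < s * m) by now apply Rmult_lt_0_compat.
apply filterlim_ext_loc with (fun r => G (/ r)).
{ exists s. intros r Hr. unfold G, prim_re, prim_im.
  assert (H1 : 0 < r + c * s) by nra. assert (H2 : 0 < r - c * s) by nra.
  assert (Hr0 : 0 < r) by lra.
  apply injective_projections; simpl.
  - assert (E1 : forall x, x = c \/ x = - c ->
      ln ((r - x * s) * ((r - x * s) * 1) + s * m * (s * m * 1)) =
      ln (1 - 2 * x * s * / r + s * (s * 1) * (/ r * (/ r * 1))) + ln (r * r)).
    { intros x Hx. assert (Hx2 : x ^ 2 + m ^ 2 = 1) by (destruct Hx; subst; lra).
      assert (EE : (r - x * s) * ((r - x * s) * 1) + s * m * (s * m * 1) =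
        (1 - 2 * x * s * / r + s * (s * 1) * (/ r * (/ r * 1))) * (r * r)).
      { transitivity (r * r - 2 * x * s * r + s ^ 2 * (x ^ 2 + m ^ 2)); [ring|].
        rewrite Hx2. field. lra. }
      rewrite EE. rewrite ln_mult; trivial; [|nra].
      assert (P := prim_pos (r - x * s)). simpl in P. rewrite EE in P.
      apply Rnot_le_lt. intros L. nra. }
    assert (E2 := E1 c (or_introl eq_refl)). assert (E3 := E1 (- c) (or_intror eq_refl)).
    replace (r - - c * s) with (r + c * s) in E3 by ring.
    replace (1 - 2 * - c * s * / r) with (1 + 2 * c * s * / r) in E3 by ring.
    rewrite E2, E3. ring.
  - f_equal.
    assert (A : forall u, 0 < u -> atan (u / (s * m)) = PI / 2 - atan (s * m / u)).
    { intros u Hu. replace (s * m / u) with (/ (u / (s * m))) by (field; split; nra).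
      rewrite atan_inv; [ring|]. now apply Rdiv_lt_0_compat. }
    rewrite !A by trivial.
    replace (s * m * / r / (1 + c * s * / r)) with (s * m / (r + c * s)) by (field; split; nra).
    replace (s * m * / r / (1 - c * s * / r)) with (s * m / (r - c * s)) by (field; split; nra).
    field. }
apply filterlim_comp with (locally (0 : R)).
- apply (filterlim_Rbar_inv p_infty). discriminate.
- apply (continuous_C_pair _ _ (0 : R_UniformSpace)).
  + apply (ex_derive_continuous (fun t => / 2 * (ln (1 - 2 * c * s * t + s ^ 2 * t ^ 2) - ln (1 + 2 * c * s * t + s ^ 2 * t ^ 2)))).
    auto_derive. repeat split; trivial; simpl; lra.
  + apply (ex_derive_continuous (fun t => - sg * (PI - atan (s * m * t / (1 + c * s * t)) - atan (s * m * t / (1 - c * s * t))))).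
    auto_derive. repeat split; trivial; lra.
Qed.

End KernelPrimitive.

(** Equal to [1 / (w - z) - 1 / (w + z)]: the residue of Cauchy's kernel at [w = z], but with decay
    [|w|^-2], so that its integral over a ray converges by itself. *)
Definition hker (z w : C) : C := (2 * z * (/ (w + z) * / (w - z)))%C.

(** [sg] tells on which side of [z] the ray passes. The primitive moves from 0 to [- sg * PI * i],
    so that two rays enclosing [z] differ by [2 i pi]. *)
Lemma ray_hker_aux s b a sg : 0 < s -> (sg = 1 \/ sg = -1) -> 0 < sg * sin (a - b) ->
  ray (X := CC) (fun r a => hker (polar s b) (polar r a)) a = (0, - sg * PI).
Proof.
intros Hs Hsg Hm.
set (c := cos (a - b)). set (m := sg * sin (a - b)) in *.
assert (Hsg2 : sg * sg = 1) by (destruct Hsg; subst sg; ring).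
assert (Hcm : c ^ 2 + m ^ 2 = 1).
{ assert (A := sin2_cos2 (a - b)). unfold Rsqr in A. unfold c, m.
  transitivity (cos (a - b) * cos (a - b) + sg * sg * (sin (a - b) * sin (a - b))); [ring|].
  rewrite Hsg2. lra. }
assert (Hms : sg * m = sin (a - b)).
{ unfold m. rewrite <- Rmult_assoc, Hsg2. ring. }
assert (Hc : -1 < c < 1) by nra.
assert (E : forall r, 0 < r -> (2 * c * s * (r ^ 2 - s ^ 2) / prim_den s c m r,
   - 2 * s * (sg * m) * (r ^ 2 + s ^ 2) / prim_den s c m r) =
   (cis a * hker (polar s b) (polar r a))%C).
{ intros r Hr. assert (N := prim_den_pos s c m Hs Hm r).
  set (n := prim_den s c m r) in *.
  assert (En : n = (r ^ 2 + s ^ 2) ^ 2 - 4 * c ^ 2 * r ^ 2 * s ^ 2).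
  { unfold n, prim_den. replace ((s * m) ^ 2) with (s ^ 2 * (1 - c ^ 2)) by (rewrite <- Hcm; ring). ring. }
  (* The form [hker z w dw] is invariant under a rotation of both points, so that [z] may be taken
     to be the positive number [s]. *)
  set (u := cis (a - b)).
  assert (Ea : cis a = (cis b * u)%C) by (unfold u; rewrite <- cis_plus; f_equal; ring).
  assert (Hu : u = (c, sg * m)) by (unfold u; rewrite Hms; reflexivity).
  assert (Q1 : (RtoC r * u + RtoC s)%C <> RtoC 0).
  { rewrite Hu. intros Q. apply (f_equal snd) in Q. simpl in Q.
    assert (sg * m <> 0) by (rewrite Hms; intros Z; unfold m in Hm; rewrite Z in Hm; lra).
    apply H. apply Rmult_eq_reg_l with r; lra. }
  assert (Q2 : (RtoC r * u - RtoC s)%C <> RtoC 0).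
  { rewrite Hu. intros Q. apply (f_equal snd) in Q. simpl in Q.
    assert (sg * m <> 0) by (rewrite Hms; intros Z; unfold m in Hm; rewrite Z in Hm; lra).
    apply H. apply Rmult_eq_reg_l with r; lra. }
  assert (Q0 := cis_neq_0 b).
  assert (Eh : (cis a * hker (polar s b) (polar r a) =
     2 * s * u * / ((r * u + s) * (r * u - s)))%C).
  { unfold hker, polar. rewrite Ea. field. repeat split; trivial.
    - replace (r * (cis b * u) - s * cis b)%C with (cis b * (r * u - s))%C by ring.
      now apply Cmult_neq_0.
    - replace (r * (cis b * u) + s * cis b)%C with (cis b * (r * u + s))%C by ring.
      now apply Cmult_neq_0. }
  rewrite Eh.
  match goal with |- ?e = _ => pose (EE := e : C); change (EE = 2 * s * u * / ((r * u + s) * (r * u - s)))%C end.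
  (* The two expressions are compared after multiplication by the complex denominator: once the
     positive number [n] is cleared, the real and imaginary parts are polynomial identities. *)
  assert (Em : (EE * ((r * u + s) * (r * u - s)) = 2 * s * u)%C).
  { unfold EE. rewrite Hu. apply injective_projections; simpl.
    - apply Rmult_eq_reg_r with n; [|lra].
      transitivity (2 * c * s * ((r ^ 2 - s ^ 2) * (r ^ 2 * (c ^ 2 - (sg * sg) * m ^ 2) - s ^ 2)
        + 2 * (sg * sg * m ^ 2) * (r ^ 2 + s ^ 2) * r ^ 2)).
      + field; lra.
      + rewrite Hsg2, En. replace (m ^ 2) with (1 - c ^ 2) by lra. ring.
    - apply Rmult_eq_reg_r with n; [|lra].
      transitivity (2 * s * (sg * m) * (2 * c ^ 2 * r ^ 2 * (r ^ 2 - s ^ 2)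
        - (r ^ 2 + s ^ 2) * (r ^ 2 * (c ^ 2 - (sg * sg) * m ^ 2) - s ^ 2))).
      + field; lra.
      + rewrite Hsg2, En. replace (m ^ 2) with (1 - c ^ 2) by lra. ring. }
  rewrite <- Em. match goal with |- @eq _ ?x ?y => change (@eq C x y) end.
  field. now split. }
unfold ray.
transitivity (minus ((0, - sg * PI) : CC) (RtoC 0 : CC)).
- apply (pint_primitive (V := RS CC) (fun r => (prim_re s c m r, prim_im s c m sg r))).
  + intros r Hr. apply is_derC_eq with (2 := E r Hr).
    apply is_derC_pair; [now apply prim_re_derive|now apply prim_im_derive].
  + intros r Hr.
    apply (continuous_ext_loc (T := R_UniformSpace) (U := C_UniformSpace)) with
     (fun r => (2 * c * s * (r ^ 2 - s ^ 2) / prim_den s c m r,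
   - 2 * s * (sg * m) * (r ^ 2 + s ^ 2) / prim_den s c m r)).
    { apply locally_R_iff. exists r; split; trivial. intros y Hy. apply E.
      apply Rabs_lt_between in Hy. lra. }
    assert (N := prim_den_pos s c m Hs Hm r). unfold prim_den in *.
    apply continuous_C_pair.
    * apply (ex_derive_continuous (fun r => 2 * c * s * (r ^ 2 - s ^ 2) / (((r - c * s) ^ 2 + (s * m) ^ 2) * ((r + c * s) ^ 2 + (s * m) ^ 2)))).
      auto_derive. simpl in *; lra.
    * apply (ex_derive_continuous (fun r => - 2 * s * (sg * m) * (r ^ 2 + s ^ 2) / (((r - c * s) ^ 2 + (s * m) ^ 2) * ((r + c * s) ^ 2 + (s * m) ^ 2)))).
      auto_derive. simpl in *; lra.
  + now apply prim_zero.
  + now apply prim_inf.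
- apply injective_projections; simpl; unfold plus, opp; simpl; ring.
Qed.

Lemma ray_hker s b a : 0 < s -> 0 < a - b < PI ->
  ray (X := CC) (fun r a => hker (polar s b) (polar r a)) a = (- (PI * Ci))%C.
Proof.
intros Hs Ha. rewrite (ray_hker_aux s b a 1); trivial.
- apply injective_projections; simpl; ring.
- now left.
- rewrite Rmult_1_l. now apply sin_gt_0.
Qed.

Lemma ray_hker_neg s b a : 0 < s -> - PI < a - b < 0 ->
  ray (X := CC) (fun r a => hker (polar s b) (polar r a)) a = (PI * Ci)%C.
Proof.
intros Hs Ha. rewrite (ray_hker_aux s b a (-1)); trivial.
- apply injective_projections; simpl; ring.
- now right.
- assert (0 < sin (- (a - b))) by (apply sin_gt_0; lra). rewrite sin_neg in H. lra.
Qed.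

Lemma Cmod_div_le (u v : C) c d : 0 < d -> Cmod u <= c -> d <= Cmod v ->
  Cmod (u * / v) <= c / d.
Proof.
intros Hd Hu Hv. assert (v <> RtoC 0) by (apply Cmod_gt_0; lra).
rewrite Cmod_mult, Cmod_inv by trivial.
apply Rmult_le_compat; trivial.
- apply Cmod_ge_0.
- left; apply Rinv_0_lt_compat; lra.
- now apply Rinv_le_contravar.
Qed.

(** Boundedness of [u] serves near 0 and its decay near infinity. The separation [k] of the ray from
    the pole enters only through the factor [CG / k]; [e] and [C1] stay fixed when the ray
    approaches the pole. *)
Lemma quot_bound p s : 0 < p -> 0 < s -> exists e C1, 0 < e /\ 0 < C1 /\
  forall u k CG r a b, 0 < k -> 0 <= CG -> 0 < r ->
  Cmod u <= CG -> Cmod u <= CG * Rpower r (- p) ->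
  k * (r + s) <= Cmod (polar r a - polar s b) ->
  Cmod (u * / (polar r a - polar s b)) <= C1 * (CG / k * (1 + / s)) * kap e r.
Proof.
intros Hp Hs.
destruct (kap_of_powers_scaled 0 (- p - 1) ltac:(lra) ltac:(lra)) as [e [C1 [He [HC1 H]]]].
exists e, C1. split; [trivial|split; trivial].
intros u k CG r a b Hk HCG Hr Hu1 Hu2 Hd.
assert (Hs' : 0 < / s) by now apply Rinv_0_lt_compat.
assert (HCk : 0 <= CG / k) by (apply Rdiv_le_0_compat; lra).
assert (Hkr : 0 < k * (r + s)) by (apply Rmult_lt_0_compat; lra).
apply H; trivial.
- apply Rmult_le_pos; lra.
- intros L. rewrite Rpower_O, Rmult_1_r by trivial.
  apply Rle_trans with (CG / (k * s)).
  + apply Cmod_div_le; trivial. now apply Rmult_lt_0_compat.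
    apply Rle_trans with (2 := Hd). apply Rmult_le_compat_l; lra.
  + replace (CG / (k * s)) with (CG / k * / s) by (field; lra).
    apply Rmult_le_compat_l; lra.
- intros L. apply Rle_trans with (CG * Rpower r (- p) / (k * r)).
  + apply Cmod_div_le; trivial. now apply Rmult_lt_0_compat.
    apply Rle_trans with (2 := Hd). apply Rmult_le_compat_l; lra.
  + assert (P := Rpower_pos r (- p)). unfold Rminus. rewrite Rpower_plus, (Rpower_Ropp r 1), Rpower_1 by trivial.
    replace (CG * Rpower r (- p) / (k * r)) with (CG / k * 1 * (Rpower r (- p) * / r)) by (field; lra).
    apply Rmult_le_compat_r.
    * apply Rmult_le_pos; [lra|left; now apply Rinv_0_lt_compat].
    * apply Rmult_le_compat_l; lra.
Qed.

Lemma sin_half_neq_0 x : x <> 0 -> - (2 * PI) < x < 2 * PI -> sin (x / 2) <> 0.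
Proof.
intros Hx Hb. destruct (Rlt_dec 0 x).
- apply Rgt_not_eq. apply sin_gt_0; lra.
- replace (x / 2) with (- (- x / 2)) by field. rewrite sin_neg.
  assert (0 < sin (- x / 2)) by (apply sin_gt_0; lra). lra.
Qed.

Lemma abs_sin_half_ge eta x : 0 < eta -> eta <= Rabs x <= 2 * PI - eta ->
  sin (eta / 2) <= Rabs (sin (x / 2)).
Proof.
intros He Hx. assert (P := PI_RGT_0). assert (E : sin (Rabs x / 2) <= Rabs (sin (x / 2))).
{ unfold Rabs at 1. destruct (Rcase_abs x).
  - replace (- x / 2) with (- (x / 2)) by field. rewrite sin_neg, <- Rabs_Ropp. apply Rle_abs.
  - apply Rle_abs. }
apply Rle_trans with (2 := E). destruct (Rle_dec (Rabs x) PI).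
- apply sin_incr_1; lra.
- replace (sin (Rabs x / 2)) with (sin (PI - Rabs x / 2)).
  + apply sin_incr_1; lra.
  + rewrite sin_minus, sin_PI, cos_PI. ring.
Qed.

Lemma cos_half_ge th x : 0 <= th <= PI / 2 -> Rabs x <= 2 * th -> cos th <= Rabs (cos (x / 2)).
Proof.
intros Ht Hx. assert (P := PI_RGT_0). apply Rle_trans with (2 := Rle_abs _).
destruct (Rle_dec 0 x).
- rewrite Rabs_pos_eq in Hx by lra. apply cos_decr_1; lra.
- rewrite Rabs_left1 in Hx by lra. rewrite <- (cos_neg (x / 2)).
  apply cos_decr_1; lra.
Qed.

Lemma polatC_mult (f f1 g g1 : R -> R -> C) r a :
  @polat CC f f1 r a -> @polat CC g g1 r a ->
  @polat CC (fun r a => (f r a * g r a)%C)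
    (fun r a => (f1 r a * g r a + f r a * g1 r a)%C) r a.
Proof. intros Hf Hg. exact (polat_scal (X := CC) f f1 g g1 r a Hf Hg). Qed.

(** * Cauchy's formula in a sector

    The multiple [g(z) 2z / (w + z)] of an explicitly integrable kernel has the
    value [g(z)] at [w = z]; subtracting it leaves the bounded quotient [q],
    whose integral may be moved across [arg w = b]. *)

Section CauchyFormula.
Variables (g : R -> R -> C) (hi th C0 p s b : R).
Hypothesis Hg : polholC (- hi) hi g.
Hypothesis Hth : 0 < th < hi.
Hypothesis Hhi : hi <= PI / 2.
Hypothesis Hp : 0 < p.
Hypothesis HB : forall r a, 0 < r -> Rabs a <= th ->
  Cmod (g r a) <= C0 /\ Cmod (g r a) <= C0 * Rpower r (- p).
Hypothesis Hs : 0 < s.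
Hypothesis Hb : Rabs b < th.

Let z := polar s b.
Let hn (r a : R) : C := (2 * z * / (polar r a + z))%C.
Let Gn (r a : R) : C := (g r a - g s b * hn r a)%C.
Let q (r a : R) : C := (Gn r a * / (polar r a - z))%C.

Lemma abs_b : - th < b < th.
Proof. now apply Rabs_lt_between. Qed.

Lemma hn_den r a : 0 < r -> - hi < a < hi -> (polar r a + z)%C <> RtoC 0.
Proof.
intros Hr Ha. assert (Bb := abs_b). apply Cmod_gt_0.
apply Rlt_le_trans with (2 := polar_sum_ge r a s b Hr Hs).
apply Rmult_lt_0_compat; [|lra]. apply Rabs_pos_lt.
apply Rgt_not_eq. apply cos_gt_0; lra.
Qed.

Lemma polhol_hn : polholC (- hi) hi hn.
Proof.
apply polholC_mult; [apply polholC_const|]. apply polholC_inv.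
- apply polholC_plus; [apply polholC_id|apply polholC_const].
- intros; now apply hn_den.
Qed.

Lemma polhol_Gn : polholC (- hi) hi Gn.
Proof.
apply polholC_minus; trivial. apply polholC_mult; [apply polholC_const|apply polhol_hn].
Qed.

Lemma C0_ge0 : 0 <= C0.
Proof.
destruct (HB 1 0 Rlt_0_1) as [A _]. { rewrite Rabs_R0; lra. }
assert (B := Cmod_ge_0 (g 1 0)). lra.
Qed.

Lemma cos_th_pos : 0 < cos th.
Proof. apply cos_gt_0; lra. Qed.

(** [hn] decays only as [1 / |w|], which caps the decay rate common to [g] and [hn] at 1. *)
Let p' := Rmin p 1.
(** The first summand bounds [|hn|], the second [|w| |hn|]; both come from
    [|w + z| >= cos th (r + s)]. *)
Let Ch := 2 / cos th + 2 * s / cos th.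

Lemma Ch_pos : 0 < Ch.
Proof.
assert (K := cos_th_pos). unfold Ch.
assert (0 < 2 / cos th) by (apply Rdiv_lt_0_compat; lra).
assert (0 < 2 * s / cos th) by (apply Rdiv_lt_0_compat; lra). lra.
Qed.

Lemma decay_weaken C1 r v p1 p2 : 0 < r -> 0 <= C1 -> p2 <= p1 -> 0 <= p2 ->
  v <= C1 -> v <= C1 * Rpower r (- p1) -> v <= C1 * Rpower r (- p2).
Proof.
intros Hr HC Hpp H2 H1 H. destruct (Rle_dec r 1).
- apply Rle_trans with (1 := H1). rewrite <- (Rmult_1_r C1) at 1.
  apply Rmult_le_compat_l; trivial. rewrite <- (Rpower_O r Hr). apply Rpower_ge_exp; lra.
- apply Rle_trans with (1 := H). apply Rmult_le_compat_l; trivial.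
  apply Rpower_le_exp; lra.
Qed.

Lemma p'_pos : 0 < p' <= 1 /\ p' <= p.
Proof. unfold p'. split; [split|]; [apply Rmin_pos; lra|apply Rmin_r|apply Rmin_l]. Qed.

Lemma hn_bound r a : 0 < r -> Rabs a <= th ->
  Cmod (hn r a) <= Ch /\ Cmod (hn r a) <= Ch * Rpower r (- p').
Proof.
intros Hr Ha. assert (K := cos_th_pos). assert (HCh := Ch_pos).
assert (D : cos th * (r + s) <= Cmod (polar r a + z)).
{ apply Rle_trans with (2 := polar_sum_ge r a s b Hr Hs).
  apply Rmult_le_compat_r; [lra|]. apply cos_half_ge; [lra|].
  unfold Rminus. eapply Rle_trans; [apply Rabs_triang|]. rewrite Rabs_Ropp. lra. }
assert (Hz : Cmod (2 * z) <= 2 * s).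
{ unfold z. rewrite Cmod_mult, Cmod_R, Cmod_polar, Rabs_pos_eq; lra. }
assert (P1 : 0 < 2 * s / cos th) by (apply Rdiv_lt_0_compat; lra).
assert (P2 : 0 < 2 / cos th) by (apply Rdiv_lt_0_compat; lra).
assert (B1 : Cmod (hn r a) <= Ch).
{ apply Rle_trans with (2 * s / (cos th * s)).
  - apply Cmod_div_le; trivial. now apply Rmult_lt_0_compat.
    apply Rle_trans with (2 := D). apply Rmult_le_compat_l; lra.
  - replace (2 * s / (cos th * s)) with (2 / cos th) by (field; lra). unfold Ch; lra. }
split; trivial. destruct p'_pos as [Q1 Q2].
apply decay_weaken with 1; lra || trivial.
apply Rle_trans with (2 * s / (cos th * r)).
- apply Cmod_div_le; trivial. now apply Rmult_lt_0_compat.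
  apply Rle_trans with (2 := D). apply Rmult_le_compat_l; lra.
- rewrite Rpower_Ropp, Rpower_1 by trivial.
  replace (2 * s / (cos th * r)) with (2 * s / cos th * / r) by (field; lra).
  apply Rmult_le_compat_r; [left; now apply Rinv_0_lt_compat|]. unfold Ch; lra.
Qed.

Let CG := C0 + C0 * Ch.

Lemma g_bound r a : 0 < r -> Rabs a <= th ->
  Cmod (g r a) <= C0 /\ Cmod (g r a) <= C0 * Rpower r (- p').
Proof.
intros Hr Ha. destruct (HB r a Hr Ha) as [B1 B2]. destruct p'_pos. split; trivial.
apply decay_weaken with p; lra || trivial. apply C0_ge0.
Qed.

Lemma Gn_bound r a : 0 < r -> Rabs a <= th ->
  Cmod (Gn r a) <= CG /\ Cmod (Gn r a) <= CG * Rpower r (- p').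
Proof.
intros Hr Ha. destruct (g_bound r a Hr Ha) as [B1 B2].
destruct (hn_bound r a Hr Ha) as [B3 B4].
destruct (g_bound s b Hs ltac:(lra)) as [B5 _].
assert (HC := C0_ge0). assert (Q := Rpower_pos r (- p')).
assert (T : Cmod (Gn r a) <= Cmod (g r a) + C0 * Cmod (hn r a)).
{ unfold Gn. eapply Rle_trans; [apply Cmod_triangle|]. rewrite Cmod_opp, Cmod_mult.
  apply Rplus_le_compat_l. apply Rmult_le_compat_r; trivial. apply Cmod_ge_0. }
split; apply Rle_trans with (1 := T); unfold CG.
- apply Rplus_le_compat; trivial. now apply Rmult_le_compat_l.
- rewrite Rmult_plus_distr_r, Rmult_assoc. apply Rplus_le_compat; trivial.
  now apply Rmult_le_compat_l.
Qed.

Lemma CG_ge0 : 0 <= CG.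
Proof. assert (A := C0_ge0). assert (B := Ch_pos). unfold CG. apply Rplus_le_le_0_compat; trivial.
apply Rmult_le_pos; lra. Qed.

Lemma Gn_zero : Gn s b = RtoC 0.
Proof.
assert (Bb := abs_b). assert (N := hn_den s b Hs ltac:(lra)). fold z in N.
unfold Gn, hn. fold z.
assert (Hz : z <> RtoC 0) by now apply polar_neq_0.
match goal with |- @eq _ ?x ?y => change (@eq C x y) end.
replace (2 * z * / (z + z))%C with (RtoC 1). { ring. }
field. intros E. apply N. rewrite <- E. ring.
Qed.

(** The singularity of [q] is removable. [Gn] vanishes at the pole; the mean value inequality along
    the radius and then along the arc, with increments bounded by 1 and 4 times [|w - z|], gives
    [|Gn| <= 5 M1 |w - z|]. *)
Lemma q_near : exists M d0, 0 < M /\ 0 < d0 /\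
  forall r a, Rabs (r - s) <= d0 -> Rabs (a - b) <= d0 -> Cmod (q r a) <= M.
Proof.
destruct polhol_Gn as [G1 HG1]. assert (Bb := abs_b).
destruct (HG1 s b Hs ltac:(lra)) as [_ [_ [_ Hc]]].
destruct (proj1 (cont2_eps (V := RS CC) G1 s b) Hc 1 Rlt_0_1) as [d [Hd Hd']].
set (M1 := Cmod (G1 s b) + 1).
assert (HM1 : 0 < M1) by (unfold M1; assert (A := Cmod_ge_0 (G1 s b)); lra).
set (m := Rmin (th + b) (th - b)).
assert (Hm : 0 < m) by (apply Rmin_pos; lra).
set (d0 := Rmin (d / 2) (Rmin (s / 2) (Rmin m 1))).
assert (E1 : d0 <= d / 2) by apply Rmin_l.
assert (E2 : d0 <= Rmin (s / 2) (Rmin m 1)) by apply Rmin_r.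
assert (E3 : Rmin (s / 2) (Rmin m 1) <= s / 2) by apply Rmin_l.
assert (E4 : Rmin (s / 2) (Rmin m 1) <= Rmin m 1) by apply Rmin_r.
assert (E5 : Rmin m 1 <= m) by apply Rmin_l. assert (E6 : Rmin m 1 <= 1) by apply Rmin_r.
assert (E7 : m <= th + b) by apply Rmin_l. assert (E8 : m <= th - b) by apply Rmin_r.
assert (Hd0 : 0 < d0) by (unfold d0; repeat apply Rmin_pos; lra).
exists (5 * M1), d0. split; [lra|split; trivial]. intros r a Hr Ha.
assert (Hr' : s / 2 <= r) by (apply Rabs_le_between in Hr; lra).
assert (Ha' : - th <= a <= th) by (apply Rabs_le_between in Ha; lra).
assert (BG : forall x y, Rabs (x - s) <= d0 -> Rabs (y - b) <= d0 -> Cmod (G1 x y) <= M1).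
{ intros x y Hx Hy. specialize (Hd' x y ltac:(lra) ltac:(lra)).
  change (Cmod (G1 x y - G1 s b) < 1) in Hd'.
  replace (G1 x y) with (G1 s b + (G1 x y - G1 s b))%C by ring.
  eapply Rle_trans; [apply Cmod_triangle|]. unfold M1. lra. }
assert (L1 : Cmod (Gn r a - Gn s a) <= Rabs (r - s) * M1).
{ apply (mean_value (V := RS CC) (fun r => Gn r a) (fun r => (cis a * G1 r a)%C) s r M1).
  - intros x Hx. apply HG1; [|lra]. apply Rlt_le_trans with (2 := proj1 Hx).
    apply Rmin_glb_lt; lra.
  - intros x Hx. assert (0 < x).
    { apply Rlt_le_trans with (2 := proj1 Hx). apply Rmin_glb_lt; lra. }
    destruct (HG1 x a ltac:(lra) ltac:(lra)) as [_ [_ [_ Hc']]].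
    apply (continuous_C_mult (fun _ => cis a)); [apply continuous_const|].
    apply (cont2_l (V := RS CC) _ _ _ Hc').
  - intros x Hx. change (Cmod (cis a * G1 x a) <= M1).
    rewrite Cmod_mult, Cmod_cis, Rmult_1_l. apply BG; trivial.
    apply Rle_trans with (2 := Hr). revert Hx. unfold Rmin, Rmax, Rabs.
    destruct (Rle_dec s r); intros; repeat destruct Rcase_abs; lra. }
assert (L2 : Cmod (Gn s a - Gn s b) <= Rabs (a - b) * (s * M1)).
{ apply (mean_value (V := RS CC) (fun a => Gn s a) (fun a => (Ci * RtoC s * cis a * G1 s a)%C) b a (s * M1)).
  - intros y Hy. apply HG1; trivial. revert Hy. unfold Rmin, Rmax.
    destruct (Rle_dec b a); intros; lra.
  - intros y Hy. destruct (HG1 s y Hs) as [_ [_ [_ Hc']]].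
    { revert Hy. unfold Rmin, Rmax. destruct (Rle_dec b a); intros; lra. }
    apply (continuous_C_mult (fun y => (Ci * RtoC s * cis y)%C)).
    + apply (continuous_C_mult (fun _ => (Ci * RtoC s)%C)); [apply continuous_const|].
      apply continuous_cis, continuous_id.
    + apply (cont2_r (V := RS CC) _ _ _ Hc').
  - intros y Hy. change (Cmod (Ci * RtoC s * cis y * G1 s y) <= s * M1).
    rewrite !Cmod_mult, Cmod_cis, Cmod_Ci, Cmod_R, Rabs_pos_eq by lra.
    rewrite Rmult_1_l, Rmult_1_r. apply Rmult_le_compat_l; [lra|]. apply BG.
    + rewrite Rminus_eq_0, Rabs_R0; lra.
    + apply Rle_trans with (2 := Ha). revert Hy. unfold Rmin, Rmax, Rabs.
      destruct (Rle_dec b a); intros; repeat destruct Rcase_abs; lra. }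
unfold q. set (w := (polar r a - z)%C).
assert (D1 : Rabs (r - s) <= Cmod w) by (apply polar_dist_ge_r; lra).
assert (D2 : s * Rabs (a - b) <= 4 * Cmod w) by (apply polar_dist_ge_a; lra).
assert (LG : Cmod (Gn r a) <= 5 * M1 * Cmod w).
{ replace (Gn r a) with ((Gn r a - Gn s a) + (Gn s a - Gn s b))%C by (rewrite Gn_zero; ring).
  eapply Rle_trans; [apply Cmod_triangle|]. nra. }
(* At the pole itself [Gn] is 0, so the value of [q] is 0 whatever the inverse of 0 is. *)
destruct (Req_dec (Cmod w) 0) as [Z|Z].
- rewrite Z, Rmult_0_r in LG. rewrite Cmod_mult.
  replace (Cmod (Gn r a)) with 0. { rewrite Rmult_0_l; lra. }
  apply Rle_antisym; trivial. apply Cmod_ge_0.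
- assert (0 < Cmod w) by (assert (A := Cmod_ge_0 w); lra).
  apply Rle_trans with (5 * M1 * Cmod w / Cmod w).
  + apply Cmod_div_le; trivial. lra.
  + right; field; lra.
Qed.

Lemma q_polat : exists q1, forall r a, 0 < r -> - hi < a < hi -> (r <> s \/ a <> b) ->
  @polat CC q q1 r a.
Proof.
destruct polhol_Gn as [G1 HG1].
destruct (polholC_minus (- hi) hi polar (fun _ _ => z) (polholC_id _ _) (polholC_const _ _ z))
  as [w1 Hw1].
eexists. intros r a Hr Ha H. apply polatC_mult; [now apply HG1|].
apply polatC_inv; [now apply Hw1|]. assert (Bb := abs_b).
apply polar_neq; trivial. destruct H as [H|H]; [now left|right].
apply sin_half_neq_0; [lra|split; lra].
Qed.

Lemma polhol_q_side lo' hi' : - hi <= lo' -> hi' <= hi -> (b <= lo' \/ hi' <= b) ->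
  polholC lo' hi' q.
Proof.
intros H1 H2 H3. destruct q_polat as [q1 Hq]. exists q1. intros r a Hr Ha. apply Hq; trivial.
lra. right; lra.
Qed.

(** The rays are rotated to the angles [b - eta] and [b + eta]. Between these, the radii below
    [s - eta] and above [s + eta] form rectangles free of the pole, whose arcs have angular width
    [2 eta]; the remaining two segments have length [2 eta], and [q] is bounded there. The
    difference is [O(eta)]. *)
Lemma ray_q_eq : ray (X := CC) q (- th) = ray (X := CC) q th.
Proof.
assert (Bb := abs_b). destruct p'_pos as [Hp1 Hp2].
destruct (quot_bound p' s ltac:(lra) Hs) as [e [C1 [He [HC1 QB]]]].
destruct q_near as [M [d0 [HM [Hd0 HN]]]].
assert (HCG := CG_ge0).
assert (Hs' : 0 < / s) by now apply Rinv_0_lt_compat.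
(* For [r <= s / 2] or [r >= 2 * s] the pole is at distance at least [(r + s) / 3], whatever the
   angle: a bound for the extreme arcs that does not degrade as [eta] tends to 0. *)
set (CC3 := C1 * (CG / (1/3) * (1 + / s))).
assert (HCC3 : 0 <= CC3).
{ unfold CC3. apply Rmult_le_pos; [lra|]. apply Rmult_le_pos; [|lra].
  apply Rdiv_le_0_compat; lra. }
(* Each of the two rectangles contributes [2 eta] times a near arc, at most [2 s M], plus a far arc,
   at most [CC3 e]; the two middle segments contribute [2 eta M] each. *)
set (K := 2 * (2 * s * M + CC3 * e) + 4 * M + 2 * (2 * s * M + CC3 * e)).
assert (HK : 0 <= K).
{ unfold K. assert (0 <= s * M) by (apply Rmult_le_pos; lra).
  assert (0 <= CC3 * e) by (apply Rmult_le_pos; lra). lra. }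
set (A := minus (ray (X := CC) q th) (ray (X := CC) q (- th))).
set (eta0 := Rmin d0 (Rmin (s / 2) (Rmin (th + b) (th - b)))).
assert (Heta0 : 0 < eta0) by (unfold eta0; repeat apply Rmin_pos; lra).
assert (F : forall eta, 0 < eta < eta0 -> norm A <= K * eta).
{ intros eta Heta.
  assert (E1 : eta0 <= d0) by apply Rmin_l.
  assert (E2 : eta0 <= Rmin (s / 2) (Rmin (th + b) (th - b))) by apply Rmin_r.
  assert (E3 : Rmin (s / 2) (Rmin (th + b) (th - b)) <= s / 2) by apply Rmin_l.
  assert (E4 : Rmin (s / 2) (Rmin (th + b) (th - b)) <= Rmin (th + b) (th - b)) by apply Rmin_r.
  assert (E5 : Rmin (th + b) (th - b) <= th + b) by apply Rmin_l.
  assert (E6 : Rmin (th + b) (th - b) <= th - b) by apply Rmin_r.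
  set (k := sin (eta / 2)).
  assert (Hk : 0 < k) by (apply sin_gt_0; lra).
  set (Ce := C1 * (CG / k * (1 + / s))).
  assert (QE : forall r a, 0 < r -> Rabs a <= th -> eta <= Rabs (a - b) ->
     Cmod (q r a) <= Ce * kap e r).
  { intros r a Hr Ha Hab. apply QB; trivial; try now apply Gn_bound.
    apply Rle_trans with (2 := polar_dist_ge r a s b Hr Hs).
    apply Rmult_le_compat_r; [lra|]. apply abs_sin_half_ge; [lra|]. split; trivial.
    apply Rle_trans with PI; [|lra].
    unfold Rminus. eapply Rle_trans; [apply Rabs_triang|]. rewrite Rabs_Ropp. lra. }
  assert (R1 : ray (X := CC) q (b + eta) = ray (X := CC) q th).
  { apply (ray_rotate (X := CC) b hi q (b + eta) th Ce e); lra || trivial.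
    - apply polhol_q_side; lra || (left; lra).
    - intros r a Hr Ha. apply QE; trivial. apply Rabs_le; lra.
      rewrite Rabs_pos_eq; lra. }
  assert (R2 : ray (X := CC) q (- th) = ray (X := CC) q (b - eta)).
  { apply (ray_rotate (X := CC) (- hi) b q (- th) (b - eta) Ce e); lra || trivial.
    - apply polhol_q_side; lra || (right; lra).
    - intros r a Hr Ha. apply QE; trivial. apply Rabs_le; lra.
      rewrite Rabs_left1; lra. }
  unfold A. rewrite <- R1, R2. clear R1 R2.
  assert (D1 : @dominated (RS CC) (fun r => cis (b + eta) *: q r (b + eta)) Ce e).
  { apply (ray_dominated (X := CC) b hi); lra || trivial.
    - apply polhol_q_side; lra || (left; lra).
    - intros r Hr. apply QE; trivial. apply Rabs_le; lra.
      rewrite Rabs_pos_eq; lra. }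
  assert (D2 : @dominated (RS CC) (fun r => cis (b - eta) *: q r (b - eta)) Ce e).
  { apply (ray_dominated (X := CC) (- hi) b); lra || trivial.
    - apply polhol_q_side; lra || (right; lra).
    - intros r Hr. apply QE; trivial. apply Rabs_le; lra.
      rewrite Rabs_left1; lra. }
  assert (QF : forall r a, 0 < r -> Rabs a <= th -> (r <= s / 2 \/ 2 * s <= r) ->
     r * Cmod (q r a) <= CC3 * (r * kap e r)).
  { intros r a Hr Ha Hrs.
    replace (CC3 * (r * kap e r)) with (r * (CC3 * kap e r)) by ring.
    apply Rmult_le_compat_l; [lra|]. apply QB; lra || trivial; try now apply Gn_bound.
    apply Rle_trans with (2 := polar_dist_ge_r r a s b Hr Hs).
    destruct Hrs; [rewrite Rabs_left1|rewrite Rabs_pos_eq]; lra. }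
  destruct q_polat as [q1 Hq1].
  set (Ip := fun u v => RInt (V := RS CC) (fun r => cis (b + eta) *: q r (b + eta)) u v).
  set (Im' := fun u v => RInt (V := RS CC) (fun r => cis (b - eta) *: q r (b - eta)) u v).
  assert (X1 : forall u v, 0 < u -> 0 < v ->
     ex_RInt (V := RS CC) (fun r => cis (b + eta) *: q r (b + eta)) u v).
  { intros u v Hu Hv. apply (ex_RInt_pos (V := RS CC)); trivial.
    intros r Hr. now apply (proj2 D1). }
  assert (X2 : forall u v, 0 < u -> 0 < v ->
     ex_RInt (V := RS CC) (fun r => cis (b - eta) *: q r (b - eta)) u v).
  { intros u v Hu Hv. apply (ex_RInt_pos (V := RS CC)); trivial.
    intros r Hr. now apply (proj2 D2). }
  (* off the ray [arg = b] and off the circle of radius [s] the box has no singularity *)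
  assert (BX : forall u v rlo rhi N, 0 <= rlo < u -> u <= v < rhi -> (rhi <= s \/ s <= rlo) ->
    (forall a, b - eta <= a <= b + eta -> u * Cmod (q u a) + v * Cmod (q v a) <= N) ->
    norm (minus (Ip u v) (Im' u v)) <= 2 * eta * N).
  { intros u v rlo rhi N Hu Hv Hrs HNN.
    assert (Hpol : forall r a, rlo < r < rhi -> - hi < a < hi -> @polat CC q q1 r a).
    { intros r a Hr Ha. apply Hq1; lra || (left; lra). }
    eapply Rle_trans; [right; apply (f_equal norm); apply (box (X := CC) (- hi) hi rlo rhi q q1 (b - eta) (b + eta) u v); lra || trivial|].
    replace (2 * eta) with (Rabs (b + eta - (b - eta))) by (rewrite Rabs_pos_eq; lra).
    apply (norm_RInt_const (V := RS CC)).
    - apply ex_RInt_cont. rewrite Rmin_left, Rmax_right by lra. intros a Ha.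
      apply (continuous_minus (V := RS CC)).
      + apply (continuous_C_mult (fun a => (Ci * RtoC v * cis a)%C)).
        * apply (continuous_C_mult (fun _ => (Ci * RtoC v)%C)); [apply continuous_const|].
          apply continuous_cis, continuous_id.
        * apply (cont2_r (V := RS CC)). apply (Hpol v a); lra.
      + apply (continuous_C_mult (fun a => (Ci * RtoC u * cis a)%C)).
        * apply (continuous_C_mult (fun _ => (Ci * RtoC u)%C)); [apply continuous_const|].
          apply continuous_cis, continuous_id.
        * apply (cont2_r (V := RS CC)). apply (Hpol u a); lra.
    - rewrite Rmin_left, Rmax_right by lra. intros a Ha.
      eapply Rle_trans; [apply (xnorm_minus_le (X := CC))|].
      apply Rle_trans with (2 := HNN a Ha). rewrite Rplus_comm. right. f_equal.
      + change (Cmod (Ci * RtoC u * cis a * q u a) = u * Cmod (q u a)).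
        rewrite !Cmod_mult, Cmod_cis, Cmod_Ci, Cmod_R, Rabs_pos_eq by lra. ring.
      + change (Cmod (Ci * RtoC v * cis a * q v a) = v * Cmod (q v a)).
        rewrite !Cmod_mult, Cmod_cis, Cmod_Ci, Cmod_R, Rabs_pos_eq by lra. ring. }
  assert (FN : forall n, 1 <= n -> / n <= s / 2 -> 2 * s <= n ->
    norm (minus (Ip (/ n) n) (Im' (/ n) n)) <= K * eta).
  { intros n Hn Hn1 Hn2. destruct (inv_n n Hn) as [Hn0 _].
    assert (Kn : forall a, b - eta <= a <= b + eta -> / n * Cmod (q (/ n) a) <= CC3 * e).
    { intros a Ha. eapply Rle_trans; [apply QF; [trivial|apply Rabs_le; lra|now left]|].
      apply Rmult_le_compat_l; trivial. eapply Rle_trans; [now apply r_kap_lo|].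
      rewrite <- (Rmult_1_r e) at 3. apply Rmult_le_compat_l; [lra|].
      rewrite <- (Rpower_O (/ n)) by trivial. apply Rpower_ge_exp; [|lra]. split; trivial.
      rewrite <- Rinv_1. apply Rinv_le_contravar; lra. }
    assert (Kn' : forall a, b - eta <= a <= b + eta -> n * Cmod (q n a) <= CC3 * e).
    { intros a Ha. eapply Rle_trans; [apply QF; [lra|apply Rabs_le; lra|now right]|].
      apply Rmult_le_compat_l; trivial. eapply Rle_trans; [apply r_kap_hi; lra|].
      rewrite <- (Rmult_1_r e) at 3. apply Rmult_le_compat_l; [lra|].
      rewrite <- (Rpower_O n) by lra. apply Rpower_le_exp; lra. }
    assert (Km : forall r a, Rabs (r - s) <= eta -> b - eta <= a <= b + eta -> Cmod (q r a) <= M).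
    { intros r a Hr Ha. apply HN. lra. apply Rabs_le; lra. }
    assert (B1 : norm (minus (Ip (/ n) (s - eta)) (Im' (/ n) (s - eta))) <= 2 * eta * (2 * s * M + CC3 * e)).
    { apply (BX _ _ 0 s); lra || (try (left; lra)).
      intros a Ha. rewrite Rplus_comm. apply Rplus_le_compat; [|now apply Kn].
      apply Rmult_le_compat; try lra. apply Cmod_ge_0. apply Km; trivial.
      rewrite Rabs_left1; lra. }
    assert (B3 : norm (minus (Ip (s + eta) n) (Im' (s + eta) n)) <= 2 * eta * (2 * s * M + CC3 * e)).
    { apply (BX _ _ s (n + 1)); lra || (try (right; lra)).
      intros a Ha. apply Rplus_le_compat; [|now apply Kn'].
      apply Rmult_le_compat; try lra. apply Cmod_ge_0. apply Km; trivial.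
      rewrite Rabs_pos_eq; lra. }
    assert (B2p : norm (Ip (s - eta) (s + eta)) <= 2 * eta * M).
    { replace (2 * eta) with (Rabs (s + eta - (s - eta))) by (rewrite Rabs_pos_eq; lra).
      apply (norm_RInt_const (V := RS CC)); [apply X1; lra|].
      rewrite Rmin_left, Rmax_right by lra. intros r Hr.
      eapply Rle_trans; [apply (norm_cis_scal (X := CC))|]. apply Km; [|lra]. apply Rabs_le; lra. }
    assert (B2m : norm (Im' (s - eta) (s + eta)) <= 2 * eta * M).
    { replace (2 * eta) with (Rabs (s + eta - (s - eta))) by (rewrite Rabs_pos_eq; lra).
      apply (norm_RInt_const (V := RS CC)); [apply X2; lra|].
      rewrite Rmin_left, Rmax_right by lra. intros r Hr.
      eapply Rle_trans; [apply (norm_cis_scal (X := CC))|]. apply Km; [|lra]. apply Rabs_le; lra. }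
    assert (S1 : Ip (/ n) n = plus (plus (Ip (/ n) (s - eta)) (Ip (s - eta) (s + eta))) (Ip (s + eta) n)).
    { unfold Ip. rewrite !(RInt_Chasles (V := RS CC)); trivial; apply X1; lra. }
    assert (S2 : Im' (/ n) n = plus (plus (Im' (/ n) (s - eta)) (Im' (s - eta) (s + eta))) (Im' (s + eta) n)).
    { unfold Im'. rewrite !(RInt_Chasles (V := RS CC)); trivial; apply X2; lra. }
    rewrite S1, S2.
    match goal with |- norm (minus (plus (plus ?a1 ?a2) ?a3) (plus (plus ?c1 ?c2) ?c3)) <= _ =>
      assert (EE : minus (plus (plus a1 a2) a3) (plus (plus c1 c2) c3) =
        plus (plus (minus a1 c1) (minus a3 c3)) (minus a2 c2)) by
        (generalize a1 a2 a3 c1 c2 c3; intros; linR (RS CC))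
    end.
    apply (norm_eq_le (V := RS CC) _ _ _ EE).
    eapply Rle_trans; [apply (norm_triangle (V := RS CC))|].
    eapply Rle_trans; [apply Rplus_le_compat; [apply (norm_triangle (V := RS CC))|
      apply (norm_minus_le (V := RS CC))]|].
    eapply Rle_trans; [apply Rplus_le_compat; apply Rplus_le_compat; [exact B1|exact B3|exact B2p|exact B2m]|].
    unfold K. right; ring. }
  (* [eta] is fixed from here on. [Ce] depends on it, but [n] is chosen last, so the truncation
     errors can still be made negligible. *)
  apply Rnot_lt_le. intros L.
  set (gap := norm (minus (ray (X := CC) q (b + eta)) (ray (X := CC) q (b - eta))) - K * eta) in *.
  assert (Hgap : 0 < gap) by (unfold gap; apply Rlt_0_minus; exact L).
  assert (HCe := dominated_C_ge0 (V := RS CC) _ _ _ D1).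
  destruct (Rpower_small_inf e (gap / (8 * (Ce + 1))) He) as [n1 [Hn1 Hn]].
  { apply Rdiv_lt_0_compat; lra. }
  set (n := Rmax n1 (Rmax 1 (Rmax (2 / s) (2 * s)))).
  assert (N1 : n1 <= n) by apply Rmax_l.
  assert (N2 : Rmax 1 (Rmax (2 / s) (2 * s)) <= n) by apply Rmax_r.
  assert (N3 : 1 <= Rmax 1 (Rmax (2 / s) (2 * s))) by apply Rmax_l.
  assert (N4 : Rmax (2 / s) (2 * s) <= Rmax 1 (Rmax (2 / s) (2 * s))) by apply Rmax_r.
  assert (N5 : 2 / s <= Rmax (2 / s) (2 * s)) by apply Rmax_l.
  assert (N6 : 2 * s <= Rmax (2 / s) (2 * s)) by apply Rmax_r.
  assert (N7 : / n <= s / 2).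
  { replace (s / 2) with (/ (2 / s)) by (field; lra). apply Rinv_le_contravar; [|lra].
    apply Rdiv_lt_0_compat; lra. }
  destruct (inv_n n ltac:(lra)) as [M1 M2].
  assert (A1 := pint_approx (V := RS CC) _ _ _ (/ n) n D1 M1 M2).
  assert (A2 := pint_approx (V := RS CC) _ _ _ (/ n) n D2 M1 M2).
  rewrite Rpower_inv_n in A1, A2 by lra. specialize (Hn n N1). specialize (FN n ltac:(lra) N7 ltac:(lra)).
  assert (T : norm (minus (ray (X := CC) q (b + eta)) (ray (X := CC) q (b - eta))) <=
    Ce * (Rpower n (- e) + Rpower n (- e)) + (K * eta + Ce * (Rpower n (- e) + Rpower n (- e)))).
  { eapply Rle_trans; [apply (xnorm_triangle3 (X := CC) _ (Ip (/ n) n))|].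
    eapply Rle_trans; [apply Rplus_le_compat_l, (xnorm_triangle3 (X := CC) _ (Im' (/ n) n))|].
    rewrite (xnorm_minus_sym (X := CC) (Im' (/ n) n)).
    apply Rplus_le_compat; [exact A1|]. apply Rplus_le_compat; [exact FN|exact A2]. }
  assert (Hn' : Ce * Rpower n (- e) <= gap / 8).
  { apply Rle_trans with ((Ce + 1) * (gap / (8 * (Ce + 1)))).
    - apply Rmult_le_compat; try lra. left; apply Rpower_pos.
    - right; field; lra. }
  unfold gap in *.
  match type of T with ?t <= _ => set (tt := t) in * end.
  assert (tt <= K * eta + gap / 2) by (unfold gap in *; lra).
  unfold gap in *. lra. }
assert (ZA : norm A = 0).
{ apply Rle_antisym; [|apply (norm_ge_0 (V := CC))].
  apply Rnot_lt_le. intros L.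
  set (eta := Rmin (eta0 / 2) (norm A / (2 * (K + 1)))).
  assert (H1 : eta <= eta0 / 2) by apply Rmin_l.
  assert (H2 : eta <= norm A / (2 * (K + 1))) by apply Rmin_r.
  assert (H0 : 0 < norm A / (2 * (K + 1))) by (apply Rdiv_lt_0_compat; lra).
  assert (H3 : 0 < eta) by (apply Rmin_pos; lra).
  specialize (F eta ltac:(lra)).
  assert (K * eta <= norm A / 2).
  { apply Rle_trans with ((K + 1) * (norm A / (2 * (K + 1)))).
    - apply Rmult_le_compat; lra.
    - right; field; lra. }
  lra. }
apply (norm_eq_zero (V := CC)) in ZA.
assert (E : ray (X := CC) q th = plus A (ray (X := CC) q (- th))).
{ unfold A. generalize (ray (X := CC) q th) (ray (X := CC) q (- th)). intros. linC CC. }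
rewrite E, ZA. symmetry. apply (plus_zero_l (G := CC)).
Qed.

Lemma ray_q_split a : Rabs a <= th -> a <> b ->
  ray (X := CC) q a = (ray (X := CC) (fun r a => g r a * / (polar r a - z)) a
    - g s b * ray (X := CC) (fun r a => hker z (polar r a)) a)%C.
Proof.
intros Ha Hab. assert (Bb := abs_b). destruct p'_pos as [Hp1 Hp2].
assert (Ha' : - th <= a <= th) by now apply Rabs_le_between.
destruct (quot_bound p' s ltac:(lra) Hs) as [e [C1 [He [HC1 QB]]]].
set (eta := Rabs (a - b)). assert (Heta : 0 < eta) by (apply Rabs_pos_lt; lra).
assert (Heta' : eta <= PI) by (apply Rabs_le; lra).
set (k := sin (eta / 2)). assert (Hk : 0 < k) by (apply sin_gt_0; lra).
assert (Dk : forall r, 0 < r -> k * (r + s) <= Cmod (polar r a - polar s b)).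
{ intros r Hr. apply Rle_trans with (2 := polar_dist_ge r a s b Hr Hs).
  apply Rmult_le_compat_r; [lra|]. apply abs_sin_half_ge; [lra|]. fold eta. lra. }
assert (Hside : exists lo' hi', - hi <= lo' /\ hi' <= hi /\ lo' < a < hi' /\ (b <= lo' \/ hi' <= b)).
{ destruct (Rlt_dec b a); [exists b, hi|exists (- hi), b]; repeat split; lra. }
destruct Hside as [lo' [hi' [H1 [H2 [H3 H4]]]]].
assert (Hden : polholC lo' hi' (fun r a => / (polar r a - z))%C).
{ apply polholC_inv.
  - apply polholC_minus; [apply polholC_id|apply polholC_const].
  - intros r x Hr Hx. apply polar_neq; trivial. right. apply sin_half_neq_0; lra. }
assert (D1 : @dominated (RS CC) (fun r => cis a *: (g r a * / (polar r a - z))%C) (C1 * (C0 / k * (1 + / s))) e).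
{ apply (ray_dominated (X := CC) lo' hi' (fun r a => g r a * / (polar r a - z))%C); lra || trivial.
  - apply polholC_mult; trivial. now apply (polhol_sub (X := CC) (- hi) hi).
  - intros r Hr. apply QB; trivial; try now apply g_bound. apply C0_ge0. now apply Dk. }
assert (D2 : @dominated (RS CC) (fun r => cis a *: hker z (polar r a)) (C1 * (Ch / k * (1 + / s))) e).
{ apply (ray_dominated (X := CC) lo' hi' (fun r a => hker z (polar r a))); lra || trivial.
  - apply (polhol_ext (X := CC)) with (fun r a => (hn r a * / (polar r a - z))%C).
    + intros. unfold hn, hker. cring.
    + apply polholC_mult; trivial. apply (polhol_sub (X := CC) (- hi) hi); trivial. apply polhol_hn.
  - intros r Hr. replace (hker z (polar r a)) with (hn r a * / (polar r a - z))%C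
      by (unfold hn, hker; ring).
    apply QB; trivial; try now apply hn_bound. left; apply Ch_pos. now apply Dk. }
assert (D3 : @dominated (RS CC) (fun r => g s b *: (cis a *: hker z (polar r a))) (Cmod (g s b) * (C1 * (Ch / k * (1 + / s)))) e).
{ split; trivial. intros r Hr. destruct (proj2 D2 r Hr) as [U1 U2]. split.
  - apply (continuous_C_mult (fun _ => g s b)); [apply continuous_const|exact U1].
  - eapply Rle_trans; [apply (norm_scal_C (X := CC))|]. rewrite Rmult_assoc.
    apply Rmult_le_compat_l; [apply Cmod_ge_0|exact U2]. }
transitivity (minus (ray (X := CC) (fun r a => g r a * / (polar r a - z))%C a)
  (@pint (RS CC) (fun r => g s b *: (cis a *: hker z (polar r a))))).
- assert (D13 : @dominated (RS CC) (fun r => cis a *: q r a) (C1 * (CG / k * (1 + / s))) e).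
  { apply (ray_dominated (X := CC) lo' hi' q); lra || trivial.
    - now apply polhol_q_side.
    - intros r Hr. apply QB; trivial; try now apply Gn_bound. apply CG_ge0. now apply Dk. }
  refine (eq_trans _ (pint_minus (V := RS CC) _ _ _ _ _ _ D1 D3)).
  apply (pint_ext (V := RS CC) _ _ _ _ D13).
  intros r Hr. unfold q, Gn, hn, hker.
  change (cis a * ((g r a - g s b * (2 * z * / (polar r a + z))) * / (polar r a - z)) =
    cis a * (g r a * / (polar r a - z)) -
     g s b * (cis a * (2 * z * (/ (polar r a + z) * / (polar r a - z)))))%C. ring.
- change (minus (ray (X := CC) (fun r a => g r a * / (polar r a - z))%C a)
  (@pint (RS CC) (fun r => g s b *: (cis a *: hker z (polar r a)))) =
   minus (ray (X := CC) (fun r a => g r a * / (polar r a - z))%C a)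
   (g s b *: ray (X := CC) (fun r a => hker z (polar r a)) a)).
  f_equal. apply (bmap_pint (V := RS CC) (W := RS CC) (fun x => g s b *: x) (Cmod (g s b))
    ) with (4 := D2).
  + intros; apply (scal_distr_l (V := CC)).
  + intros c x. change (g s b * (RtoC c * x) = RtoC c * (g s b * x))%C. ring.
  + intros x. apply (norm_scal_C (X := CC)).
Qed.

(** The integrals of [q] over the two rays agree, so those of [g(w) / (w - z)] differ exactly as
    those of [g(z) hker z], which are [g(z)] times [i pi] and [- i pi]. *)
Lemma cauchy_formula :
  (ray (X := CC) (fun r a => g r a * / (polar r a - z)) (- th)
   - ray (X := CC) (fun r a => g r a * / (polar r a - z)) th)%C = (2 * PI * Ci * g s b)%C.
Proof.
assert (Bb := abs_b). assert (E := ray_q_eq).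
rewrite (ray_q_split th), (ray_q_split (- th)) in E;
  try (apply Rabs_le; lra); try lra.
unfold z in E. rewrite (ray_hker s b th), (ray_hker_neg s b (- th)) in E; try lra. fold z in E.
set (x1 := ray (X := CC) (fun r a => g r a * / (polar r a - z))%C (- th)) in *.
set (x2 := ray (X := CC) (fun r a => g r a * / (polar r a - z))%C th) in *.
match goal with |- @eq _ ?x ?y => change (@eq C x y) end.
replace (x1 - x2)%C with ((x1 - g s b * (PI * Ci)) - x2 + g s b * (PI * Ci))%C by ring.
rewrite E. ring.
Qed.

End CauchyFormula.

(** * Arguments and sectors in polar coordinates *)

Lemma abs_Carg z : Rabs (Carg z) = acos (Re z / Cmod z).
Proof.
unfold Carg. assert (H := acos_bound (Re z / Cmod z)).
destruct (Rle_dec 0 (Im z)); [|rewrite Rabs_Ropp]; apply Rabs_pos_eq; lra.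
Qed.

Lemma Re_polar r a : Re (polar r a) = r * cos a.
Proof. unfold polar, cis; simpl. ring. Qed.

Lemma Im_polar r a : Im (polar r a) = r * sin a.
Proof. unfold polar, cis; simpl. ring. Qed.

Lemma cos_arg_polar r a : 0 < r -> Re (polar r a) / Cmod (polar r a) = cos a.
Proof. intros Hr. rewrite Re_polar, Cmod_polar by lra. field; lra. Qed.

(** The condition is put on cosines, so that it covers every real angle [a], also beyond [PI], where
    the argument jumps. *)
Lemma not_sector_polar mu r a : 0 < r -> 0 <= mu <= PI -> cos a < cos mu ->
  ~ sector mu (polar r a).
Proof.
intros Hr Hmu Ha [[_ H]|H].
- rewrite abs_Carg, cos_arg_polar in H by trivial.
  assert (B := acos_bound (cos a)).
  assert (C := cos_decr_1 (acos (cos a)) mu ltac:(lra) ltac:(lra) ltac:(lra) ltac:(lra) H).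
  rewrite cos_acos in C by (apply COS_bound). lra.
- now apply (polar_neq_0 r a).
Qed.

Lemma Carg_polar r a : 0 < r -> - PI < a < PI -> Carg (polar r a) = a.
Proof.
intros Hr Ha. unfold Carg. rewrite cos_arg_polar, Im_polar by trivial.
destruct (Rle_dec 0 (r * sin a)) as [L|L].
- apply acos_cos. split; [|lra]. apply Rnot_lt_le. intros N.
  assert (0 < sin (- a)) by (apply sin_gt_0; lra). rewrite sin_neg in H. nra.
- rewrite <- (cos_neg a), acos_cos; [ring|]. split; [|lra].
  apply Rnot_lt_le. intros N.
  assert (0 < sin a) by (apply sin_gt_0; lra). nra.
Qed.

Lemma Cpower_polar r a al : 0 < r -> - PI < a < PI -> Cpower (polar r a) al = zpow al r a.
Proof.
intros Hr Ha. unfold Cpower, zpow. rewrite Carg_polar, Cmod_polar by lra || trivial.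
reflexivity.
Qed.

(** * Contour integrals of functions in polar form *)

Section Contour.
Context {X : CompleteNormedModule C_AbsRing}.

(** The polar form of [path_integral], to which [frac_B] and [semigroup] reduce by conversion. *)
Definition cint (F : R -> R -> X) (th : R) : X :=
  (/ (2 * PI * Ci))%C *: minus (ray F (- th)) (ray F th).

Definition rdom (F : R -> R -> X) (a C e : R) : Prop :=
  @dominated (RS X) (fun r => cis a *: F r a) C e.

Lemma rdom_intro lo hi F a C e : polhol lo hi F -> lo < a < hi -> 0 < e ->
  (forall r, 0 < r -> norm (F r a) <= C * kap e r) -> rdom F a C e.
Proof. intros. now apply (ray_dominated lo hi). Qed.

Lemma ray_ext F G a C e : rdom F a C e -> (forall r, 0 < r -> F r a = G r a) ->
  ray F a = ray G a.
Proof.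
intros HF E. apply (pint_ext (V := RS X) _ _ C e HF). intros r Hr. now rewrite E.
Qed.

Lemma rdom_ext F G a C e : rdom F a C e -> (forall r, 0 < r -> F r a = G r a) ->
  rdom G a C e.
Proof.
intros HF E. apply (dominated_ext (V := RS X) _ _ C e HF). intros r Hr. now rewrite E.
Qed.

Lemma cint_ext F G th C e C' e' : rdom F th C e -> rdom F (- th) C' e' ->
  (forall r, 0 < r -> F r th = G r th) -> (forall r, 0 < r -> F r (- th) = G r (- th)) ->
  cint F th = cint G th.
Proof.
intros H1 H2 E1 E2. unfold cint.
now rewrite (ray_ext F G th C e H1 E1), (ray_ext F G (- th) C' e' H2 E2).
Qed.

Lemma ray_plus F G a C e C' e' : rdom F a C e -> rdom G a C' e' ->
  ray (fun r a => plus (F r a) (G r a)) a = plus (ray F a) (ray G a).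
Proof.
intros HF HG. refine (eq_trans _ (pint_plus (V := RS X) _ _ _ _ _ _ HF HG)).
unfold ray. f_equal. apply FunctionalExtensionality.functional_extensionality.
intros r. apply (scal_distr_l (V := X)).
Qed.

Lemma norm_ray_le F a C e : rdom F a C e -> norm (ray F a) <= 2 * C.
Proof. exact (norm_pint_le (V := RS X) _ C e). Qed.

Lemma Cmod_2piI : Cmod (2 * PI * Ci) = 2 * PI.
Proof. rewrite !Cmod_mult, !Cmod_R, Cmod_Ci, !Rabs_pos_eq; try lra.
assert (P := PI_RGT_0); lra. Qed.

Lemma c2piI_neq_0 : (2 * PI * Ci)%C <> RtoC 0.
Proof. apply Cmod_gt_0. rewrite Cmod_2piI. assert (P := PI_RGT_0); lra. Qed.

Lemma norm_cint_le F th C e : rdom F th C e -> rdom F (- th) C e ->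
  norm (cint F th) <= C.
Proof.
intros H1 H2. assert (HC := dominated_C_ge0 (V := RS X) _ _ _ H1).
unfold cint. eapply Rle_trans; [apply norm_scal_C|].
rewrite Cmod_inv by apply c2piI_neq_0. rewrite Cmod_2piI.
assert (P := PI2_3_2).
apply Rmult_le_reg_l with (2 * PI); [lra|].
rewrite <- Rmult_assoc, Rinv_r, Rmult_1_l by lra.
eapply Rle_trans; [apply xnorm_minus_le|].
assert (B1 := norm_ray_le _ _ _ _ H1). assert (B2 := norm_ray_le _ _ _ _ H2).
apply Rle_trans with (2 * C + 2 * C); [lra|].
assert (0 <= (PI - 2) * C) by (apply Rmult_le_pos; lra). lra.
Qed.

Lemma cint_plus F G th C1 e1 C2 e2 C3 e3 C4 e4 :
  rdom F th C1 e1 -> rdom F (- th) C2 e2 -> rdom G th C3 e3 -> rdom G (- th) C4 e4 ->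
  cint (fun r a => plus (F r a) (G r a)) th = plus (cint F th) (cint G th).
Proof.
intros H1 H2 H3 H4. unfold cint.
rewrite (ray_plus F G th C1 e1 C3 e3), (ray_plus F G (- th) C2 e2 C4 e4) by trivial.
linC X.
Qed.

Lemma cint_rotate lo hi F th th' C e :
  polhol lo hi F -> polhol (- hi) (- lo) F -> lo < th -> th <= th' -> th' < hi -> 0 < e ->
  (forall r a, 0 < r -> th <= Rabs a <= th' -> norm (F r a) <= C * kap e r) ->
  0 < th -> cint F th = cint F th'.
Proof.
intros H1 H2 L1 L2 L3 He HB Hth. unfold cint.
assert (E1 : ray F (- th) = ray F (- th')).
{ symmetry. apply (ray_rotate (- hi) (- lo) F (- th') (- th) C e); lra || trivial.
  intros r a Hr Ha. apply HB; trivial. rewrite Rabs_left1; lra. }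
assert (E2 : ray F th = ray F th').
{ apply (ray_rotate lo hi F th th' C e); lra || trivial.
  intros r a Hr Ha. apply HB; trivial. rewrite Rabs_pos_eq; lra. }
now rewrite E1, E2.
Qed.

End Contour.

Lemma cint_bmap {X Y : CompleteNormedModule C_AbsRing} (L : X -> Y) M F th C1 e C2 e' :
  (forall x y, L (plus x y) = plus (L x) (L y)) ->
  (forall (c : C) x, L (c *: x) = c *: L x) ->
  (forall x, norm (L x) <= M * norm x) ->
  rdom F th C1 e -> rdom F (- th) C2 e' ->
  cint (fun r a => L (F r a)) th = L (cint F th).
Proof.
intros Lp Ls Lb H1 H2. unfold cint. rewrite Ls.
assert (E : forall a C3 e3, rdom F a C3 e3 -> ray (fun r a => L (F r a)) a = L (ray F a)).
{ intros a C3 e3 H. unfold ray.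
  rewrite <- (bmap_pint (V := RS X) (W := RS Y) L M) with (4 := H); trivial.
  - f_equal. apply FunctionalExtensionality.functional_extensionality.
    intros r. symmetry. apply Ls.
  - intros c x. apply (Ls (RtoC c) x). }
rewrite (E _ _ _ H1), (E _ _ _ H2).
assert (Lm : forall x y, L (minus x y) = minus (L x) (L y)).
{ intros x y. replace (minus x y) with (plus x ((-(1))%C *: y)) by linC X.
  rewrite Lp, Ls. generalize (L x) (L y). intros. linC Y. }
now rewrite Lm.
Qed.

(** * Functional calculus *)

Section Resolvent.
Context {X : CompleteNormedModule C_AbsRing}.
Variables (gamma omega : R) (A : partial_op X).
Hypothesis Hgamma : -1 < gamma < 0.
Hypothesis Homega : 0 < omega < PI / 2.
Hypothesis HA : almost_sectorial gamma omega A.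

Let Rs := resolvent A.

(** * Algebra and holomorphy of the resolvent *)

Lemma A_lin : linear_op A.
Proof. apply HA. Qed.

Lemma dom_plus x y : dom A x -> dom A y -> dom A (plus x y).
Proof. intros Hx Hy. now apply (proj1 (proj2 A_lin)). Qed.

Lemma op_plus x y : dom A x -> dom A y -> op A (plus x y) = plus (op A x) (op A y).
Proof. intros Hx Hy. now apply (proj1 (proj2 A_lin)). Qed.

Lemma dom_scal (c : C) x : dom A x -> dom A (c *: x).
Proof. intros Hx. now apply (proj2 (proj2 A_lin)). Qed.

Lemma op_scal (c : C) x : dom A x -> op A (c *: x) = c *: op A x.
Proof. intros Hx. now apply (proj2 (proj2 A_lin)). Qed.

Lemma opp_scal (x : X) : opp x = (-(1))%C *: x.
Proof. linC X. Qed.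

Lemma dom_opp x : dom A x -> dom A (opp x).
Proof. intros Hx. rewrite opp_scal. now apply dom_scal. Qed.

Lemma op_opp x : dom A x -> op A (opp x) = opp (op A x).
Proof. intros Hx. rewrite !opp_scal. now apply op_scal. Qed.

Definition reg (z : C) : Prop := ~ sector omega z.

Lemma reg_resolvent z : reg z -> resolvent_set A z.
Proof.
intros H. apply NNPP. intros N. apply H. now apply (proj1 (proj2 (proj2 HA))).
Qed.

Lemma resolvent_spec z y : reg z -> dom A (Rs z y) /\ shifted A z (Rs z y) = y.
Proof.
intros H. apply reg_resolvent in H. destruct H as [H _].
apply (iota_correct (fun x => dom A x /\ shifted A z x = y)). apply H.
Qed.

Lemma resolvent_unique z x y : reg z -> dom A x -> shifted A z x = y -> x = Rs z y.
Proof.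
intros Hz Hx Hy. destruct (resolvent_spec z y Hz) as [H1 H2].
apply reg_resolvent in Hz. destruct Hz as [Hz _]. destruct (Hz y) as [u [_ Hu]].
rewrite <- (Hu x), <- (Hu (Rs z y)); trivial; now split.
Qed.

Lemma resolvent_dom z y : reg z -> dom A (Rs z y).
Proof. intros H. now apply resolvent_spec. Qed.

Lemma resolvent_op z y : reg z -> op A (Rs z y) = minus (z *: Rs z y) y.
Proof.
intros H. destruct (resolvent_spec z y H) as [H1 H2]. rewrite <- H2 at 3.
unfold shifted. generalize (Rs z y) (op A (Rs z y)). intros. linC X.
Qed.

Lemma resolvent_plus z x y : reg z -> Rs z (plus x y) = plus (Rs z x) (Rs z y).
Proof.
intros H. symmetry. apply resolvent_unique; trivial.
- apply dom_plus; now apply resolvent_dom.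
- unfold shifted. rewrite op_plus by now apply resolvent_dom.
  rewrite !resolvent_op by trivial. generalize (Rs z x) (Rs z y). intros. linC X.
Qed.

Lemma resolvent_scal z (c : C) x : reg z -> Rs z (c *: x) = c *: Rs z x.
Proof.
intros H. symmetry. apply resolvent_unique; trivial.
- apply dom_scal; now apply resolvent_dom.
- unfold shifted. rewrite op_scal by now apply resolvent_dom.
  rewrite !resolvent_op by trivial. generalize (Rs z x). intros. linC X.
Qed.

Lemma resolvent_minus z x y : reg z -> Rs z (minus x y) = minus (Rs z x) (Rs z y).
Proof.
intros H. unfold minus. rewrite resolvent_plus, (opp_scal y), resolvent_scal by trivial.
now rewrite <- opp_scal.
Qed.

Lemma resolvent_identity z w y : reg z -> reg w ->
  minus (Rs z y) (Rs w y) = (w - z)%C *: Rs z (Rs w y).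
Proof.
intros Hz Hw. rewrite <- resolvent_scal by trivial.
assert (E : plus (Rs w y) (Rs z ((w - z)%C *: Rs w y)) = Rs z y).
{ apply resolvent_unique; trivial.
  - apply dom_plus; now apply resolvent_dom.
  - unfold shifted. rewrite op_plus by now apply resolvent_dom.
    rewrite !resolvent_op by trivial.
    generalize (Rs w y) (Rs z ((w - z)%C *: Rs w y)). intros. linC X. }
rewrite <- E. generalize (Rs w y) (Rs z ((w - z)%C *: Rs w y)). intros. linC X.
Qed.

Lemma scal_cancel (c : C) (x y : X) : c <> RtoC 0 -> c *: x = c *: y -> x = y.
Proof.
intros Hc H. assert (E : x = (/ c)%C *: (c *: x)) by (linC X; field; trivial).
rewrite E, H. linC X. field; trivial.
Qed.

Lemma resolvent_comm z w y : reg z -> reg w -> Rs z (Rs w y) = Rs w (Rs z y).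
Proof.
intros Hz Hw. destruct (classic (z = w)) as [->|N]; trivial.
assert (E1 := resolvent_identity z w y Hz Hw).
assert (E2 := resolvent_identity w z y Hw Hz).
apply (scal_cancel (w - z)%C).
{ intros E. apply N. replace w with (w - z + z)%C by ring. rewrite E. ring. }
rewrite <- E1.
assert (E3 : (w - z)%C *: Rs w (Rs z y) = opp ((z - w)%C *: Rs w (Rs z y))) by linC X.
rewrite E3, <- E2. generalize (Rs z y) (Rs w y). intros. linC X.
Qed.

Lemma resolvent_product z w y : reg z -> reg w -> z <> w ->
  Rs w (Rs z y) = (/ (w - z))%C *: minus (Rs z y) (Rs w y).
Proof.
intros Hz Hw N.
assert (Hn : (w - z)%C <> RtoC 0).
{ intros E. apply N. replace w with (w - z + z)%C by ring. rewrite E. ring. }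
apply (scal_cancel (w - z)%C); trivial.
rewrite (resolvent_identity z w), resolvent_comm by trivial.
generalize (Rs w (Rs z y)). intros. linC X. now field.
Qed.

Lemma reg_polar r a : 0 < r -> cos a < cos omega -> reg (polar r a).
Proof. intros Hr Ha. apply not_sector_polar; lra || trivial. Qed.

Lemma resolvent_bound_polar th : omega < th < PI -> exists K, 0 < K /\
  forall r a x, 0 < r -> cos a <= cos th ->
    norm (Rs (polar r a) x) <= K * Rpower r gamma * norm x.
Proof.
(* The assumed bound holds off a closed sector, so an angle strictly between [omega] and [th] is
   taken in order to include the ray [arg z = th]. *)
intros Hth. destruct (proj2 (proj2 (proj2 HA)) ((omega + th) / 2)) as [K [HK H]]; [lra|].
exists K. split; trivial. intros r a x Hr Ha.
assert (B := H (polar r a)). rewrite Cmod_polar in B by lra. apply B.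
apply not_sector_polar; trivial; [lra|].
apply Rle_lt_trans with (1 := Ha). apply cos_decreasing_1; lra.
Qed.

Lemma resolvent_bounded z : reg z -> exists M, forall x, norm (Rs z x) <= M * norm x.
Proof.
intros H. destruct (reg_resolvent z H) as [_ [M HM]]. exists M. intros x.
destruct (resolvent_spec z x H) as [H1 H2]. specialize (HM _ H1). now rewrite H2 in HM.
Qed.

Lemma resolvent_local_bound r a : 0 < r -> cos a < cos omega -> exists d M, 0 < d /\ 0 < M /\
  forall r' a', Rabs (r' - r) < d -> Rabs (a' - a) < d ->
    0 < r' /\ cos a' < cos omega /\
    forall x, norm (Rs (polar r' a') x) <= M * norm x.
Proof.
(* [th] is the angle whose cosine is halfway between [cos a] and [cos omega]; all angles near [a]
   then stay on its outer side. *)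
intros Hr Ha. set (t := (cos a + cos omega) / 2).
assert (Ht : -1 <= t <= 1).
{ assert (A1 := COS_bound a). assert (A2 := COS_bound omega). unfold t; lra. }
assert (Ht2 : -1 < t).
{ assert (A1 := COS_bound a). unfold t. lra. }
set (th := acos t). assert (Hc : cos th = t) by (now apply cos_acos).
assert (Hth := acos_bound t). fold th in Hth.
assert (Hth1 : omega < th).
{ apply Rnot_le_lt. intros L.
  assert (Q := cos_decr_1 th omega ltac:(lra) ltac:(lra) ltac:(lra) ltac:(lra) L).
  unfold t in Hc. lra. }
assert (Hth2 : th < PI).
{ destruct (Req_dec th PI) as [E|E]; [|lra]. rewrite E, cos_PI in Hc. lra. }
destruct (resolvent_bound_polar th ltac:(lra)) as [K [HK HB]].
assert (Cc : continuous cos a) by apply continuous_cos.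
destruct (proj1 (continuous_eps (V := R_NormedModule) cos a) Cc (t - cos a)) as [d [Hd Hd']].
{ unfold t; lra. }
exists (Rmin d (r / 2)), (K * Rpower (r / 2) gamma). split; [apply Rmin_pos; lra|].
split; [apply Rmult_lt_0_compat; trivial; apply Rpower_pos|].
intros r' a' Hr' Ha'.
assert (Rmin d (r / 2) <= d) by apply Rmin_l. assert (Rmin d (r / 2) <= r / 2) by apply Rmin_r.
assert (r / 2 < r') by (apply Rabs_lt_between in Hr'; lra).
assert (Q := Hd' a' ltac:(lra)). change (Rabs (cos a' - cos a) < t - cos a) in Q.
apply Rabs_lt_between in Q.
split; [lra|split; [unfold t in Q; lra|]]. intros x.
eapply Rle_trans; [apply HB; lra|].
apply Rmult_le_compat_r; [apply norm_ge_0|]. apply Rmult_le_compat_l; [lra|].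
unfold Rpower. assert (ln (r / 2) < ln r') by (apply ln_increasing; lra).
left. apply exp_increasing. nra.
Qed.

Lemma resolvent_xcont2 x r a : 0 < r -> cos a < cos omega ->
  xcont2 (fun r a => Rs (polar r a) x) r a.
Proof.
intros Hr Ha. destruct (resolvent_local_bound r a Hr Ha) as [d [M [Hd [HM H]]]].
apply (cont2_eps (V := RS X)). intros eps Heps.
set (N := M * (norm (Rs (polar r a) x) + 1)).
assert (HN : 0 < N).
{ apply Rmult_lt_0_compat; trivial. assert (Q := norm_ge_0 (Rs (polar r a) x)). lra. }
assert (Cp : continuous (fun p : R * R => polar (fst p) (snd p) : CC) (r, a))
  by apply continuous_polar.
destruct (proj1 (cont2_eps (V := RS CC) polar r a) Cp (eps / N)) as [d' [Hd' Hp]].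
{ now apply Rdiv_lt_0_compat. }
exists (Rmin d d'). split; [now apply Rmin_pos|]. intros r' a' Hr' Ha'.
assert (Rmin d d' <= d) by apply Rmin_l. assert (Rmin d d' <= d') by apply Rmin_r.
destruct (H r' a' ltac:(lra) ltac:(lra)) as [J1 [J2 J3]].
specialize (Hp r' a' ltac:(lra) ltac:(lra)).
change (Cmod (polar r' a' - polar r a) < eps / N) in Hp.
apply (xnorm_eq_lt _ _ _ (resolvent_identity (polar r' a') (polar r a) x
  (reg_polar _ _ J1 J2) (reg_polar _ _ Hr Ha))).
eapply Rle_lt_trans; [apply norm_scal_C|].
rewrite <- Cmod_opp.
replace (- (polar r a - polar r' a'))%C with (polar r' a' - polar r a)%C by ring.
apply Rle_lt_trans with (Cmod (polar r' a' - polar r a) * N).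
- apply Rmult_le_compat_l; [apply Cmod_ge_0|]. eapply Rle_trans; [apply J3|].
  unfold N. apply Rmult_le_compat_l; lra.
- apply Rlt_le_trans with (eps / N * N); [now apply Rmult_lt_compat_r|].
  right; field; lra.
Qed.

Lemma resolvent_is_der x (w : R -> C) t dw r a : 0 < r -> cos a < cos omega ->
  w t = polar r a -> is_derC w t dw ->
  (exists d M, 0 < d /\ 0 < M /\ forall t', Rabs (t' - t) < d -> reg (w t') /\
     forall x, norm (Rs (w t') x) <= M * norm x) ->
  is_der (fun t => Rs (w t) x) t (opp (dw *: Rs (w t) (Rs (w t) x))).
Proof.
intros Hr Ha Hw Hd [d [M [Hd0 [HM H]]]].
assert (Hreg : reg (w t)) by (rewrite Hw; now apply reg_polar).
apply is_der_eps. intros eps Heps.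
set (R2 := Rs (w t) (Rs (w t) x)).
set (N := M * norm R2 + norm R2 + 1).
assert (N0 := norm_ge_0 R2).
assert (HMN : 0 <= M * norm R2) by (apply Rmult_le_pos; lra).
assert (HN : 0 < N) by (unfold N; lra).
set (Q := Cmod dw + 1).
assert (HQ : 0 < Q) by (unfold Q; assert (U := Cmod_ge_0 dw); lra).
destruct (proj1 (is_der_eps (X := CC) w t dw) Hd (Rmin 1 (eps / (2 * N)))) as [d1 [Hd1 H1]].
{ apply Rmin_pos; [lra|]. apply Rdiv_lt_0_compat; lra. }
exists (Rmin (Rmin d d1) (eps / (2 * N * Q * Q))). split.
{ repeat apply Rmin_pos; trivial. apply Rdiv_lt_0_compat; trivial.
  repeat apply Rmult_lt_0_compat; lra. }
intros y Hy.
assert (L1 : Rmin (Rmin d d1) (eps / (2 * N * Q * Q)) <= Rmin d d1) by apply Rmin_l.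
assert (L2 : Rmin (Rmin d d1) (eps / (2 * N * Q * Q)) <= eps / (2 * N * Q * Q)) by apply Rmin_r.
assert (L3 : Rmin d d1 <= d) by apply Rmin_l. assert (L4 : Rmin d d1 <= d1) by apply Rmin_r.
destruct (H y ltac:(lra)) as [Hy1 Hy2]. specialize (H1 y ltac:(lra)).
change (Cmod (w y - w t - RtoC (y - t) * dw) <= Rmin 1 (eps / (2 * N)) * Rabs (y - t)) in H1.
assert (M1 : Rmin 1 (eps / (2 * N)) <= 1) by apply Rmin_l.
assert (M2 : Rmin 1 (eps / (2 * N)) <= eps / (2 * N)) by apply Rmin_r.
set (D := (w y - w t)%C) in *. set (h := RtoC (y - t)) in *.
assert (AP := Rabs_pos (y - t)).
assert (HD : Cmod D <= Q * Rabs (y - t)).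
{ replace D with ((D - h * dw) + h * dw)%C by ring.
  eapply Rle_trans; [apply Cmod_triangle|]. rewrite Cmod_mult.
  replace (Cmod h) with (Rabs (y - t)) by (symmetry; apply Cmod_R). unfold Q. nra. }
assert (I1 : minus (Rs (w y) x) (Rs (w t) x) = (- D)%C *: Rs (w y) (Rs (w t) x)).
{ rewrite resolvent_identity by trivial. f_equal. unfold D. cring. }
assert (I2 : minus (Rs (w y) (Rs (w t) x)) R2 = (- D)%C *: Rs (w y) R2).
{ unfold R2. rewrite resolvent_identity by trivial. f_equal. unfold D. cring. }
(* Applying the resolvent identity twice gives the exact remainder: a term of second order in the
   increment [D] and the first-order remainder of [w] applied to [R2]. *)
assert (E : minus (minus (Rs (w y) x) (Rs (w t) x)) (h *: opp (dw *: R2)) =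
  minus ((D * D)%C *: Rs (w y) R2) ((D - h * dw)%C *: R2)).
{ rewrite I1.
  assert (E' : Rs (w y) (Rs (w t) x) = plus R2 ((- D)%C *: Rs (w y) R2)).
  { rewrite <- I2. generalize (Rs (w y) (Rs (w t) x)). intros. linC X. }
  rewrite E'. generalize (Rs (w y) R2). intros. linC X. }
apply (xnorm_eq_le _ _ _ E).
eapply Rle_trans; [apply xnorm_minus_le|].
eapply Rle_trans; [apply Rplus_le_compat; apply norm_scal_C|].
rewrite Cmod_mult.
assert (T1 : Cmod D * Cmod D * norm (Rs (w y) R2) <= eps / 2 * Rabs (y - t)).
{ apply Rle_trans with ((Q * Rabs (y - t)) * (Q * (eps / (2 * N * Q * Q))) * N).
  - apply Rmult_le_compat.
    + apply Rmult_le_pos; apply Cmod_ge_0.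
    + apply norm_ge_0.
    + apply Rmult_le_compat; trivial; try apply Cmod_ge_0.
      apply Rle_trans with (1 := HD). apply Rmult_le_compat_l; lra.
    + apply Rle_trans with (1 := Hy2 R2). unfold N. lra.
  - right. field. lra. }
assert (T2 : Cmod (D - h * dw) * norm R2 <= eps / 2 * Rabs (y - t)).
{ apply Rle_trans with (eps / (2 * N) * Rabs (y - t) * N).
  - apply Rmult_le_compat; trivial; try apply Cmod_ge_0.
    + apply Rle_trans with (1 := H1). apply Rmult_le_compat_r; lra.
    + unfold N. lra.
  - right. field. lra. }
lra.
Qed.

Lemma resolvent_polhol x lo hi : (forall a, lo < a < hi -> cos a < cos omega) ->
  polhol lo hi (fun r a => Rs (polar r a) x).
Proof.
intros Hlh. exists (fun r a => opp (Rs (polar r a) (Rs (polar r a) x))).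
intros r a Hr Ha. specialize (Hlh a Ha).
destruct (resolvent_local_bound r a Hr Hlh) as [d [M [Hd [HM H]]]].
split; [|split; [|split]].
- eapply is_der_eq; [apply (resolvent_is_der x (fun r => polar r a) r (cis a) r a); trivial|].
  + destruct (polholC_id (a - 1) (a + 1)) as [g1 G].
    eapply is_derC_eq.
    * apply is_derC_mult; [|apply (is_der_const (X := CC))].
      apply (is_derC_R (fun r => r)). apply is_derive_id.
    * change (RtoC 1 * cis a + RtoC r * 0 = cis a)%C. ring.
  + exists d, M. split; [trivial|split; trivial]. intros r' Hr'.
    destruct (H r' a Hr' ltac:(rewrite Rminus_eq_0, Rabs_R0; trivial)) as [A1 [A2 A3]].
    split; trivial. now apply reg_polar.
  + simpl. generalize (Rs (polar r a) (Rs (polar r a) x)). intros. linC X.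
- eapply is_der_eq; [apply (resolvent_is_der x (fun a => polar r a) a (Ci * RtoC r * cis a)%C r a); trivial|].
  + eapply is_derC_eq.
    * apply is_derC_mult; [apply (is_der_const (X := CC))|].
      apply (is_derC_cis (fun a => a)). apply is_derive_id.
    * change (0 * cis a + RtoC r * (RtoC 1 * Ci * cis a) = Ci * RtoC r * cis a)%C. ring.
  + exists d, M. split; [trivial|split; trivial]. intros a' Ha'.
    destruct (H r a' ltac:(rewrite Rminus_eq_0, Rabs_R0; trivial) Ha') as [A1 [A2 A3]].
    split; trivial. now apply reg_polar.
  + simpl. generalize (Rs (polar r a) (Rs (polar r a) x)). intros. linC X.
- now apply resolvent_xcont2.
- apply (continuous_opp (V := RS X)).
  (* R(w)R(w)x - R(z)R(z)x = (R(w)y - R(z)y) + R(w)(R(w)x - R(z)x), y = R(z)x *)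
  set (y := Rs (polar r a) x).
  apply (cont2_eps (V := RS X) (fun r a => Rs (polar r a) (Rs (polar r a) x))). intros eps Heps.
  destruct (proj1 (cont2_eps (V := RS X) (fun r a => Rs (polar r a) y) r a) (resolvent_xcont2 y r a Hr Hlh) (eps / 2))
    as [d1 [Hd1 H1]]; [lra|].
  destruct (proj1 (cont2_eps (V := RS X) (fun r a => Rs (polar r a) x) r a) (resolvent_xcont2 x r a Hr Hlh) (eps / (2 * M)))
    as [d2 [Hd2 H2]]; [apply Rdiv_lt_0_compat; lra|].
  exists (Rmin d (Rmin d1 d2)). split; [repeat apply Rmin_pos; trivial|]. intros r' a' Hr' Ha'.
  assert (L1 : Rmin d (Rmin d1 d2) <= d) by apply Rmin_l.
  assert (L2 : Rmin d (Rmin d1 d2) <= Rmin d1 d2) by apply Rmin_r.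
  assert (L3 : Rmin d1 d2 <= d1) by apply Rmin_l. assert (L4 : Rmin d1 d2 <= d2) by apply Rmin_r.
  specialize (H1 r' a' ltac:(lra) ltac:(lra)). specialize (H2 r' a' ltac:(lra) ltac:(lra)).
  destruct (H r' a' ltac:(lra) ltac:(lra)) as [A1 [A2 A3]].
  assert (Hreg : reg (polar r' a')) by now apply reg_polar.
  assert (E : minus (Rs (polar r' a') (Rs (polar r' a') x)) (Rs (polar r a) y) =
    plus (minus (Rs (polar r' a') y) (Rs (polar r a) y))
      (Rs (polar r' a') (minus (Rs (polar r' a') x) y))).
  { rewrite resolvent_minus by trivial.
    generalize (Rs (polar r' a') (Rs (polar r' a') x)) (Rs (polar r a) y) (Rs (polar r' a') y).
    intros. linC X. }
  apply (xnorm_eq_lt _ _ _ E).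
  eapply Rle_lt_trans; [apply xnorm_triangle|].
  assert (U : norm (Rs (polar r' a') (minus (Rs (polar r' a') x) y)) <= eps / 2).
  { eapply Rle_trans; [apply A3|].
    apply Rle_trans with (M * (eps / (2 * M))).
    - apply Rmult_le_compat_l; [lra|]. left; exact H2.
    - right; field; lra. }
  replace eps with (eps / 2 + eps / 2) by field.
  apply Rplus_lt_le_compat; [exact H1|exact U].
Qed.

(** The angle runs past [PI]: together with its mirror image this allows both rays of a contour to
    be turned onto the negative half-line. *)
Lemma resolvent_polhol_up x : polhol omega (2 * PI - omega) (fun r a => Rs (polar r a) x).
Proof.
apply resolvent_polhol. intros a Ha. assert (P := PI_RGT_0).
destruct (Rle_dec a PI).
- apply cos_decreasing_1; lra.
- replace (cos a) with (cos (2 * PI - a)) by (rewrite cos_minus, cos_2PI, sin_2PI; ring).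
  apply cos_decreasing_1; lra.
Qed.

Lemma resolvent_polhol_down x : polhol (- (2 * PI - omega)) (- omega) (fun r a => Rs (polar r a) x).
Proof.
apply resolvent_polhol. intros a Ha. assert (P := PI_RGT_0). rewrite <- (cos_neg a).
destruct (Rle_dec (- a) PI).
- apply cos_decreasing_1; lra.
- replace (cos (- a)) with (cos (2 * PI + a))
    by (rewrite cos_plus, cos_neg, cos_2PI, sin_2PI; ring).
  apply cos_decreasing_1; lra.
Qed.

(** * Contour integrals of scalar functions against the resolvent *)

Variable hi : R.
Hypothesis Hhi : omega < hi <= PI / 2.

(** Against a resolvent of size [r^gamma] the integrand is [O(r^gamma)] near 0, with [gamma > -1],
    and [O(r^(gamma - p))] near infinity, with [gamma - p < -1]. The same [C0] serves both bounds,
    so norms of operators can be read off it. *)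
Definition hol_decay (f : R -> R -> C) (C0 p : R) : Prop :=
  polholC (- hi) hi f /\ 1 + gamma < p /\
  forall r a, 0 < r -> Rabs a < hi -> Cmod (f r a) <= C0 /\ Cmod (f r a) <= C0 * Rpower r (- p).

Definition Phi (th : R) (f : R -> R -> C) (x : X) : X :=
  cint (fun r a => f r a *: Rs (polar r a) x) th.

Lemma hol_decay_C0 f C0 p : hol_decay f C0 p -> 0 <= C0.
Proof.
intros [_ [_ H]]. destruct (H 1 0 Rlt_0_1) as [A1 _]. { rewrite Rabs_R0; lra. }
assert (A2 := Cmod_ge_0 (f 1 0)). lra.
Qed.

Lemma hol_decay_cont f C0 p a r : hol_decay f C0 p -> Rabs a < hi -> 0 < r -> contC (fun r => f r a) r.
Proof.
intros [H _] Ha Hr. apply (polhol_cont (X := CC) (- hi) hi); trivial.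
now apply Rabs_lt_between.
Qed.

Lemma cos_lt_omega a th : omega < th -> th <= Rabs a <= PI -> cos a < cos omega.
Proof.
intros H1 H2. assert (E : cos a = cos (Rabs a)).
{ unfold Rabs. destruct (Rcase_abs a); trivial. now rewrite cos_neg. }
rewrite E. apply cos_decreasing_1; lra.
Qed.

Lemma cos_le_th a th : omega < th -> th <= Rabs a <= PI -> cos a <= cos th.
Proof.
intros H1 H2. assert (E : cos a = cos (Rabs a)).
{ unfold Rabs. destruct (Rcase_abs a); trivial. now rewrite cos_neg. }
rewrite E. apply cos_decr_1; lra.
Qed.

(** [e] and [K] do not depend on [u], and the bound is linear in [C0]: estimates of scalar
    functions, such as differences of exponentials, become estimates of operators with no further
    limit. *)
Lemma resolvent_decay_dominated p th : 1 + gamma < p -> omega < th < PI -> exists e K, 0 < e /\ 0 < K /\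
  forall (u : R -> R -> C) C0 x a, 0 <= C0 -> th <= Rabs a <= PI ->
  (forall r, 0 < r -> contC (fun r => u r a) r) ->
  (forall r, 0 < r -> Cmod (u r a) <= C0 /\ Cmod (u r a) <= C0 * Rpower r (- p)) ->
  rdom (fun r a => u r a *: Rs (polar r a) x) a (K * C0 * norm x) e /\
  forall r, 0 < r -> norm (u r a *: Rs (polar r a) x) <= K * C0 * norm x * kap e r.
Proof.
intros Hp Hth. destruct (resolvent_bound_polar th Hth) as [K0 [HK0 HB]].
destruct (kap_of_powers_scaled gamma (gamma - p) ltac:(lra) ltac:(lra)) as [e [C1 [He [HC1 H]]]].
exists e, (C1 * K0). split; trivial. split; [now apply Rmult_lt_0_compat|].
intros u C0 x a HC0 Ha Hc Hu.
assert (Hn := norm_ge_0 x).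
assert (B : forall r, 0 < r -> norm (u r a *: Rs (polar r a) x) <= C1 * K0 * C0 * norm x * kap e r).
{ intros r Hr. replace (C1 * K0 * C0 * norm x) with (C1 * (K0 * C0 * norm x)) by ring.
  destruct (Hu r Hr) as [U1 U2].
  assert (BR := HB r a x Hr (cos_le_th a th ltac:(lra) Ha)).
  assert (P := Rpower_pos r gamma). assert (P' := Rpower_pos r (- p)).
  apply H; trivial.
  - apply Rmult_le_pos; trivial. apply Rmult_le_pos; lra.
  - intros _. eapply Rle_trans; [apply norm_scal_C|].
    apply Rle_trans with (C0 * (K0 * Rpower r gamma * norm x)); [|right; ring].
    apply Rmult_le_compat; trivial. apply Cmod_ge_0. apply norm_ge_0.
  - intros _. eapply Rle_trans; [apply norm_scal_C|].
    unfold Rminus. rewrite Rpower_plus.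
    apply Rle_trans with (C0 * Rpower r (- p) * (K0 * Rpower r gamma * norm x)); [|right; ring].
    apply Rmult_le_compat; trivial. apply Cmod_ge_0. apply norm_ge_0. }
split; [|exact B]. split; trivial. intros r Hr. split.
- apply continuous_scal_C; [apply continuous_const|].
  apply continuous_scal_C; [now apply Hc|].
  apply (cont2_l (V := RS X) (fun r a => Rs (polar r a) x)). apply resolvent_xcont2; trivial.
  apply cos_lt_omega with th; lra.
- eapply Rle_trans; [apply norm_cis_scal|]. now apply B.
Qed.

Lemma hol_decay_dominated p th : 1 + gamma < p -> omega < th < hi -> exists e K, 0 < e /\ 0 < K /\
  forall f C0 x a, hol_decay f C0 p -> th <= Rabs a < hi ->
  rdom (fun r a => f r a *: Rs (polar r a) x) a (K * C0 * norm x) e /\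
  forall r, 0 < r -> norm (f r a *: Rs (polar r a) x) <= K * C0 * norm x * kap e r.
Proof.
intros Hp Hth. destruct (resolvent_decay_dominated p th Hp ltac:(lra)) as [e [K [He [HK H]]]].
exists e, K. split; [trivial|split; trivial]. intros f C0 x a Hf Ha.
apply H; [now apply (hol_decay_C0 f C0 p)|lra| |].
- intros r Hr. apply (hol_decay_cont f C0 p); trivial; lra.
- intros r Hr. apply Hf; trivial; lra.
Qed.

Lemma abs_th th : omega < th < hi -> Rabs th = th /\ Rabs (- th) = th.
Proof. intros H. rewrite Rabs_Ropp. assert (Rabs th = th) by (apply Rabs_pos_eq; lra). now split. Qed.

Lemma hol_decay_rdom f C0 p th x : hol_decay f C0 p -> omega < th < hi -> exists C1 e,
  rdom (fun r a => f r a *: Rs (polar r a) x) th C1 e /\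
  rdom (fun r a => f r a *: Rs (polar r a) x) (- th) C1 e.
Proof.
intros Hf Hth. destruct (hol_decay_dominated p th (proj1 (proj2 Hf)) Hth) as [e [K [He [HK H]]]].
destruct (abs_th th Hth) as [T1 T2].
exists (K * C0 * norm x), e. split; apply H; trivial; rewrite ?T2, ?T1; lra.
Qed.

Lemma Phi_bound p th : 1 + gamma < p -> omega < th < hi -> exists K, 0 < K /\
  forall f C0 x, hol_decay f C0 p -> norm (Phi th f x) <= K * C0 * norm x.
Proof.
intros Hp Hth. destruct (hol_decay_dominated p th Hp Hth) as [e [K [He [HK H]]]].
destruct (abs_th th Hth) as [T1 T2].
exists K. split; trivial. intros f C0 x Hf.
apply norm_cint_le with e; apply H; trivial; rewrite ?T2, ?T1; lra.
Qed.

Lemma reg_th r a th : omega < th -> th <= Rabs a <= PI -> 0 < r -> reg (polar r a).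
Proof. intros H1 H2 Hr. apply reg_polar; trivial. now apply cos_lt_omega with th. Qed.

Lemma Phi_plus f C0 p th x y : hol_decay f C0 p -> omega < th < hi ->
  Phi th f (plus x y) = plus (Phi th f x) (Phi th f y).
Proof.
intros Hf Hth. destruct (hol_decay_rdom f C0 p th (plus x y) Hf Hth) as [C1 [e1 [D1 D2]]].
destruct (hol_decay_rdom f C0 p th x Hf Hth) as [C2 [e2 [D3 D4]]].
destruct (hol_decay_rdom f C0 p th y Hf Hth) as [C3 [e3 [D5 D6]]].
destruct (abs_th th Hth) as [T1 T2].
unfold Phi. rewrite <- (cint_plus _ _ th C2 e2 C2 e2 C3 e3 C3 e3) by trivial.
apply (cint_ext _ _ th C1 e1 C1 e1); trivial; intros r Hr;
rewrite resolvent_plus by (apply (reg_th r _ th); rewrite ?T1, ?T2; lra || trivial);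
apply (scal_distr_l (V := X)).
Qed.

Lemma Phi_scal f C0 p th (c : C) x : hol_decay f C0 p -> omega < th < hi ->
  Phi th f (c *: x) = c *: Phi th f x.
Proof.
intros Hf Hth. destruct (hol_decay_rdom f C0 p th (c *: x) Hf Hth) as [C1 [e1 [D1 D2]]].
destruct (hol_decay_rdom f C0 p th x Hf Hth) as [C2 [e2 [D3 D4]]].
destruct (abs_th th Hth) as [T1 T2].
unfold Phi. rewrite <- (cint_bmap (fun v => c *: v) (Cmod c)
   (fun r a => f r a *: Rs (polar r a) x) th C2 e2 C2 e2); trivial.
- apply (cint_ext _ _ th C1 e1 C1 e1); trivial; intros r Hr;
  rewrite resolvent_scal by (apply (reg_th r _ th); rewrite ?T1, ?T2; lra || trivial);
  match goal with |- context [Rs ?z x] => generalize (Rs z x) end; intros; linC X.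
- intros; apply (scal_distr_l (V := X)).
- intros; linC X.
- apply norm_scal_C.
Qed.

Lemma Phi_ext f g C0 p th x : hol_decay f C0 p -> omega < th < hi ->
  (forall r a, 0 < r -> Rabs a < hi -> f r a = g r a) -> Phi th f x = Phi th g x.
Proof.
intros Hf Hth E. destruct (hol_decay_rdom f C0 p th x Hf Hth) as [C1 [e1 [D1 D2]]].
destruct (abs_th th Hth) as [T1 T2].
apply (cint_ext _ _ th C1 e1 C1 e1); trivial; intros r Hr; rewrite E; trivial;
rewrite ?T1, ?T2; lra.
Qed.

Lemma Phi_fplus f g C0 p C1 p' th x : hol_decay f C0 p -> hol_decay g C1 p' -> omega < th < hi ->
  Phi th (fun r a => f r a + g r a)%C x = plus (Phi th f x) (Phi th g x).
Proof.
intros Hf Hg Hth. destruct (hol_decay_rdom f C0 p th x Hf Hth) as [C2 [e2 [D1 D2]]].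
destruct (hol_decay_rdom g C1 p' th x Hg Hth) as [C3 [e3 [D3 D4]]].
unfold Phi. rewrite <- (cint_plus _ _ th C2 e2 C2 e2 C3 e3 C3 e3) by trivial.
f_equal. apply functional_extensionality. intros r. apply functional_extensionality. intros a.
apply (scal_distr_r (V := X)).
Qed.

Lemma Phi_fscal c f C0 p th x : hol_decay f C0 p -> omega < th < hi ->
  Phi th (fun r a => c * f r a)%C x = c *: Phi th f x.
Proof.
intros Hf Hth. destruct (hol_decay_rdom f C0 p th x Hf Hth) as [C2 [e2 [D1 D2]]].
unfold Phi. rewrite <- (cint_bmap (fun v => c *: v) (Cmod c)
   (fun r a => f r a *: Rs (polar r a) x) th C2 e2 C2 e2); trivial.
- f_equal. apply functional_extensionality. intros r. apply functional_extensionality. intros a.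
  generalize (Rs (polar r a) x). intros. linC X.
- intros; apply (scal_distr_l (V := X)).
- intros; linC X.
- apply norm_scal_C.
Qed.

Lemma Phi_rotate f C0 p th th' x : hol_decay f C0 p -> omega < th -> th <= th' -> th' < hi ->
  Phi th f x = Phi th' f x.
Proof.
intros Hf H1 H2 H3. destruct (hol_decay_dominated p th (proj1 (proj2 Hf)) ltac:(lra)) as [e [K [He [HK H]]]].
apply (cint_rotate omega hi _ th th' (K * C0 * norm x) e); lra || trivial.
- apply polhol_mul; [apply (polhol_sub (X := CC) (- hi) hi); lra || apply Hf|].
  apply polhol_sub with omega (2 * PI - omega); lra || apply resolvent_polhol_up.
- apply polhol_mul; [apply (polhol_sub (X := CC) (- hi) hi); lra || apply Hf|].
  apply polhol_sub with (- (2 * PI - omega)) (- omega); lra || apply resolvent_polhol_down.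
- intros r a Hr Ha. apply H; trivial. lra.
Qed.

(** The poles [s e^{ib}], [th < |b| <= PI], lie outside the contour. *)
Lemma outer_dist th b s : omega < th < hi -> th < Rabs b <= PI -> 0 < s ->
  exists k, 0 < k /\ forall r a, 0 < r -> Rabs a <= th ->
    k * (r + s) <= Cmod (polar r a - polar s b).
Proof.
intros Hth Hb Hs. assert (P := PI_RGT_0). set (eta := Rabs b - th).
exists (sin (eta / 2)). split; [apply sin_gt_0; unfold eta; lra|].
intros r a Hr Ha. apply Rle_trans with (2 := polar_dist_ge r a s b Hr Hs).
apply Rmult_le_compat_r; [lra|].
apply abs_sin_half_ge; [unfold eta; lra|]. unfold eta. split.
- assert (T := Rabs_triang (a - b) (- a)). rewrite Rabs_Ropp in T.
  replace (a - b + - a) with (- b) in T by ring. rewrite Rabs_Ropp in T. lra.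
- assert (T := Rabs_triang a (- b)). rewrite Rabs_Ropp in T.
  unfold Rminus. lra.
Qed.

Lemma outer_neq th b s r a : omega < th < hi -> th < Rabs b <= PI -> 0 < s -> 0 < r ->
  Rabs a <= th -> (polar s b - polar r a)%C <> RtoC 0.
Proof.
intros Hth Hb Hs Hr Ha. destruct (outer_dist th b s Hth Hb Hs) as [k [Hk H]].
specialize (H r a Hr Ha). apply Cmod_gt_0.
replace (polar s b - polar r a)%C with (- (polar r a - polar s b))%C by ring.
rewrite Cmod_opp. apply Rlt_le_trans with (2 := H). apply Rmult_lt_0_compat; lra.
Qed.

Lemma Cinv_minus_swap (z w : C) : (w - z)%C <> RtoC 0 -> (/ (w - z) = - / (z - w))%C.
Proof.
intros H. field. split; trivial. intros E. apply H.
replace (w - z)%C with (- (z - w))%C by ring. rewrite E. ring.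
Qed.

Lemma outer_bound f C0 p th b s : hol_decay f C0 p -> omega < th < hi -> th < Rabs b <= PI -> 0 < s ->
  exists C1, 0 <= C1 /\ forall r a, 0 < r -> Rabs a <= th ->
   Cmod (f r a * / (polar s b - polar r a)) <= C1 /\
   Cmod (f r a * / (polar s b - polar r a)) <= C1 * Rpower r (- p).
Proof.
intros Hf Hth Hb Hs. destruct (outer_dist th b s Hth Hb Hs) as [k [Hk H]].
assert (HC := hol_decay_C0 _ _ _ Hf).
assert (Hks : 0 < k * s) by now apply Rmult_lt_0_compat.
exists (C0 / (k * s)). split; [now apply Rdiv_le_0_compat|]. intros r a Hr Ha.
destruct (proj2 (proj2 Hf) r a Hr ltac:(lra)) as [U1 U2]. specialize (H r a Hr Ha).
assert (D : k * s <= Cmod (polar s b - polar r a)).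
{ replace (polar s b - polar r a)%C with (- (polar r a - polar s b))%C by ring.
  rewrite Cmod_opp. apply Rle_trans with (2 := H). apply Rmult_le_compat_l; lra. }
split.
- now apply Cmod_div_le.
- replace (C0 / (k * s) * Rpower r (- p)) with (C0 * Rpower r (- p) / (k * s)) by (field; lra).
  now apply Cmod_div_le.
Qed.

Lemma outer_cont f C0 p th b s r a : hol_decay f C0 p -> omega < th < hi -> th < Rabs b <= PI -> 0 < s ->
  0 < r -> Rabs a <= th -> contC (fun r => f r a * / (polar s b - polar r a))%C r.
Proof.
intros Hf Hth Hb Hs Hr Ha. apply continuous_C_mult.
- apply (hol_decay_cont f C0 p); trivial; lra.
- apply continuous_C_inv.
  + apply (continuous_minus (V := CC)); [apply continuous_const|].
    apply continuous_C_mult; [apply continuous_RtoC, continuous_id|apply continuous_const].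
  + now apply (outer_neq th).
Qed.

(** With its pole outside, [f(z) / (w - z)] is holomorphic in the sector between the rays, so one
    ray can be rotated onto the other across the positive half-line and the two integrals cancel. *)
Lemma outer_vanish f C0 p th b s : hol_decay f C0 p -> omega < th < hi -> th < Rabs b <= PI -> 0 < s ->
  cint (X := CC) (fun r a => f r a * / (polar s b - polar r a))%C th = RtoC 0.
Proof.
intros Hf Hth Hb Hs. destruct (outer_dist th b s Hth Hb Hs) as [k [Hk H]].
assert (HC := hol_decay_C0 _ _ _ Hf). assert (Hp := proj1 (proj2 Hf)).
destruct (quot_bound p s ltac:(lra) Hs) as [e [C1 [He [HC1 QB]]]].
set (hi2 := Rmin hi (Rabs b)).
assert (L1 : hi2 <= hi) by apply Rmin_l. assert (L2 : hi2 <= Rabs b) by apply Rmin_r.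
assert (L3 : th < hi2) by (apply Rmin_glb_lt; lra).
unfold cint.
rewrite (ray_rotate (X := CC) (- hi2) hi2 (fun r a => f r a * / (polar s b - polar r a))%C (- th) th
  (C1 * (C0 / k * (1 + / s))) e); lra || trivial.
- match goal with |- context [ray ?u th] => generalize (ray (X := CC) u th) end.
  intros v. change (/ (2 * PI * Ci) * (v - v) = 0)%C. ring.
- apply polholC_mult; [apply (polhol_sub (X := CC) (- hi) hi); lra || apply Hf|].
  apply polholC_inv; [apply polholC_minus; [apply polholC_const|apply polholC_id]|].
  intros r a Hr Ha.
  assert (N : (polar r a - polar s b)%C <> RtoC 0).
  { apply polar_neq; trivial. right.
    assert (P := PI_RGT_0).
    assert (Hab : Rabs a < Rabs b) by (apply Rlt_le_trans with hi2; trivial; now apply Rabs_lt_between).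
    apply sin_half_neq_0.
    - intros E. replace a with b in Hab by lra. lra.
    - assert (Rabs (a - b) < 2 * PI).
      { unfold Rminus. eapply Rle_lt_trans; [apply Rabs_triang|]. rewrite Rabs_Ropp. lra. }
      now apply Rabs_lt_between. }
  intros E. apply N. replace (polar r a - polar s b)%C with (- (polar s b - polar r a))%C by ring.
  rewrite E. ring.
- intros r a Hr Ha. assert (Ha' : Rabs a <= th) by (apply Rabs_le; lra).
  change (Cmod (f r a * / (polar s b - polar r a)) <= C1 * (C0 / k * (1 + / s)) * kap e r).
  rewrite Cinv_minus_swap by now apply (outer_neq th).
  replace (f r a * - / (polar r a - polar s b))%C with (- (f r a * / (polar r a - polar s b)))%C by ring.
  rewrite Cmod_opp. destruct (proj2 (proj2 Hf) r a Hr ltac:(lra)) as [U1 U2].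
  apply QB; trivial. now apply H.
Qed.

Lemma reg_outer th b s : omega < th < hi -> th < Rabs b <= PI -> 0 < s -> reg (polar s b).
Proof. intros Hth Hb Hs. apply (reg_th s b th); lra. Qed.

Lemma rdom_scal_vec (u : R -> R -> C) a C1 e (v : X) : rdom (X := CC) u a C1 e ->
  rdom (fun r a => u r a *: v) a (norm v * C1) e.
Proof.
intros [He H]. split; trivial. intros r Hr. destruct (H r Hr) as [H1 H2]. split.
- apply continuous_ext with (fun r => (cis a * u r a)%C *: v).
  + intros y. linC X.
  + apply continuous_scal_C; [exact H1|apply continuous_const].
- assert (E : cis a *: (u r a *: v) = (cis a * u r a)%C *: v) by linC X.
  apply (xnorm_eq_le _ _ _ E). eapply Rle_trans; [apply norm_scal_C|].
  rewrite Rmult_comm, Rmult_assoc. apply Rmult_le_compat_l; [apply norm_ge_0|exact H2].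
Qed.

Lemma cint_scal_vec (u : R -> R -> C) th C1 e C2 e2 (v : X) :
  rdom (X := CC) u th C1 e -> rdom (X := CC) u (- th) C2 e2 ->
  cint (fun r a => u r a *: v) th = cint (X := CC) u th *: v.
Proof.
intros H1 H2. apply (cint_bmap (X := CC) (Y := X) (fun c => c *: v) (norm v) u th C1 e C2 e2); trivial.
- intros c d. apply (scal_distr_r (V := X)).
- intros c d. change ((c * d)%C *: v = c *: (d *: v)). linC X.
- intros c. rewrite Rmult_comm. apply norm_scal_C.
Qed.

Lemma outer_rdom f C0 p th b s a x : hol_decay f C0 p -> omega < th < hi -> th < Rabs b <= PI -> 0 < s ->
  Rabs a = th -> exists C1 e,
  rdom (fun r a => (f r a * / (polar s b - polar r a))%C *: Rs (polar r a) x) a C1 e.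
Proof.
intros Hf Hth Hb Hs Ha.
destruct (outer_bound f C0 p th b s Hf Hth Hb Hs) as [C1 [HC1 HB]].
destruct (resolvent_decay_dominated p th (proj1 (proj2 Hf)) ltac:(lra)) as [e [K [He [HK H]]]].
exists (K * C1 * norm x), e. apply H; lra || trivial.
- intros r Hr. apply (outer_cont f C0 p th); trivial; lra.
- intros r Hr. apply HB; lra.
Qed.

Lemma outer_scalar_rdom f C0 p th b s a : hol_decay f C0 p -> omega < th < hi -> th < Rabs b <= PI -> 0 < s ->
  Rabs a = th -> exists C1 e,
  rdom (X := CC) (fun r a => f r a * / (polar s b - polar r a))%C a C1 e.
Proof.
intros Hf Hth Hb Hs Ha. destruct (outer_dist th b s Hth Hb Hs) as [k [Hk H]].
assert (HC := hol_decay_C0 _ _ _ Hf). assert (Hp := proj1 (proj2 Hf)).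
destruct (quot_bound p s ltac:(lra) Hs) as [e [C1 [He [HC1 QB]]]].
exists (C1 * (C0 / k * (1 + / s))), e. split; trivial. intros r Hr. split.
- apply (continuous_C_mult (fun _ => cis a)); [apply continuous_const|].
  apply (outer_cont f C0 p th); trivial; lra.
- eapply Rle_trans; [apply (norm_cis_scal (X := CC))|].
  change (Cmod (f r a * / (polar s b - polar r a)) <= C1 * (C0 / k * (1 + / s)) * kap e r).
  rewrite Cinv_minus_swap by (apply (outer_neq th); trivial; lra).
  replace (f r a * - / (polar r a - polar s b))%C with (- (f r a * / (polar r a - polar s b)))%C by ring.
  rewrite Cmod_opp. destruct (proj2 (proj2 Hf) r a Hr ltac:(lra)) as [U1 U2].
  apply QB; trivial. apply H; trivial; lra.
Qed.

(** The resolvent identity gives [R(w) R(z) x = (R(z) x - R(w) x) / (w - z)]. The part with [R(w) x]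
    is a fixed vector times a scalar contour integral, which is 0 by [outer_vanish]. *)
Lemma resolvent_Phi f C0 p th b s x : hol_decay f C0 p -> omega < th < hi -> th < Rabs b <= PI -> 0 < s ->
  Rs (polar s b) (Phi th f x) = Phi th (fun r a => f r a * / (polar s b - polar r a))%C x.
Proof.
intros Hf Hth Hb Hs. destruct (abs_th th Hth) as [T1 T2].
assert (Hw := reg_outer th b s Hth Hb Hs).
destruct (resolvent_bounded _ Hw) as [M HM].
destruct (hol_decay_rdom f C0 p th x Hf Hth) as [C1 [e1 [D1 D2]]].
destruct (outer_rdom f C0 p th b s th x Hf Hth Hb Hs T1) as [C2 [e2 D3]].
destruct (outer_rdom f C0 p th b s (- th) x Hf Hth Hb Hs T2) as [C3 [e3 D4]].
destruct (outer_scalar_rdom f C0 p th b s th Hf Hth Hb Hs T1) as [C4 [e4 D5]].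
destruct (outer_scalar_rdom f C0 p th b s (- th) Hf Hth Hb Hs T2) as [C5 [e5 D6]].
set (v := opp (Rs (polar s b) x)).
assert (E : Phi th (fun r a => f r a * / (polar s b - polar r a))%C x =
  plus (Phi th (fun r a => f r a * / (polar s b - polar r a))%C x)
   (cint (fun r a => (f r a * / (polar s b - polar r a))%C *: v) th)).
{ rewrite (cint_scal_vec _ th C4 e4 C5 e5 v D5 D6), (outer_vanish f C0 p) by trivial.
  generalize (Phi th (fun r a => f r a * / (polar s b - polar r a))%C x). intros. linC X. }
rewrite E. unfold Phi.
rewrite <- (cint_plus _ _ th C2 e2 C3 e3 (norm v * C4) e4 (norm v * C5) e5);
  try now apply rdom_scal_vec. 2, 3 : trivial.
assert (LP : forall y z, Rs (polar s b) (plus y z) = plus (Rs (polar s b) y) (Rs (polar s b) z))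
  by (intros; now apply resolvent_plus).
assert (LS : forall (c : C) y, Rs (polar s b) (c *: y) = c *: Rs (polar s b) y)
  by (intros; now apply resolvent_scal).
rewrite <- (cint_bmap (Rs (polar s b)) M _ th C1 e1 C1 e1 LP LS HM D1 D2).
assert (B : forall C1 e1 a, rdom (fun r a => f r a *: Rs (polar r a) x) a C1 e1 ->
  exists C2 e2, rdom (fun r a => Rs (polar s b) (f r a *: Rs (polar r a) x)) a C2 e2).
{ intros K1 k1 a D. exists (Rmax M 0 * K1), k1. destruct D as [He D]. split; trivial.
  intros r Hr. destruct (D r Hr) as [U1 U2]. split.
  - apply continuous_ext with (fun r => Rs (polar s b) (cis a *: (f r a *: Rs (polar r a) x))).
    + intros y. apply LS.
    + apply (bmap_continuous (V := RS X) (W := RS X) (Rs (polar s b)) M); trivial.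
      intros c y. apply (LS (RtoC c) y).
  - apply (xnorm_eq_le _ _ _ (eq_sym (LS _ _))). eapply Rle_trans; [apply HM|].
    rewrite Rmult_assoc. apply Rle_trans with (Rmax M 0 * norm (cis a *: (f r a *: Rs (polar r a) x))).
    + apply Rmult_le_compat_r; [apply norm_ge_0|apply Rmax_l].
    + apply Rmult_le_compat_l; [apply Rmax_r|exact U2]. }
destruct (B _ _ _ D1) as [C6 [e6 D7]]. destruct (B _ _ _ D2) as [C7 [e7 D8]].
assert (PW : forall r a, 0 < r -> Rabs a = th ->
  Rs (polar s b) (f r a *: Rs (polar r a) x) =
  plus ((f r a * / (polar s b - polar r a))%C *: Rs (polar r a) x)
   ((f r a * / (polar s b - polar r a))%C *: v)).
{ intros r a Hr Ha. rewrite LS.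
  rewrite resolvent_product; trivial.
  - unfold v. generalize (Rs (polar r a) x) (Rs (polar s b) x). intros. linC X.
  - apply (reg_th r a th); lra.
  - intros E'. apply (outer_neq th b s r a); trivial; [lra|]. rewrite E'. ring. }
apply (cint_ext _ _ th C6 e6 C7 e7 D7 D8); intros r Hr; now apply PW.
Qed.

(** * Multiplicativity of the calculus *)

Lemma inv_sum_le sg r eta : 0 < sg -> 0 < r -> 0 < eta < 1 ->
  / (sg + r) <= Rpower sg (- eta) * Rpower r (eta - 1).
Proof.
intros Hs Hr He.
(* [sg + r] is the product of its powers [eta] and [1 - eta], each bounded below by the power of one
   variable. This splits Cauchy's kernel into the product form required by [fubini_pint]. *)
replace (eta - 1) with (- (1 - eta)) by ring. rewrite !Rpower_Ropp, <- Rinv_mult.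
apply Rinv_le_contravar.
- apply Rmult_lt_0_compat; apply Rpower_pos.
- apply Rle_trans with (Rpower (sg + r) eta * Rpower (sg + r) (1 - eta)).
  + apply Rmult_le_compat; try (left; apply Rpower_pos); left; apply Rpower_lt_base; lra.
  + rewrite <- Rpower_plus. replace (eta + (1 - eta)) with 1 by ring. rewrite Rpower_1; lra.
Qed.

(** [f] is integrated over [arg = th], [g] over [arg = th'], [th < th']. *)
Section Product.
Variables (f g : R -> R -> C) (C0 p C1 p' th th' : R) (x : X).
Hypothesis Hf : hol_decay f C0 p.
Hypothesis Hg : hol_decay g C1 p'.
Hypothesis Hth : omega < th.
Hypothesis Hth' : th < th'.
Hypothesis Hthhi : th' < hi.

(** The integrand of the double integral for [Phi th' g (Phi th f x)] once the outer resolvent has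
    been moved inside, with the direction factors of both rays. *)
Let DF (be a sg r : R) : X :=
  (cis be * g sg be * / (polar sg be - polar r a))%C *: (cis a *: (f r a *: Rs (polar r a) x)).

Lemma DF_dist be a : Rabs be = th' -> Rabs a = th -> exists k, 0 < k /\
  forall sg r, 0 < sg -> 0 < r -> k * (sg + r) <= Cmod (polar sg be - polar r a).
Proof.
intros Hb Ha. assert (P := PI_RGT_0). exists (sin ((th' - th) / 2)).
split; [apply sin_gt_0; lra|]. intros sg r Hs Hr.
apply Rle_trans with (2 := polar_dist_ge sg be r a Hs Hr). apply Rmult_le_compat_r; [lra|].
apply abs_sin_half_ge; [lra|]. split.
- assert (T := Rabs_triang (be - a) a). replace (be - a + a) with be in T by ring. lra.
- unfold Rminus. eapply Rle_trans; [apply Rabs_triang|]. rewrite Rabs_Ropp. lra.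
Qed.

Lemma DF_neq be a sg r : Rabs be = th' -> Rabs a = th -> 0 < sg -> 0 < r ->
  (polar sg be - polar r a)%C <> RtoC 0.
Proof.
intros Hb Ha Hs Hr. destruct (DF_dist be a Hb Ha) as [k [Hk H]].
apply Cmod_gt_0. apply Rlt_le_trans with (2 := H sg r Hs Hr).
apply Rmult_lt_0_compat; lra.
Qed.

Lemma DF_cont be a sg r : Rabs be = th' -> Rabs a = th -> 0 < sg -> 0 < r ->
  @cont2 (RS X) (DF be a) sg r.
Proof.
intros Hb Ha Hs Hr. apply continuous_scal_C; [apply continuous_C_mult; [apply continuous_C_mult|]|].
- apply continuous_const.
- apply (continuous_comp (V := R_UniformSpace) (W := C_UniformSpace)
    (fun q : R * R => fst q) (fun sg => g sg be)); [apply continuous_fst|].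
  apply (hol_decay_cont g C1 p'); trivial; lra.
- apply continuous_C_inv; [|now apply DF_neq].
  apply (continuous_minus (V := CC)).
  + apply continuous_C_mult; [apply continuous_RtoC, continuous_fst|apply continuous_const].
  + apply continuous_C_mult; [apply continuous_RtoC, continuous_snd|apply continuous_const].
- apply (continuous_comp (V := R_UniformSpace) (W := X)
    (fun q : R * R => snd q) (fun r => cis a *: (f r a *: Rs (polar r a) x))); [apply continuous_snd|].
  apply continuous_scal_C; [apply continuous_const|].
  apply continuous_scal_C; [apply (hol_decay_cont f C0 p); trivial; lra|].
  apply (cont2_l (V := RS X) (fun r a => Rs (polar r a) x)).
  apply resolvent_xcont2; trivial. apply cos_lt_omega with th; lra.
Qed.

Lemma DF_bound be a : Rabs be = th' -> Rabs a = th -> exists K e1 e2, 0 < e1 /\ 0 < e2 /\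
  forall sg r, 0 < sg -> 0 < r -> norm (DF be a sg r) <= K * (kap e1 sg * kap e2 r).
Proof.
intros Hb Ha. destruct (DF_dist be a Hb Ha) as [k [Hk Hd]].
destruct (resolvent_bound_polar th ltac:(lra)) as [K0 [HK0 HB]].
assert (Hp := proj1 (proj2 Hf)). assert (Hp' := proj1 (proj2 Hg)).
assert (HC0 := hol_decay_C0 _ _ _ Hf). assert (HC1 := hol_decay_C0 _ _ _ Hg).
(* [1/|w - z|] is split as [|w|^(-eta) |z|^(eta-1)] with [- gamma < eta < 1] *)
set (eta := (1 - gamma) / 2).
destruct (kap_of_powers_scaled (- eta) (- p' - eta)) as [e1 [D1 [He1 [HD1 H1]]]];
  [unfold eta; lra|unfold eta; lra|].
destruct (kap_of_powers_scaled (gamma + (eta - 1)) (- p + (gamma + (eta - 1)))) as [e2 [D2 [He2 [HD2 H2]]]];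
  [unfold eta; lra|unfold eta; lra|].
exists ((D1 * C1) * (D2 * (C0 * (K0 * norm x) / k))), e1, e2.
split; [trivial|split; trivial]. intros sg r Hs Hr.
assert (Nx := norm_ge_0 x).
destruct (proj2 (proj2 Hg) sg be Hs ltac:(lra)) as [G1 G2].
destruct (proj2 (proj2 Hf) r a Hr ltac:(lra)) as [F1 F2].
assert (BR := HB r a x Hr (cos_le_th a th ltac:(lra) ltac:(lra))).
assert (Q1 : Cmod (g sg be) * Rpower sg (- eta) <= D1 * C1 * kap e1 sg).
{ apply H1; trivial.
  - intros _. apply Rmult_le_compat_r; trivial. left; apply Rpower_pos.
  - intros _. unfold Rminus. rewrite Rpower_plus, <- Rmult_assoc.
    apply Rmult_le_compat_r; trivial. left; apply Rpower_pos. }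
assert (Q2 : Cmod (f r a) * (K0 * Rpower r gamma * norm x) * Rpower r (eta - 1) / k
  <= D2 * (C0 * (K0 * norm x) / k) * kap e2 r).
{ assert (HW : 0 <= C0 * (K0 * norm x) / k).
  { apply Rdiv_le_0_compat; trivial. apply Rmult_le_pos; trivial. apply Rmult_le_pos; lra. }
  assert (HKn : 0 <= K0 * norm x) by (apply Rmult_le_pos; lra).
  apply H2; trivial.
  - intros _. rewrite Rpower_plus.
    replace (Cmod (f r a) * (K0 * Rpower r gamma * norm x) * Rpower r (eta - 1) / k)
      with (Cmod (f r a) * ((K0 * norm x) * (Rpower r gamma * Rpower r (eta - 1)) / k)) by (field; lra).
    replace (C0 * (K0 * norm x) / k * (Rpower r gamma * Rpower r (eta - 1)))
      with (C0 * ((K0 * norm x) * (Rpower r gamma * Rpower r (eta - 1)) / k)) by (field; lra).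
    apply Rmult_le_compat_r; trivial. apply Rdiv_le_0_compat; trivial.
    apply Rmult_le_pos; trivial. apply Rmult_le_pos; left; apply Rpower_pos.
  - intros _. rewrite !Rpower_plus.
    replace (Cmod (f r a) * (K0 * Rpower r gamma * norm x) * Rpower r (eta - 1) / k)
      with (Cmod (f r a) * ((K0 * norm x) * (Rpower r gamma * Rpower r (eta - 1)) / k)) by (field; lra).
    replace (C0 * (K0 * norm x) / k * (Rpower r (- p) * (Rpower r gamma * Rpower r (eta - 1))))
      with (C0 * Rpower r (- p) * ((K0 * norm x) * (Rpower r gamma * Rpower r (eta - 1)) / k)) by (field; lra).
    apply Rmult_le_compat_r; trivial. apply Rdiv_le_0_compat; trivial.
    apply Rmult_le_pos; trivial. apply Rmult_le_pos; left; apply Rpower_pos. }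
unfold DF. eapply Rle_trans; [apply norm_scal_C|].
assert (V1 : norm (cis a *: (f r a *: Rs (polar r a) x)) <= Cmod (f r a) * (K0 * Rpower r gamma * norm x)).
{ eapply Rle_trans; [apply norm_cis_scal|]. eapply Rle_trans; [apply norm_scal_C|].
  apply Rmult_le_compat_l; trivial. apply Cmod_ge_0. }
assert (V2 : Cmod (cis be * g sg be * / (polar sg be - polar r a)) <=
  Cmod (g sg be) * (Rpower sg (- eta) * Rpower r (eta - 1)) / k).
{ apply Rle_trans with (Cmod (g sg be) / (k * (sg + r))).
  - apply Cmod_div_le; [apply Rmult_lt_0_compat; lra| |now apply Hd].
    rewrite Cmod_mult, Cmod_cis. lra.
  - replace (Cmod (g sg be) / (k * (sg + r))) with (Cmod (g sg be) * / (sg + r) / k) by (field; lra).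
    apply Rmult_le_compat_r; [left; now apply Rinv_0_lt_compat|].
    apply Rmult_le_compat_l; [apply Cmod_ge_0|]. apply inv_sum_le; trivial. unfold eta; lra. }
apply Rle_trans with ((Cmod (g sg be) * (Rpower sg (- eta) * Rpower r (eta - 1)) / k) *
  (Cmod (f r a) * (K0 * Rpower r gamma * norm x))).
- apply Rmult_le_compat; trivial. apply Cmod_ge_0. apply norm_ge_0.
- replace ((Cmod (g sg be) * (Rpower sg (- eta) * Rpower r (eta - 1)) / k) *
  (Cmod (f r a) * (K0 * Rpower r gamma * norm x))) with
  ((Cmod (g sg be) * Rpower sg (- eta)) *
   (Cmod (f r a) * (K0 * Rpower r gamma * norm x) * Rpower r (eta - 1) / k)) by (field; lra).
  apply Rle_trans with ((D1 * C1 * kap e1 sg) * (D2 * (C0 * (K0 * norm x) / k) * kap e2 r)); [|right; ring].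
  apply Rmult_le_compat; trivial.
  + apply Rmult_le_pos; [apply Cmod_ge_0|left; apply Rpower_pos].
  + apply Rdiv_le_0_compat; trivial. apply Rmult_le_pos; [|left; apply Rpower_pos].
    apply Rmult_le_pos; [apply Cmod_ge_0|]. apply Rmult_le_pos; trivial.
    apply Rmult_le_pos; [lra|left; apply Rpower_pos].
Qed.

(** The two orders of integration: in [DI] the variable of [f] is integrated first, in [DJ] that of
    [g]. *)
Let DI (be a : R) : X := @pint (RS X) (fun sg => @pint (RS X) (fun r => DF be a sg r)).
Let DJ (be a : R) : X := @pint (RS X) (fun r => @pint (RS X) (fun sg => DF be a sg r)).

Lemma DI_DJ be a : Rabs be = th' -> Rabs a = th -> DI be a = DJ be a.
Proof.
intros Hb Ha. destruct (DF_bound be a Hb Ha) as [K [e1 [e2 [He1 [He2 HB]]]]].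
apply (fubini_pint (V := RS X) (DF be a) K e1 e2); trivial.
intros; now apply DF_cont.
Qed.

Lemma DI_dom be a : Rabs be = th' -> Rabs a = th -> exists C2 e,
  @dominated (RS X) (fun sg => @pint (RS X) (fun r => DF be a sg r)) C2 e.
Proof.
intros Hb Ha. destruct (DF_bound be a Hb Ha) as [K [e1 [e2 [He1 [He2 HB]]]]].
exists (2 * K), e1. apply (param_dominated (V := RS X) (DF be a) K e1 e2); trivial.
intros; now apply DF_cont.
Qed.

Lemma DJ_dom be a : Rabs be = th' -> Rabs a = th -> exists C2 e,
  @dominated (RS X) (fun r => @pint (RS X) (fun sg => DF be a sg r)) C2 e.
Proof.
intros Hb Ha. destruct (DF_bound be a Hb Ha) as [K [e1 [e2 [He1 [He2 HB]]]]].
exists (2 * K), e2. apply (param_dominated (V := RS X) (fun r sg => DF be a sg r) K e2 e1); trivial.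
- intros; apply cont2_swap; now apply DF_cont.
- intros. rewrite (Rmult_comm (kap e2 _)). now apply HB.
Qed.

Lemma pint_scal {Y : CompleteNormedModule C_AbsRing} (c : C) (h : R -> Y) C2 e :
  @dominated (RS Y) h C2 e ->
  @pint (RS Y) (fun r => c *: h r) = c *: @pint (RS Y) h.
Proof.
intros H. apply (bmap_pint (V := RS Y) (W := RS Y) (fun v => c *: v) (Cmod c)) with (4 := H).
- intros; apply (scal_distr_l (V := Y)).
- intros d v. change (c *: (RtoC d *: v) = RtoC d *: (c *: v)). linC Y.
- apply norm_scal_C.
Qed.

(** [resolvent_Phi] at each point of the outer ray turns the inner operator into a contour integral
    with the kernel [1 / (w - z)]. *)
Lemma ray_product_outer be : Rabs be = th' ->
  ray (fun sg be => g sg be *: Rs (polar sg be) (Phi th f x)) be =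
  (/ (2 * PI * Ci))%C *: minus (DI be (- th)) (DI be th).
Proof.
intros Hb. destruct (abs_th th ltac:(lra)) as [T1 T2].
destruct (DI_dom be th Hb T1) as [K1 [e1 Q1]].
destruct (DI_dom be (- th) Hb T2) as [K2 [e2 Q2]].
assert (Q3 : exists K3 e3, rdom (fun sg be => g sg be *: Rs (polar sg be) (Phi th f x)) be K3 e3).
{ destruct (hol_decay_dominated p' th' (proj1 (proj2 Hg)) ltac:(lra)) as [e [K [He [HK H]]]].
  exists (K * C1 * norm (Phi th f x)), e. apply H; trivial. lra. }
destruct Q3 as [K3 [e3 Q3]].
unfold DI.
assert (E : forall sg, 0 < sg -> cis be *: (g sg be *: Rs (polar sg be) (Phi th f x)) =
  (/ (2 * PI * Ci))%C *: minus (@pint (RS X) (fun r => DF be (- th) sg r))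
   (@pint (RS X) (fun r => DF be th sg r))).
{ intros sg Hs. rewrite (resolvent_Phi f C0 p th be sg x) by (trivial; lra).
  assert (EE : forall a, Rabs a = th -> @pint (RS X) (fun r => DF be a sg r) =
    (cis be * g sg be)%C *: ray (fun r a => (f r a * / (polar sg be - polar r a))%C *: Rs (polar r a) x) a).
  { intros a Ha. destruct (outer_rdom f C0 p th be sg a x Hf ltac:(lra) ltac:(lra) Hs Ha) as [K4 [e4 Q5]].
    unfold ray. rewrite <- (pint_scal _ _ _ _ Q5). f_equal.
    apply functional_extensionality. intros r. unfold DF.
    generalize (Rs (polar r a) x). intros. linC X. }
  rewrite (EE _ T1), (EE _ T2). unfold Phi, cint.
  generalize (ray (fun r a => (f r a * / (polar sg be - polar r a))%C *: Rs (polar r a) x) (- th)).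
  generalize (ray (fun r a => (f r a * / (polar sg be - polar r a))%C *: Rs (polar r a) x) th).
  intros. linC X. }
transitivity (@pint (RS X) (fun sg => (/ (2 * PI * Ci))%C *: minus (@pint (RS X) (fun r => DF be (- th) sg r))
   (@pint (RS X) (fun r => DF be th sg r)))).
- apply (pint_ext (V := RS X) _ _ _ _ Q3 E).
- (* the difference need not share a single [kap], so split it first *)
  transitivity (@pint (RS X) (fun sg => minus ((/ (2 * PI * Ci))%C *: (@pint (RS X) (fun r => DF be (- th) sg r)))
   ((/ (2 * PI * Ci))%C *: (@pint (RS X) (fun r => DF be th sg r))))).
  + f_equal. apply functional_extensionality. intros sg.
    generalize (@pint (RS X) (fun r => DF be (- th) sg r)) (@pint (RS X) (fun r => DF be th sg r)).
    intros. linC X.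
  + assert (DS : forall h K e, @dominated (RS X) h K e ->
      @dominated (RS X) (fun r => (/ (2 * PI * Ci))%C *: h r) (Cmod (/ (2 * PI * Ci)) * K) e).
    { intros h K e H. apply (bmap_dominated (V := RS X) (W := RS X) (fun v => (/ (2 * PI * Ci))%C *: v)); trivial.
      - intros; apply (scal_distr_l (V := X)).
      - intros d v. change ((/ (2 * PI * Ci))%C *: (RtoC d *: v) = RtoC d *: ((/ (2 * PI * Ci))%C *: v)). linC X.
      - apply norm_scal_C.
      - apply Cmod_ge_0. }
    refine (eq_trans (pint_minus (V := RS X) _ _ _ _ _ _ (DS _ _ _ Q2) (DS _ _ _ Q1)) _).
    refine (eq_trans (f_equal2 minus (pint_scal _ _ _ _ Q2) (pint_scal _ _ _ _ Q1)) _).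
    match goal with |- minus (_ *: ?u) (_ *: ?v) = _ => generalize u v end.
    intros u v. change (minus ((/ (2 * PI * Ci))%C *: u) ((/ (2 * PI * Ci))%C *: v) = (/ (2 * PI * Ci))%C *: (minus u v)).
    linC X.
Qed.

(** In this order the inner integral is scalar: [g(w) / (w - z)] over the contour at [th'], with [z]
    inside it, where Cauchy's formula gives [2 i pi g(z)]. *)
Lemma DJ_diff a : Rabs a = th ->
  minus (DJ (- th') a) (DJ th' a) =
  (2 * PI * Ci)%C *: ray (fun r a => (f r a * g r a)%C *: Rs (polar r a) x) a.
Proof.
intros Ha. destruct (abs_th th' ltac:(lra)) as [T1 T2].
destruct (DJ_dom th' a T1 Ha) as [K1 [e1 Q1]].
destruct (DJ_dom (- th') a T2 Ha) as [K2 [e2 Q2]].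
refine (eq_trans (eq_sym (pint_minus (V := RS X) _ _ _ _ _ _ Q2 Q1)) _).
assert (HC0 := hol_decay_C0 _ _ _ Hf). assert (HC1 := hol_decay_C0 _ _ _ Hg).
assert (Q3 : exists K3 e3, rdom (fun r a => (f r a * g r a)%C *: Rs (polar r a) x) a K3 e3).
{ destruct (resolvent_decay_dominated p th (proj1 (proj2 Hf)) ltac:(lra)) as [e [K [He [HK H]]]].
  exists (K * (C0 * C1) * norm x), e. apply H; [now apply Rmult_le_pos|lra| |].
  - intros r Hr. apply continuous_C_mult; [apply (hol_decay_cont f C0 p)|apply (hol_decay_cont g C1 p')]; trivial; lra.
  - intros r Hr. destruct (proj2 (proj2 Hf) r a Hr ltac:(lra)) as [F1 F2].
    destruct (proj2 (proj2 Hg) r a Hr ltac:(lra)) as [G1 G2]. rewrite Cmod_mult.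
    split.
    + apply Rmult_le_compat; trivial; apply Cmod_ge_0.
    + replace (C0 * C1 * Rpower r (- p)) with (C0 * Rpower r (- p) * C1) by ring.
      apply Rmult_le_compat; trivial; apply Cmod_ge_0. }
destruct Q3 as [K3 [e3 Q3]].
unfold ray. rewrite <- (pint_scal _ _ _ _ Q3).
symmetry.
assert (Q4 : @dominated (RS X) (fun r => (2 * PI * Ci)%C *: (cis a *: ((f r a * g r a)%C *: Rs (polar r a) x))) (Cmod (2 * PI * Ci) * K3) e3).
{ apply (bmap_dominated (V := RS X) (W := RS X) (fun v => (2 * PI * Ci)%C *: v)); trivial.
  - intros; apply (scal_distr_l (V := X)).
  - intros d v. change ((2 * PI * Ci)%C *: (RtoC d *: v) = RtoC d *: ((2 * PI * Ci)%C *: v)). linC X.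
  - apply norm_scal_C.
  - apply Cmod_ge_0. }
apply (pint_ext (V := RS X) _ _ _ _ Q4).
intros r Hr.
(* For fixed [r] the vector factor of [DF] is constant in [sg] and comes out of the inner
   integral. *)
assert (IN : forall be, Rabs be = th' -> @pint (RS X) (fun sg => DF be a sg r) =
  ray (X := CC) (fun sg be => g sg be * / (polar sg be - polar r a))%C be *: (cis a *: (f r a *: Rs (polar r a) x))).
{ intros be Hb. destruct (DF_dist be a Hb Ha) as [k [Hk Hd]].
  destruct (quot_bound p' r ltac:(assert (Z := proj1 (proj2 Hg)); lra) Hr) as [e [D1 [He [HD1 QB]]]].
  assert (DD : rdom (X := CC) (fun sg be => g sg be * / (polar sg be - polar r a))%C be (D1 * (C1 / k * (1 + / r))) e).
  { split; trivial. intros sg Hs. split.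
    - apply (continuous_C_mult (fun _ => cis be)); [apply continuous_const|].
      apply continuous_C_mult; [apply (hol_decay_cont g C1 p'); trivial; lra|].
      apply continuous_C_inv; [|now apply DF_neq].
      apply (continuous_minus (V := CC)); [|apply continuous_const].
      apply continuous_C_mult; [apply continuous_RtoC, continuous_id|apply continuous_const].
    - eapply Rle_trans; [apply (norm_cis_scal (X := CC))|].
      destruct (proj2 (proj2 Hg) sg be Hs ltac:(lra)) as [G1 G2].
      apply QB; trivial. now apply Hd. }
  set (v := cis a *: (f r a *: Rs (polar r a) x)).
  unfold ray. refine (eq_trans _ (bmap_pint (V := RS CC) (W := RS X) (fun c => c *: v) (norm v) _ _ _ _ _ _ DD)).
  - unfold DF. fold v. f_equal. apply functional_extensionality. intros sg. f_equal.
    change ((cis be * g sg be * / (polar sg be - polar r a)) = cis be * (g sg be * / (polar sg be - polar r a)))%C. ring.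
  - intros c d. apply (scal_distr_r (V := X)).
  - intros c d. change ((RtoC c * d)%C *: v = RtoC c *: (d *: v)). linC X.
  - intros c. rewrite Rmult_comm. apply norm_scal_C. }
rewrite (IN _ T1), (IN _ T2).
assert (CF := cauchy_formula g hi th' C1 p' r a (proj1 Hg) ltac:(lra) ltac:(lra)
  ltac:(assert (Z := proj1 (proj2 Hg)); lra)
  ltac:(intros; apply (proj2 (proj2 Hg)); trivial; lra) Hr ltac:(lra)).
revert CF.
generalize (ray (X := CC) (fun sg be => g sg be * / (polar sg be - polar r a))%C (- th')).
generalize (ray (X := CC) (fun sg be => g sg be * / (polar sg be - polar r a))%C th').
intros u1 u2 CF. change C in u1, u2.
assert (EE : (2 * PI * Ci)%C *: (cis a *: ((f r a * g r a)%C *: Rs (polar r a) x)) =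
  (2 * PI * Ci * g r a)%C *: (cis a *: (f r a *: Rs (polar r a) x))).
{ generalize (Rs (polar r a) x). intros. linC X. }
rewrite EE, <- CF.
generalize (cis a *: (f r a *: Rs (polar r a) x)). intros v. linC X.
Qed.

Lemma Phi_mult_angles :
  Phi th' g (Phi th f x) = Phi th (fun r a => f r a * g r a)%C x.
Proof.
destruct (abs_th th' ltac:(lra)) as [T1 T2]. destruct (abs_th th ltac:(lra)) as [T3 T4].
unfold Phi at 1. unfold cint. rewrite (ray_product_outer _ T1), (ray_product_outer _ T2).
rewrite (DI_DJ _ _ T1 T3), (DI_DJ _ _ T1 T4), (DI_DJ _ _ T2 T3), (DI_DJ _ _ T2 T4).
transitivity ((/ (2 * PI * Ci))%C *: ((/ (2 * PI * Ci))%C *: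
  minus (minus (DJ (- th') (- th)) (DJ th' (- th))) (minus (DJ (- th') th) (DJ th' th)))).
- generalize (DJ (- th') (- th)) (DJ th' (- th)) (DJ (- th') th) (DJ th' th). intros. linC X.
- rewrite (DJ_diff _ T3), (DJ_diff _ T4). unfold Phi, cint.
  match goal with |- context [minus (_ *: ?u) (_ *: ?v)] => generalize u v end.
  intros. assert (N := c2piI_neq_0). linC X; field; repeat split;
  try (intros Z; apply N; rewrite Z; ring).
Qed.

End Product.

(** The two contours have to be disjoint for the kernel [1 / (w - z)], so that of [g] is first
    turned outwards, halfway to [hi]. *)
Lemma Phi_mult f g C0 p C1 p' th x : hol_decay f C0 p -> hol_decay g C1 p' -> omega < th < hi ->
  Phi th g (Phi th f x) = Phi th (fun r a => f r a * g r a)%C x.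
Proof.
intros Hf Hg Hth. rewrite (Phi_rotate g C1 p' th ((th + hi) / 2)) by (trivial; lra).
apply (Phi_mult_angles f g C0 p C1 p'); trivial; lra.
Qed.

(** * Rational functions of [A] *)

Lemma polar_1_PI : polar 1 PI = RtoC (-1).
Proof. unfold polar, cis. rewrite cos_PI, sin_PI. apply injective_projections; simpl; ring. Qed.

Lemma polar_opp_PI r : polar r (- PI) = polar r PI.
Proof. unfold polar, cis. rewrite cos_neg, sin_neg, sin_PI, Ropp_0. reflexivity. Qed.

Lemma cis_opp_PI : cis (- PI) = cis PI.
Proof. unfold cis. rewrite cos_neg, sin_neg, sin_PI, Ropp_0. reflexivity. Qed.

Lemma Re_polar_ge0 r a : 0 < r -> Rabs a < hi -> 0 < Re (polar r a).
Proof.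
intros Hr Ha. rewrite Re_polar. apply Rmult_lt_0_compat; trivial.
apply Rabs_lt_between in Ha. apply cos_gt_0; lra.
Qed.

Lemma one_plus_ge r a : 0 < r -> Rabs a < hi ->
  1 <= Cmod (1 + polar r a) /\ r <= Cmod (1 + polar r a).
Proof.
intros Hr Ha. assert (H := Re_polar_ge0 r a Hr Ha).
assert (E : Cmod (1 + polar r a) ^ 2 = 1 + 2 * Re (polar r a) + r ^ 2).
{ assert (E0 := Cmod_sqr (polar r a)). rewrite Cmod_polar in E0 by lra.
  rewrite E0, Cmod_sqr. generalize (polar r a). intros [u w]. simpl. ring. }
split; apply le_of_sqr; try apply Cmod_ge_0; rewrite E; nra.
Qed.

Lemma one_plus_neq_0 r a : 0 < r -> Rabs a < hi -> (1 + polar r a)%C <> RtoC 0.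
Proof. intros Hr Ha. apply Cmod_gt_0. destruct (one_plus_ge r a Hr Ha). lra. Qed.

Definition v0 (r a : R) : C := (/ (1 + polar r a))%C.
Definition u0 (r a : R) : C := (polar r a * v0 r a)%C.

Lemma v0_bound r a : 0 < r -> Rabs a < hi -> Cmod (v0 r a) <= 1 /\ Cmod (v0 r a) <= / r.
Proof.
intros Hr Ha. destruct (one_plus_ge r a Hr Ha) as [H1 H2].
unfold v0. rewrite Cmod_inv by now apply one_plus_neq_0.
split; [apply Rle_trans with (/ 1); [|rewrite Rinv_1; lra]|]; apply Rinv_le_contravar; lra.
Qed.

Lemma u0_bound r a : 0 < r -> Rabs a < hi -> Cmod (u0 r a) <= 1.
Proof.
intros Hr Ha. destruct (v0_bound r a Hr Ha) as [_ H].
unfold u0. rewrite Cmod_mult, Cmod_polar by lra.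
apply Rmult_le_compat_l with (r := r) in H; [|lra]. rewrite Rinv_r in H; lra.
Qed.

Lemma polhol_v0 : polholC (- hi) hi v0.
Proof.
apply polholC_inv; [apply polholC_plus; [apply polholC_const|apply polholC_id]|].
intros r a Hr Ha. apply one_plus_neq_0; trivial. now apply Rabs_lt_between.
Qed.

Lemma polhol_u0 : polholC (- hi) hi u0.
Proof. apply polholC_mult; [apply polholC_id|apply polhol_v0]. Qed.

Lemma hol_decay_intro f C0 p : polholC (- hi) hi f -> 1 + gamma < p -> 0 <= C0 ->
  (forall r a, 0 < r <= 1 -> Rabs a < hi -> Cmod (f r a) <= C0) ->
  (forall r a, 1 <= r -> Rabs a < hi -> Cmod (f r a) <= C0 * Rpower r (- p)) ->
  hol_decay f C0 p.
Proof.
intros H1 H2 HC H3 H4. split; [trivial|split; trivial]. intros r a Hr Ha.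
destruct (Rle_dec r 1) as [L|L].
- assert (B := H3 r a ltac:(lra) Ha). split; trivial. apply Rle_trans with (1 := B).
  rewrite <- (Rmult_1_r C0) at 1. apply Rmult_le_compat_l; trivial.
  rewrite <- (Rpower_O r Hr). apply Rpower_ge_exp; lra.
- assert (B := H4 r a ltac:(lra) Ha). split; trivial. apply Rle_trans with (1 := B).
  rewrite <- (Rmult_1_r C0) at 2. apply Rmult_le_compat_l; trivial.
  rewrite <- (Rpower_O r Hr). apply Rpower_le_exp; lra.
Qed.

Lemma hol_decay_mult_bdd f C0 p u M : hol_decay f C0 p -> polholC (- hi) hi u ->
  (forall r a, 0 < r -> Rabs a < hi -> Cmod (u r a) <= M) ->
  hol_decay (fun r a => f r a * u r a)%C (C0 * M) p.
Proof.
intros Hf Hu HM. assert (HC := hol_decay_C0 _ _ _ Hf). destruct Hf as [H1 [H2 H3]].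
split; [now apply polholC_mult|split; trivial]. intros r a Hr Ha.
destruct (H3 r a Hr Ha) as [F1 F2]. specialize (HM r a Hr Ha). rewrite Cmod_mult. split.
- apply Rmult_le_compat; trivial; apply Cmod_ge_0.
- replace (C0 * M * Rpower r (- p)) with (C0 * Rpower r (- p) * M) by ring.
  apply Rmult_le_compat; trivial; apply Cmod_ge_0.
Qed.

Lemma hol_decay_ext f g C0 p : (forall r a, 0 < r -> Rabs a < hi -> f r a = g r a) ->
  hol_decay f C0 p -> hol_decay g C0 p.
Proof.
intros E [H1 [H2 H3]]. split; [|split; trivial].
- apply (polhol_ext (X := CC)) with f; trivial. intros r a Hr Ha. apply E; trivial.
  now apply Rabs_lt_between.
- intros r a Hr Ha. rewrite <- E by trivial. now apply H3.
Qed.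

Lemma hol_decay_cscal c f C0 p : hol_decay f C0 p -> hol_decay (fun r a => c * f r a)%C (C0 * Cmod c) p.
Proof.
intros Hf. apply (hol_decay_ext (fun r a => f r a * c)%C).
- intros; ring.
- apply hol_decay_mult_bdd; trivial; [apply polholC_const|]. intros; lra.
Qed.

(** [z^i / (1 + z)^(i + j)] *)
Definition pf (i j : nat) (r a : R) : C := (u0 r a ^ i * v0 r a ^ j)%C.

Lemma pf_bound i j r a : 0 < r -> Rabs a < hi ->
  Cmod (pf i j r a) <= 1 /\ Cmod (pf i j r a) <= Rpower r (- INR j).
Proof.
intros Hr Ha. destruct (v0_bound r a Hr Ha) as [V1 V2]. assert (U := u0_bound r a Hr Ha).
unfold pf. rewrite Cmod_mult, !Cmod_pow.
assert (U' : 0 <= Cmod (u0 r a) ^ i <= 1).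
{ split; [apply pow_le, Cmod_ge_0|]. rewrite <- (pow1 i). apply pow_incr. split; trivial. apply Cmod_ge_0. }
assert (V' : 0 <= Cmod (v0 r a) ^ j <= 1).
{ split; [apply pow_le, Cmod_ge_0|]. rewrite <- (pow1 j). apply pow_incr. split; trivial. apply Cmod_ge_0. }
assert (W : Cmod (v0 r a) ^ j <= Rpower r (- INR j)).
{ rewrite Rpower_Ropp, Rpower_pow, <- pow_inv by trivial.
  apply pow_incr. split; trivial. apply Cmod_ge_0. }
split.
- rewrite <- (Rmult_1_l 1). now apply Rmult_le_compat.
- rewrite <- (Rmult_1_l (Rpower r _)). apply Rmult_le_compat; trivial; lra.
Qed.

Lemma polhol_pf i j : polholC (- hi) hi (pf i j).
Proof. apply polholC_mult; apply polholC_pow; [apply polhol_u0|apply polhol_v0]. Qed.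

Lemma hol_decay_pf i j : (1 <= j)%nat -> hol_decay (pf i j) 1 (INR j).
Proof.
intros Hj. apply hol_decay_intro; try lra.
- apply polhol_pf.
- apply le_INR in Hj. simpl in Hj. lra.
- intros r a Hr Ha. now apply pf_bound.
- intros r a Hr Ha. rewrite Rmult_1_l. apply pf_bound; lra || trivial.
Qed.

Notation inv1A := (inv_one_plus A).

Lemma reg_m1 : reg (RtoC (-1)).
Proof. rewrite <- polar_1_PI. apply (reg_th 1 PI hi); try lra. assert (P := PI_RGT_0).
rewrite Rabs_pos_eq; lra. Qed.

Lemma inv1A_Phi f C0 p th x : hol_decay f C0 p -> omega < th < hi ->
  inv1A (Phi th f x) = Phi th (fun r a => f r a * v0 r a)%C x.
Proof.
intros Hf Hth. assert (P := PI_RGT_0). unfold inv_one_plus. rewrite <- polar_1_PI.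
change (opp (Rs (polar 1 PI) (Phi th f x)) = Phi th (fun r a => f r a * v0 r a)%C x).
rewrite (resolvent_Phi f C0 p th PI 1 x) by (trivial; try lra; rewrite Rabs_pos_eq; lra).
assert (H1 : hol_decay (fun r a => f r a * v0 r a)%C (C0 * 1) p).
{ apply hol_decay_mult_bdd; trivial; [apply polhol_v0|]. intros; now apply v0_bound. }
assert (H2 := hol_decay_cscal (-(1))%C _ _ _ H1).
rewrite <- (Phi_ext (fun r a => -(1) * (f r a * v0 r a))%C _ _ p th x H2 Hth).
- rewrite (Phi_fscal _ _ _ _ _ _ H1 Hth).
  generalize (Phi th (fun r a => f r a * v0 r a)%C x). intros. linC X.
- intros r a Hr Ha. rewrite polar_1_PI. unfold v0. field.
  assert (N := one_plus_neq_0 r a Hr Ha). repeat split; trivial.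
  intros E. apply N. replace (1 + polar r a)%C with (- (RtoC (-1) - polar r a))%C.
  + rewrite E. ring.
  + apply injective_projections; simpl; ring.
Qed.

(** The contour is opened until both rays lie on the negative half-line, where they cancel. On the
    way is the pole [-1] of [1 / (1 + z)]; adding a multiple of [hker 1] by [v = R(-1) x] removes it
    and leaves the function [G], regular outside the sector. Since [hker 1] has contour integral 1,
    the vanishing of the integral of [G] reads [Phi th v0 x + v = 0]. *)
Lemma Phi_v0 th x : omega < th < hi -> Phi th v0 x = inv1A x.
Proof.
intros Hth. assert (P := PI_RGT_0). assert (P3 := PI2_3_2).
set (v := Rs (RtoC (-1)) x).
assert (Hm1 := reg_m1).
destruct (abs_th th Hth) as [T1 T2].
(* [G = - R(z) R(-1) x + R(-1) x / (z - 1) = R(z) x / (1 + z) + 2 R(-1) x / (z^2 - 1)] *)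
set (G := fun r a => plus (opp (Rs (polar r a) v)) ((/ (polar r a - 1))%C *: v)).
assert (E10 : polar 1 0 = RtoC 1) by (unfold polar; rewrite cis_0; ring).
assert (HG : forall r a, 0 < r -> th <= Rabs a <= PI -> (1 + polar r a)%C <> RtoC 0 ->
  (polar r a - 1)%C <> RtoC 0 ->
  G r a = plus (v0 r a *: Rs (polar r a) x) (hker 1 (polar r a) *: v)).
{ intros r a Hr Ha N1 N2. unfold G, v.
  assert (Hz : reg (polar r a)) by (apply (reg_th r a th); lra).
  assert (I := resolvent_identity (polar r a) (RtoC (-1)) x Hz Hm1).
  assert (E : opp (Rs (polar r a) (Rs (RtoC (-1)) x)) =
     v0 r a *: minus (Rs (polar r a) x) (Rs (RtoC (-1)) x)).
  { rewrite I. unfold v0. generalize (Rs (polar r a) (Rs (RtoC (-1)) x)). intros. linC X.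
    replace (RtoC (-1)) with (-(1))%C by (apply injective_projections; simpl; ring).
    field; trivial. }
  rewrite E. unfold v0, hker.
  assert (N3 : (polar r a + 1)%C <> RtoC 0) by (intros Z; apply N1; rewrite <- Z; ring).
  generalize (Rs (polar r a) x) (Rs (RtoC (-1)) x). intros. linC X. field. repeat split; trivial. }
assert (D1 : forall r a, 0 < r -> Rabs (r - 1) <= Cmod (1 + polar r a)).
{ intros r a Hr. replace (1 + polar r a)%C with (polar r a - polar 1 PI)%C.
  - apply polar_dist_ge_r; lra.
  - rewrite polar_1_PI. apply injective_projections; simpl; ring. }
set (k := sin (th / 2)).
assert (Hk : 0 < k) by (apply sin_gt_0; lra).
assert (D2 : forall r a, 0 < r -> th <= Rabs a <= PI -> k * (r + 1) <= Cmod (polar r a - 1)).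
{ intros r a Hr Ha. rewrite <- E10. apply Rle_trans with (2 := polar_dist_ge r a 1 0 Hr Rlt_0_1).
  apply Rmult_le_compat_r; [lra|]. rewrite Rminus_0_r. apply abs_sin_half_ge; lra. }
assert (NZ : forall r a, 0 < r -> th <= Rabs a <= PI -> (polar r a - 1)%C <> RtoC 0).
{ intros r a Hr Ha. apply Cmod_gt_0. apply Rlt_le_trans with (2 := D2 r a Hr Ha).
  apply Rmult_lt_0_compat; lra. }
destruct (resolvent_bound_polar th ltac:(lra)) as [K [HK HB]].
destruct (kap_of_powers_scaled gamma (gamma - 1) ltac:(lra) ltac:(lra)) as [e [C1 [He [HC1 KP]]]].
assert (Nx := norm_ge_0 x). assert (Nv := norm_ge_0 v).
set (Q := (4 * (K * norm v) + 4 * / k * norm v) + (2 * K * norm x + 4 * / k * norm v)).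
assert (Hk' : 0 < / k) by now apply Rinv_0_lt_compat.
assert (HQ1 : 0 <= K * norm v) by (apply Rmult_le_pos; lra).
assert (HQ2 : 0 <= / k * norm v) by (apply Rmult_le_pos; lra).
assert (HQ3 : 0 <= K * norm x) by (apply Rmult_le_pos; lra).
assert (BG : forall r a, 0 < r -> th <= Rabs a <= PI -> norm (G r a) <= C1 * Q * kap e r).
{ intros r a Hr Ha. assert (Ca := cos_le_th a th ltac:(lra) Ha).
  assert (BI : Cmod (/ (polar r a - 1)) <= / k / (r + 1)).
  { rewrite Cmod_inv by now apply NZ. replace (/ k / (r + 1)) with (/ (k * (r + 1))) by (field; lra).
    apply Rinv_le_contravar; [apply Rmult_lt_0_compat; lra|now apply D2]. }
  assert (BI2 : / k / (r + 1) <= / k).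
  { apply Rle_trans with (/ k * 1); [|lra]. apply Rmult_le_compat_l; [lra|].
    rewrite <- Rinv_1. apply Rinv_le_contravar; lra. }
  assert (B1 : norm (G r a) <= K * Rpower r gamma * norm v + / k * norm v).
  { unfold G. eapply Rle_trans; [apply xnorm_triangle|]. apply Rplus_le_compat.
    - apply Rle_trans with (norm (Rs (polar r a) v)).
      + right. apply (norm_opp (V := X)).
      + now apply HB.
    - eapply Rle_trans; [apply norm_scal_C|]. apply Rmult_le_compat_r; lra. }
  apply KP; trivial.
  - unfold Q; lra.
  - intros L. apply Rle_trans with (1 := B1).
    assert (1 <= Rpower r gamma) by (rewrite <- (Rpower_O r Hr); apply Rpower_ge_exp; lra).
    assert (0 <= (/ k * norm v) * (Rpower r gamma - 1)) by (apply Rmult_le_pos; lra).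
    assert (0 <= (K * norm v) * Rpower r gamma) by (apply Rmult_le_pos; lra).
    assert (0 <= (/ k * norm v) * Rpower r gamma) by (apply Rmult_le_pos; lra).
    assert (0 <= (K * norm x) * Rpower r gamma) by (apply Rmult_le_pos; lra).
    unfold Q. lra.
  - intros L. assert (Pg := Rpower_pos r (gamma - 1)).
    assert (Eg : Rpower r gamma = r * Rpower r (gamma - 1)).
    { rewrite <- (Rpower_1 r) at 2 by trivial. rewrite <- Rpower_plus. f_equal; ring. }
    assert (Rg : / r ^ 2 <= Rpower r (gamma - 1)).
    { replace (/ r ^ 2) with (Rpower r (- INR 2)) by (rewrite Rpower_Ropp, Rpower_pow; trivial).
      apply Rpower_le_exp; simpl; lra. }
    (* Up to radius 2, where [1 + z] may vanish, the defining form of [G] is used; beyond it the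
       second form is, because only there is the decay [r^(gamma - 1)] visible term by term. *)
    destruct (Rle_dec r 2) as [L2|L2].
    + apply Rle_trans with (1 := B1). rewrite Eg.
      assert (1 <= 4 * Rpower r (gamma - 1)).
      { apply Rle_trans with (4 * / r ^ 2); [|lra].
        apply Rmult_le_reg_r with (r ^ 2); [simpl; nra|]. rewrite Rmult_assoc, Rinv_l by (simpl; nra).
        simpl; nra. }
      assert (0 <= (/ k * norm v) * (4 * Rpower r (gamma - 1) - 1)) by (apply Rmult_le_pos; lra).
      assert (0 <= (K * norm v) * Rpower r (gamma - 1)) by (apply Rmult_le_pos; lra).
      assert (0 <= (/ k * norm v) * Rpower r (gamma - 1)) by (apply Rmult_le_pos; lra).
      assert (0 <= (K * norm x) * Rpower r (gamma - 1)) by (apply Rmult_le_pos; lra).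
      assert (0 <= (2 - r) * ((K * norm v) * Rpower r (gamma - 1))) by (apply Rmult_le_pos; lra).
      unfold Q. lra.
    + assert (H1r : r / 2 <= Cmod (1 + polar r a)).
      { apply Rle_trans with (2 := D1 r a Hr). rewrite Rabs_pos_eq; lra. }
      assert (N1 : (1 + polar r a)%C <> RtoC 0) by (apply Cmod_gt_0; lra).
      apply (xnorm_eq_le _ _ _ (HG r a Hr Ha N1 (NZ r a Hr Ha))).
      eapply Rle_trans; [apply xnorm_triangle|].
      assert (V0 : Cmod (v0 r a) <= 2 / r).
      { unfold v0. rewrite Cmod_inv by trivial. replace (2 / r) with (/ (r / 2)) by (field; lra).
        apply Rinv_le_contravar; lra. }
      assert (A1 : norm (v0 r a *: Rs (polar r a) x) <= 2 * (K * norm x) * Rpower r (gamma - 1)).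
      { eapply Rle_trans; [apply norm_scal_C|].
        apply Rle_trans with (2 / r * (K * Rpower r gamma * norm x)).
        - apply Rmult_le_compat; trivial; try apply Cmod_ge_0; try apply norm_ge_0. now apply HB.
        - rewrite Eg. right. field; lra. }
      assert (A2 : norm (hker 1 (polar r a) *: v) <= 4 * (/ k * norm v) * Rpower r (gamma - 1)).
      { eapply Rle_trans; [apply norm_scal_C|]. unfold hker.
        replace (polar r a + 1)%C with (1 + polar r a)%C by ring.
        fold (v0 r a). rewrite !Cmod_mult, !Cmod_R, Rabs_R1.
        rewrite (Rabs_pos_eq 2) by lra.
        apply Rle_trans with (2 * 1 * (2 / r * (/ k / (r + 1))) * norm v).
        - apply Rmult_le_compat_r; trivial. apply Rmult_le_compat_l; [lra|].
          apply Rmult_le_compat; trivial; apply Cmod_ge_0.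
        - apply Rle_trans with (4 * (/ k * norm v) * / r ^ 2).
          + replace (2 * 1 * (2 / r * (/ k / (r + 1))) * norm v) with
              (4 * (/ k * norm v) * (/ r * / (r + 1))) by (field; lra).
            apply Rmult_le_compat_l; [lra|]. rewrite <- Rinv_mult. apply Rinv_le_contravar; simpl; nra.
          + apply Rmult_le_compat_l; lra. }
      assert (0 <= (K * norm v) * Rpower r (gamma - 1)) by (apply Rmult_le_pos; lra).
      assert (0 <= (/ k * norm v) * Rpower r (gamma - 1)) by (apply Rmult_le_pos; lra).
      unfold Q. lra. }
assert (PH1 : polhol omega (2 * PI - omega) G).
{ apply polhol_plus.
  - apply (polhol_ext omega (2 * PI - omega) (fun r a => (fun _ _ => RtoC (-1)) r a *: Rs (polar r a) v)).
    + intros. linC X.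
    + apply (polhol_mul omega _ (fun _ _ => RtoC (-1))); [apply polholC_const|apply resolvent_polhol_up].
  - apply (polhol_mul omega _ (fun r a => / (polar r a - 1))%C); [|apply polhol_const].
    apply polholC_inv; [apply polholC_minus; [apply polholC_id|apply polholC_const]|].
    intros r a Hr Ha. rewrite <- E10. apply polar_neq; try lra. right.
    apply sin_half_neq_0; lra. }
assert (PH2 : polhol (- (2 * PI - omega)) (- omega) G).
{ apply polhol_plus.
  - apply (polhol_ext (- (2 * PI - omega)) (- omega) (fun r a => (fun _ _ => RtoC (-1)) r a *: Rs (polar r a) v)).
    + intros. linC X.
    + apply (polhol_mul _ (- omega) (fun _ _ => RtoC (-1))); [apply polholC_const|apply resolvent_polhol_down].
  - apply (polhol_mul _ (- omega) (fun r a => / (polar r a - 1))%C); [|apply polhol_const].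
    apply polholC_inv; [apply polholC_minus; [apply polholC_id|apply polholC_const]|].
    intros r a Hr Ha. rewrite <- E10. apply polar_neq; try lra. right.
    apply sin_half_neq_0; lra. }
assert (Z : cint G th = zero).
(* At the angle [PI] the two rays are the same half-line, and their integrals cancel. *)
{ rewrite (cint_rotate omega (2 * PI - omega) G th PI (C1 * Q) e); lra || trivial.
  unfold cint. assert (E : ray G (- PI) = ray G PI).
  { unfold ray. f_equal. apply functional_extensionality. intros r. unfold G.
    now rewrite polar_opp_PI, cis_opp_PI. }
  rewrite E. generalize (ray G PI). intros. linC X. }
assert (HV := hol_decay_pf 0 1 (le_n _)).
assert (HV' : hol_decay v0 1 (INR 1)).
{ apply (hol_decay_ext (pf 0 1)); trivial. intros. unfold pf. simpl. ring. }
destruct (hol_decay_rdom v0 _ _ th x HV' Hth) as [C2 [e2 [R1 R2]]].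
assert (RG : forall a, Rabs a = th -> rdom G a (C1 * Q) e).
{ intros a Ha. destruct (Rle_dec 0 a) as [L|L].
  - rewrite Rabs_pos_eq in Ha by lra. subst a.
    apply (rdom_intro omega (2 * PI - omega)); lra || trivial.
    intros r Hr. apply BG; lra.
  - rewrite Rabs_left1 in Ha by lra.
    apply (rdom_intro (- (2 * PI - omega)) (- omega)); lra || trivial.
    intros r Hr. apply BG; trivial. rewrite Rabs_left1; lra. }
assert (RH : forall a, Rabs a = th -> exists C3 e3, rdom (X := CC) (fun r a => hker 1 (polar r a)) a C3 e3).
{ intros a Ha. assert (Hah : Rabs a < hi) by lra.
  destruct (quot_bound 1 1 Rlt_0_1 Rlt_0_1) as [e3 [D3 [He3 [HD3 QB]]]].
  exists (D3 * (2 / k * (1 + / 1))), e3.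
  apply (rdom_ext (X := CC) (fun r a => (2 * v0 r a) * / (polar r a - polar 1 0))%C).
  2 : { intros r Hr. unfold hker, v0. rewrite E10.
        replace (polar r a + 1)%C with (1 + polar r a)%C by ring. cring. }
  split; trivial. intros r Hr. destruct (v0_bound r a Hr Hah) as [V1 V2]. split.
  - apply (continuous_C_mult (fun _ => cis a)); [apply continuous_const|].
    apply continuous_C_mult.
    + apply (continuous_C_mult (fun _ => RtoC 2)); [apply continuous_const|].
      apply (polhol_cont (X := CC) (- hi) hi); [apply polhol_v0|trivial|now apply Rabs_lt_between].
    + apply continuous_C_inv.
      * apply (continuous_minus (V := CC)); [|apply continuous_const].
        apply continuous_C_mult; [apply continuous_RtoC, continuous_id|apply continuous_const].
      * rewrite E10. apply NZ; trivial. lra.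
  - eapply Rle_trans; [apply (norm_cis_scal (X := CC))|]. apply QB; trivial; try lra.
    + rewrite Cmod_mult, Cmod_R, Rabs_pos_eq; lra.
    + rewrite Cmod_mult, Cmod_R, Rabs_pos_eq, Rpower_Ropp, Rpower_1; lra.
    + rewrite E10. apply D2; lra. }
destruct (RH th T1) as [C3 [e3 R3]]. destruct (RH (- th) T2) as [C4 [e4 R4]].
assert (EG : cint G th = plus (Phi th v0 x) (cint (X := CC) (fun r a => hker 1 (polar r a)) th *: v)).
{ rewrite <- (cint_scal_vec _ th C3 e3 C4 e4 v R3 R4). unfold Phi.
  rewrite <- (cint_plus _ _ th C2 e2 C2 e2 (norm v * C3) e3 (norm v * C4) e4);
    try now apply rdom_scal_vec. 2, 3 : trivial.
  apply (cint_ext G _ th (C1 * Q) e (C1 * Q) e); try now apply RG.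
  - intros r Hr. apply HG; trivial; try lra. apply one_plus_neq_0; trivial; lra. apply NZ; lra.
  - intros r Hr. apply HG; trivial; try lra. apply one_plus_neq_0; trivial; lra. apply NZ; lra. }
assert (C1h : cint (X := CC) (fun r a => hker 1 (polar r a)) th = RtoC 1).
{ unfold cint. rewrite <- E10. rewrite (ray_hker 1 0 th), (ray_hker_neg 1 0 (- th)) by lra.
  rewrite E10. change (/ (2 * PI * Ci) * (PI * Ci - - (PI * Ci)) = 1)%C. field.
  split. apply Cmod_gt_0; rewrite Cmod_Ci; lra.
  intros E. apply (f_equal fst) in E. simpl in E. lra. }
rewrite C1h, Z in EG. unfold inv_one_plus. change (Phi th v0 x = opp v).
assert (E : Phi th v0 x = minus (plus (Phi th v0 x) (RtoC 1 *: v)) v).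
{ generalize (Phi th v0 x). intros. linC X. }
rewrite E, <- EG. linC X.
Qed.

Lemma inv1A_spec y : dom A (inv1A y) /\ op A (inv1A y) = minus y (inv1A y).
Proof.
assert (H := reg_m1). unfold inv_one_plus.
change (dom A (opp (Rs (RtoC (-1)) y)) /\ op A (opp (Rs (RtoC (-1)) y)) = minus y (opp (Rs (RtoC (-1)) y))).
assert (D := resolvent_dom (RtoC (-1)) y H).
split; [now apply dom_opp|]. rewrite op_opp, resolvent_op by trivial.
generalize (Rs (RtoC (-1)) y). intros. linC X; apply injective_projections; simpl; ring.
Qed.

Lemma inv1A_unique v : dom A v -> inv1A (plus v (op A v)) = v.
Proof.
intros Hv. assert (H := reg_m1). unfold inv_one_plus.
assert (E : opp v = Rs (RtoC (-1)) (plus v (op A v))).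
{ apply resolvent_unique; trivial; [now apply dom_opp|]. unfold shifted.
  rewrite op_opp by trivial. generalize (op A v). intros. linC X; apply injective_projections; simpl; ring. }
change (opp (Rs (RtoC (-1)) (plus v (op A v))) = v). rewrite <- E. linC X.
Qed.

Lemma iter_inv1A_Phi th x j : omega < th < hi -> Nat.iter (S j) inv1A x = Phi th (pf 0 (S j)) x.
Proof.
intros Hth. induction j as [|j IH].
- simpl Nat.iter. rewrite <- (Phi_v0 th x Hth).
  apply (Phi_ext _ _ 1 (INR 1)); trivial.
  + apply (hol_decay_ext (pf 0 1)); [|apply hol_decay_pf; lia]. intros. unfold pf. simpl. ring.
  + intros. unfold pf. simpl. ring.
- change (inv1A (Nat.iter (S j) inv1A x) = Phi th (pf 0 (S (S j))) x). rewrite IH.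
  assert (H1 := hol_decay_pf 0 (S j) ltac:(lia)). rewrite (inv1A_Phi _ _ _ _ _ H1 Hth).
  symmetry. apply (Phi_ext _ _ 1 (INR (S (S j)))); trivial; [apply hol_decay_pf; lia|].
  intros. unfold pf. simpl. ring.
Qed.

(** Since [(f + z f) / (1 + z) = f], the vector [Phi th f x] is [(1 + A)^{-1}] applied to
    [Phi th f x + Phi th g x]. It therefore lies in the domain, and the value of [A] on it is read
    off; no limit is taken through [A]. *)
Lemma Phi_op f g C0 p C1 p' th x : hol_decay f C0 p -> hol_decay g C1 p' -> omega < th < hi ->
  (forall r a, 0 < r -> Rabs a < hi -> g r a = polar r a * f r a)%C ->
  dom A (Phi th f x) /\ op A (Phi th f x) = Phi th g x.
Proof.
intros Hf Hg Hth E.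
assert (Es : Phi th f x = inv1A (plus (Phi th f x) (Phi th g x))).
{ assert (E1 : inv1A (plus (Phi th f x) (Phi th g x)) = plus (inv1A (Phi th f x)) (inv1A (Phi th g x))).
  { unfold inv_one_plus. change (opp (Rs (RtoC (-1)) (plus (Phi th f x) (Phi th g x))) =
      plus (opp (Rs (RtoC (-1)) (Phi th f x))) (opp (Rs (RtoC (-1)) (Phi th g x)))).
    rewrite resolvent_plus by apply reg_m1.
    generalize (Rs (RtoC (-1)) (Phi th f x)) (Rs (RtoC (-1)) (Phi th g x)). intros. linC X. }
  rewrite E1, (inv1A_Phi f C0 p), (inv1A_Phi g C1 p') by trivial.
  assert (Hb := fun u (C2 p2 : R) (H : hol_decay u C2 p2) => hol_decay_mult_bdd u C2 p2 v0 1 H polhol_v0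
    ltac:(intros; now apply v0_bound)).
  rewrite <- (Phi_fplus _ _ _ _ _ _ th x (Hb _ _ _ Hf) (Hb _ _ _ Hg) Hth).
  apply (Phi_ext _ _ C0 p); trivial.
  intros r a Hr Ha. rewrite E by trivial. unfold v0. field. now apply one_plus_neq_0. }
destruct (inv1A_spec (plus (Phi th f x) (Phi th g x))) as [D1 D2]. rewrite <- Es in D1, D2.
split; trivial. rewrite D2. generalize (Phi th f x) (Phi th g x). intros. linC X.
Qed.

Lemma iter_op_inv1A th x i j : omega < th < hi ->
  Nat.iter i (op A) (Nat.iter (i + S j) inv1A x) = Phi th (pf i (S j)) x.
Proof.
intros Hth. revert j. induction i as [|i IH]; intros j.
- simpl Nat.iter at 1. now apply iter_inv1A_Phi.
- change (op A (Nat.iter i (op A) (Nat.iter (S i + S j) inv1A x)) = Phi th (pf (S i) (S j)) x).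
  replace (S i + S j)%nat with (i + S (S j))%nat by lia. rewrite IH.
  apply (Phi_op _ _ 1 (INR (S (S j))) 1 (INR (S j))); trivial; try (apply hol_decay_pf; lia).
  intros. unfold pf, u0. simpl. ring.
Qed.

(** * Bijectivity of [A] *)

Lemma A_injective v : dom A v -> op A v = zero -> v = zero.
Proof.
intros Hv H0. destruct (resolvent_bound_polar hi ltac:(lra)) as [K [HK HB]].
assert (P := PI_RGT_0).
destruct (Rpower_small (1 + gamma) (/ (2 * K)) ltac:(lra)) as [r [Hr Hr2]].
{ apply Rinv_0_lt_compat; lra. }
specialize (Hr2 r ltac:(lra)).
assert (Hz : reg (polar r PI)).
{ apply (reg_th r PI hi); try lra. rewrite Rabs_pos_eq; lra. }
(* A vector of the kernel satisfies [v = z R(z) v], of norm at most [K r^(1 + gamma) |v|]; [r] was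
   chosen to make the factor at most 1/2. *)
assert (E : v = Rs (polar r PI) (polar r PI *: v)).
{ apply resolvent_unique; trivial. unfold shifted. rewrite H0. linC X. }
assert (B := HB r PI (polar r PI *: v) Hr ltac:(rewrite cos_PI; apply COS_bound)).
rewrite <- E in B. assert (N := norm_ge_0 v).
assert (B2 : norm v <= / 2 * norm v).
{ apply Rle_trans with (1 := B).
  apply Rle_trans with (K * Rpower r gamma * (r * norm v)).
  - apply Rmult_le_compat_l. { apply Rmult_le_pos; [lra|left; apply Rpower_pos]. }
    eapply Rle_trans; [apply norm_scal_C|]. rewrite Cmod_polar; lra.
  - assert (Eg : r * Rpower r gamma = Rpower r (1 + gamma)).
    { rewrite Rpower_plus, Rpower_1 by trivial. reflexivity. }
    replace (K * Rpower r gamma * (r * norm v)) with (K * (r * Rpower r gamma) * norm v) by ring.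
    apply Rmult_le_compat_r; trivial. rewrite Eg.
    apply Rmult_le_compat_l with (r := K) in Hr2; [|lra].
    replace (K * / (2 * K)) with (/ 2) in Hr2 by (field; lra). exact Hr2. }
apply (norm_eq_zero (V := X)). lra.
Qed.

Lemma dom_minus x y : dom A x -> dom A y -> dom A (minus x y).
Proof. intros Hx Hy. apply dom_plus; trivial. now apply dom_opp. Qed.

Lemma op_minus x y : dom A x -> dom A y -> op A (minus x y) = minus (op A x) (op A y).
Proof. intros Hx Hy. unfold minus. rewrite op_plus, op_opp; trivial. now apply dom_opp. Qed.

Lemma A_inj v w : dom A v -> dom A w -> op A v = op A w -> v = w.
Proof.
intros Hv Hw H.
assert (Z : minus v w = zero).
{ apply A_injective; [now apply dom_minus|]. rewrite op_minus, H by trivial.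
  generalize (op A w). intros. linC X. }
assert (E : v = plus (minus v w) w) by linC X. rewrite E, Z. linC X.
Qed.

(** [0] is in the resolvent set: since [gamma > -1], the resolvents
    [(- a - A)^{-1}] converge as [a] decreases to [0]. *)
Lemma A_surjective y : exists v, dom A v /\ op A v = y.
Proof.
destruct (resolvent_bound_polar hi ltac:(lra)) as [K [HK HB]].
assert (P := PI_RGT_0).
destruct (Rpower_small (1 + gamma) (/ (2 * K)) ltac:(lra)) as [r [Hr Hr2]].
{ apply Rinv_0_lt_compat; lra. }
specialize (Hr2 r ltac:(lra)).
assert (Hz : forall b, 0 < b -> reg (polar b PI)).
{ intros b Hb. apply (reg_th b PI hi); try lra. rewrite Rabs_pos_eq; lra. }
assert (Ep : forall b, polar b PI = (- RtoC b)%C).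
{ intros b. unfold polar, cis. rewrite cos_PI, sin_PI. apply injective_projections; simpl; ring. }
set (M := K * Rpower r gamma).
assert (HM : 0 < M) by (apply Rmult_lt_0_compat; trivial; apply Rpower_pos).
assert (HrM : r * M <= / 2).
{ unfold M. apply Rmult_le_compat_l with (r := K) in Hr2; [|lra].
  replace (K * / (2 * K)) with (/ 2) in Hr2 by (field; lra).
  rewrite Rpower_plus, Rpower_1 in Hr2 by trivial. lra. }
assert (HBr : forall x, norm (Rs (polar r PI) x) <= M * norm x).
{ intros x. apply HB; trivial. rewrite cos_PI; apply COS_bound. }
(* The resolvent identity between the radii [b] and [r] has a factor at most [r M <= 1/2], which
   absorbs half of the norm to be bounded. The bound is uniform as [b] tends to 0, unlike the
   assumed [b^gamma]. *)
assert (Bd : forall b x, 0 < b <= r -> norm (Rs (polar b PI) x) <= 2 * M * norm x).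
{ intros b x Hb.
  assert (I := resolvent_identity (polar r PI) (polar b PI) x (Hz r Hr) (Hz b ltac:(lra))).
  set (u := Rs (polar b PI) x) in *.
  assert (T : norm u <= norm (Rs (polar r PI) x) + norm (minus u (Rs (polar r PI) x))) by apply xnorm_le_minus.
  rewrite (xnorm_minus_sym u) in T.
  assert (T2 : norm (minus (Rs (polar r PI) x) u) <= / 2 * norm u).
  { apply (xnorm_eq_le _ _ _ I). eapply Rle_trans; [apply norm_scal_C|].
    apply Rle_trans with (r * (M * norm u)).
    - apply Rmult_le_compat; try apply Cmod_ge_0; try apply norm_ge_0; trivial.
      rewrite !Ep. replace (- RtoC b - - RtoC r)%C with (RtoC (r - b)) by
        (apply injective_projections; simpl; ring).
      rewrite Cmod_R, Rabs_pos_eq; lra.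
    - rewrite <- Rmult_assoc. apply Rmult_le_compat_r; trivial. apply norm_ge_0. }
  specialize (HBr x). lra. }
assert (Lip : forall b c, 0 < b <= r -> 0 < c <= r ->
  norm (minus (Rs (polar b PI) y) (Rs (polar c PI) y)) <= Rabs (b - c) * (2 * M * (2 * M * norm y))).
{ intros b c Hb Hc.
  apply (xnorm_eq_le _ _ _ (resolvent_identity _ _ y (Hz b ltac:(lra)) (Hz c ltac:(lra)))).
  eapply Rle_trans; [apply norm_scal_C|].
  replace (polar c PI - polar b PI)%C with (RtoC (b - c))
    by (rewrite !Ep; apply injective_projections; simpl; ring).
  rewrite Cmod_R. apply Rmult_le_compat_l; [apply Rabs_pos|].
  eapply Rle_trans; [now apply Bd|]. apply Rmult_le_compat_l; [lra|]. now apply Bd. }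
assert (Ny := norm_ge_0 y).
set (Q := 2 * M * (2 * M * norm y) + 1).
assert (HQ : 1 <= Q).
{ unfold Q. assert (0 <= 2 * M * (2 * M * norm y)); [|lra].
  apply Rmult_le_pos; [lra|]. apply Rmult_le_pos; lra. }
assert (Lim : exists v, filterlim (fun b => Rs (polar b PI) y) (at_right 0) (locally v)).
{ apply (proj1 (filterlim_locally_cauchy (U := X) (F := at_right 0) _)). intros eps.
  exists (fun b => 0 < b < Rmin r (eps / Q)). split.
  - assert (Hm : 0 < Rmin r (eps / Q)).
    { apply Rmin_pos; trivial. apply Rdiv_lt_0_compat; [apply cond_pos|lra]. }
    exists (mkposreal _ Hm). intros b Hb Hb0. change (Rabs (b - 0) < Rmin r (eps / Q)) in Hb.
    rewrite Rminus_0_r, Rabs_pos_eq in Hb by lra. now split.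
  - intros b c Hb Hc.
    assert (L1 : Rmin r (eps / Q) <= r) by apply Rmin_l.
    assert (L2 : Rmin r (eps / Q) <= eps / Q) by apply Rmin_r.
    apply (norm_compat1 (V := X)).
    apply Rle_lt_trans with (1 := Lip c b ltac:(lra) ltac:(lra)).
    assert (Hcb : Rabs (c - b) < eps / Q) by (apply Rabs_lt_between; lra).
    apply Rle_lt_trans with (Rabs (c - b) * Q).
    + apply Rmult_le_compat_l; [apply Rabs_pos|]. unfold Q; lra.
    + apply Rmult_lt_compat_r with (r := Q) in Hcb; [|lra].
      replace (eps / Q * Q) with (pos eps) in Hcb by (field; lra). exact Hcb. }
destruct Lim as [v Hv].
(* Here [A R(-b) y = - b R(-b) y - y], and the first term tends to 0 by the uniform bound. *)
assert (LimA : filterlim (fun b => op A (Rs (polar b PI) y)) (at_right 0) (locally (opp y))).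
{ apply (proj2 (filterlim_norm_iff (V := RS X) (at_right 0)
    (fun b => op A (Rs (polar b PI) y)) (opp y))). intros eps Heps.
  assert (Hm : 0 < Rmin r (eps / Q)).
  { apply Rmin_pos; trivial. apply Rdiv_lt_0_compat; lra. }
  assert (HM2 : 0 < 2 * M * norm y + 1).
  { assert (0 <= 2 * M * norm y) by (apply Rmult_le_pos; lra). lra. }
  assert (Hm2 : 0 < Rmin r (eps / (2 * M * norm y + 1))).
  { apply Rmin_pos; trivial. now apply Rdiv_lt_0_compat. }
  exists (mkposreal _ Hm2). intros b Hb Hb0.
  change (Rabs (b - 0) < Rmin r (eps / (2 * M * norm y + 1))) in Hb.
  rewrite Rminus_0_r, Rabs_pos_eq in Hb by lra.
  assert (L1 : Rmin r (eps / (2 * M * norm y + 1)) <= r) by apply Rmin_l.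
  assert (L2 : Rmin r (eps / (2 * M * norm y + 1)) <= eps / (2 * M * norm y + 1)) by apply Rmin_r.
  assert (E : minus (op A (Rs (polar b PI) y)) (opp y) = polar b PI *: Rs (polar b PI) y).
  { rewrite resolvent_op by now apply Hz. generalize (Rs (polar b PI) y). intros. linC X. }
  apply (xnorm_eq_lt _ _ _ E). eapply Rle_lt_trans; [apply norm_scal_C|].
  rewrite Cmod_polar by lra.
  apply Rle_lt_trans with (b * (2 * M * norm y + 1)).
  - apply Rmult_le_compat_l; [lra|]. assert (B := Bd b y ltac:(lra)). lra.
  - apply Rlt_le_trans with (eps / (2 * M * norm y + 1) * (2 * M * norm y + 1)).
    + apply Rmult_lt_compat_r; lra.
    + right. field. lra. }
(* Closedness is used by contradiction: a ball around [(v, - y)] that misses the graph would contain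
   the points [(R(-b) y, A R(-b) y)] for small [b]. *)
assert (HC : dom A v /\ op A v = opp y).
{ assert (Cl := proj1 (proj2 HA)). unfold closed_op in Cl.
  apply (Cl (v, opp y)). intros [d Hd].
  assert (B1 := Hv (ball v d) (locally_ball v d)).
  assert (B2 := LimA (ball (opp y) d) (locally_ball (opp y) d)).
  assert (B3 : at_right 0 (fun b => 0 < b)).
  { exists (mkposreal 1 Rlt_0_1). intros b _ Hb. exact Hb. }
  unfold filtermap in B1, B2.
  destruct (filter_ex _ (filter_and _ _ (filter_and _ _ B1 B2) B3)) as [b [[Hb1 Hb2] Hb3]].
  apply (Hd (Rs (polar b PI) y, op A (Rs (polar b PI) y))).
  - split; trivial.
  - split; trivial. apply resolvent_dom. now apply Hz. }
exists (opp v). split; [now apply dom_opp|]. rewrite op_opp by apply HC. rewrite (proj2 HC). linC X.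
Qed.

(** * Powers of [A] and the regularising operator *)

Lemma dom_pow_plus n v w : dom_pow A n v -> dom_pow A n w -> dom_pow A n (plus v w).
Proof.
revert v w; induction n as [|n IH]; intros v w; simpl; trivial.
intros [V1 V2] [W1 W2]. split; [now apply dom_plus|]. rewrite op_plus by trivial. now apply IH.
Qed.

Lemma dom_pow_opp n v : dom_pow A n v -> dom_pow A n (opp v).
Proof.
revert v; induction n as [|n IH]; intros v; simpl; trivial.
intros [V1 V2]. split; [now apply dom_opp|]. rewrite op_opp by trivial. now apply IH.
Qed.

Lemma dom_pow_S n v : dom_pow A (S n) v -> dom_pow A n v.
Proof.
revert v; induction n as [|n IH]; intros v H; [exact I|].
destruct H as [H1 H2]. split; trivial. now apply IH.
Qed.

Lemma dom_pow_inv1A n v : dom_pow A n v -> dom_pow A (S n) (inv1A v).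
Proof.
revert v; induction n as [|n IH]; intros v H.
- split; [apply inv1A_spec|exact I].
- split; [apply inv1A_spec|]. rewrite (proj2 (inv1A_spec v)).
  apply dom_pow_plus; trivial. apply dom_pow_opp. apply IH. now apply dom_pow_S.
Qed.

Lemma dom_pow_iter_inv1A n x : dom_pow A n (Nat.iter n inv1A x).
Proof. induction n as [|n IH]; [exact I|]. now apply dom_pow_inv1A. Qed.

Lemma range_iter_inv1A n v : dom_pow A n v -> exists x, Nat.iter n inv1A x = v.
Proof.
revert v; induction n as [|n IH]; intros v H.
- now exists v.
- destruct (IH (plus v (op A v))) as [x Hx].
  + apply dom_pow_plus; [now apply dom_pow_S|apply H].
  + exists x. change (inv1A (Nat.iter n inv1A x) = v). rewrite Hx. apply inv1A_unique, H.
Qed.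

Lemma dom_pow_iter_op k n v : dom_pow A (k + n) v -> dom_pow A n (Nat.iter k (op A) v).
Proof.
revert v; induction k as [|k IH]; intros v H; trivial.
rewrite Nat.iter_succ_r. apply IH. apply H.
Qed.

Lemma dom_pow_le k n v : dom_pow A (k + n) v -> dom_pow A k v.
Proof.
revert v; induction k as [|k IH]; intros v H; [exact I|].
destruct H as [H1 H2]. split; trivial. now apply IH.
Qed.

Lemma iter_op_inj k v w : dom_pow A k v -> dom_pow A k w ->
  Nat.iter k (op A) v = Nat.iter k (op A) w -> v = w.
Proof.
revert v w; induction k as [|k IH]; intros v w Hv Hw H; trivial.
rewrite !Nat.iter_succ_r in H. apply A_inj; [apply Hv|apply Hw|].
apply IH; [apply Hv|apply Hw|exact H].
Qed.

Lemma iter_op_surj k n y : dom_pow A n y -> exists v, dom_pow A (k + n) v /\ Nat.iter k (op A) v = y.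
Proof.
intros Hy. induction k as [|k [v [H1 H2]]]; [now exists y|].
destruct (A_surjective v) as [w [W1 W2]]. exists w. split.
- split; trivial. now rewrite W2.
- now rewrite Nat.iter_succ_r, W2.
Qed.

Lemma inv1A_inj x y : inv1A x = inv1A y -> x = y.
Proof.
intros H. destruct (inv1A_spec x) as [_ E1]. destruct (inv1A_spec y) as [_ E2].
rewrite H in E1. rewrite E1 in E2.
assert (E : x = plus (minus x (inv1A y)) (inv1A y)) by (generalize (inv1A y); intros; linC X).
rewrite E, E2. generalize (inv1A y). intros. linC X.
Qed.

Lemma iter_inv1A_inj n x y : Nat.iter n inv1A x = Nat.iter n inv1A y -> x = y.
Proof. induction n as [|n IH]; simpl; trivial. intros H. apply IH. now apply inv1A_inj. Qed.

Section Psi.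
Variables k m : nat.
Hypothesis Hk : (1 <= k)%nat.
Hypothesis Hm : (2 <= m)%nat.
Let n := ((m - 1) * k)%nat.

Lemma mk_eq : (m * k = k + n)%nat.
Proof. unfold n. destruct m as [|m']; [lia|]. simpl. rewrite Nat.sub_0_r. reflexivity. Qed.

Lemma n_pos : (1 <= n)%nat.
Proof. unfold n. nia. Qed.

Lemma psi_op_Phi th x : omega < th < hi -> psi_op A k m x = Phi th (pf k n) x.
Proof.
intros Hth. unfold psi_op. rewrite mk_eq. assert (N := n_pos).
destruct n as [|j]; [lia|]. now apply iter_op_inv1A.
Qed.

Lemma psi_op_inj x y : psi_op A k m x = psi_op A k m y -> x = y.
Proof.
unfold psi_op. rewrite mk_eq. intros H. apply iter_op_inj in H.
- now apply iter_inv1A_inj in H.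
- apply (dom_pow_le k n), dom_pow_iter_inv1A.
- apply (dom_pow_le k n), dom_pow_iter_inv1A.
Qed.

(** [(1 + A)^{-(k+n)}] maps onto [D(A^(k+n))], and [A^k] maps this onto [D(A^n)] because [A] is
    surjective. *)
Lemma psi_op_range y : dom_pow A n y <-> exists x, psi_op A k m x = y.
Proof.
unfold psi_op. rewrite mk_eq. split.
- intros H. destruct (iter_op_surj k n y H) as [v [V1 V2]].
  destruct (range_iter_inv1A (k + n) v V1) as [x Hx]. exists x. now rewrite Hx.
- intros [x <-]. apply dom_pow_iter_op. apply dom_pow_iter_inv1A.
Qed.

Lemma psi_pow_pf r a : 0 < r -> (1 + polar r a)%C <> RtoC 0 -> (psi m (polar r a) ^ k)%C = pf k n r a.
Proof.
intros Hr H. unfold psi, pf, u0, v0, n.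
assert (E : (polar r a / (1 + polar r a) ^ m = (polar r a * / (1 + polar r a)) * (/ (1 + polar r a)) ^ (m - 1))%C).
{ destruct m as [|m']; [lia|]. simpl. rewrite Nat.sub_0_r.
  assert (Ei : forall j, ((/ (1 + polar r a)) ^ j = / (1 + polar r a) ^ j)%C).
  { induction j as [|j IH]; simpl. { field; intros Z; injection Z; lra. }
    rewrite IH. field; repeat split; trivial; now apply Cpow_nz. }
  rewrite Ei. field; repeat split; trivial; now apply Cpow_nz. }
rewrite E, Cpow_mult_l, <- Cpow_mult_r. reflexivity.
Qed.

End Psi.

Lemma Phi_fminus f g C0 p C1 p' th x : hol_decay f C0 p -> hol_decay g C1 p' -> omega < th < hi ->
  Phi th (fun r a => f r a - g r a)%C x = minus (Phi th f x) (Phi th g x).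
Proof.
intros Hf Hg Hth. assert (Hg' := hol_decay_cscal (-(1))%C g C1 p' Hg).
transitivity (Phi th (fun r a => f r a + -(1) * g r a)%C x).
- unfold Phi. f_equal. apply functional_extensionality. intros r.
  apply functional_extensionality. intros a. f_equal. cring.
- rewrite (Phi_fplus _ _ _ _ _ _ th x Hf Hg' Hth), (Phi_fscal _ _ _ _ _ _ Hg Hth).
  generalize (Phi th f x) (Phi th g x). intros. linC X.
Qed.

(** The prescribed contours may open up to the angle [PI], whereas the calculus stays below [hi].
    Only bounds on the region swept by the rotation are asked for, not on the whole sector. *)
Lemma E_rotate p th th' (u : R -> R -> C) C0 x : 1 + gamma < p -> omega < th -> th <= th' -> th' < PI ->
  polholC (- PI) PI u -> 0 <= C0 ->
  (forall r a, 0 < r -> th <= Rabs a <= th' ->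
     Cmod (u r a) <= C0 /\ Cmod (u r a) <= C0 * Rpower r (- p)) ->
  cint (fun r a => u r a *: Rs (polar r a) x) th = cint (fun r a => u r a *: Rs (polar r a) x) th' /\
  exists C1 e, rdom (fun r a => u r a *: Rs (polar r a) x) th' C1 e /\
    rdom (fun r a => u r a *: Rs (polar r a) x) (- th') C1 e.
Proof.
intros Hp H1 H2 H3 Hu HC HB. destruct (resolvent_decay_dominated p th Hp ltac:(lra)) as [e [K [He [HK H]]]].
assert (HD : forall a, th <= Rabs a <= th' ->
  rdom (fun r a => u r a *: Rs (polar r a) x) a (K * C0 * norm x) e /\
  forall r, 0 < r -> norm (u r a *: Rs (polar r a) x) <= K * C0 * norm x * kap e r).
{ intros a Ha. apply H; trivial; [lra| |].
  - intros r Hr. apply (polhol_cont (X := CC) (- PI) PI); trivial. apply Rabs_lt_between. lra.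
  - intros r Hr. now apply HB. }
split.
- apply (cint_rotate omega PI _ th th' (K * C0 * norm x) e); lra || trivial.
  + apply polhol_mul; [apply (polhol_sub (X := CC) (- PI) PI); lra || trivial|].
    apply polhol_sub with omega (2 * PI - omega); lra || apply resolvent_polhol_up.
  + apply polhol_mul; [apply (polhol_sub (X := CC) (- PI) PI); lra || trivial|].
    apply polhol_sub with (- (2 * PI - omega)) (- omega); lra || apply resolvent_polhol_down.
  + intros r a Hr Ha. now apply HD.
- exists (K * C0 * norm x), e. split; apply HD; rewrite ?Rabs_Ropp, Rabs_pos_eq; lra.
Qed.

(** * Fractional power and semigroup *)

Section Power.
Variable alpha : R.
Hypothesis Halpha : 1 + gamma < alpha.
Hypothesis Halpha_hi : alpha * hi < PI / 2.

Lemma Cmod_zpow al r a : Cmod (zpow al r a) = Rpower r al.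
Proof.
unfold zpow. rewrite Cmod_mult, Cmod_cis, Cmod_R, Rabs_pos_eq; [ring|]. left; apply Rpower_pos.
Qed.

Lemma Re_zpow al r a : Re (zpow al r a) = Rpower r al * cos (al * a).
Proof. unfold zpow, cis; simpl. ring. Qed.

Lemma cos_al_ge h a : 0 <= alpha * h <= PI -> Rabs a <= h -> cos (alpha * h) <= cos (alpha * a).
Proof.
intros Hh Ha. assert (E : cos (alpha * a) = cos (alpha * Rabs a)).
{ unfold Rabs. destruct (Rcase_abs a); trivial. rewrite <- cos_neg. f_equal; ring. }
rewrite E. assert (P := Rabs_pos a). apply cos_decr_1; try nra.
Qed.

Lemma Cmod_Cexp z : Cmod (Cexp z) = exp (Re z).
Proof.
unfold Cexp. rewrite Cmod_mult, Cmod_cis, Cmod_R, Rabs_pos_eq; [ring|]. left; apply exp_pos.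
Qed.

Definition et (t r a : R) : C := Cexp (- (RtoC t * zpow alpha r a)).

Lemma Cmod_et t r a c : 0 <= t -> c <= cos (alpha * a) ->
  Cmod (et t r a) <= exp (- (t * c * Rpower r alpha)).
Proof.
intros Ht Hc. unfold et. rewrite Cmod_Cexp.
replace (Re (- (RtoC t * zpow alpha r a))) with (- (t * Re (zpow alpha r a)))
  by (destruct (zpow alpha r a) as [u v]; simpl; ring).
rewrite Re_zpow. assert (P := Rpower_pos r alpha).
assert (L : t * c * Rpower r alpha <= t * (Rpower r alpha * cos (alpha * a))).
{ replace (t * c * Rpower r alpha) with (t * (Rpower r alpha * c)) by ring.
  apply Rmult_le_compat_l; trivial. apply Rmult_le_compat_l; lra. }
destruct L as [L|L]; [left; apply exp_increasing; lra|right; now rewrite L].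
Qed.

Lemma polhol_et lo h t : polholC lo h (et t).
Proof.
apply polholC_exp, polholC_opp, polholC_mult; [apply polholC_const|apply polholC_zpow].
Qed.

Lemma exp_neg_le1 x : 0 <= x -> exp (- x) <= 1.
Proof.
intros [H|<-]; [|rewrite Ropp_0, exp_0; lra]. left. rewrite <- exp_0. apply exp_increasing; lra.
Qed.

(** From [exp x = exp (x / 3)^3]. The cube absorbs two factors [z^alpha], which arise from the
    second-order remainder in [t], and leaves one for the decay [r^(- alpha)]. *)
Lemma exp_neg_cube x : 0 < x -> exp (- x) <= 27 / x ^ 3.
Proof.
intros Hx. rewrite exp_Ropp. replace (27 / x ^ 3) with (/ (x / 3) ^ 3) by (field; lra).
apply Rinv_le_contravar; [apply pow_lt; lra|].
replace (exp x) with (exp (x / 3) ^ 3).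
- apply pow_incr. split; [lra|]. left. apply Rlt_trans with (1 + x / 3); [lra|]. apply exp_ineq1; lra.
- simpl. rewrite Rmult_1_r, <- !exp_plus. f_equal. field.
Qed.

Lemma pow_exp_bound t c : 0 < t -> 0 < c -> exists C0, 0 < C0 /\
  (forall r j, (j <= 2)%nat -> 0 < r <= 1 ->
     Rpower r alpha ^ j * exp (- (t * c * Rpower r alpha)) <= C0) /\
  (forall r j, (j <= 2)%nat -> 1 <= r ->
     Rpower r alpha ^ j * exp (- (t * c * Rpower r alpha)) <= C0 * Rpower r (- alpha)).
Proof.
intros Ht Hc. assert (Htc : 0 < t * c) by now apply Rmult_lt_0_compat.
assert (H3 : 0 < (t * c) ^ 3) by now apply pow_lt.
assert (P27 : 0 < 27 / (t * c) ^ 3) by (apply Rdiv_lt_0_compat; lra).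
exists (1 + 27 / (t * c) ^ 3). split; [lra|]. split.
- intros r j Hj Hr. assert (P := Rpower_pos r alpha).
  assert (L : Rpower r alpha <= 1) by (rewrite <- (Rpower_O r) by lra; apply Rpower_ge_exp; lra).
  apply Rle_trans with (1 * 1); [|lra]. apply Rmult_le_compat; try (left; apply exp_pos).
  + apply pow_le; lra.
  + rewrite <- (pow1 j). apply pow_incr; lra.
  + apply exp_neg_le1. apply Rmult_le_pos; lra.
- intros r j Hj Hr. assert (P := Rpower_pos r alpha). rewrite Rpower_Ropp.
  set (s := Rpower r alpha) in *.
  assert (L : 1 <= s) by (unfold s; rewrite <- (Rpower_O r) by lra; apply Rpower_le_exp; lra).
  apply Rle_trans with (s ^ 2 * (27 / (t * c * s) ^ 3)).
  + apply Rmult_le_compat; try (left; apply exp_pos).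
    * apply pow_le; lra.
    * now apply Rle_pow.
    * apply exp_neg_cube. now apply Rmult_lt_0_compat.
  + replace (s ^ 2 * (27 / (t * c * s) ^ 3)) with (27 / (t * c) ^ 3 * / s) by (field; lra).
    apply Rmult_le_compat_r; [left; now apply Rinv_0_lt_compat|lra].
Qed.

Let cc := cos (alpha * hi).

Lemma cc_pos : 0 < cc.
Proof. apply cos_gt_0; nra. Qed.

Lemma cc_le a : Rabs a < hi -> cc <= cos (alpha * a).
Proof. intros Ha. assert (P := PI_RGT_0). apply cos_al_ge; [|lra]. split; nra. Qed.

(** [j] counts the factors [z^alpha] produced by expansion in [t]. [C0] is chosen before [f] and
    [M], so a scalar increment of size [M] yields an operator increment of size [O(M)]. *)
Lemma hol_decay_exp_bound t : 0 < t -> exists C0, 0 < C0 /\ forall (f : R -> R -> C) M j, (j <= 2)%nat ->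
  polholC (- hi) hi f -> 0 <= M ->
  (forall r a, 0 < r -> Rabs a < hi ->
    Cmod (f r a) <= M * (Rpower r alpha ^ j * exp (- (t * cc * Rpower r alpha)))) ->
  hol_decay f (M * C0) alpha.
Proof.
intros Ht. destruct (pow_exp_bound t cc Ht cc_pos) as [C0 [HC0 [B1 B2]]].
exists C0. split; trivial. intros f M j Hj Hf HM H.
apply hol_decay_intro; trivial.
- apply Rmult_le_pos; lra.
- intros r a Hr Ha. eapply Rle_trans; [apply H; lra|]. apply Rmult_le_compat_l; trivial.
  now apply B1.
- intros r a Hr Ha. eapply Rle_trans; [apply H; lra|]. rewrite (Rmult_assoc M C0).
  apply Rmult_le_compat_l; trivial. now apply B2.
Qed.

Lemma et_le t t0 r a : 0 <= t0 -> t0 <= t -> Rabs a < hi ->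
  Cmod (et t r a) <= exp (- (t0 * cc * Rpower r alpha)).
Proof.
intros H0 Ht Ha. eapply Rle_trans; [apply (Cmod_et t r a cc); [lra|now apply cc_le]|].
assert (L : t0 * cc * Rpower r alpha <= t * cc * Rpower r alpha).
{ apply Rmult_le_compat_r; [left; apply Rpower_pos|]. apply Rmult_le_compat_r; trivial.
  left; apply cc_pos. }
destruct L as [L|L]; [left; apply exp_increasing; lra|right; now rewrite L].
Qed.

Definition zet (t r a : R) : C := (zpow alpha r a * et t r a)%C.

Lemma polhol_zet lo h t : polholC lo h (zet t).
Proof. apply polholC_mult; [apply polholC_zpow|apply polhol_et]. Qed.

Lemma is_derC_et t r a : is_derC (fun t => et t r a) t (- zet t r a)%C.
Proof.
unfold zet, et. eapply is_derC_eq.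
- apply is_derC_exp. apply (is_der_opp (X := CC)).
  apply is_derC_mult; [|apply (is_der_const (X := CC))].
  apply (is_derC_R (fun t => t)). apply is_derive_id.
- set (E := Cexp _). change (- (RtoC 1 * zpow alpha r a + RtoC t * 0) * E = - (zpow alpha r a * E))%C. ring.
Qed.

Lemma continuous_et t r a : contC (fun t => et t r a) t.
Proof. apply (is_der_cont (X := CC) _ _ _ (is_derC_et t r a)). Qed.

Lemma between_ge t0 t t' s : t0 <= t -> t0 <= t' -> Rmin t t' <= s <= Rmax t t' -> t0 <= s.
Proof. intros H1 H2 [H3 _]. apply Rle_trans with (2 := H3). now apply Rmin_glb. Qed.

Lemma between_abs t t' s : Rmin t t' <= s <= Rmax t t' -> Rabs (s - t) <= Rabs (t' - t).
Proof.
unfold Rmin, Rmax, Rabs. destruct (Rle_dec t t'); intros; repeat destruct Rcase_abs; lra.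
Qed.

Lemma et_diff t0 t t' r a : 0 <= t0 -> t0 <= t -> t0 <= t' -> Rabs a < hi ->
  Cmod (et t' r a - et t r a) <=
  Rabs (t' - t) * (Rpower r alpha ^ 1 * exp (- (t0 * cc * Rpower r alpha))).
Proof.
intros H0 H1 H2 Ha.
apply (mean_value (V := RS CC) (fun t => et t r a) (fun t => - zet t r a)%C t t').
- intros s _. apply is_derC_et.
- intros s _. apply (continuous_opp (V := CC)).
  apply (continuous_C_mult (fun _ => zpow alpha r a)); [apply continuous_const|apply continuous_et].
- intros s Hs. change (Cmod (- zet s r a) <= Rpower r alpha ^ 1 * exp (- (t0 * cc * Rpower r alpha))).
  unfold zet. rewrite Cmod_opp, Cmod_mult, Cmod_zpow, pow_1.
  apply Rmult_le_compat_l; [left; apply Rpower_pos|]. apply et_le; trivial.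
  now apply (between_ge t0 t t').
Qed.

(** Mean value inequality for [s |-> et s + s * zet t], whose derivative [zet t - zet s] is
    controlled by [et_diff]. *)
Lemma et_diff2 t0 t t' r a : 0 <= t0 -> t0 <= t -> t0 <= t' -> Rabs a < hi ->
  Cmod (et t' r a - et t r a + RtoC (t' - t) * zet t r a) <=
  Rabs (t' - t) ^ 2 * (Rpower r alpha ^ 2 * exp (- (t0 * cc * Rpower r alpha))).
Proof.
intros H0 H1 H2 Ha.
replace (et t' r a - et t r a + RtoC (t' - t) * zet t r a)%C with
  ((et t' r a + RtoC t' * zet t r a) - (et t r a + RtoC t * zet t r a))%C
  by (rewrite RtoC_minus; ring).
replace (Rabs (t' - t) ^ 2 * (Rpower r alpha ^ 2 * exp (- (t0 * cc * Rpower r alpha)))) with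
  (Rabs (t' - t) * (Rabs (t' - t) * (Rpower r alpha ^ 2 * exp (- (t0 * cc * Rpower r alpha))))) by ring.
assert (P := Rpower_pos r alpha).
apply (mean_value (V := RS CC) (fun s => et s r a + RtoC s * zet t r a)%C
  (fun s => - zet s r a + zet t r a)%C t t').
- intros s _. apply (is_der_plus (X := CC)); [apply is_derC_et|].
  eapply is_derC_eq.
  + apply is_derC_mult; [|apply (is_der_const (X := CC))].
    apply (is_derC_R (fun t => t)). apply is_derive_id.
  + change (RtoC 1 * zet t r a + RtoC s * 0 = zet t r a)%C. ring.
- intros s _. apply (continuous_plus (V := CC)); [|apply continuous_const].
  apply (continuous_opp (V := CC)).
  apply (continuous_C_mult (fun _ => zpow alpha r a)); [apply continuous_const|apply continuous_et].
- intros s Hs. change (Cmod (- zet s r a + zet t r a) <= Rabs (t' - t) * (Rpower r alpha ^ 2 * exp (- (t0 * cc * Rpower r alpha)))).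
  replace (- zet s r a + zet t r a)%C with (- (zpow alpha r a * (et s r a - et t r a)))%C by (unfold zet; ring).
  rewrite Cmod_opp, Cmod_mult, Cmod_zpow.
  assert (B := et_diff t0 t s r a H0 H1 ltac:(now apply (between_ge t0 t t')) Ha).
  apply Rle_trans with (Rpower r alpha * (Rabs (t' - t) * (Rpower r alpha ^ 1 * exp (- (t0 * cc * Rpower r alpha))))).
  + apply Rmult_le_compat_l; [lra|]. apply Rle_trans with (1 := B).
    apply Rmult_le_compat_r; [|now apply between_abs].
    apply Rmult_le_pos; [apply pow_le; lra|left; apply exp_pos].
  + right; ring.
Qed.

Lemma hol_decay_et t : 0 < t -> exists C0, hol_decay (et t) C0 alpha.
Proof.
intros Ht. destruct (hol_decay_exp_bound t Ht) as [C0 [HC0 H]]. exists (1 * C0).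
apply (H _ 1 0%nat); [lia|apply polhol_et|lra|]. intros r a Hr Ha.
rewrite pow_O, !Rmult_1_l. apply et_le; trivial; lra.
Qed.

Lemma zet_le t t0 r a : 0 <= t0 -> t0 <= t -> Rabs a < hi ->
  Cmod (zet t r a) <= Rpower r alpha * exp (- (t0 * cc * Rpower r alpha)).
Proof.
intros H1 H2 H3. unfold zet. rewrite Cmod_mult, Cmod_zpow.
apply Rmult_le_compat_l; [left; apply Rpower_pos|]. now apply et_le.
Qed.

Lemma hol_decay_zet t : 0 < t -> exists C0, hol_decay (zet t) C0 alpha.
Proof.
intros Ht. destruct (hol_decay_exp_bound t Ht) as [C0 [HC0 H]]. exists (1 * C0).
apply (H _ 1 1%nat); [lia|apply polhol_zet|lra|]. intros r a Hr Ha.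
rewrite pow_1, Rmult_1_l. apply zet_le; trivial; lra.
Qed.

Variable th : R.
Hypothesis Hth : omega < th < hi.

(** All four bounds are [Phi_bound] applied to scalar increments, uniformly on [[t0, +oo)]. The last
    one expresses differentiability in [t] with a quadratic remainder, which avoids differentiating
    the contour integral. *)
Lemma T_estimates t0 : 0 < t0 -> exists M, 0 < M /\ forall t t' x, t0 <= t -> t0 <= t' ->
  norm (Phi th (et t) x) <= M * norm x /\
  norm (minus (Phi th (et t') x) (Phi th (et t) x)) <= M * Rabs (t' - t) * norm x /\
  norm (minus (Phi th (zet t') x) (Phi th (zet t) x)) <= M * Rabs (t' - t) * norm x /\
  norm (plus (minus (Phi th (et t') x) (Phi th (et t) x)) (RtoC (t' - t) *: Phi th (zet t) x))
    <= M * Rabs (t' - t) ^ 2 * norm x.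
Proof.
intros Ht0. destruct (Phi_bound alpha th Halpha Hth) as [K [HK HP]].
destruct (hol_decay_exp_bound t0 Ht0) as [C0 [HC0 H]].
exists (K * C0). split; [now apply Rmult_lt_0_compat|]. intros t t' x Ht Ht'.
destruct (hol_decay_et t ltac:(lra)) as [D1 E1]. destruct (hol_decay_et t' ltac:(lra)) as [D2 E2].
destruct (hol_decay_zet t ltac:(lra)) as [D3 E3]. destruct (hol_decay_zet t' ltac:(lra)) as [D4 E4].
assert (A0 := Rabs_pos (t' - t)).
assert (F1 : hol_decay (fun r a => et t' r a - et t r a)%C (Rabs (t' - t) * C0) alpha).
{ apply (H _ (Rabs (t' - t)) 1%nat); [lia|apply polholC_minus; apply polhol_et|trivial|].
  intros r a Hr Ha. apply et_diff; lra. }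
split; [|split; [|split]].
- assert (F0 : hol_decay (et t) (1 * C0) alpha).
  { apply (H _ 1 0%nat); [lia|apply polhol_et|lra|]. intros r a Hr Ha.
    rewrite pow_O, !Rmult_1_l. apply et_le; trivial; lra. }
  eapply Rle_trans; [apply (HP _ _ x F0)|]. right; ring.
- rewrite <- (Phi_fminus _ _ _ _ _ _ th x E2 E1 Hth).
  eapply Rle_trans; [apply (HP _ _ x F1)|]. right; ring.
- rewrite <- (Phi_fminus _ _ _ _ _ _ th x E4 E3 Hth).
  assert (F2 : hol_decay (fun r a => zet t' r a - zet t r a)%C (Rabs (t' - t) * C0) alpha).
  { apply (H _ (Rabs (t' - t)) 2%nat); [lia|apply polholC_minus; apply polhol_zet|trivial|].
    intros r a Hr Ha. assert (P := Rpower_pos r alpha).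
    replace (zet t' r a - zet t r a)%C with (zpow alpha r a * (et t' r a - et t r a))%C by (unfold zet; ring).
    rewrite Cmod_mult, Cmod_zpow.
    apply Rle_trans with (Rpower r alpha * (Rabs (t' - t) * (Rpower r alpha ^ 1 * exp (- (t0 * cc * Rpower r alpha))))).
    - apply Rmult_le_compat_l; [lra|]. apply et_diff; lra.
    - right; ring. }
  eapply Rle_trans; [apply (HP _ _ x F2)|]. right; ring.
- rewrite <- (Phi_fminus _ _ _ _ _ _ th x E2 E1 Hth), <- (Phi_fscal _ _ _ _ _ _ E3 Hth),
    <- (Phi_fplus _ _ _ _ _ _ th x F1 (hol_decay_cscal _ _ _ _ E3) Hth).
  assert (F3 : hol_decay (fun r a => et t' r a - et t r a + RtoC (t' - t) * zet t r a)%C (Rabs (t' - t) ^ 2 * C0) alpha).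
  { apply (H _ (Rabs (t' - t) ^ 2) 2%nat); [lia| |apply pow_le; trivial|].
    - apply polholC_plus; [apply polholC_minus; apply polhol_et|].
      apply polholC_mult; [apply polholC_const|apply polhol_zet].
    - intros r a Hr Ha. apply et_diff2; lra. }
  eapply Rle_trans; [apply (HP _ _ x F3)|]. right; ring.
Qed.

(** [1 / (1 + z^alpha)], that is [(1 + A^alpha)^{-1}] under [Phi]. *)
Definition wf (r a : R) : C := (/ (1 + zpow alpha r a))%C.

Lemma one_plus_zpow r a : Rabs a < hi ->
  1 <= Cmod (1 + zpow alpha r a) /\ Rpower r alpha <= Cmod (1 + zpow alpha r a).
Proof.
intros Ha. assert (P := Rpower_pos r alpha). assert (Hc := cc_le a Ha). assert (H0 := cc_pos).
assert (HR : 0 < Re (zpow alpha r a)) by (rewrite Re_zpow; apply Rmult_lt_0_compat; lra).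
assert (E : Cmod (1 + zpow alpha r a) ^ 2 = 1 + 2 * Re (zpow alpha r a) + Rpower r alpha ^ 2).
{ assert (E0 := Cmod_sqr (zpow alpha r a)). rewrite Cmod_zpow in E0.
  rewrite E0, Cmod_sqr. generalize (zpow alpha r a). intros [u v]. simpl. ring. }
split; apply le_of_sqr; try apply Cmod_ge_0; rewrite E; nra.
Qed.

Lemma one_plus_zpow_neq r a : Rabs a < hi -> (1 + zpow alpha r a)%C <> RtoC 0.
Proof. intros Ha. apply Cmod_gt_0. destruct (one_plus_zpow r a Ha). lra. Qed.

Lemma polhol_wf : polholC (- hi) hi wf.
Proof.
apply polholC_inv; [apply polholC_plus; [apply polholC_const|apply polholC_zpow]|].
intros r a Hr Ha. apply one_plus_zpow_neq. now apply Rabs_lt_between.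
Qed.

Lemma wf_bound r a : Rabs a < hi -> Cmod (wf r a) <= 1 /\ Cmod (wf r a) <= Rpower r (- alpha).
Proof.
intros Ha. destruct (one_plus_zpow r a Ha) as [H1 H2]. assert (P := Rpower_pos r alpha).
unfold wf. rewrite Cmod_inv by now apply one_plus_zpow_neq.
split; [apply Rle_trans with (/ 1); [|rewrite Rinv_1; lra]|rewrite Rpower_Ropp];
  apply Rinv_le_contravar; lra.
Qed.

Lemma hol_decay_wf : hol_decay wf 1 alpha.
Proof.
split; [apply polhol_wf|split; [trivial|]]. intros r a Hr Ha. rewrite Rmult_1_l. now apply wf_bound.
Qed.

(** [wf] decays faster than integrability requires, by the exponent [alpha - 1 - gamma]. Half of
    this excess is spent on [|e^(- t z^alpha) - 1| <= 2 (t r^alpha)^del]; the decay left is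
    [p = (alpha + 1 + gamma) / 2 > 1 + gamma], and the power [t^del] comes out. *)
Lemma T_W_estimate : exists M del, 0 < M /\ 0 < del /\ forall t x, 0 < t ->
  norm (minus (Phi th (et t) (Phi th wf x)) (Phi th wf x)) <= M * Rpower t del * norm x.
Proof.
set (del := (alpha - 1 - gamma) / (2 * alpha)).
assert (Hdel : 0 < del) by (apply Rdiv_lt_0_compat; lra).
assert (Ed : alpha * del = (alpha - 1 - gamma) / 2) by (unfold del; field; lra).
set (p := alpha - alpha * del).
assert (Hp : 1 + gamma < p) by (unfold p; lra).
destruct (Phi_bound p th Hp Hth) as [K [HK HP]].
exists (K * 2), del. split; [lra|split; trivial]. intros t x Ht.
destruct (hol_decay_et t Ht) as [C0 E1]. assert (HW := hol_decay_wf).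
rewrite (Phi_mult wf (et t) 1 alpha C0 alpha) by trivial.
assert (E2 : hol_decay (fun r a => wf r a * et t r a)%C (1 * 1) alpha).
{ apply hol_decay_mult_bdd; trivial; [apply polhol_et|]. intros r a Hr Ha.
  eapply Rle_trans; [apply (et_le t t); lra|]. apply exp_neg_le1.
  assert (P := Rpower_pos r alpha). assert (Q := cc_pos). apply Rmult_le_pos; [apply Rmult_le_pos|]; lra. }
rewrite <- (Phi_fminus _ _ _ _ _ _ th x E2 HW Hth).
assert (Pt := Rpower_pos t del).
(* With [y = t r^alpha], the modulus is at most [y] for [y <= 1] and at most 2 otherwise; both are
   at most [2 y^del] because [del <= 1]. *)
assert (B : forall r a, 0 < r -> Rabs a < hi ->
  Cmod (et t r a - 1) <= 2 * (Rpower t del * Rpower r (alpha * del))).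
{ intros r a Hr Ha. assert (P := Rpower_pos r alpha). assert (Q := cc_pos).
  assert (Ex : Rpower t del * Rpower r (alpha * del) = Rpower (t * Rpower r alpha) del).
  { rewrite <- Rpower_mult, Rpower_mult_distr; trivial. }
  rewrite Ex. set (y := t * Rpower r alpha).
  assert (Hy : 0 < y) by now apply Rmult_lt_0_compat.
  assert (Hdel1 : del <= 1).
  { apply Rmult_le_reg_l with alpha; lra. }
  destruct (Rle_dec y 1) as [L|L].
  - apply Rle_trans with y.
    + assert (D := et_diff 0 0 t r a ltac:(lra) ltac:(lra) ltac:(lra) Ha).
      assert (E0 : et 0 r a = RtoC 1).
      { unfold et. replace (- (RtoC 0 * zpow alpha r a))%C with (RtoC 0) by ring.
        unfold Cexp, cis; simpl. rewrite exp_0, cos_0, sin_0.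
        apply injective_projections; simpl; ring. }
      rewrite E0, Rminus_0_r, Rabs_pos_eq, pow_1 in D by lra.
      apply Rle_trans with (1 := D). unfold y. apply Rmult_le_compat_l; [lra|].
      rewrite !Rmult_0_l, Ropp_0, exp_0. lra.
    + apply Rle_trans with (Rpower y del).
      * rewrite <- (Rpower_1 y) at 1 by trivial. apply Rpower_ge_exp; lra.
      * assert (Z := Rpower_pos y del). lra.
  - apply Rle_trans with 2.
    + eapply Rle_trans; [apply Cmod_triangle|]. rewrite Cmod_opp, Cmod_1.
      assert (T := et_le t t r a ltac:(lra) ltac:(lra) Ha).
      assert (exp (- (t * cc * Rpower r alpha)) <= 1).
      { apply exp_neg_le1. apply Rmult_le_pos; [apply Rmult_le_pos|]; lra. }
      lra.
    + assert (1 <= Rpower y del); [|lra]. rewrite <- (Rpower_O y) by trivial.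
      apply Rpower_le_exp; lra. }
assert (F : hol_decay (fun r a => wf r a * et t r a - wf r a)%C (2 * Rpower t del) p).
{ apply hol_decay_intro; trivial.
  - apply polholC_minus; [apply polholC_mult; [apply polhol_wf|apply polhol_et]|apply polhol_wf].
  - lra.
  - intros r a Hr Ha. destruct (wf_bound r a Ha) as [W1 W2].
    replace (wf r a * et t r a - wf r a)%C with (wf r a * (et t r a - 1))%C by ring.
    rewrite Cmod_mult. apply Rle_trans with (1 * (2 * (Rpower t del * Rpower r (alpha * del)))).
    + apply Rmult_le_compat; try apply Cmod_ge_0; trivial. apply B; lra.
    + assert (Rpower r (alpha * del) <= 1) by (rewrite <- (Rpower_O r) by lra; apply Rpower_ge_exp; lra).
      assert (0 < Rpower r (alpha * del)) by apply Rpower_pos. nra.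
  - intros r a Hr Ha. destruct (wf_bound r a Ha) as [W1 W2].
    replace (wf r a * et t r a - wf r a)%C with (wf r a * (et t r a - 1))%C by ring.
    rewrite Cmod_mult.
    apply Rle_trans with (Rpower r (- alpha) * (2 * (Rpower t del * Rpower r (alpha * del)))).
    + apply Rmult_le_compat; try apply Cmod_ge_0; trivial. apply B; lra.
    + right. unfold p. replace (- (alpha - alpha * del)) with (- alpha + alpha * del) by ring.
      rewrite Rpower_plus. ring. }
eapply Rle_trans; [apply (HP _ _ x F)|]. right; ring.
Qed.

(** * Comparison with the prescribed contours *)

Variables (k m : nat) (theta1 theta2 : R).
Hypothesis Hk : (1 <= k)%nat.
Hypothesis Hm : (2 <= m)%nat.
Hypothesis Hkm : INR ((m - 1) * k) > alpha + 1 + gamma.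
Hypothesis Htheta1 : th < theta1 < PI.
Hypothesis Htheta2 : th < theta2 < PI.
Hypothesis Htheta2_al : alpha * theta2 < PI / 2.

Let n := ((m - 1) * k)%nat.

Definition bf (r a : R) : C := (zpow alpha r a * pf k n r a)%C.

Lemma Rpower_le_1 r e : 0 < r <= 1 -> 0 <= e -> Rpower r e <= 1.
Proof. intros Hr He. rewrite <- (Rpower_O r) by lra. apply Rpower_ge_exp; lra. Qed.

(** [bf] behaves as [r^(alpha - n)] at infinity, and the choice of [k] and [m] says exactly that
    [n - alpha > 1 + gamma]. *)
Lemma hol_decay_bf : hol_decay bf 1 (INR n - alpha).
Proof.
apply hol_decay_intro; try lra.
- apply polholC_mult; [apply polholC_zpow|apply polhol_pf].
- change (INR ((m - 1) * k)) with (INR n) in Hkm. lra.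
- intros r a Hr Ha. destruct (pf_bound k n r a ltac:(lra) Ha) as [B1 B2].
  unfold bf. rewrite Cmod_mult, Cmod_zpow, <- (Rmult_1_l 1).
  apply Rmult_le_compat; trivial; [left; apply Rpower_pos|apply Cmod_ge_0|].
  apply Rpower_le_1; lra.
- intros r a Hr Ha. destruct (pf_bound k n r a ltac:(lra) Ha) as [B1 B2].
  unfold bf. rewrite Cmod_mult, Cmod_zpow, Rmult_1_l.
  replace (- (INR n - alpha)) with (alpha + - INR n) by ring. rewrite Rpower_plus.
  apply Rmult_le_compat_l; trivial. left; apply Rpower_pos.
Qed.

Lemma one_plus_ge_wide th' r a : 0 <= th' < PI -> 0 < r -> Rabs a <= th' ->
  cos (th' / 2) * (r + 1) <= Cmod (1 + polar r a).
Proof.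
intros Ht Hr Ha. assert (H := polar_sum_ge r a 1 0 Hr Rlt_0_1).
replace (polar 1 0) with (RtoC 1) in H by (unfold polar; rewrite cis_0; ring).
rewrite Cplus_comm in H. apply Rle_trans with (2 := H).
apply Rmult_le_compat_r; [lra|]. rewrite Rminus_0_r. apply cos_half_ge; lra.
Qed.

Lemma one_plus_neq_wide r a : 0 < r -> - PI < a < PI -> (1 + polar r a)%C <> RtoC 0.
Proof.
intros Hr Ha. apply Cmod_gt_0. assert (Q := Rabs_pos a).
assert (Ha' : Rabs a < PI) by now apply Rabs_lt_between.
apply Rlt_le_trans with (2 := one_plus_ge_wide (Rabs a) r a ltac:(lra) Hr (Rle_refl _)).
apply Rmult_lt_0_compat; [apply cos_gt_0|]; lra.
Qed.

(** The contour is turned from [theta1] down to [th]. Since [theta1] may exceed [PI / 2], the lower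
    bound [|1 + z| >= q (1 + r)] with [q = cos (theta1 / 2)] takes the place of the one in the right
    half plane. *)
Lemma frac_B_Phi x : frac_B A alpha k m theta1 x = Phi th bf x.
Proof.
assert (P := PI_RGT_0). set (q := cos (theta1 / 2)).
assert (Hq : 0 < q) by (apply cos_gt_0; lra).
assert (Hq' : 0 < / q) by now apply Rinv_0_lt_compat.
assert (Hbf : polholC (- PI) PI bf).
{ apply polholC_mult; [apply polholC_zpow|].
  assert (V : polholC (- PI) PI v0).
  { apply polholC_inv; [apply polholC_plus; [apply polholC_const|apply polholC_id]|].
    intros; now apply one_plus_neq_wide. }
  apply polholC_mult; apply polholC_pow; trivial.
  apply polholC_mult; [apply polholC_id|trivial]. }
assert (VB : forall r a, 0 < r -> Rabs a <= theta1 ->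
   Cmod (v0 r a) <= / q /\ Cmod (v0 r a) <= / q * / r /\ Cmod (u0 r a) <= / q).
{ intros r a Hr Ha. assert (B := one_plus_ge_wide theta1 r a ltac:(lra) Hr Ha). fold q in B.
  assert (N : (1 + polar r a)%C <> RtoC 0).
  { apply Cmod_gt_0. apply Rlt_le_trans with (2 := B). apply Rmult_lt_0_compat; lra. }
  assert (V1 : Cmod (v0 r a) <= / q * / r).
  { unfold v0. rewrite Cmod_inv, <- Rinv_mult by trivial.
    apply Rinv_le_contravar; [now apply Rmult_lt_0_compat|].
    apply Rle_trans with (2 := B). apply Rmult_le_compat_l; lra. }
  split; [|split; trivial].
  - unfold v0. rewrite Cmod_inv by trivial. apply Rinv_le_contravar; trivial.
    apply Rle_trans with (2 := B). rewrite <- (Rmult_1_r q) at 1. apply Rmult_le_compat_l; lra.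
  - unfold u0. rewrite Cmod_mult, Cmod_polar by lra.
    apply Rmult_le_compat_l with (r := r) in V1; [|lra].
    replace (r * (/ q * / r)) with (/ q) in V1 by (field; lra). exact V1. }
assert (Hkm' : INR n > alpha + 1 + gamma) by exact Hkm.
destruct (E_rotate (INR n - alpha) th theta1 bf ((/ q) ^ k * (/ q) ^ n) x) as [E [C1 [e [D1 D2]]]];
  try lra; trivial.
- apply Rmult_le_pos; apply pow_le; lra.
- intros r a Hr Ha. destruct (VB r a Hr ltac:(lra)) as [V1 [V2 V3]].
  assert (U : Cmod (u0 r a) ^ k <= (/ q) ^ k) by (apply pow_incr; split; trivial; apply Cmod_ge_0).
  assert (W1 : Cmod (v0 r a) ^ n <= (/ q) ^ n) by (apply pow_incr; split; trivial; apply Cmod_ge_0).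
  assert (W2 : Cmod (v0 r a) ^ n <= (/ q) ^ n * Rpower r (- INR n)).
  { rewrite Rpower_Ropp, Rpower_pow, <- pow_inv, <- Rpow_mult_distr by trivial.
    apply pow_incr; split; trivial; apply Cmod_ge_0. }
  assert (U0 : 0 <= Cmod (u0 r a) ^ k) by (apply pow_le, Cmod_ge_0).
  assert (W0 : 0 <= Cmod (v0 r a) ^ n) by (apply pow_le, Cmod_ge_0).
  assert (Q1 : 0 <= (/ q) ^ k) by (apply pow_le; lra).
  assert (Q2 : 0 <= (/ q) ^ n) by (apply pow_le; lra).
  assert (Pa := Rpower_pos r alpha).
  unfold bf, pf. rewrite !Cmod_mult, !Cmod_pow, Cmod_zpow.
  apply (fun H1 H2 => conj H1 H2).
  + destruct (Rle_dec r 1) as [L|L].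
    * apply Rle_trans with (1 * ((/ q) ^ k * (/ q) ^ n)); [|lra].
      apply Rmult_le_compat; trivial; [lra|now apply Rmult_le_pos|apply Rpower_le_1; lra|].
      now apply Rmult_le_compat.
    * apply Rle_trans with (Rpower r alpha * ((/ q) ^ k * ((/ q) ^ n * Rpower r (- INR n)))).
      { apply Rmult_le_compat_l; [lra|]. now apply Rmult_le_compat. }
      replace (Rpower r alpha * ((/ q) ^ k * ((/ q) ^ n * Rpower r (- INR n)))) with
        ((/ q) ^ k * (/ q) ^ n * (Rpower r alpha * Rpower r (- INR n))) by ring.
      rewrite <- Rpower_plus. rewrite <- (Rmult_1_r ((/ q) ^ k * (/ q) ^ n)) at 2.
      apply Rmult_le_compat_l; [now apply Rmult_le_pos|].
      rewrite <- (Rpower_O r) by lra. apply Rpower_le_exp; lra.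
  + apply Rle_trans with (Rpower r alpha * ((/ q) ^ k * ((/ q) ^ n * Rpower r (- INR n)))).
    { apply Rmult_le_compat_l; [lra|]. now apply Rmult_le_compat. }
    replace (- (INR n - alpha)) with (alpha + - INR n) by ring. rewrite Rpower_plus.
    right; ring.
- change (Phi th bf x) with (cint (fun r a => bf r a *: Rs (polar r a) x) th). rewrite E.
  change (cint (fun r a => (Cpower (polar r a) alpha * psi m (polar r a) ^ k)%C *: Rs (polar r a) x) theta1 =
    cint (fun r a => bf r a *: Rs (polar r a) x) theta1).
  symmetry. apply (cint_ext _ _ theta1 C1 e C1 e); trivial.
  + intros r Hr. f_equal. unfold bf. rewrite Cpower_polar by (trivial; lra).
    f_equal. symmetry. apply (psi_pow_pf k m); trivial. apply one_plus_neq_wide; lra.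
  + intros r Hr. f_equal. unfold bf. rewrite Cpower_polar by (trivial; lra).
    f_equal. symmetry. apply (psi_pow_pf k m); trivial. apply one_plus_neq_wide; lra.
Qed.

(** The rotation from [theta2] to [th] passes only through angles [a] with
    [cos (alpha a) >= cos (alpha theta2) > 0], where the exponential still decays. *)
Lemma semigroup_Phi t x : 0 < t -> semigroup A alpha theta2 t x = Phi th (et t) x.
Proof.
intros Ht. assert (P := PI_RGT_0). assert (Hal : 0 < alpha) by lra.
assert (H2 : 0 < theta2) by lra.
assert (Hc : 0 < cos (alpha * theta2)) by (apply cos_gt_0; nra).
destruct (pow_exp_bound t (cos (alpha * theta2)) Ht Hc) as [C0 [HC0 [B1 B2]]].
destruct (E_rotate alpha th theta2 (et t) (1 + C0) x) as [E [C1 [e [D1 D2]]]];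
  try lra; trivial.
- apply polhol_et.
- intros r a Hr Ha.
  assert (B : Cmod (et t r a) <= exp (- (t * cos (alpha * theta2) * Rpower r alpha))).
  { apply Cmod_et; [lra|]. apply cos_al_ge; nra. }
  assert (Pa := Rpower_pos r alpha).
  assert (L1 : exp (- (t * cos (alpha * theta2) * Rpower r alpha)) <= 1).
  { apply exp_neg_le1. apply Rmult_le_pos; [apply Rmult_le_pos|]; lra. }
  split; [lra|]. apply Rle_trans with (1 := B). destruct (Rle_dec r 1) as [L|L].
  + assert (1 <= Rpower r (- alpha)) by (rewrite <- (Rpower_O r) by lra; apply Rpower_ge_exp; lra).
    nra.
  + assert (Q := B2 r 0%nat ltac:(lia) ltac:(lra)). rewrite pow_O, Rmult_1_l in Q.
    apply Rle_trans with (1 := Q). apply Rmult_le_compat_r; [left; apply Rpower_pos|lra].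
- change (Phi th (et t) x) with (cint (fun r a => et t r a *: Rs (polar r a) x) th). rewrite E.
  change (cint (fun r a => Cexp (- (RtoC t * Cpower (polar r a) alpha)) *: Rs (polar r a) x) theta2 =
    cint (fun r a => et t r a *: Rs (polar r a) x) theta2).
  symmetry. apply (cint_ext _ _ theta2 C1 e C1 e); trivial;
  intros r Hr; unfold et; rewrite Cpower_polar by (trivial; lra); reflexivity.
Qed.

(** * The fractional power and the semigroup *)

Let L := frac_power A alpha k m theta1.
Let T := semigroup A alpha theta2.
Let Ps := psi_op A k m.

Lemma Ps_Phi x : Ps x = Phi th (pf k n) x.
Proof. now apply psi_op_Phi. Qed.

Lemma hol_decay_pfkn : hol_decay (pf k n) 1 (INR n).
Proof. apply hol_decay_pf. apply (n_pos k m Hk Hm). Qed.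

(** The working form of the domain. [psi_op_range] trades membership in the domain of a power of [A]
    for solvability of [Ps y = Phi th bf x], in which both sides belong to the calculus. *)
Lemma dom_L x : dom L x <-> exists y, Ps y = Phi th bf x.
Proof.
unfold L, frac_power. cbn [dom]. rewrite frac_B_Phi. apply (psi_op_range k m Hk Hm).
Qed.

Lemma op_L x y : Ps y = Phi th bf x -> op L x = y.
Proof.
intros H. unfold L, frac_power. cbn [op]. rewrite frac_B_Phi.
assert (I := iota_correct (V := X) (fun y => psi_op A k m y = Phi th bf x)).
apply (psi_op_inj k m Hk Hm). rewrite I; [symmetry; exact H|].
exists y. split; trivial. intros y' Hy'. apply (psi_op_inj k m Hk Hm).
rewrite Hy'. exact H.
Qed.

Lemma op_L_spec x : dom L x -> Ps (op L x) = Phi th bf x.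
Proof. intros H. apply dom_L in H. destruct H as [y Hy]. now rewrite (op_L x y Hy). Qed.

Lemma hol_decay_mult f g C0 p C1 p' : hol_decay f C0 p -> hol_decay g C1 p' -> hol_decay (fun r a => f r a * g r a)%C (C0 * C1) p.
Proof.
intros Hf Hg. apply hol_decay_mult_bdd; trivial; [apply Hg|].
intros r a Hr Ha. now apply (proj2 (proj2 Hg)).
Qed.

Lemma Phi_comm f g C0 p C1 p' x : hol_decay f C0 p -> hol_decay g C1 p' ->
  Phi th g (Phi th f x) = Phi th f (Phi th g x).
Proof.
intros Hf Hg.
rewrite (Phi_mult f g C0 p C1 p'), (Phi_mult g f C1 p' C0 p) by trivial.
apply (Phi_ext _ _ _ _ th x (hol_decay_mult _ _ _ _ _ _ Hf Hg) Hth). intros; ring.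
Qed.

(** After [Ps] is applied, this is the scalar identity [zet t * pf k n = et t * bf]. *)
Lemma L_T t x : 0 < t -> dom L (Phi th (et t) x) /\ op L (Phi th (et t) x) = Phi th (zet t) x.
Proof.
intros Ht. destruct (hol_decay_et t Ht) as [C1 E1]. destruct (hol_decay_zet t Ht) as [C2 E2].
assert (HB := hol_decay_bf). assert (HP := hol_decay_pfkn).
assert (E : Ps (Phi th (zet t) x) = Phi th bf (Phi th (et t) x)).
{ rewrite Ps_Phi.
  rewrite (Phi_mult (zet t) (pf k n) C2 alpha 1 (INR n)), (Phi_mult (et t) bf C1 alpha 1 (INR n - alpha)) by trivial.
  apply (Phi_ext _ _ _ _ th x (hol_decay_mult _ _ _ _ _ _ E2 HP) Hth).
  intros. unfold zet, bf. ring. }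
split.
- apply dom_L. now exists (Phi th (zet t) x).
- now apply op_L.
Qed.

(** [Ps] and the operator of [bf] both commute with the semigroup inside the calculus; injectivity
    of [Ps] carries this over to [L]. *)
Lemma L_T_comm t x : 0 < t -> dom L x -> op L (Phi th (et t) x) = Phi th (et t) (op L x).
Proof.
intros Ht Hx. destruct (hol_decay_et t Ht) as [C1 E1].
assert (HB := hol_decay_bf). assert (HP := hol_decay_pfkn).
apply op_L.
rewrite Ps_Phi, (Phi_comm (et t) (pf k n) C1 alpha 1 (INR n)) by trivial.
rewrite <- Ps_Phi, op_L_spec by trivial.
now apply (Phi_comm bf (et t) 1 (INR n - alpha) C1 alpha).
Qed.

(** After [Ps] is applied, this is [pf * wf + bf * wf = pf], because [bf] is [z^alpha] times
    [pf]. *)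
Lemma W_spec x : dom L x -> x = Phi th wf (plus x (op L x)).
Proof.
intros Hx. assert (HB := hol_decay_bf). assert (HP := hol_decay_pfkn). assert (HW := hol_decay_wf).
apply (psi_op_inj k m Hk Hm). change (Ps x = Ps (Phi th wf (plus x (op L x)))).
rewrite (Ps_Phi (Phi th wf _)).
rewrite (Phi_comm wf (pf k n) 1 alpha 1 (INR n)) by trivial.
rewrite (Phi_plus _ _ _ _ _ _ HP Hth), <- (Ps_Phi (op L x)), op_L_spec by trivial.
rewrite (Phi_plus _ _ _ _ _ _ HW Hth).
rewrite (Phi_mult (pf k n) wf 1 (INR n) 1 alpha), (Phi_mult bf wf 1 (INR n - alpha) 1 alpha) by trivial.
rewrite <- (Phi_fplus _ _ _ _ _ _ th x (hol_decay_mult _ _ _ _ _ _ HP HW) (hol_decay_mult _ _ _ _ _ _ HB HW) Hth).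
rewrite Ps_Phi. apply (Phi_ext _ _ _ _ th x HP Hth).
intros r a Hr Ha. unfold bf, wf. field. now apply one_plus_zpow_neq.
Qed.

Lemma T_linear t x y (c : C) : 0 < t -> T t (plus x y) = plus (T t x) (T t y) /\ T t (c *: x) = c *: T t x.
Proof.
intros Ht. unfold T. rewrite !semigroup_Phi by trivial. destruct (hol_decay_et t Ht) as [C1 E1]. split.
- now apply (Phi_plus _ C1 alpha).
- now apply (Phi_scal _ C1 alpha).
Qed.

Lemma T_dom t x : 0 < t -> dom L (T t x).
Proof. intros Ht. unfold T. rewrite semigroup_Phi by trivial. now apply L_T. Qed.

Lemma T_comm t x : 0 < t -> dom L x -> op L (T t x) = T t (op L x).
Proof. intros Ht Hx. unfold T. rewrite !semigroup_Phi by trivial. now apply L_T_comm. Qed.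

Lemma T_bounds t0 : 0 < t0 -> exists M, 0 < M /\ forall t t' x, t0 <= t -> t0 <= t' ->
  norm (T t x) <= M * norm x /\
  norm (minus (T t' x) (T t x)) <= M * Rabs (t' - t) * norm x /\
  norm (minus (op L (T t' x)) (op L (T t x))) <= M * Rabs (t' - t) * norm x /\
  norm (plus (minus (T t' x) (T t x)) (RtoC (t' - t) *: op L (T t x)))
    <= M * Rabs (t' - t) ^ 2 * norm x.
Proof.
intros Ht0. destruct (T_estimates t0 Ht0) as [M [HM H]]. exists M. split; trivial.
intros t t' x Ht Ht'. unfold T. rewrite !semigroup_Phi by lra.
rewrite !(proj2 (L_T _ _ (Rlt_le_trans _ _ _ Ht0 Ht))), !(proj2 (L_T _ _ (Rlt_le_trans _ _ _ Ht0 Ht'))).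
now apply H.
Qed.

Lemma T_initial : exists M del, 0 < M /\ 0 < del /\ forall t x, 0 < t -> dom L x ->
  norm (minus (T t x) x) <= M * Rpower t del * (norm x + norm (op L x)).
Proof.
destruct T_W_estimate as [M [del [HM [Hdel H]]]]. exists M, del. split; [trivial|split; trivial].
intros t x Ht Hx. unfold T. rewrite semigroup_Phi by trivial.
assert (B := H t (plus x (op L x)) Ht). rewrite <- W_spec in B by trivial.
apply Rle_trans with (1 := B). apply Rmult_le_compat_l.
- apply Rmult_le_pos; [lra|left; apply Rpower_pos].
- apply xnorm_triangle.
Qed.

End Power.

End Resolvent.

(** * The abstract Cauchy problem *)

Section CauchyProblem.
Context {X : CompleteNormedModule C_AbsRing}.
Variables (L : partial_op X) (S : R -> X -> X) (phi : R -> R).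
Hypothesis S_lin : forall t x y (c : C), 0 < t ->
  S t (plus x y) = plus (S t x) (S t y) /\ S t (c *: x) = c *: S t x.
Hypothesis S_dom : forall t x, 0 < t -> dom L (S t x).
Hypothesis S_comm : forall t x, 0 < t -> dom L x -> op L (S t x) = S t (op L x).
Hypothesis S_bounds : forall t0, 0 < t0 -> exists M, 0 < M /\
  forall t t' x, t0 <= t -> t0 <= t' ->
  norm (S t x) <= M * norm x /\
  norm (minus (S t' x) (S t x)) <= M * Rabs (t' - t) * norm x /\
  norm (minus (op L (S t' x)) (op L (S t x))) <= M * Rabs (t' - t) * norm x /\
  norm (plus (minus (S t' x) (S t x)) (RtoC (t' - t) *: op L (S t x)))
    <= M * Rabs (t' - t) ^ 2 * norm x.
Hypothesis S_initial : exists M del, 0 < M /\ 0 < del /\ forall t x, 0 < t -> dom L x ->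
  norm (minus (S t x) x) <= M * Rpower t del * (norm x + norm (op L x)).
Hypothesis phi_cont : forall t, 0 <= t ->
  filterlim phi (within (fun s => 0 <= s) (locally t)) (locally (phi t)).
Hypothesis phi_pos : forall t, 0 < t -> 0 < phi t.

(** The extension of [phi] by the constant [phi 0] to negative times is continuous on the whole
    line, so the primitive [I] has a two-sided derivative at 0 as well. *)
Let phi0 (s : R) : R := phi (Rmax 0 s).
Let I (t : R) : R := RInt phi0 0 t.

Lemma phi0_continuous t : continuous phi0 t.
Proof.
assert (H0 : 0 <= Rmax 0 t) by apply Rmax_l.
apply (continuous_eps (V := R_NormedModule)). intros eps Heps.
assert (HL : locally (phi (Rmax 0 t)) (fun y => Rabs (y - phi (Rmax 0 t)) < eps))
  by (apply locally_R_iff; now exists eps).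
assert (H := phi_cont (Rmax 0 t) H0 _ HL).
unfold filtermap, within in H. apply locally_R_iff in H. destruct H as [d [Hd H]].
exists d. split; trivial. intros y Hy. apply H; [|apply Rmax_l].
apply Rle_lt_trans with (2 := Hy). unfold Rmax, Rabs.
repeat destruct Rle_dec; repeat destruct Rcase_abs; lra.
Qed.

Lemma I_derive t : is_derive I t (phi0 t).
Proof.
apply (is_derive_RInt (V := R_NormedModule) phi0 I 0 t); [|apply phi0_continuous].
apply filter_forall. intros s. apply (RInt_correct (V := R_CompleteNormedModule)).
apply ex_RInt_continuous. intros; apply phi0_continuous.
Qed.

Lemma I_continuous t : continuous I t.
Proof. apply (ex_derive_continuous I). eexists; apply I_derive. Qed.

Lemma I_RInt t : 0 <= t -> I t = RInt phi 0 t.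
Proof.
intros Ht. apply RInt_ext. rewrite Rmin_left, Rmax_right by trivial.
intros s Hs. unfold phi0. rewrite Rmax_right; lra.
Qed.

Lemma I_0 : I 0 = 0.
Proof. apply (RInt_point (V := R_CompleteNormedModule)). Qed.

Lemma phi0_eq t : 0 <= t -> phi0 t = phi t.
Proof. intros Ht. unfold phi0. now rewrite Rmax_right. Qed.

Lemma I_increasing s t : 0 <= s -> s < t -> I s < I t.
Proof.
intros Hs Hst. assert (E : I t = I s + RInt phi0 s t).
{ unfold I. rewrite <- (RInt_Chasles (V := R_CompleteNormedModule) phi0 0 s t); trivial;
  apply ex_RInt_continuous; intros; apply phi0_continuous. }
rewrite E. assert (0 < RInt phi0 s t); [|lra].
apply RInt_gt_0; trivial.
- intros x Hx. rewrite phi0_eq by lra. apply phi_pos; lra.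
- intros; apply phi0_continuous.
Qed.

Lemma S_minus t x y : 0 < t -> S t (minus x y) = minus (S t x) (S t y).
Proof.
intros Ht. assert (E : minus x y = plus x ((-(1))%C *: y)) by linC X.
rewrite E, (proj1 (S_lin t x _ (RtoC 1) Ht)), (proj2 (S_lin t y y _ Ht)).
generalize (S t x) (S t y). intros. linC X.
Qed.

Lemma S_zero t : 0 < t -> S t zero = zero.
Proof.
intros Ht. assert (E : minus zero zero = (zero : X)) by linC X.
assert (E' : minus (S t zero) (S t zero) = zero) by (generalize (S t zero); intros; linC X).
exact (eq_trans (f_equal (S t) (eq_sym E)) (eq_trans (S_minus t zero zero Ht) E')).
Qed.

(** The quadratic remainder in [S_bounds], taken on [[t / 2, +oo)], is what the derivative
    requires. *)
Lemma S_is_der t x : 0 < t -> is_der (fun s => S s x) t (opp (op L (S t x))).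
Proof.
intros Ht. destruct (S_bounds (t / 2) ltac:(lra)) as [M [HM H]].
apply is_der_eps. intros eps Heps.
set (Q := M * norm x + 1). assert (Nx := norm_ge_0 x).
assert (HQ : 0 < Q) by (unfold Q; assert (0 <= M * norm x) by (apply Rmult_le_pos; lra); lra).
exists (Rmin (t / 2) (eps / Q)). split.
{ apply Rmin_pos; [lra|now apply Rdiv_lt_0_compat]. }
intros y Hy. assert (L1 : Rmin (t / 2) (eps / Q) <= t / 2) by apply Rmin_l.
assert (L2 : Rmin (t / 2) (eps / Q) <= eps / Q) by apply Rmin_r.
assert (Hy2 : t / 2 <= y) by (apply Rabs_lt_between in Hy; lra).
destruct (H t y x ltac:(lra) Hy2) as [_ [_ [_ B]]].
assert (E : minus (minus (S y x) (S t x)) (RtoC (y - t) *: opp (op L (S t x))) =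
  plus (minus (S y x) (S t x)) (RtoC (y - t) *: op L (S t x))).
{ generalize (S y x) (S t x) (op L (S t x)). intros. linC X. }
apply (xnorm_eq_le _ _ _ E). apply Rle_trans with (1 := B).
assert (A := Rabs_pos (y - t)).
apply Rle_trans with (Q * (eps / Q) * Rabs (y - t)); [|right; field; lra].
replace (M * Rabs (y - t) ^ 2 * norm x) with (M * norm x * Rabs (y - t) * Rabs (y - t)) by ring.
apply Rmult_le_compat_r; trivial.
apply Rmult_le_compat; [apply Rmult_le_pos; lra|trivial|unfold Q; lra|lra].
Qed.

Lemma LS_cont t x : 0 < t -> cont (fun s => op L (S s x)) t.
Proof.
intros Ht. destruct (S_bounds (t / 2) ltac:(lra)) as [M [HM H]].
apply cont_eps. intros eps Heps.
set (Q := M * norm x + 1). assert (Nx := norm_ge_0 x).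
assert (HMx : 0 <= M * norm x) by (apply Rmult_le_pos; lra).
assert (HQ : 0 < Q) by (unfold Q; lra).
exists (Rmin (t / 2) (eps / Q)). split.
{ apply Rmin_pos; [lra|now apply Rdiv_lt_0_compat]. }
intros y Hy. assert (L1 : Rmin (t / 2) (eps / Q) <= t / 2) by apply Rmin_l.
assert (L2 : Rmin (t / 2) (eps / Q) <= eps / Q) by apply Rmin_r.
assert (Hy2 : t / 2 <= y) by (apply Rabs_lt_between in Hy; lra).
destruct (H t y x ltac:(lra) Hy2) as [_ [_ [B _]]].
apply Rle_lt_trans with (1 := B). assert (A := Rabs_pos (y - t)).
apply Rle_lt_trans with (Rabs (y - t) * Q).
- replace (M * Rabs (y - t) * norm x) with (Rabs (y - t) * (M * norm x)) by ring.
  apply Rmult_le_compat_l; trivial. unfold Q; lra.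
- apply Rlt_le_trans with (eps / Q * Q); [|right; field; lra].
  apply Rmult_lt_compat_r; lra.
Qed.

Lemma is_der_comp (f : R -> X) (g : R -> R) t df dg : is_der f (g t) df -> is_derive g t dg ->
  is_der (fun s => f (g s)) t (RtoC dg *: df).
Proof. exact (is_derive_comp (K := R_AbsRing) (V := RS X) f g t df dg). Qed.

(** Nothing is assumed about [S 0], so the value at 0 is put in by hand. Continuity there comes from
    [S_initial] and [I t -> 0], hence from [u0] being in the domain of [L]. *)
Lemma existence Th u0 : dom L u0 ->
  classical_solution (fun t => - phi t) L Th u0
    (fun t => if Rle_dec t 0 then u0 else S (I t) u0).
Proof.
intros Hu0. set (u := fun t => if Rle_dec t 0 then u0 else S (I t) u0).
assert (Hu : forall t, 0 < t -> u t = S (I t) u0).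
{ intros t Ht. unfold u. destruct (Rle_dec t 0); [lra|reflexivity]. }
assert (HI : forall t, 0 < t -> 0 < I t).
{ intros t Ht. rewrite <- I_0. apply I_increasing; lra. }
assert (Hloc : forall t, 0 < t -> locally t (fun s => S (I s) u0 = u s)).
{ intros t Ht. apply locally_R_iff. exists t. split; trivial. intros y Hy.
  symmetry. apply Hu. apply Rabs_lt_between in Hy. lra. }
assert (Hder : forall t, 0 < t -> is_der u t (RtoC (- phi t) *: op L (u t))).
{ intros t Ht. apply (is_der_ext_loc (fun s => S (I s) u0)); [now apply Hloc|].
  eapply is_der_eq.
  - apply (is_der_comp (fun s => S s u0) I); [apply S_is_der; now apply HI|apply I_derive].
  - rewrite phi0_eq, Hu by lra. generalize (op L (S (I t) u0)). intros. linC X.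
    apply injective_projections; simpl; ring. }
split; [|split].
- intros t Ht. destruct (Rle_lt_dec t 0) as [L0|L0].
  + assert (t = 0) by lra. subst t. destruct S_initial as [M [del [HM [Hdel HS]]]].
    apply (proj2 (filterlim_norm_iff (V := RS X) (within (fun s => 0 <= s < Th) (locally 0)) u (u 0))). intros eps Heps.
    assert (E0 : u 0 = u0) by (unfold u; destruct (Rle_dec 0 0); [reflexivity|lra]).
    rewrite E0. set (Q := norm u0 + norm (op L u0) + 1).
    assert (N1 := norm_ge_0 u0). assert (N2 := norm_ge_0 (op L u0)).
    assert (HQ : 0 < Q) by (unfold Q; lra).
    destruct (Rpower_small del (eps / (2 * M * Q)) Hdel) as [r0 [Hr0 HR]].
    { apply Rdiv_lt_0_compat; trivial. repeat apply Rmult_lt_0_compat; lra. }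
    destruct (proj1 (continuous_eps (V := R_NormedModule) I 0) (I_continuous 0) r0 Hr0) as [d [Hd HId]].
    unfold within. apply locally_R_iff. exists d. split; trivial. intros y Hy Hy0.
    destruct (Req_dec y 0) as [->|Hy1].
    * rewrite E0. assert (E : minus u0 u0 = zero) by linC X.
      apply (xnorm_eq_lt _ _ _ E). apply Rle_lt_trans with 0; trivial.
      right. apply (norm_zero (V := X)).
    * specialize (HId y Hy). change (Rabs (I y - I 0) < r0) in HId. rewrite I_0, Rminus_0_r in HId.
      assert (HIy : 0 < I y) by (apply HI; lra). rewrite Rabs_pos_eq in HId by lra.
      rewrite Hu by lra. apply Rle_lt_trans with (1 := HS (I y) u0 HIy Hu0).
      specialize (HR (I y) ltac:(lra)).
      apply Rle_lt_trans with (M * (eps / (2 * M * Q)) * Q).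
      { apply Rmult_le_compat; [|lra| |unfold Q; lra].
        - apply Rmult_le_pos; [lra|left; apply Rpower_pos].
        - apply Rmult_le_compat_l; lra. }
      replace (M * (eps / (2 * M * Q)) * Q) with (eps / 2) by (field; lra). lra.
  + intros P HP. assert (Cu := is_der_cont u t _ (Hder t L0) P HP).
    unfold filtermap, within in *. revert Cu. apply filter_imp. now intros.
- exists (fun t => RtoC (- phi t) *: op L (u t)). intros t Ht.
  split; [apply Hder; lra|split; [|split; [|reflexivity]]].
  + assert (HIt := HI t ltac:(lra)).
    apply (continuous_ext_loc (T := R_UniformSpace) (U := X)) with
      (fun s => RtoC (- phi0 s) *: op L (S (I s) u0)).
    { assert (H1 := Hloc t ltac:(lra)). assert (H2 : locally t (fun s => 0 < s)).
      { apply locally_R_iff. exists t. split; [lra|]. intros y Hy. apply Rabs_lt_between in Hy. lra. }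
      assert (H3 := filter_and _ _ H1 H2). revert H3. apply filter_imp.
      intros s [E Hs]. rewrite <- E, phi0_eq by lra. reflexivity. }
    apply continuous_scal_C.
    * apply continuous_RtoC. apply (continuous_opp (V := R_NormedModule)). apply phi0_continuous.
    * apply (continuous_comp (V := R_UniformSpace) (W := X) I (fun s => op L (S s u0))).
      apply I_continuous. now apply LS_cont.
  + rewrite Hu by lra. apply S_dom. apply HI; lra.
- unfold u. destruct (Rle_dec 0 0); [reflexivity|lra].
Qed.

(** * Uniqueness of classical solutions *)

Section Uniqueness.
Variables (Th : R) (u0 : X) (u du : R -> X).
Hypothesis u_cont : forall t, 0 <= t < Th ->
  filterlim u (within (fun s => 0 <= s < Th) (locally t)) (locally (u t)).
Hypothesis u_sol : forall t, 0 < t < Th ->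
  is_der u t (du t) /\ cont du t /\ dom L (u t) /\ du t = RtoC (- phi t) *: op L (u t).
Hypothesis u_init : u 0 = u0.
Variable t : R.
Hypothesis Ht : 0 < t < Th.

Let tau (s : R) : R := I t - I s.
Let v (s : R) : X := S (tau s) (u s).

Lemma tau_pos s : 0 <= s < t -> 0 < tau s.
Proof. intros Hs. unfold tau. assert (A := I_increasing s t ltac:(lra) ltac:(lra)). lra. Qed.

Lemma tau_derive s : is_derive tau s (- phi0 s).
Proof.
unfold tau. replace (- phi0 s) with (minus 0 (phi0 s)) by (unfold minus, plus, opp; simpl; ring).
apply (is_derive_minus (V := R_NormedModule)); [apply (is_derive_const (V := R_NormedModule))|apply I_derive].
Qed.

Lemma tau_continuous s : continuous tau s.
Proof. apply (ex_derive_continuous tau). eexists; apply tau_derive. Qed.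

Lemma tau_local s : 0 < tau s -> exists d, 0 < d /\ forall y, Rabs (y - s) < d -> tau s / 2 <= tau y.
Proof.
intros Hs. destruct (proj1 (continuous_eps (V := R_NormedModule) tau s) (tau_continuous s) (tau s / 2))
  as [d [Hd H]]; [lra|].
exists d. split; trivial. intros y Hy. specialize (H y Hy).
change (Rabs (tau y - tau s) < tau s / 2) in H. apply Rabs_lt_between in H. lra.
Qed.

(** Half of a product rule: where the vector vanishes, the derivative of the operator factor drops
    out, and local boundedness and continuity of [S] suffice. [v_derive] adds the other half, the
    operator applied to the fixed vector [u s]. *)
Lemma S_tau_derive_vanishing s (w : R -> X) dw : 0 < tau s -> w s = zero -> is_der w s dw ->
  is_der (fun y => S (tau y) (w y)) s (S (tau s) dw).
Proof.
intros Hs Hw0 Hw. destruct (S_bounds (tau s / 2) ltac:(lra)) as [M [HM HB]].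
destruct (tau_local s Hs) as [d1 [Hd1 H1]].
apply is_der_eps. intros eps Heps.
set (Q := M * norm dw + 1). assert (Nw := norm_ge_0 dw).
assert (HMw : 0 <= M * norm dw) by (apply Rmult_le_pos; lra).
assert (HQ : 0 < Q) by (unfold Q; lra).
destruct (proj1 (is_der_eps w s dw) Hw (eps / (2 * M))) as [d2 [Hd2 H2]].
{ apply Rdiv_lt_0_compat; lra. }
destruct (proj1 (continuous_eps (V := R_NormedModule) tau s) (tau_continuous s) (eps / (2 * Q)))
  as [d3 [Hd3 H3]]. { apply Rdiv_lt_0_compat; lra. }
exists (Rmin d1 (Rmin d2 d3)). split; [repeat apply Rmin_pos; trivial|]. intros y Hy.
assert (L1 : Rmin d1 (Rmin d2 d3) <= d1) by apply Rmin_l.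
assert (L2 : Rmin d1 (Rmin d2 d3) <= Rmin d2 d3) by apply Rmin_r.
assert (L3 : Rmin d2 d3 <= d2) by apply Rmin_l. assert (L4 : Rmin d2 d3 <= d3) by apply Rmin_r.
specialize (H1 y ltac:(lra)). specialize (H2 y ltac:(lra)). specialize (H3 y ltac:(lra)).
change (Rabs (tau y - tau s) < eps / (2 * Q)) in H3.
assert (Hty : 0 < tau y) by lra.
set (h := RtoC (y - s)) in *.
set (R1 := minus (minus (w y) (w s)) (h *: dw)) in *.
assert (E : minus (minus (S (tau y) (w y)) (S (tau s) (w s))) (h *: S (tau s) dw) =
  plus (S (tau y) R1) (h *: minus (S (tau y) dw) (S (tau s) dw))).
{ unfold R1. rewrite Hw0.
  assert (Z := S_zero (tau s) Hs). assert (Z' := S_zero (tau y) Hty).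
  rewrite !S_minus, (proj2 (S_lin (tau y) dw dw h Hty)), Z, Z' by trivial.
  generalize (S (tau y) (w y)) (S (tau s) dw) (S (tau y) dw). intros. linC X. }
apply (xnorm_eq_le _ _ _ E). eapply Rle_trans; [apply xnorm_triangle|].
destruct (HB (tau y) (tau s) R1 ltac:(lra) ltac:(lra)) as [B1 _].
destruct (HB (tau s) (tau y) dw ltac:(lra) ltac:(lra)) as [_ [B2 _]].
assert (A := Rabs_pos (y - s)).
assert (T1 : norm (S (tau y) R1) <= eps / 2 * Rabs (y - s)).
{ apply Rle_trans with (1 := B1). apply Rle_trans with (M * (eps / (2 * M) * Rabs (y - s))).
  - apply Rmult_le_compat_l; [lra|exact H2].
  - right; field; lra. }
assert (T2 : norm (h *: minus (S (tau y) dw) (S (tau s) dw)) <= eps / 2 * Rabs (y - s)).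
{ eapply Rle_trans; [apply norm_scal_C|]. unfold h. rewrite Cmod_R.
  apply Rle_trans with (Rabs (y - s) * (eps / (2 * Q) * Q)); [|right; field; lra].
  apply Rmult_le_compat_l; trivial. apply Rle_trans with (1 := B2).
  replace (M * Rabs (tau y - tau s) * norm dw) with (Rabs (tau y - tau s) * (M * norm dw)) by ring.
  apply Rmult_le_compat; trivial; try lra. apply Rabs_pos. unfold Q; lra. }
lra.
Qed.

(** The equation contributes [- phi S(tau) L u], the derivative of [tau] contributes
    [phi L S(tau) u]; they cancel because [S] commutes with [L] on its domain. *)
Lemma v_derive s : 0 < s < t -> is_der v s zero.
Proof.
intros Hs. assert (Hts := tau_pos s ltac:(lra)).
destruct (u_sol s ltac:(lra)) as [Hd [_ [Hdom Heq]]].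
assert (D1 : is_der (fun y => S (tau y) (minus (u y) (u s))) s (S (tau s) (du s))).
{ apply S_tau_derive_vanishing; trivial.
  - linC X.
  - eapply is_der_eq; [apply (is_der_plus _ (fun _ => opp (u s))); [exact Hd|apply is_der_const]|].
    linC X. }
assert (D2 : is_der (fun y => S (tau y) (u s)) s (RtoC (- phi0 s) *: opp (op L (S (tau s) (u s))))).
{ apply (is_der_comp (fun r => S r (u s)) tau); [now apply S_is_der|apply tau_derive]. }
assert (D := is_der_plus _ _ _ _ _ D1 D2).
destruct (tau_local s Hts) as [d [Hd' Hl]].
apply (is_der_ext_loc (fun y => plus (S (tau y) (minus (u y) (u s))) (S (tau y) (u s)))).
- apply locally_R_iff. exists d. split; trivial. intros y Hy. specialize (Hl y Hy).
  unfold v. rewrite S_minus by lra. generalize (S (tau y) (u y)) (S (tau y) (u s)). intros. linC X.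
- eapply is_der_eq; [exact D|].
  rewrite S_comm, Heq, (proj2 (S_lin (tau s) (op L (u s)) (op L (u s)) _ Hts)), phi0_eq by (trivial; lra).
  generalize (S (tau s) (op L (u s))). intros. linC X.
Qed.

Lemma v_constant s1 s2 : 0 < s1 <= s2 -> s2 < t -> v s1 = v s2.
Proof.
intros H1 H2. apply (constant_of_derive_zero (V := RS X) v).
rewrite Rmin_left, Rmax_right by lra. intros s Hs. apply v_derive. lra.
Qed.

(** Near 0 the time [tau s] stays above half of [tau 0 > 0], where [S] is uniformly bounded and
    Lipschitz, so the limit of [u] passes through [S]. *)
Lemma v_near_0 eps : 0 < eps -> exists d, 0 < d /\ forall s, 0 < s < d -> s < t ->
  norm (minus (v s) (S (I t) u0)) < eps.
Proof.
intros Heps. assert (Ht0 : tau 0 = I t) by (unfold tau; rewrite I_0; ring).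
assert (Hp := tau_pos 0 ltac:(lra)).
destruct (S_bounds (tau 0 / 2) ltac:(lra)) as [M [HM HB]].
destruct (tau_local 0 Hp) as [d1 [Hd1 H1]].
assert (N := norm_ge_0 u0).
assert (HMu : 0 < M * norm u0 + 1) by (assert (0 <= M * norm u0) by (apply Rmult_le_pos; lra); lra).
assert (Hu0 : 0 <= 0 < Th) by lra.
destruct (proj1 (filterlim_norm_iff (V := RS X) _ u (u 0)) (u_cont 0 Hu0) (eps / (2 * M)))
  as [d2 H2]. { apply Rdiv_lt_0_compat; lra. }
destruct (proj1 (continuous_eps (V := R_NormedModule) tau 0) (tau_continuous 0) (eps / (2 * (M * norm u0 + 1))))
  as [d3 [Hd3 H3]]. { apply Rdiv_lt_0_compat; lra. }
exists (Rmin d1 (Rmin d2 d3)). split; [repeat apply Rmin_pos; trivial; apply cond_pos|].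
intros s Hs Hst.
assert (L1 : Rmin d1 (Rmin d2 d3) <= d1) by apply Rmin_l.
assert (L2 : Rmin d1 (Rmin d2 d3) <= Rmin d2 d3) by apply Rmin_r.
assert (L3 : Rmin d2 d3 <= d2) by apply Rmin_l. assert (L4 : Rmin d2 d3 <= d3) by apply Rmin_r.
assert (As : Rabs (s - 0) = s) by (rewrite Rminus_0_r, Rabs_pos_eq; lra).
specialize (H1 s ltac:(lra)). specialize (H3 s ltac:(lra)).
assert (Hb : Rabs (s - 0) < d2) by lra.
assert (H2' := H2 s Hb ltac:(lra)).
rewrite u_init in H2'.
change (Rabs (tau s - tau 0) < eps / (2 * (M * norm u0 + 1))) in H3.
rewrite <- Ht0. unfold v.
assert (E : minus (S (tau s) (u s)) (S (tau 0) u0) =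
  plus (S (tau s) (minus (u s) u0)) (minus (S (tau s) u0) (S (tau 0) u0))).
{ rewrite S_minus by lra. generalize (S (tau s) (u s)) (S (tau s) u0) (S (tau 0) u0). intros. linC X. }
apply (xnorm_eq_lt _ _ _ E). eapply Rle_lt_trans; [apply xnorm_triangle|].
destruct (HB (tau s) (tau 0) (minus (u s) u0) ltac:(lra) ltac:(lra)) as [B1 _].
destruct (HB (tau 0) (tau s) u0 ltac:(lra) ltac:(lra)) as [_ [B2 _]].
apply Rle_lt_trans with (M * norm (minus (u s) u0) + M * Rabs (tau s - tau 0) * norm u0);
  [now apply Rplus_le_compat|].
assert (T1 : M * norm (minus (u s) u0) < M * (eps / (2 * M))) by (apply Rmult_lt_compat_l; [lra|exact H2']).
assert (T2 : M * Rabs (tau s - tau 0) * norm u0 <= eps / (2 * (M * norm u0 + 1)) * (M * norm u0 + 1)).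
{ replace (M * Rabs (tau s - tau 0) * norm u0) with (Rabs (tau s - tau 0) * (M * norm u0)) by ring.
  apply Rmult_le_compat; try lra. apply Rabs_pos. apply Rmult_le_pos; lra. }
replace (M * (eps / (2 * M))) with (eps / 2) in T1 by (field; lra).
replace (eps / (2 * (M * norm u0 + 1)) * (M * norm u0 + 1)) with (eps / 2) in T2 by (field; lra).
lra.
Qed.

(** Here [tau s] tends to 0, where no uniform bound for [S] is available. Instead [S (tau s) (u s)]
    is compared with [u s] itself by [S_initial], which needs the graph norm of [u s] to be bounded
    near [t]. *)
Lemma v_near_t eps : 0 < eps -> exists d, 0 < d /\ forall s, t - d < s < t -> 0 < s ->
  norm (minus (v s) (u t)) < eps.
Proof.
intros Heps. destruct S_initial as [M [del [HM [Hdel HS]]]].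
destruct (u_sol t Ht) as [Hd [Hdc _]].
assert (Hphi := phi_pos t ltac:(lra)).
assert (Cu := is_der_cont u t _ Hd).
(* A bound of the graph norm of [u s] near [t]: [u] and [du] move by at most 1, and
   [L u = - du / phi] with [phi s >= phi t / 2]. *)
set (Bd := norm (u t) + 1 + 2 / phi t * (norm (du t) + 1)).
assert (N1 := norm_ge_0 (u t)). assert (N2 := norm_ge_0 (du t)).
assert (Hip : 0 < 2 / phi t) by (apply Rdiv_lt_0_compat; lra).
assert (HBd : 0 < Bd).
{ unfold Bd. assert (0 < 2 / phi t * (norm (du t) + 1)) by (apply Rmult_lt_0_compat; lra). lra. }
destruct (Rpower_small del (eps / (2 * M * Bd)) Hdel) as [r0 [Hr0 HR]].
{ apply Rdiv_lt_0_compat; trivial. repeat apply Rmult_lt_0_compat; lra. }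
destruct (proj1 (continuous_eps (V := R_NormedModule) tau t) (tau_continuous t) r0 Hr0) as [d1 [Hd1 H1]].
destruct (proj1 (cont_eps u t) Cu (Rmin 1 (eps / 2))) as [d2 [Hd2 H2]]; [apply Rmin_pos; lra|].
destruct (proj1 (cont_eps du t) Hdc 1 Rlt_0_1) as [d3 [Hd3 H3]].
destruct (proj1 (continuous_eps (V := R_NormedModule) phi0 t) (phi0_continuous t) (phi t / 2)) as [d4 [Hd4 H4]]; [lra|].
exists (Rmin (Rmin d1 d2) (Rmin d3 d4)). split; [repeat apply Rmin_pos; trivial|].
intros s Hs Hs0.
assert (L1 : Rmin (Rmin d1 d2) (Rmin d3 d4) <= Rmin d1 d2) by apply Rmin_l.
assert (L2 : Rmin (Rmin d1 d2) (Rmin d3 d4) <= Rmin d3 d4) by apply Rmin_r.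
assert (L3 : Rmin d1 d2 <= d1) by apply Rmin_l. assert (L4 : Rmin d1 d2 <= d2) by apply Rmin_r.
assert (L5 : Rmin d3 d4 <= d3) by apply Rmin_l. assert (L6 : Rmin d3 d4 <= d4) by apply Rmin_r.
assert (As : Rabs (s - t) = t - s) by (rewrite Rabs_left1; lra).
specialize (H1 s ltac:(lra)). specialize (H2 s ltac:(lra)). specialize (H3 s ltac:(lra)).
specialize (H4 s ltac:(lra)).
change (Rabs (tau s - tau t) < r0) in H1. change (Rabs (phi0 s - phi0 t) < phi t / 2) in H4.
assert (Ett : tau t = 0) by (unfold tau; ring).
assert (Hts := tau_pos s ltac:(lra)).
rewrite Ett, Rminus_0_r, Rabs_pos_eq in H1 by lra.
rewrite !phi0_eq in H4 by lra. apply Rabs_lt_between in H4.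
destruct (u_sol s ltac:(lra)) as [_ [_ [Hdom Heq]]].
assert (M1 : Rmin 1 (eps / 2) <= 1) by apply Rmin_l.
assert (M2 : Rmin 1 (eps / 2) <= eps / 2) by apply Rmin_r.
assert (Nu : norm (u s) <= norm (u t) + 1).
{ apply Rle_trans with (1 := xnorm_le_minus (u s) (u t)). apply Rplus_le_compat_l. lra. }
assert (Nd : norm (du s) <= norm (du t) + 1).
{ apply Rle_trans with (1 := xnorm_le_minus (du s) (du t)). apply Rplus_le_compat_l. lra. }
assert (EL : op L (u s) = RtoC (- / phi s) *: du s).
{ rewrite Heq. generalize (op L (u s)). intros w. linC X.
  rewrite !Cmult_1_r, <- RtoC_mult. f_equal. field. lra. }
assert (NL : norm (op L (u s)) <= 2 / phi t * (norm (du t) + 1)).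
{ apply (xnorm_eq_le _ _ _ EL). eapply Rle_trans; [apply norm_scal_C|].
  rewrite Cmod_R, Rabs_Ropp, Rabs_pos_eq by (left; apply Rinv_0_lt_compat; lra).
  apply Rmult_le_compat; trivial.
  - left; apply Rinv_0_lt_compat; lra.
  - apply norm_ge_0.
  - replace (2 / phi t) with (/ (phi t / 2)) by (field; lra). apply Rinv_le_contravar; lra. }
eapply Rle_lt_trans; [apply (xnorm_triangle3 _ (u s))|].
assert (T1 : norm (minus (v s) (u s)) <= eps / 2).
{ apply Rle_trans with (1 := HS (tau s) (u s) Hts Hdom).
  specialize (HR (tau s) ltac:(lra)).
  apply Rle_trans with (M * (eps / (2 * M * Bd)) * Bd); [|right; field; lra].
  apply Rmult_le_compat.
  - apply Rmult_le_pos; [lra|left; apply Rpower_pos].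
  - apply Rplus_le_le_0_compat; apply norm_ge_0.
  - apply Rmult_le_compat_l; lra.
  - unfold Bd. lra. }
replace eps with (eps / 2 + eps / 2) by field.
apply Rplus_le_lt_compat; trivial. lra.
Qed.

Lemma uniqueness : u t = S (I t) u0.
Proof.
assert (Z : norm (minus (u t) (S (I t) u0)) = 0).
{ apply Rle_antisym; [|apply norm_ge_0]. apply Rnot_lt_le. intros Lt.
  set (eps := norm (minus (u t) (S (I t) u0))) in *.
  destruct (v_near_0 (eps / 2) ltac:(lra)) as [d1 [Hd1 H1]].
  destruct (v_near_t (eps / 2) ltac:(lra)) as [d2 [Hd2 H2]].
  set (s1 := Rmin (d1 / 2) (t / 2)). set (s2 := Rmax (t - d2 / 2) (t / 2)).
  assert (A1 : s1 <= d1 / 2) by apply Rmin_l. assert (A2 : s1 <= t / 2) by apply Rmin_r.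
  assert (A3 : 0 < s1) by (apply Rmin_pos; lra).
  assert (A4 : t - d2 / 2 <= s2) by apply Rmax_l. assert (A5 : t / 2 <= s2) by apply Rmax_r.
  assert (A6 : s2 < t) by (apply Rmax_lub_lt; lra).
  assert (A7 : 0 < s1 < d1) by lra. assert (A8 : s1 < t) by lra.
  assert (A9 : t - d2 < s2 < t) by lra. assert (A10 : 0 < s2) by lra.
  specialize (H1 s1 A7 A8). specialize (H2 s2 A9 A10).
  rewrite <- (v_constant s1 s2) in H2 by lra.
  assert (T := xnorm_triangle3 (u t) (v s1) (S (I t) u0)).
  rewrite (xnorm_minus_sym (u t) (v s1)) in T. fold eps in T. lra. }
apply (norm_eq_zero (V := X)) in Z.
assert (E : u t = plus (minus (u t) (S (I t) u0)) (S (I t) u0)).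
{ generalize (S (I t) u0). intros. linC X. }
rewrite E, Z. apply (plus_zero_l (G := X)).
Qed.

End Uniqueness.

Lemma solution_operator_of_semigroup Th :
  solution_operator (fun t => - phi t) L Th (fun t => S (RInt phi 0 t)).
Proof.
intros u0 Hu0. split.
- eexists. now apply existence.
- intros u [Hc [[du Hdu] Hi]] t Ht. rewrite <- I_RInt by lra.
  now apply (uniqueness Th u0 u du).
Qed.

End CauchyProblem.

(* [semigroup A alpha theta t] is [exp (- t A^alpha)], whence the sign in
   [- phi t]. *)
Theorem theorem3p1
  (X : CompleteNormedModule C_AbsRing) (gamma omega alpha : R)
  (A : partial_op X) (phi : R -> R) (T : R)
  (k m : nat) (theta1 theta2 : R)
  (Hgamma : -1 < gamma < 0)
  (Homega : 0 < omega < PI / 2)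
  (HA : almost_sectorial gamma omega A)
  (Halpha : 1 + gamma < alpha < PI / (2 * omega))
  (Hphi_cont : forall t, 0 <= t ->
     filterlim phi (within (fun s => 0 <= s) (locally t)) (locally (phi t)))
  (Hphi_ge0 : forall t, 0 <= t -> 0 <= phi t)
  (Hphi_gt0 : forall t, 0 < t -> 0 < phi t)
  (HT : 0 < T)
  (Hk : (1 <= k)%nat) (Hm : (2 <= m)%nat)
  (Hkm : INR ((m - 1) * k) > alpha + 1 + gamma)
  (Htheta1 : omega < theta1 < PI)
  (Htheta2 : omega < theta2 < Rmin PI (PI / (2 * alpha))) :
  solution_operator (fun t => - phi t) (frac_power A alpha k m theta1) T
    (fun t => semigroup A alpha theta2 (RInt phi 0 t)).
Proof.
assert (P := PI_RGT_0). assert (Hal : 0 < alpha) by lra.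
assert (M1 : Rmin PI (PI / (2 * alpha)) <= PI) by apply Rmin_l.
assert (M2 : Rmin PI (PI / (2 * alpha)) <= PI / (2 * alpha)) by apply Rmin_r.
assert (Hth2 : alpha * theta2 < PI / 2).
{ replace (PI / 2) with (alpha * (PI / (2 * alpha))) by (field; lra).
  apply Rmult_lt_compat_l; lra. }
(* The calculus has to live in the right half plane, where [z^alpha] keeps a positive real part, and
   below both prescribed angles, so that one contour inside it can be turned out to each of them. *)
set (hi := Rmin (PI / 2) (Rmin theta1 theta2)).
assert (L1 : hi <= PI / 2) by apply Rmin_l.
assert (L2 : hi <= Rmin theta1 theta2) by apply Rmin_r.
assert (L3 : Rmin theta1 theta2 <= theta1) by apply Rmin_l.
assert (L4 : Rmin theta1 theta2 <= theta2) by apply Rmin_r.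
assert (L5 : omega < hi) by (repeat apply Rmin_glb_lt; lra).
assert (Hhi : alpha * hi < PI / 2).
{ apply Rle_lt_trans with (2 := Hth2). apply Rmult_le_compat_l; lra. }
(* Strictly below [hi], which leaves room for the second contour in the proof of
   multiplicativity. *)
set (th := (omega + hi) / 2).
assert (Hth : omega < th < hi) by (unfold th; lra).
assert (H1 : th < theta1 < PI) by lra. assert (H2 : th < theta2 < PI) by lra.
apply solution_operator_of_semigroup; trivial.
- exact (T_linear gamma omega A Hgamma Homega HA hi (conj L5 L1)
    alpha (proj1 Halpha) Hhi th Hth k m theta2 Hk Hm H2 Hth2).
- exact (T_dom gamma omega A Hgamma Homega HA hi (conj L5 L1)
    alpha (proj1 Halpha) Hhi th Hth k m theta1 theta2 Hk Hm Hkm H1 H2 Hth2).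
- exact (T_comm gamma omega A Hgamma Homega HA hi (conj L5 L1)
    alpha (proj1 Halpha) Hhi th Hth k m theta1 theta2 Hk Hm Hkm H1 H2 Hth2).
- exact (T_bounds gamma omega A Hgamma Homega HA hi (conj L5 L1)
    alpha (proj1 Halpha) Hhi th Hth k m theta1 theta2 Hk Hm Hkm H1 H2 Hth2).
- exact (T_initial gamma omega A Hgamma Homega HA hi (conj L5 L1)
    alpha (proj1 Halpha) Hhi th Hth k m theta1 theta2 Hk Hm Hkm H1 H2 Hth2).
Qed.
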